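(* Let $E$ be an isolated eigenvalue of $H_\kappa$ of finite multiplicity with associated eigenspace $\mathcal{E}$. Suppose that for each of the three subscripts $$\phi_{\mathrm{sc},\mathrm{el},\mathrm{am}}=\chi_{\mathrm{sc},\mathrm{el},\mathrm{am}}+\psi_{\mathrm{sc},\mathrm{el},\mathrm{am}},\qquad |\chi_{\mathrm{sc},\mathrm{el},\mathrm{am}}(r)|\leq c\,r^{-1}\ \ \forall r>0,\qquad \psi_{\mathrm{sc},\mathrm{el},\mathrm{am}}\in L^\infty(0,\infty),$$ for some constant $c>0$, and assume additionally that $\mathcal{E}\subset\operatorname{Dom}(A^q)$ for some $q>1$. Then for $b>0$ large enough and independent of $N$ and $M$, one can always find $\lambda_{NM}\in\operatorname{Spec}_2(H_\kappa,\mathcal{L}_{NM})$ such that $$|\lambda_{NM}-E|<b\left(N^{-\frac{q-1}{2}}+M^{-\frac{q-1}{2}}\right)\quad\text{and}\quad \|(I-\Pi_{\mathcal{E}})v_{NM}\|<b\left(N^{-\frac{q-1}{2}}+M^{-\frac{q-1}{2}}\right),$$ where $v_{NM}\in\mathcal{L}_{NM}$, $\|v_{NM}\|=1$, solves $Q(\lambda_{NM})\underline{v_{NM}}=0$.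
   Context: Let $\kappa$ be a nonzero integer and let $\phi_{\mathrm{sc}},\phi_{\mathrm{el}},\phi_{\mathrm{am}}$ be real-valued functions on $(0,\infty)$. The radial Dirac operator on $L^2(0,\infty)^2$ is $$H_\kappa=\begin{pmatrix}1+\phi_{\mathrm{sc}}(r)+\phi_{\mathrm{el}}(r)&-\frac{d}{dr}+\frac{\kappa}{r}+\phi_{\mathrm{am}}(r)\\ \frac{d}{dr}+\frac{\kappa}{r}+\phi_{\mathrm{am}}(r)&-1-\phi_{\mathrm{sc}}(r)+\phi_{\mathrm{el}}(r)\end{pmatrix}.$$ It is assumed throughout that the potentials are such that $H_\kappa$ is essentially self-adjoint on $C_0^\infty(0,\infty)^2$; $H_\kappa$ also denotes the self-adjoint closure. Odd-order Hermite functions: $\Phi_k(r)=c_{2k+1}^{-1}h_{2k+1}(r)e^{-r^2/2}$, $r\ge0$, $k=0,1,2,\dots$, with $h_n(z)=(-1)^ne^{z^2}\frac{d^n}{dz^n}e^{-z^2}$ and $c_n=\sqrt{2^{n-1}n!\sqrt\pi}$; they form an orthonormal basis of $L^2(0,\infty)$. For integers $N,M\ge1$, $$\mathcal{L}_{NM}=\operatorname{Span}\left\{\begin{pmatrix}\Phi_0\\0\end{pmatrix},\dots,\begin{pmatrix}\Phi_{N-1}\\0\end{pmatrix},\begin{pmatrix}0\\\Phi_0\end{pmatrix},\dots,\begin{pmatrix}0\\\Phi_{M-1}\end{pmatrix}\right\}.$$ Let $A=\begin{pmatrix}\tilde A&0\\0&\tilde A\end{pmatrix}$, where $\tilde A=-\partial_r^2+r^2$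 is the self-adjoint harmonic oscillator on $L^2(0,\infty)$ with Dirichlet boundary condition at $0$ (with eigenfunctions $\Phi_k$); $A^q$ is defined by the functional calculus. Second order spectrum: for a self-adjoint operator $G$ and a subspace $\mathcal{L}=\operatorname{Span}\{b_1,\dots,b_n\}\subset\operatorname{Dom}(G)$ with $b_j$ linearly independent, let $K=(\langle Gb_j,Gb_k\rangle)$, $L=(\langle Gb_j,b_k\rangle)$, $B=(\langle b_j,b_k\rangle)$, $Q(z)=Bz^2-2zL+K$, and $\operatorname{Spec}_2(G,\mathcal{L})=\{\lambda\in\mathbb{C}: Q(\lambda)\underline{v}=0\text{ for some }0\ne\underline{v}\in\mathbb{C}^n\}$. A vector $v\in\mathcal{L}$ is identified with its coefficient vector $\underline{v}\in\mathbb{C}^n$ in the basis $\{b_j\}$; $Q(\lambda)\underline{v}=0$ is equivalent to $\langle(\lambda-G)v,(\overline\lambda-G)w\rangle=0$ for all $w\in\mathcal{L}$. Here $Q$ is the polynomial for $G=H_\kappa$, $\mathcal{L}=\mathcal{L}_{NM}$ and the listed basis. $\Pi_{\mathcal{E}}$ is the orthogonal projection onto $\mathcal{E}$. *)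

(* Defs.v *)
From HB Require Import structures.
From mathcomp Require Import all_boot all_order all_algebra.
From mathcomp Require Import all_classical all_reals all_analysis.
From mathcomp Require Import complex.

Set Implicit Arguments.
Unset Strict Implicit.
Unset Printing Implicit Defensive.

Import Order.TTheory GRing.Theory Num.Theory.
Import numFieldNormedType.Exports.

Local Open Scope classical_set_scope.
Local Open Scope ring_scope.
Local Open Scope complex_scope.

(* With values in R, unlike Num.Re and Num.Im. *)
Local Notation Re := complex.Re.
Local Notation Im := complex.Im.

(** The elements of the Hilbert space L^2(0,oo)^2 are represented by pairs of functions on the whole of R, of
   which only the values on (0,oo) matter: all norms and integrals are taken
   with respect to [half_line].  Almost everywhere equality of u and v is
   expressed as [hnorm (u - v) = 0]. *)

Section HilbertSpace.
Context {R : realType}.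

Definition half_line : {measure set (measurableTypeR R) -> \bar R} :=
  mrestr (@lebesgue_measure R) (measurable_itv `]0%R, +oo[).

Definition spinor := ((R -> R[i]^o) * (R -> R[i]^o))%type.

Definition cL2 (f : R -> R[i]) : Prop :=
  (fun r : measurableTypeR R => Re (f r)) \in Lfun half_line 2%:E /\
  (fun r : measurableTypeR R => Im (f r)) \in Lfun half_line 2%:E.

Definition L2 (u : spinor) : Prop := cL2 u.1 /\ cL2 u.2.

Definition cintegral (mu : {measure set (measurableTypeR R) -> \bar R})
    (D : set R) (f : R -> R[i]) : R[i] :=
  (\int[mu]_(r in D) Re (f r)) +i* (\int[mu]_(r in D) Im (f r)).

(* Linear in the first argument. *)
Definition inner (u v : spinor) : R[i] :=
  cintegral half_line setT
    (fun r => (u.1 r : R[i]) * (v.1 r : R[i])^* + (u.2 r : R[i]) * (v.2 r : R[i])^*).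

Definition hnorm (u : spinor) : R := Num.sqrt (Re (inner u u)).

End HilbertSpace.

Section Operators.
Context {R : realType}.
Local Notation spinor := (@spinor R).

(* Unbounded operators are given by their graphs. *)
Definition operator := spinor -> spinor -> Prop.

Implicit Types (T : operator) (u v w f g : spinor) (z : R[i]).

Definition in_dom T u : Prop := exists w, T u w.

(* The value T u, for u in the domain (determined up to a null set); the zero
   function otherwise. *)
Definition value T u : spinor := xget 0 [set w | T u w].

Definition closure_op T : operator := fun f g =>
  [/\ L2 f, L2 g &
      forall e : R, 0 < e ->
        exists u w, [/\ T u w, hnorm (f - u) < e & hnorm (g - w) < e]].

Definition adjoint_op T : operator := fun f g =>
  [/\ L2 f, L2 g & forall u w, T u w -> inner w f = inner u g].

Definition densely_defined T : Prop :=
  forall f, L2 f -> forall e : R, 0 < e -> exists2 u, in_dom T u & hnorm (f - u) < e.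

Definition selfadjoint T : Prop :=
  densely_defined T /\ forall f g, T f g <-> adjoint_op T f g.

Definition ess_selfadjoint T : Prop :=
  (forall u w, T u w -> L2 u /\ L2 w) /\ selfadjoint (closure_op T).

(* T f (z *: f + g) means (T - z) f = g: T - z is onto, and bounded below. *)
Definition resolvent_set T : set R[i] := [set z |
  (forall g, L2 g -> exists f, T f (z *: f + g)) /\
  (exists C : R, forall f g, T f (z *: f + g) -> hnorm f <= C * hnorm g)].

Definition spectrum T : set R[i] := ~` resolvent_set T.

Definition eigenspace_op T z : set spinor := [set f | T f (z *: f)].

Definition eigenvalue_op T z : Prop :=
  exists2 f, eigenspace_op T z f & hnorm f != 0.

Definition isolated_in_spectrum T z : Prop :=
  exists2 d : R, 0 < d &
    forall z', spectrum T z' -> Normc.normc (z' - z) < d -> z' = z.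

Definition finite_multiplicity T z : Prop :=
  exists (n : nat) (e : 'I_n -> spinor),
    (forall i, eigenspace_op T z (e i)) /\
    forall f, eigenspace_op T z f ->
      exists a : 'I_n -> R[i], hnorm (f - \sum_i a i *: e i) = 0.

(* Orthogonal projection onto a closed subspace (determined up to a null set).
   It exists in particular for finite dimensional subspaces. *)
Definition orth_proj (S : set spinor) u : spinor :=
  xget 0 [set p | S p /\ forall v, S v -> inner (u - p) v = 0].

(** [spectral_measure T P mu] : P is the projection-valued measure of the
   self-adjoint operator T, and mu u is the scalar measure <P(.)u,u>.
   Countable additivity of P is carried by mu u being a measure.  The last two
   clauses say that T is the integral of x dP(x): the domain of T is
   {u | x^2 is (mu u)-integrable}, and <Tu,P(S)u> is the integral of x over S
   with respect to mu u (S = setT gives the quadratic form of T). *)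
Record spectral_measure T (P : set R -> spinor -> spinor)
    (mu : spinor -> {measure set (measurableTypeR R) -> \bar R}) : Prop := {
  spectral_L2 : forall (S : set (measurableTypeR R)) u,
    measurable S -> L2 u -> L2 (P S u);
  spectral_sym : forall (S : set (measurableTypeR R)) u v,
    measurable S -> L2 u -> L2 v -> inner (P S u) v = inner u (P S v);
  spectral_mul : forall (S S' : set (measurableTypeR R)) u,
    measurable S -> measurable S' -> L2 u ->
    hnorm (P S (P S' u) - P (S `&` S') u) = 0;
  spectral_one : forall u, L2 u -> hnorm (P setT u - u) = 0;
  spectral_scalar : forall (S : set (measurableTypeR R)) u,
    measurable S -> L2 u -> mu u S = (Re (inner (P S u) u))%:E;
  spectral_dom : forall u, L2 u ->
    in_dom T u <-> (\int[mu u]_x (x ^+ 2)%:E < +oo)%E;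
  spectral_value : forall (S : set (measurableTypeR R)) u w,
    measurable S -> T u w ->
    inner w (P S u) = (\int[mu u]_(x in S) x)%:C }.

(* The domain of f(T). *)
Definition dom_calculus T (f : R -> R) : set spinor := [set u |
  exists P mu, [/\ spectral_measure T P mu, L2 u &
                   (\int[mu u]_x ((f x) ^+ 2)%:E < +oo)%E]].

(* The domain of T^q for a nonnegative operator T: the values of x `^ q at
   x < 0 are irrelevant. *)
Definition dom_power T (q : R) : set spinor := dom_calculus T (fun x => x `^ q).

Definition lincomb n (b : 'I_n -> spinor) (v : 'cV[R[i]]_n) : spinor :=
  \sum_j v j 0 *: b j.

Definition lin_indep n (b : 'I_n -> spinor) : Prop :=
  forall v : 'cV[R[i]]_n, hnorm (lincomb b v) = 0 -> v = 0.

Definition Kmx T n (b : 'I_n -> spinor) : 'M[R[i]]_n :=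
  \matrix_(j, k) inner (value T (b j)) (value T (b k)).

Definition Lmx T n (b : 'I_n -> spinor) : 'M[R[i]]_n :=
  \matrix_(j, k) inner (value T (b j)) (b k).

Definition Bmx n (b : 'I_n -> spinor) : 'M[R[i]]_n :=
  \matrix_(j, k) inner (b j) (b k).

Definition Qmx T n (b : 'I_n -> spinor) (z : R[i]) : 'M[R[i]]_n :=
  z ^+ 2 *: Bmx b - (2 * z) *: Lmx T b + Kmx T b.

(* The first two conditions are the standing requirements on the b_j; they are
   part of the definition so that membership is never due to a default
   [value]. *)
Definition spec2 T n (b : 'I_n -> spinor) : set R[i] := [set z |
  [/\ forall j, in_dom T (b j), lin_indep b &
      exists2 v : 'cV[R[i]]_n, v != 0 & Qmx T b z *m v = 0]].

End Operators.

Section Dirac.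
Context {R : realType}.

Definition cderive (f : R -> R[i]) (r : R) : R[i] :=
  derive1 (fun x => Re (f x)) r +i* derive1 (fun x => Im (f x)) r.

Definition smooth (f : R -> R) : Prop :=
  forall (n : nat) (x : R), derivable (derive1n n f) x 1.

(* C_0^oo(0,oo), extended by zero to R. *)
Definition test_function (f : R -> R[i]) : Prop :=
  [/\ smooth (fun x => Re (f x)), smooth (fun x => Im (f x)) &
      exists a b : R, 0 < a /\ forall x, x < a \/ b < x -> f x = 0].

Definition dirac_expr (kappa : int) (phisc phiel phiam : R -> R)
    (u : @spinor R) : @spinor R :=
  (fun r => (1 + phisc r + phiel r)%:C * u.1 r
            + (- cderive u.2 r + (kappa%:~R / r + phiam r)%:C * u.2 r),
   fun r => (cderive u.1 r + (kappa%:~R / r + phiam r)%:C * u.1 r)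
            + (- 1 - phisc r + phiel r)%:C * u.2 r).

Definition dirac_min_op (kappa : int) (phisc phiel phiam : R -> R) : @operator R :=
  fun u w => [/\ test_function u.1, test_function u.2 &
                 w = dirac_expr kappa phisc phiel phiam u].

Definition dirac_op (kappa : int) (phisc phiel phiam : R -> R) : @operator R :=
  closure_op (dirac_min_op kappa phisc phiel phiam).

Definition coulomb_plus_bounded (c : R) (phi : R -> R) : Prop :=
  exists chi psi : R -> R,
    [/\ forall r, 0 < r -> phi r = chi r + psi r,
        forall r, 0 < r -> `|chi r| <= c * r^-1 &
        psi \in Lfun half_line +oo%E].

End Dirac.

Section Oscillator.
Context {R : realType}.

Definition hermite (n : nat) (z : R) : R :=
  (-1) ^+ n * expR (z ^+ 2) * derive1n n (fun x : R => expR (- x ^+ 2)) z.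

Definition hermite_const (n : nat) : R :=
  Num.sqrt (2 ^+ n.-1 * n`!%:R * Num.sqrt pi).

Definition Phi (k : nat) (r : R) : R :=
  (hermite_const k.*2.+1)^-1 * hermite k.*2.+1 r * expR (- (r ^+ 2 / 2)).

Definition hermite_basis (N M : nat) (j : 'I_(N + M)) : @spinor R :=
  match fintype.split j with
  | inl k => (fun r => (Phi k r)%:C, fun=> 0)
  | inr k => (fun=> 0, fun r => (Phi k r)%:C)
  end.

Definition locally_integrable (s : R -> R[i]) : Prop := forall r : R,
  lebesgue_measure.-integrable `[0, r] (fun x => (Re (s x))%:E) /\
  lebesgue_measure.-integrable `[0, r] (fun x => (Im (s x))%:E).

(* Graph of -d^2/dr^2 + r^2 on its maximal Dirichlet domain: u and u' are
   absolutely continuous on bounded intervals [0, r], with u(0) = 0, u' = p,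
   u'' = s, and w = - u'' + r^2 u is in L^2. *)
Definition oscillator (u w : R -> R[i]) : Prop :=
  [/\ cL2 u, cL2 w &
   exists p s : R -> R[i], exists p0 : R[i],
   [/\ locally_integrable s,
       forall r, 0 <= r -> p r = p0 + cintegral lebesgue_measure `[0, r] s,
       {ae half_line, forall r, u r = cintegral lebesgue_measure `[0, r] p} &
       {ae half_line, forall r, w r = - s r + (r ^+ 2)%:C * u r}]].

Definition oscillator2 : @operator R :=
  fun u w => oscillator u.1 w.1 /\ oscillator u.2 w.2.

End Oscillator.

(* Main.v *)
From HB Require Import structures.
From mathcomp Require Import all_boot all_order all_algebra.
From mathcomp Require Import all_classical all_reals all_analysis.
From mathcomp Require Import measurable_realfun ess_sup_inf complex ring lra zify.
Require Import Defs.

(** Write delta = N^(-(q-1)/2) + M^(-(q-1)/2).  Both inequalities are weak when delta is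
    bounded below, that is, when N or M stays bounded, and need a perturbation argument when
    delta is small.

    When delta is small.  A vector u in the domain of the power q of the oscillator has
    Hermite coefficients with rapid decay [spectral_decay].  As the Coulomb potentials are
    dominated by the kinetic energy through the Hardy inequality [hardy, D_bound], the
    truncated expansions of an eigenvector converge in the graph norm of the Dirac operator,
    at the rate delta [eigen_approx].  As E is isolated, H - E is bounded below on the
    orthogonal complement of the eigenspace [gap_orthogonal].  These two facts make up
    [spectral_approx], and they imply both that the pencil has an eigenvalue within a
    multiple of delta of E [pencil_eigenvalue], by the maximum principle applied to the
    resolvent of the pencil, and that all eigenvectors for such eigenvalues are within a
    multiple of delta of the eigenspace [pencil_eigenvector].

    When delta is not small.  The distance of a unit vector from the eigenspace is at most 1,
    so that one only needs points of the second order spectrum in a disc independent of N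
    and M.  The difficulty is that N may be small while M is arbitrarily large, or
    conversely: then nothing is known about approximation, and all points of the spectrum
    might drift to infinity.  This is excluded as follows [small_component].  With few
    functions in the first component, the compressed operator L is bounded up to a term B
    from the Coulomb singularity in the second component, while the compressed square K
    is comparable, up to B, to the kinetic energy of that component.  The matrix of the
    kinetic energy has a Laguerre polynomial as its characteristic polynomial, so that the
    trace of (t + kinetic energy)^-1 is about sqrt (M / t) [kinetic_spectrum]; and the trace
    of B relative to the kinetic energy is only logarithmic in M [trace_bound].  If all roots
    of the pencil Q(z) = z^2 - 2 z L + K were large, ln |det Q(x) det Q(-x) / det Q(0)^2|
    would be nearly quadratic in x on a long interval.  It is, however, about
    2 ln det (1 + x^2 K^-1), up to logarithmic terms, and this grows only like |x| sqrt M
    [density_inequality, bounded_root].  The case of few functions in the second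
    component follows by exchanging the components [swap_potentials].

    Two points precede all this: the Hermite functions must be shown to lie in the domain of
    the closure of the operator [rsp_in_dom], and the potentials are not assumed
    to be measurable: this is recovered from the action of the operator on test functions
    [measurable_potentials]. *)

Set Implicit Arguments. Unset Strict Implicit. Unset Printing Implicit Defensive.
Import Order.TTheory GRing.Theory Num.Theory.
Import numFieldNormedType.Exports.
Local Open Scope classical_set_scope.
Local Open Scope ring_scope.
Local Open Scope complex_scope.
Local Open Scope sesquilinear_scope.
Local Notation Re := complex.Re.
Local Notation Im := complex.Im.
Local Notation normc := Normc.normc.
Local Notation "z ^*" := (Num.conj z) : complex_scope.

(** * Semi-inner product spaces *)

Section ComplexAux.
Context {R : realType}.
Implicit Types z w : R[i].

Lemma cReD z w : Re (z + w) = Re z + Re w. Proof. by case: z; case: w. Qed.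
Lemma cImD z w : Im (z + w) = Im z + Im w. Proof. by case: z; case: w. Qed.
Lemma cReN z : Re (- z) = - Re z. Proof. by case: z. Qed.
Lemma cImN z : Im (- z) = - Im z. Proof. by case: z. Qed.
Lemma cReM z w : Re (z * w) = Re z * Re w - Im z * Im w.
Proof. by case: z; case: w. Qed.
Lemma cImM z w : Im (z * w) = Re z * Im w + Im z * Re w.
Proof. by case: z; case: w. Qed.
Lemma conjcE z : z^* = conjc z. Proof. by []. Qed.
Lemma cReJ z : Re z^* = Re z. Proof. by rewrite conjcE; case: z. Qed.
Lemma cImJ z : Im z^* = - Im z. Proof. by rewrite conjcE; case: z. Qed.

Lemma cReZ (x : R) z : Re (x%:C * z) = x * Re z.
Proof. by rewrite cReM /= mul0r subr0. Qed.
Lemma cReZJ (x : R) z : Re ((x%:C)^* * z) = x * Re z.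
Proof. by rewrite cReM cReJ cImJ /= oppr0 mul0r subr0. Qed.

Lemma cconjK z : z^*^* = z. Proof. exact: conjCK. Qed.
Lemma cconjR (x : R) : (x%:C)^* = x%:C :> R[i].
Proof. by rewrite conjcE /= oppr0. Qed.

Lemma complexP z w : Re z = Re w -> Im z = Im w -> z = w.
Proof. by case: z; case: w => a b c d /= -> ->. Qed.

Lemma sqr_normcE z : normc z ^+ 2 = Re z ^+ 2 + Im z ^+ 2.
Proof. by case: z => a b /=; rewrite sqr_sqrtr // addr_ge0 ?sqr_ge0. Qed.

Lemma normc_ge0 z : 0 <= normc z.
Proof. by case: z => a b /=; rewrite sqrtr_ge0. Qed.

Lemma normcJ z : normc z^* = normc z.
Proof. by rewrite conjcE; case: z => a b /=; rewrite sqrrN. Qed.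

Lemma normcR (x : R) : normc x%:C = `|x|.
Proof. by rewrite /= expr0n /= addr0 sqrtr_sqr. Qed.

Lemma normc_ler z w : normc (z + w) <= normc z + normc w.
Proof. exact: le_normcD. Qed.

Lemma normc_eq0P z : normc z = 0 -> z = 0.
Proof. exact: Normc.eq0_normc. Qed.

Lemma normcX z n : normc (z ^+ n) = normc z ^+ n.
Proof.
elim: n => [|n IH]; first by rewrite !expr0 Normc.normc1.
by rewrite !exprS Normc.normcM IH.
Qed.

Lemma mulJc z : z * z^* = (normc z ^+ 2)%:C.
Proof. by rewrite sqr_normcE conjcE; case: z => a b; simpc; congr (_ +i* _); ring. Qed.
End ComplexAux.

(** Definiteness is not required: the form may vanish on null functions, so that one
    can work with functions instead of classes of functions. Consequently equalities
    of vectors appear below as the vanishing of the norm of a difference. *)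
Record is_form (R : realType) (V : lmodType R[i]) (ip : V -> V -> R[i]) : Prop := {
  formDl : forall u v w, ip (u + v) w = ip u w + ip v w;
  formZl : forall a u w, ip (a *: u) w = a * ip u w;
  formC : forall u v, ip v u = (ip u v)^*;
  form_ge0 : forall u, 0 <= Re (ip u u) }.

Section PreHilbert.
Context {R : realType} {V : lmodType R[i]} {ip : V -> V -> R[i]}.
Hypothesis fip : is_form ip.
Implicit Types (u v w : V) (a : R[i]) (x : R).

Definition nrm2 u : R := Re (ip u u).
Definition nrm u : R := Num.sqrt (nrm2 u).

Lemma formDr u v w : ip u (v + w) = ip u v + ip u w.
Proof. by rewrite (formC fip) (formDl fip) rmorphD /= -!(formC fip). Qed.
Lemma formZr a u w : ip u (a *: w) = a^* * ip u w.
Proof. by rewrite (formC fip) (formZl fip) rmorphM /= -!(formC fip). Qed.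
Lemma formNl u w : ip (- u) w = - ip u w.
Proof. by rewrite -scaleN1r (formZl fip) mulN1r. Qed.
Lemma formNr u w : ip u (- w) = - ip u w.
Proof. by rewrite -scaleN1r formZr rmorphN1 mulN1r. Qed.
Lemma formBl u v w : ip (u - v) w = ip u w - ip v w.
Proof. by rewrite (formDl fip) formNl. Qed.
Lemma formBr u v w : ip u (v - w) = ip u v - ip u w.
Proof. by rewrite formDr formNr. Qed.
Lemma form0l w : ip 0 w = 0.
Proof. by rewrite -(scale0r (0 : V)) (formZl fip) mul0r. Qed.
Lemma form0r w : ip w 0 = 0.
Proof. by rewrite (formC fip) form0l conjC0. Qed.
Lemma form_suml I r (P : pred I) (F : I -> V) w :
  ip (\sum_(i <- r | P i) F i) w = \sum_(i <- r | P i) ip (F i) w.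
Proof.
apply: (big_morph (fun u => ip u w) _ (form0l w)) => u v; exact: (formDl fip).
Qed.
Lemma form_sumr I r (P : pred I) (F : I -> V) w :
  ip w (\sum_(i <- r | P i) F i) = \sum_(i <- r | P i) ip w (F i).
Proof. apply: (big_morph (fun u => ip w u) _ (form0r w)) => u v; exact: formDr. Qed.

Lemma form_self u : ip u u = (nrm2 u)%:C.
Proof.
apply: complexP => //=; have := formC fip u u.
by move=> /(congr1 (@complex.Im R)); rewrite cImJ => h; lra.
Qed.

Lemma nrm2_ge0 u : 0 <= nrm2 u. Proof. exact: form_ge0 fip u. Qed.
Lemma nrm_ge0 u : 0 <= nrm u. Proof. exact: sqrtr_ge0. Qed.
Lemma sqr_nrm u : nrm u ^+ 2 = nrm2 u. Proof. by rewrite sqr_sqrtr ?nrm2_ge0. Qed.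

Lemma nrm2D u v : nrm2 (u + v) = nrm2 u + 2 * Re (ip u v) + nrm2 v.
Proof.
rewrite /nrm2 (formDl fip) !formDr !cReD (formC fip u v) cReJ; ring.
Qed.
Lemma nrm2N u : nrm2 (- u) = nrm2 u.
Proof. by rewrite /nrm2 formNl formNr opprK. Qed.
Lemma nrm2B u v : nrm2 (u - v) = nrm2 u - 2 * Re (ip u v) + nrm2 v.
Proof. by rewrite nrm2D formNr cReN nrm2N; ring. Qed.
Lemma nrm2Z a u : nrm2 (a *: u) = normc a ^+ 2 * nrm2 u.
Proof. by rewrite /nrm2 (formZl fip) formZr mulrA mulJc cReM /= mul0r subr0. Qed.
Lemma nrmZ a u : nrm (a *: u) = normc a * nrm u.
Proof. by rewrite /nrm nrm2Z sqrtrM ?sqr_ge0 // sqrtr_sqr ger0_norm // normc_ge0. Qed.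
Lemma nrmN u : nrm (- u) = nrm u. Proof. by rewrite /nrm nrm2N. Qed.
Lemma nrm0 : nrm 0 = 0. Proof. by rewrite /nrm /nrm2 form0l sqrtr0. Qed.

Lemma ReCS u v : Re (ip u v) <= nrm u * nrm v.
Proof.
have key (p q r : R) : 0 <= p -> 0 <= r ->
    (forall x, 0 <= p + 2 * x * q + x ^+ 2 * r) -> q ^+ 2 <= p * r.
  move=> p0 r0 h; have [r1|r1] := eqVneq r 0.
    have [q1|q1] := eqVneq q 0; first by rewrite q1 r1 expr0n /= mulr0.
    have := h (- (p + 1) / (2 * q)); rewrite r1 mulr0 addr0.
    have -> : p + 2 * (- (p + 1) / (2 * q)) * q = -1 by field.
    by rewrite ler0N1.
  have rp : 0 < r by rewrite lt_def r1.
  have := h (- q / r).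
  have -> : p + 2 * (- q / r) * q + (- q / r) ^+ 2 * r = (p * r - q ^+ 2) / r by field.
  by rewrite ler_pdivlMr // mul0r subr_ge0.
have h x : 0 <= nrm2 u + 2 * x * Re (ip u v) + x ^+ 2 * nrm2 v.
  have := nrm2_ge0 (u + x%:C *: v); rewrite nrm2D nrm2Z formZr sqr_normcE.
  by rewrite cReM cReJ cImJ /= oppr0 mul0r subr0 expr0n /= addr0 mulrA.
have /key := h; move/(_ (nrm2_ge0 u) (nrm2_ge0 v)) => k.
apply: (le_trans (ler_norm _)); rewrite -sqrtr_sqr -sqrtrM ?nrm2_ge0 //.
by rewrite ler_wsqrtr.
Qed.

Lemma formCS u v : normc (ip u v) <= nrm u * nrm v.
Proof.
have [z0|z0] := eqVneq (normc (ip u v)) 0.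
  by rewrite z0 mulr_ge0 ?nrm_ge0.
set z := ip u v in z0 *; have zp : 0 < normc z by rewrite lt_def z0 normc_ge0.
have := ReCS (z^* *: u) v; rewrite (formZl fip) -/z mulrC mulJc /= nrmZ normcJ.
by rewrite expr2 -mulrA ler_pM2l.
Qed.

Lemma nrmD u v : nrm (u + v) <= nrm u + nrm v.
Proof.
rewrite -(@ler_pXn2r _ 2) ?nnegrE ?addr_ge0 ?nrm_ge0 // sqr_nrm nrm2D sqrrD !sqr_nrm.
by rewrite lerD2r lerD2l -[leRHS]mulr_natl ler_wpM2l // ReCS.
Qed.
Lemma nrmB u v : nrm (u - v) <= nrm u + nrm v.
Proof. by rewrite -(nrmN v) nrmD. Qed.
Lemma nrmBC u v : nrm (u - v) = nrm (v - u).
Proof. by rewrite -nrmN opprB. Qed.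
Lemma nrm_tri u v : nrm u <= nrm v + nrm (u - v).
Proof. by apply: le_trans (nrmD _ _); rewrite addrC subrK. Qed.
Lemma nrm_eq0_form u v : nrm u = 0 -> ip u v = 0.
Proof.
move=> u0; apply: normc_eq0P; apply/eqP; rewrite eq_le normc_ge0 andbT.
by have := formCS u v; rewrite u0 mul0r.
Qed.
Lemma nrm_eq0_formr u v : nrm u = 0 -> ip v u = 0.
Proof. by move=> u0; rewrite (formC fip) nrm_eq0_form // conjC0. Qed.

Lemma pyth u v : ip u v = 0 -> nrm2 (u + v) = nrm2 u + nrm2 v.
Proof. by move=> h; rewrite nrm2D h /= mulr0 addr0. Qed.

Lemma nrm_le x u : 0 <= x -> nrm2 u <= x ^+ 2 -> nrm u <= x.
Proof.
by move=> x0 h; rewrite -(@ler_pXn2r _ 2) ?nnegrE ?nrm_ge0 // sqr_nrm.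
Qed.
End PreHilbert.
Arguments nrm2 {R V} ip u.
Arguments nrm {R V} ip u.

(** * Complete spaces and operators with a gap *)

Lemma geo_small (R : realType) (x A e : R) : 0 <= x < 1 -> 0 < e ->
  exists N : nat, forall n, (N <= n)%N -> A * x ^+ n < e.
Proof.
move=> /andP[x0 x1] e0.
have [A0|A0] := leP A 0.
  by exists 0%N => n _; rewrite (le_lt_trans _ e0) // mulr_le0_ge0 ?exprn_ge0.
have h : (fun n : nat => x ^+ n : R) @ \oo --> (0 : R).
  by apply: cvg_expr; rewrite ger0_norm.
have /cvgrPdist_lt/(_ _ (divr_gt0 e0 A0)) [N _ hN] := h.
exists N => n Nn; have := hN n Nn.
by rewrite /= sub0r normrN ger0_norm ?exprn_ge0 // ltr_pdivlMr // mulrC.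
Qed.

Definition complete_form (R : realType) (V : lmodType R[i]) (ip : V -> V -> R[i]) :=
  forall u : nat -> V,
  (forall e : R, 0 < e -> exists N : nat, forall m n, (N <= n)%N -> (n <= m)%N ->
     nrm ip (u m - u n) < e) ->
  exists l, forall e : R, 0 < e -> exists N : nat, forall n, (N <= n)%N ->
     nrm ip (u n - l) < e.

Lemma eq0_small (R : realType) (x : R) : 0 <= x -> (forall e, 0 < e -> x <= e) -> x = 0.
Proof.
move=> x0 h; apply/eqP; rewrite eq_le x0 andbT leNgt; apply/negP => xp.
by have := h (x / 2) (divr_gt0 xp (ltr0n _ 2)); lra.
Qed.

(** A bounded symmetric operator with spectrum in {0} and [2/3, 2] is bounded
   below off its kernel: the iterates of 1 - X/2 converge geometrically to the
   projection onto the kernel. *)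
Section RangeClosed.
Context {R : realType} {V : lmodType R[i]} {ip : V -> V -> R[i]}.
Hypothesis fip : is_form ip.
Hypothesis cplt : complete_form ip.
Variable X : V -> V.
Local Notation nrm := (nrm ip).
Local Notation nrm2 := (nrm2 ip).
Hypothesis Xsym : forall u v, Re (ip (X u) v) = Re (ip u (X v)).
Hypothesis Xlin : forall u v (x : R), nrm (X (u + x%:C *: v) - (X u + x%:C *: X v)) = 0.
Hypothesis Xle2 : forall u, nrm2 (X u) <= 2 * Re (ip (X u) u).
Hypothesis Xge : forall u, 2 * Re (ip (X u) u) <= 3 * nrm2 (X u).

Let ReD0l (u v w : V) : nrm (u - v) = 0 -> Re (ip u w) = Re (ip v w).
Proof.
by move=> h; rewrite -[u](subrK v) (formDl fip) (nrm_eq0_form fip _ h) add0r.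
Qed.

Let X_lip u : nrm (X u) <= 2 * nrm u.
Proof.
have := Xle2 u; have := ReCS fip (X u) u; rewrite -(sqr_nrm fip).
have [->|p0] := eqVneq (nrm (X u)) 0.
  by move=> *; rewrite mulr_ge0 ?nrm_ge0.
have p : 0 < nrm (X u) by rewrite lt_def p0 nrm_ge0.
move=> h1 h2; rewrite -(ler_pM2l p) -expr2; apply: (le_trans h2).
lra.
Qed.

Let X_ran u : 2 * nrm2 (X u) <= 3 * Re (ip (X (X u)) (X u)).
Proof.
have h := Xle2 (X u + (- (2/3))%:C *: u).
have := ReD0l (X (X u) + (- (2/3))%:C *: X u) (Xlin (X u) u (- (2/3))).
have e := ReD0l (X u + (- (2/3))%:C *: u) (Xlin (X u) u (- (2/3))).
have n0 := nrm2_ge0 fip (X (X u + (- (2/3))%:C *: u)).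
move: h; rewrite e (formDl fip) !(formDr fip) !(formZl fip) !(formZr fip) => h _.
move: h; rewrite !cReD !(cReZ, cReZJ) => h.
have s1 := Xsym (X u) u; have k := Xge u.
have k2 : nrm2 (X u) = Re (ip (X u) (X u)) by [].
rewrite -k2 in s1.
rewrite -k2 in h.
move: h k n0 s1; set a := Re (ip (X (X u)) (X u)); set b := nrm2 (X u).
set c := Re (ip (X u) u) => h k n0 s1; lra.
Qed.

Fixpoint ker_iter (f : V) n : V :=
  if n is n'.+1 then let r := ker_iter f n' in r + (- 2^-1)%:C *: X r else f.

Let p_step f n : nrm2 (X (ker_iter f n.+1)) <= 2/3 * nrm2 (X (ker_iter f n)).
Proof.
rewrite /=; set r := ker_iter f n; set p := X r.
have e := Xlin r p (- 2^-1); rewrite -/p in e.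
have -> : nrm2 (X (r + (- 2^-1)%:C *: p)) = nrm2 (p + (- 2^-1)%:C *: X p).
  rewrite -!(sqr_nrm fip); congr (_ ^+ 2); apply/eqP; rewrite eq_le.
  have := nrm_tri fip (X (r + (- 2^-1)%:C *: p)) (p + (- 2^-1)%:C *: X p).
  have := nrm_tri fip (p + (- 2^-1)%:C *: X p) (X (r + (- 2^-1)%:C *: p)).
  by rewrite e (nrmBC fip) e !addr0 => -> ->.
rewrite (nrm2D fip) (nrm2Z fip) (formZr fip) normcR normrN ger0_norm ?invr_ge0 //.
rewrite cReZJ.
have h1 := Xle2 p; have h2 := X_ran r; rewrite -/p in h2.
rewrite (formC fip) cReJ; lra.
Qed.

Let p_bound f n : nrm (X (ker_iter f n)) <= (5/6) ^+ n * nrm (X f).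
Proof.
elim: n => [|n IH]; first by rewrite expr0 mul1r.
rewrite exprS -mulrA; apply: (@le_trans _ _ (5/6 * nrm (X (ker_iter f n)))); last first.
  by rewrite ler_wpM2l //; lra.
apply: nrm_le => //; first by rewrite mulr_ge0 ?nrm_ge0 //; lra.
apply: (le_trans (p_step f n)); rewrite exprMn (sqr_nrm fip).
rewrite ler_wpM2r ?(nrm2_ge0 fip) //; lra.
Qed.

Let r_cauchy f n k : nrm (ker_iter f (n + k) - ker_iter f n)
  <= 3 * (5/6) ^+ n * nrm (X f) * (1 - (5/6) ^+ k).
Proof.
elim: k => [|k IH]; first by rewrite addn0 subrr (nrm0 fip) expr0 subrr mulr0.
rewrite addnS /= addrAC; apply: (le_trans (nrmD fip _ _)).
rewrite (nrmZ fip) normcR normrN ger0_norm ?invr_ge0 //.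
have := p_bound f (n + k); rewrite exprD exprS.
set A := (5/6) ^+ n; set B := (5/6) ^+ k => h; rewrite -/A -/B in IH.
apply: (le_trans (lerD IH (ler_wpM2l _ h))); first by rewrite invr_ge0.
by rewrite le_eqVlt; apply/orP; left; apply/eqP; field.
Qed.

Lemma bounded_below_off_kernel f :
  (forall r, nrm (X r) = 0 -> Re (ip f r) = 0) -> nrm f <= 3 * nrm (X f).
Proof.
move=> hf.
have x56 : 0 <= (5/6 : R) < 1 by apply/andP; split; lra.
have [|r hr] := cplt (u := ker_iter f).
  move=> e e0; have [N hN] := geo_small (3 * nrm (X f)) x56 e0.
  exists N => m n Nn nm; rewrite -(subnKC nm).
  apply: (le_lt_trans (r_cauchy f n (m - n))).
  apply: le_lt_trans (hN n Nn).
  have [x0 _] := andP x56; rewrite -subr_ge0.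
  rewrite (_ : _ - _ = 3 * nrm (X f) * ((5/6) ^+ n * (5/6) ^+ (m - n))); last by ring.
  by rewrite !mulr_ge0 ?nrm_ge0 ?exprn_ge0.
have X0 : nrm (X r) = 0.
  apply: eq0_small => [|e e0]; first exact: nrm_ge0.
  have [N1 h1] := geo_small (nrm (X f)) x56 (divr_gt0 e0 (ltr0n _ 2)).
  have e4 : 0 < e / 4 by rewrite divr_gt0.
  have [N2 h2] := hr _ e4.
  pose n := maxn N1 N2.
  have := h1 n (leq_maxl _ _); have := h2 n (leq_maxr _ _).
  have := p_bound f n.
  have := Xlin (ker_iter f n) (ker_iter f n - r) (-1).
  have -> : ker_iter f n + (-1)%:C *: (ker_iter f n - r) = r.
    by rewrite rmorphN1 scaleN1r opprB addrCA subrr addr0.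
  move=> e1; have := nrm_tri fip (X r) (X (ker_iter f n) + (-1)%:C *: X (ker_iter f n - r)).
  rewrite e1 addr0; have := nrmD fip (X (ker_iter f n)) ((-1)%:C *: X (ker_iter f n - r)).
  rewrite (nrmZ fip) normcR normrN1 mul1r.
  have := X_lip (ker_iter f n - r).
  rewrite [_ ^+ n * _]mulrC; lra.
have fr : Re (ip f r) = 0 by apply: hf.
have rn n : Re (ip (ker_iter f n) r) = 0.
  elim: n => [//|n IH] /=; rewrite (formDl fip) (formZl fip) cReD IH cReZ add0r.
  by rewrite Xsym (nrm_eq0_formr fip) // mulr0.
have r0 : nrm r = 0.
  apply: eq0_small => [|e e0]; first exact: nrm_ge0.
  have [N h2] := hr _ e0.
  have [->|nr0] := eqVneq (nrm r) 0; first exact: ltW.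
  have rp : 0 < nrm r by rewrite lt_def nr0 nrm_ge0.
  have := ReCS fip (r - ker_iter f N) r.
  rewrite (formBl fip) cReD cReN rn oppr0 addr0 -[Re (ip r r)]/(nrm2 r) -(sqr_nrm fip) (nrmBC fip).
  rewrite expr2 ler_pM2r // => h; apply: ltW; exact: le_lt_trans h (h2 _ (leqnn _)).
rewrite -subr_ge0; apply/ler_addgt0Pr => e e0.
have [N h] := hr _ e0.
have := r_cauchy f 0 N; rewrite add0n /= expr0 mulr1 (nrmBC fip) => h1.
have := nrm_tri fip f (ker_iter f N); have := nrm_tri fip (ker_iter f N) r.
rewrite r0 add0r => h3 h4; have h5 := h _ (leqnn _).
have : 0 <= (5/6) ^+ N * nrm (X f) by rewrite mulr_ge0 ?nrm_ge0 ?exprn_ge0 //; case/andP: x56.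
move: h1; rewrite mulrBr mulr1 -mulrA [nrm (X f) * _]mulrC; lra.
Qed.
End RangeClosed.

(** * Isolated points of the spectrum *)

Section SpectralGap.
Context {R : realType} {V : lmodType R[i]} {ip : V -> V -> R[i]}.
Hypothesis fip : is_form ip.
Variable T : V -> V -> Prop.
Local Notation nrm := (nrm ip).
Local Notation nrm2 := (nrm2 ip).

Definition linear_rel := forall a u w v x, T u w -> T v x -> T (a *: u + v) (a *: w + x).
Definition symmetric_rel := forall u w v x, T u w -> T v x -> ip w v = ip u x.
Definition ae_invariant := forall u w u' w',
  T u w -> nrm (u - u') = 0 -> nrm (w - w') = 0 -> T u' w'.
(** Regularity of a real point, for an operator given by its graph. *)
Definition regular_point (t : R) :=
  (forall g, exists f, T f (t%:C *: f + g)) /\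
  exists C : R, forall f g, T f (t%:C *: f + g) -> nrm f <= C * nrm g.

Hypothesis Tlin : linear_rel.
Hypothesis Tsym : symmetric_rel.
Hypothesis Text : ae_invariant.

Lemma rel0 u w : T u w -> T 0 0.
Proof. by move=> h; have := Tlin (-1) h h; rewrite !scaleN1r !addNr. Qed.
Lemma relZ a u w : T u w -> T (a *: u) (a *: w).
Proof. by move=> h; have := Tlin a h (rel0 h); rewrite !addr0. Qed.
Lemma relD u w v x : T u w -> T v x -> T (u + v) (w + x).
Proof. by move=> h k; have := Tlin 1 h k; rewrite !scale1r. Qed.
Lemma relB u w v x : T u w -> T v x -> T (u - v) (w - x).
Proof. by move=> h k; have := relD h (relZ (-1) k); rewrite !scaleN1r. Qed.

(** With S the inverse of T - t and s its norm, S^2 - s^2 is not bounded below,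
   so S - s or S + s is not: one of t + 1/s, t - 1/s is not regular. *)
Lemma gap_principle t m f w : 0 < m ->
  (forall s : R, `|s - t| < m -> regular_point s) -> T f w ->
  m * nrm f <= nrm (w - t%:C *: f).
Proof.
move=> m0 reg Tfw; rewrite leNgt; apply/negP => ltf.
have [onto [C hC]] := reg t (ltac:(by rewrite subrr normr0)).
pose A := [set x : R | exists f g, [/\ T f (t%:C *: f + g), nrm g <= 1 & x = nrm f]].
have f_pos : 0 < nrm f.
  rewrite lt_def nrm_ge0 andbT; apply/eqP => f0; move: ltf.
  by rewrite f0 mulr0 ltNge nrm_ge0.
pose g0 := w - t%:C *: f.
have Tfg : T f (t%:C *: f + g0) by rewrite /g0 addrC subrK.
have g_pos : 0 < nrm g0.
  rewrite lt_def nrm_ge0 andbT; apply/eqP => g00.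
  by have := hC _ _ Tfg; rewrite g00 mulr0 leNgt f_pos.
have C0 : 0 < C.
  have := lt_le_trans f_pos (hC _ _ Tfg); by rewrite pmulr_lgt0.
have A_sup : has_sup A.
  split; first by exists (nrm 0), 0, 0; split; rewrite ?(nrm0 fip) // scaler0 addr0; exact: rel0 Tfw.
  exists C => _ [f1 [g1 [h1 h2 ->]]]; apply: (le_trans (hC _ _ h1)).
  by rewrite -[leRHS]mulr1 ler_pM2l.
pose b := sup A.
have bub f1 g1 : T f1 (t%:C *: f1 + g1) -> nrm f1 <= b * nrm g1.
  move=> h; have [g1z|g1z] := eqVneq (nrm g1) 0.
    by have := hC _ _ h; rewrite g1z !mulr0.
  have gp : 0 < nrm g1 by rewrite lt_def g1z nrm_ge0.
  rewrite -ler_pdivrMr //; apply: sup_upper_bound => //.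
  exists ((nrm g1)^-1%:C *: f1), ((nrm g1)^-1%:C *: g1); split.
  - by have := relZ (nrm g1)^-1%:C h; rewrite scalerDr !scalerA mulrC.
  - by rewrite (nrmZ fip) normcR ger0_norm ?invr_ge0 ?nrm_ge0 // mulVf.
  - by rewrite (nrmZ fip) normcR ger0_norm ?invr_ge0 ?nrm_ge0 // mulrC.
have b0 : 0 < b.
  have := lt_le_trans f_pos (bub _ _ Tfg); by rewrite pmulr_lgt0.
pose s := b^-1.
have s0 : 0 < s by rewrite invr_gt0.
have sm : s < m.
  rewrite /s invf_plt ?posrE //.
  have := bub _ _ Tfg; rewrite -ler_pdivrMr //; apply: lt_le_trans.
  by rewrite ltr_pdivlMr // mulrC ltr_pdivrMr // mulrC.
have [|_ [C1 hC1]] := reg (t + s); first by rewrite addrC addKr gtr0_norm.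
have [|_ [C2 hC2]] := reg (t - s); first by rewrite addrC addKr normrN gtr0_norm.
pose D1 := `|C1| + 1; pose D2 := `|C2| + 1.
have D1p : 0 < D1 by rewrite ltr_wpDl.
have D2p : 0 < D2 by rewrite ltr_wpDl.
pose K := D2 * (s * (D1 * s + 1)).
have K0 : 0 < K by rewrite !mulr_gt0 // addr_gt0 ?mulr_gt0.
(* the test vector below has norm at least b / 2 and at most s * K * eta *)
pose eta := b / 4 / (s * K).
have eta0 : 0 < eta by rewrite !divr_gt0 // mulr_gt0.
pose de := Num.min (b / 2) ((eta / b) ^+ 2 / (2 * b)).
have de0 : 0 < de.
  rewrite /de lt_min; apply/andP; split; first exact: divr_gt0.
  by apply: divr_gt0; [apply: exprn_gt0; exact: divr_gt0 | exact: mulr_gt0].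
have [_ [f1 [g1 [Tf1 g1le ->]]] f1big] := sup_adherent de0 A_sup.
have [f2 Tf2] := onto f1.
pose h := f2 - (b ^+ 2)%:C *: g1.
have f1b : nrm f1 <= b.
  by apply: (le_trans (bub _ _ Tf1)); rewrite -[leRHS]mulr1 ler_pM2l.
have f2b : nrm f2 <= b * nrm f1 by exact: bub.
have sym12 : Re (ip f2 g1) = nrm2 f1.
  have := Tsym Tf2 Tf1; rewrite (formDl fip) (formDr fip) (formZl fip) (formZr fip).
  rewrite -[X in _ = X + _](_ : t%:C * ip f2 f1 = _); last first.
    by congr (_ * _); apply: complexP; rewrite ?cReJ ?cImJ //= oppr0.
  by move=> /addrI /(congr1 (@complex.Re R)) <-.
have f1ge : b - de <= nrm f1 by exact: ltW.
have hsmall : nrm h <= eta.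
  apply: (nrm_le fip) => //; first exact: ltW.
  rewrite /h (nrm2B fip) (nrm2Z fip) (formZr fip) cReZJ sym12 normcR ger0_norm ?sqr_ge0 //.
  rewrite -!(sqr_nrm fip).
  have q1 : nrm f2 ^+ 2 <= b ^+ 2 * nrm f1 ^+ 2.
    by rewrite -exprMn ler_pXn2r ?nnegrE ?mulr_ge0 ?nrm_ge0 // ltW.
  have q2 : nrm g1 ^+ 2 <= 1 by rewrite expr_le1 // nrm_ge0.
  have q3 : (b ^+ 2) ^+ 2 * nrm g1 ^+ 2 <= (b ^+ 2) ^+ 2.
    by rewrite -[leRHS]mulr1 ler_wpM2l ?sqr_ge0.
  have q4 : de <= (eta / b) ^+ 2 / (2 * b) by rewrite ge_min lexx orbT.
  have q5 : b ^+ 2 - nrm f1 ^+ 2 <= 2 * b * de.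
    have e1 : (b - nrm f1) * (b + nrm f1) <= de * (2 * b).
      apply: ler_pM; rewrite ?subr_ge0 ?addr_ge0 ?nrm_ge0 ?(ltW b0) //; [lra|lra].
    rewrite (_ : _ - _ = (b - nrm f1) * (b + nrm f1)); last by ring.
    by rewrite [leRHS]mulrC.
  have q6 : 2 * b * de <= (eta / b) ^+ 2.
    by rewrite mulrC -ler_pdivlMr // mulr_gt0.
  have q7 : b ^+ 2 * (b ^+ 2 - nrm f1 ^+ 2) <= eta ^+ 2.
    apply: (le_trans (ler_wpM2l (sqr_ge0 b) (le_trans q5 q6))).
    by rewrite expr_div_n mulrCA mulfV ?mulr1 // expf_neq0 // gt_eqF.
  nra.
pose k := f1 + b%:C *: g1.
pose y := f2 + b%:C *: f1.
have Ty : T y (t%:C *: y + k).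
  have := relD Tf2 (relZ b%:C Tf1); congr (T _ _).
  by rewrite /y /k !scalerDr !scalerA [b%:C * _]mulrC -!addrA; congr (_ + _); rewrite addrCA.
have yk : y = b%:C *: k + h.
  by rewrite /y /k /h scalerDr scalerA -rmorphM /= -expr2 addrACA [b%:C *: f1 + f2]addrC -addrA addrN addr0.
have sb : s * b = 1 by rewrite mulVf // gt_eqF.
have ynorm : nrm y <= D1 * (s * eta).
  have : T y ((t + s)%:C *: y + (- s%:C) *: h).
    move: Ty; congr (T _ _); rewrite rmorphD /= scalerDl -addrA; congr (_ + _).
    by rewrite {1}yk scalerDr scalerA -rmorphM sb scale1r -addrA scaleNr addrN addr0.
  move=> /hC1 /le_trans -> //; rewrite (nrmZ fip) normcN normcR gtr0_norm //.
  apply: (@le_trans _ _ (D1 * (s * nrm h))).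
    by rewrite ler_wpM2r ?mulr_ge0 ?nrm_ge0 ?(ltW s0) // (le_trans (ler_norm _)) // lerDl.
  by rewrite !ler_pM2l.
have knorm : nrm k <= s * ((D1 * s + 1) * eta).
  have -> : k = s%:C *: (y - h).
    by rewrite yk addrK scalerA -rmorphM sb scale1r.
  rewrite (nrmZ fip) normcR gtr0_norm // ler_pM2l //.
  apply: (le_trans (nrmB fip _ _)); rewrite mulrDl mul1r -mulrA; exact: lerD.
have : nrm f1 <= D2 * (s * (s * ((D1 * s + 1) * eta))).
  have : T f1 ((t - s)%:C *: f1 + s%:C *: k).
    move: Tf1; congr (T _ _).
    rewrite /k rmorphB /= scalerBl scalerDr scalerA -rmorphM sb scale1r -addrA; congr (_ + _).
    by rewrite addrA addNr add0r.
  move=> /hC2 /le_trans -> //; rewrite (nrmZ fip) normcR gtr0_norm //.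
  apply: (@le_trans _ _ (D2 * (s * nrm k))).
    by rewrite ler_wpM2r ?mulr_ge0 ?nrm_ge0 ?(ltW s0) // (le_trans (ler_norm _)) // lerDl.
  by rewrite !ler_pM2l.
have -> : D2 * (s * (s * ((D1 * s + 1) * eta))) = s * K * eta by rewrite /K; ring.
have -> : s * K * eta = b / 4.
  by rewrite mulrC /eta divfK // gt_eqF // mulr_gt0.
have : de <= b / 2 by rewrite ge_min lexx.
lra.
Qed.

Variable d : R.
Hypothesis d0 : 0 < d.
Hypothesis reg : forall t : R, t != 0 -> `|t| < d -> regular_point t.

(** All s with |s - t| < |t| lie in the punctured interval of regular points, since
    |t| <= d / 2. *)
Lemma gap_resolvent t f w : `|t| <= d / 2 -> T f w -> `|t| * nrm f <= nrm (w - t%:C *: f).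
Proof.
have [->|t0] := eqVneq t 0; first by rewrite normr0 mul0r nrm_ge0.
move=> td; apply: gap_principle; first by rewrite normr_gt0.
move=> s st; apply: reg.
  by apply: contraTneq st => ->; rewrite sub0r normrN ltxx.
have := ler_normD (s - t) t; rewrite subrK => /le_lt_trans; apply.
lra.
Qed.

(** Expand the square in gap_resolvent at t = d / 2 and t = - d / 2. *)
Lemma gap_form f w : T f w -> d * `|Re (ip w f)| <= nrm2 w.
Proof.
move=> h.
have key (t : R) : `|t| = d / 2 -> 2 * t * Re (ip w f) <= nrm2 w.
  move=> td; have := gap_resolvent (f := f) (w := w) (t := t).
  rewrite td => /(_ (lexx _) h) => k.
  have : (d / 2 * nrm f) ^+ 2 <= nrm (w - t%:C *: f) ^+ 2.
    by rewrite ler_pXn2r // nnegrE ?nrm_ge0 // mulr_ge0 ?nrm_ge0 // ltW ?divr_gt0.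
  rewrite (sqr_nrm fip) (nrm2B fip) (nrm2Z fip) (formZr fip) cReZJ normcR td exprMn (sqr_nrm fip).
  lra.
have d2 : 0 <= d / 2 by rewrite ltW // divr_gt0.
have [h0|h0] := ler0P (Re (ip w f)).
  have := key (- (d / 2)); rewrite normrN ger0_norm // => /(_ erefl); lra.
have := key (d / 2); rewrite ger0_norm // => /(_ erefl); lra.
Qed.

(** With X = 1 + t S, where t = d / 2 and S inverts T - t, the kernel of X is that of
    T, and gap_form says that the spectrum of X lies in {0} and [2/3, 2]:
    bounded_below_off_kernel applies to X f. *)
Lemma gap_orthogonal f w : complete_form ip -> T f w ->
  (forall p, T p 0 -> ip f p = 0) -> d / 6 * nrm f <= nrm w.
Proof.
move=> cplt Tf perp.
have [t [tE t0 td]] : exists t, [/\ t = d / 2, 0 < t & `|t| < d].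
  by exists (d / 2); rewrite divr_gt0 // gtr0_norm ?divr_gt0 //; split => //; move: d0; lra.
have [onto [C hC]] := reg (lt0r_neq0 t0) td.
have [S hS] := choice onto.
pose X g := t%:C *: S g + g.
have SX g : T (S g) (X g) by exact: hS.
have Xsub g : t%:C *: S g = X g - g by rewrite addrK.
have Xsym u v : Re (ip (X u) v) = Re (ip u (X v)).
  have e g : g = X g - t%:C *: S g by rewrite Xsub opprB addrC subrK.
  have -> : ip (X u) v = ip (X u) (X v) - (t%:C)^* * ip (X u) (S v).
    by rewrite -(formZr fip) -(formBr fip) -e.
  have -> : ip u (X v) = ip (X u) (X v) - t%:C * ip (S u) (X v).
    by rewrite -(formZl fip) -(formBl fip) -e.
  by rewrite !cReD !cReN cReZJ cReZ (Tsym (SX u) (SX v)).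
have Xlin u v (x : R) : nrm (X (u + x%:C *: v) - (X u + x%:C *: X v)) = 0.
  pose y := S (u + x%:C *: v) - (S u + x%:C *: S v).
  have -> : X (u + x%:C *: v) - (X u + x%:C *: X v) = t%:C *: y.
    rewrite /X /y !scalerBr !scalerDr !scalerA [t%:C * _]mulrC.
    by rewrite addrACA opprD addrACA subrr addr0.
  have : T y (t%:C *: y + 0).
    have := relB (SX (u + x%:C *: v)) (relD (SX u) (relZ x%:C (SX v))).
    congr (T _ _); rewrite addr0 /X /y !scalerBr !scalerDr !scalerA [t%:C * _]mulrC.
    by rewrite addrACA opprD addrACA subrr addr0.
  move=> /hC; rewrite (nrm0 fip) mulr0 => k.
  by rewrite (nrmZ fip) [nrm y](_ : _ = 0) ?mulr0 //; apply/eqP; rewrite eq_le k nrm_ge0.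
have Xq u : `|nrm2 (X u) - Re (ip (X u) u)| * 2 <= nrm2 (X u).
  apply: le_trans (gap_form (SX u)).
  have -> : nrm2 (X u) - Re (ip (X u) u) = t * Re (ip (X u) (S u)).
    by rewrite -cReZJ -(formZr fip) Xsub (formBr fip) cReD cReN.
  rewrite normrM gtr0_norm // tE; lra.
have Xle2 u : nrm2 (X u) <= 2 * Re (ip (X u) u).
  have := Xq u; have := ler_norm (nrm2 (X u) - Re (ip (X u) u)); lra.
have Xge u : 2 * Re (ip (X u) u) <= 3 * nrm2 (X u).
  have := Xq u; have := ler_norm (- (nrm2 (X u) - Re (ip (X u) u))); rewrite normrN; lra.
have kerX r : nrm (X r) = 0 -> Re (ip f r) = 0.
  move=> hr; have Sr : T (S r) 0.
    by apply: (Text (SX r)); rewrite ?subrr ?(nrm0 fip) // subr0.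
  have -> : ip f r = ip f (X r) - (t%:C)^* * ip f (S r).
    by rewrite -(formZr fip) -(formBr fip) Xsub opprB addrC subrK.
  by rewrite (perp _ Sr) mulr0 subr0 (nrm_eq0_formr fip).
have := bounded_below_off_kernel fip cplt Xsym Xlin Xle2 Xge kerX.
have : t * nrm (X f) <= nrm w.
  have TX : T (X f) (t%:C *: X f + w).
    by have := Tlin t%:C (SX f) Tf.
  have := gap_resolvent (t := t) _ TX; rewrite gtr0_norm // addrAC subrr add0r; apply.
  by rewrite tE.
rewrite tE; have := nrm_ge0 (ip := ip) (X f); move: d0; nra.
Qed.
End SpectralGap.

(** * A maximum principle for rational functions *)

Lemma normc_nat (R : realType) n : normc (n%:R : R[i]) = n%:R.
Proof. by rewrite -(rmorph_nat (real_complex R)) normcR ger0_norm. Qed.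

Section MaximumModulus.
Context {R : realType}.
Implicit Types (p q : {poly R[i]}) (r B : R).

(** Averaging over z and -z replaces p(z) by its even part as a polynomial in
   z^2, of half the degree. *)
Lemma max_modulus_poly p r B : 0 <= r ->
  (forall z, normc z = r -> normc p.[z] <= B) -> normc p.[0] <= B.
Proof.
have [m] := ubnP (size p).
elim: m => // m IH in p r *; rewrite ltnS => sp r0 h.
have [sp1|sp1] := leqP (size p) 1.
  have := h r%:C; rewrite normcR ger0_norm // => /(_ erefl).
  by rewrite (size1_polyC sp1) !hornerC.
have half2 (x : R[i]) : 2^-1 * (x + x) = x by field.
have ev z : (even_poly p).[z ^+ 2] = 2^-1 * (p.[z] + p.[- z]).
  rewrite -{2 3}[p]poly_even_odd !hornerD !hornerM !horner_comp !hornerXn !hornerX sqrrN.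
  by rewrite mulrN addrACA subrr addr0 half2.
have e0 : (even_poly p).[0] = p.[0].
  by have := ev 0; rewrite expr2 mulr0 oppr0 half2.
rewrite -e0; apply: (IH _ (r ^+ 2)).
- rewrite (leq_ltn_trans (size_even_poly _)) //.
  have : (uphalf (size p) < size p)%N.
    by move: sp1; case: (size p) => [|[|k]] // _; lia.
  by move=> /leq_trans; apply.
- exact: sqr_ge0.
- move=> w hw; pose z := sqrtc w.
  have zw : z ^+ 2 = w by exact: sqr_sqrtc.
  have nz : normc z = r.
    apply/eqP; rewrite -(@eqrXn2 _ 2) ?normc_ge0 // -normcX zw hw; exact/eqP.
  rewrite -zw ev Normc.normcM.
  have -> : normc (2^-1 : R[i]) = 2^-1.
    by rewrite Normc.normcV normc_nat.
  rewrite ler_pdivrMl // mulr2n mulrDl mul1r.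
  by apply: (le_trans (normc_ler _ _)); rewrite lerD // h // normcN.
Qed.

(** The factor 1 / (1 - z/l) is the limit of the polynomials
   (1 - (z/l)^m) / (1 - z/l), uniformly on the disc. *)
Lemma max_modulus_ratio (s : seq R[i]) p r B : 0 <= r -> 0 <= B ->
  (forall l, l \in s -> r < normc l) ->
  (forall z, normc z = r -> normc p.[z] <= B * \prod_(l <- s) normc (1 - z / l)) ->
  normc p.[0] <= B.
Proof.
elim: s p B => [|l s IH] p B r0 B0 hs h.
  by apply: (max_modulus_poly r0) => z /h; rewrite big_nil mulr1.
have rl : r < normc l by apply: hs; rewrite inE eqxx.
have l0 : 0 < normc l by exact: le_lt_trans rl.
have lN0 : l != 0 by apply: contraTneq l0 => ->; rewrite Normc.normc0 ltxx.
pose th := r / normc l.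
have th01 : 0 <= th < 1 by rewrite divr_ge0 ?normc_ge0 //= ltr_pdivrMr // mul1r.
apply/ler_addgt0Pr => e e0.
have [m hm] := geo_small B th01 e0.
pose G := \sum_(k < m.+1) (l^-1 *: 'X) ^+ k : {poly R[i]}.
have GE z : G.[z] * (1 - z / l) = 1 - (z / l) ^+ m.+1.
  have -> : G.[z] = \sum_(k < m.+1) (z / l) ^+ k.
    by rewrite horner_sum; apply: eq_bigr => k _; rewrite horner_exp hornerZ hornerX mulrC.
  by rewrite mulrC -[1 - z / l]opprB mulNr -subrX1 opprB.
have G0 : G.[0] = 1.
  by have := GE 0; rewrite mul0r subr0 mulr1 expr0n subr0.
rewrite -[p.[0]]mulr1 -G0 -hornerM; apply: IH => //.
- by rewrite addr_ge0 // ltW.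
- by move=> k ks; apply: hs; rewrite inE ks orbT.
move=> z hz; rewrite hornerM Normc.normcM.
have := h z hz; rewrite big_cons.
set P := \prod_(_ <- _) _ => hp.
have P0 : 0 <= P by apply: prodr_ge0 => *; exact: normc_ge0.
apply: (le_trans (ler_wpM2r (normc_ge0 _) hp)).
rewrite (_ : _ * _ * _ = B * (normc G.[z] * normc (1 - z / l)) * P); last by ring.
rewrite ler_wpM2r // -Normc.normcM GE.
have : normc (1 - (z / l) ^+ m.+1) <= 1 + th ^+ m.+1.
  apply: (le_trans (normc_ler _ _)); rewrite Normc.normc1 normcN normcX lerD2l.
  by rewrite Normc.normcM Normc.normcV hz.
move=> /(ler_wpM2l B0) /le_trans; apply; rewrite mulrDr mulr1 lerD2l ltW //.
exact: hm (leqnSn _).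
Qed.
End MaximumModulus.

(** * Perturbation of the quadratic pencil *)

Ltac lr := repeat match goal with H := _ |- _ => clearbody H end; lra.
Ltac lr' := repeat match goal with H := _ |- _ => clearbody H end; nra.
Section QuadraticPencil.
Context {R : realType} {V : lmodType R[i]} {ip : V -> V -> R[i]}.
Hypothesis fip : is_form ip.
Local Notation nrm := (nrm ip).
Local Notation nrm2 := (nrm2 ip).
Variables (n : nat) (b a : 'I_n -> V).

Definition comb (c : 'I_n -> V) (x : 'cV[R[i]]_n) : V := \sum_j x j 0 *: c j.

Lemma combD c x y : comb c (x + y) = comb c x + comb c y.
Proof. by rewrite -big_split; apply: eq_bigr => j _; rewrite mxE scalerDl. Qed.
Lemma combZ c z x : comb c (z *: x) = z *: comb c x.
Proof. by rewrite scaler_sumr; apply: eq_bigr => j _; rewrite mxE scalerA. Qed.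
Lemma combB c x y : comb c (x - y) = comb c x - comb c y.
Proof. by rewrite combD -[- y]scaleN1r combZ scaleN1r. Qed.
Lemma comb_lin c c' x z : comb (fun j => z *: c j - c' j) x = z *: comb c x - comb c' x.
Proof.
rewrite scaler_sumr -sumrB; apply: eq_bigr => j _.
by rewrite scalerBr !scalerA mulrC.
Qed.

(** The quadratic pencil of the compression of (z - T)^2 to the span of b, where
   a j stands for T (b j). *)
Definition pencil (z : R[i]) : 'M[R[i]]_n :=
  \matrix_(j, k) ip (z *: b k - a k) (z^* *: b j - a j).

Lemma pencilE z x j :
  (pencil z *m x) j 0 = ip (z *: comb b x - comb a x) (z^* *: b j - a j).
Proof.
rewrite -comb_lin (form_suml fip) mxE; apply: eq_bigr => k _.
by rewrite mxE (formZl fip) mulrC.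
Qed.

Lemma pencil_form z x w : ip (z *: comb b x - comb a x) (z^* *: comb b w - comb a w) =
  \sum_j (w j 0)^* * (pencil z *m x) j 0.
Proof.
rewrite -(comb_lin b a w) (form_sumr fip); apply: eq_bigr => j _.
by rewrite (formZr fip) pencilE.
Qed.

Definition pencil_poly : 'M[{poly R[i]}]_n := \matrix_(j, k)
  ('X^2 * (ip (b k) (b j))%:P - 'X * (ip (b k) (a j) + ip (a k) (b j))%:P
   + (ip (a k) (a j))%:P).

Lemma pencil_polyE z : pencil z = map_mx (horner_eval z) pencil_poly.
Proof.
apply/matrixP => j k; rewrite !mxE /horner_eval !(hornerD, hornerN, hornerM, hornerXn, hornerX, hornerC).
rewrite (formBl fip) !(formBr fip) !(formZl fip) !(formZr fip) cconjK; ring.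
Qed.

Lemma det_pencil z : \det (pencil z) = (\det pencil_poly).[z].
Proof. by rewrite pencil_polyE det_map_mx. Qed.

(** [spectral_approx Pi d0 de]: Pi is the orthogonal projection of the span of b
   onto the kernel of T, from which T is at least d0 away, and which is within
   de of the span of b in graph norm. *)
Record spectral_approx (Pi : 'cV[R[i]]_n -> V) (d0 de : R) : Prop := {
  sa_orth : forall x, ip (comb b x - Pi x) (Pi x) = 0;
  sa_sym : forall x y, ip (comb a x) (Pi y) = 0;
  sa_gap : forall x, d0 * nrm (comb b x - Pi x) <= nrm (comb a x);
  sa_near : forall x, exists y, nrm (comb b y - Pi x) <= de * nrm (Pi x) /\
              nrm (comb a y) <= de * nrm (Pi x) }.

Section Perturbation.
Variables (Pi : 'cV[R[i]]_n -> V) (d0 de : R).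
Hypothesis d0_gt0 : 0 < d0.
Hypothesis de_gt0 : 0 < de.
Hypothesis SA : spectral_approx Pi d0 de.

Let test_bounds z x F :
  normc z <= 1 -> normc z <= d0 / 8 ->
  (forall w, normc (ip (z *: comb b x - comb a x) (z^* *: comb b w - comb a w))
     <= F * nrm (comb a w)) -> 0 <= F ->
  let X := nrm (comb b x) in let Y := nrm (comb a x) in
  let P := nrm (Pi x) in let v := nrm (comb b x - Pi x) in let r := normc z in
  [/\ X ^+ 2 = P ^+ 2 + v ^+ 2, v * d0 <= Y,
      Y ^+ 2 <= 2 * (2 * de * P * (r * X + Y) + F * (Y + de * P)) &
      r ^+ 2 * P ^+ 2 <= 2 * de * P * (r * X + Y) + F * (de * P)].
Proof.
move=> z1 zd hF F0 X Y P v r.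
set p := Pi x.
have [u uE] : exists u, comb b x - p = u by exists (comb b x - p).
have vE : v = nrm u by rewrite -uE.
have [y [hy1 hy2]] := sa_near SA x.
have bx : comb b x = p + u by rewrite -uE addrC subrK.
have up : ip u p = 0 by rewrite -uE; exact: sa_orth SA x.
have pu : ip p u = 0 by rewrite (formC fip) up conjC0.
have ap : ip (comb a x) p = 0 := sa_sym SA x x.
have pa : ip p (comb a x) = 0 by rewrite (formC fip) ap conjC0.
have r0 : 0 <= r := normc_ge0 z.
have X0 : 0 <= X := nrm_ge0 _. have Y0 : 0 <= Y := nrm_ge0 _.
have P0 : 0 <= P := nrm_ge0 _. have v0 : 0 <= v := nrm_ge0 _.
have gap : v * d0 <= Y by rewrite mulrC; exact: sa_gap SA x.
pose e := comb b y - p.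
have by_ : comb b y = p + e by rewrite /e addrC subrK.
have e_le : nrm e <= de * P by [].
have W : nrm (z *: comb b x - comb a x) <= r * X + Y.
  by apply: (le_trans (nrmB fip _ _)); rewrite (nrmZ fip).
have W2 : nrm (z^* *: e - comb a y) <= 2 * de * P.
  apply: (le_trans (nrmB fip _ _)); rewrite (nrmZ fip) normcJ.
  have : r * nrm e <= 1 * (de * P) by apply: ler_pM => //; exact: nrm_ge0.
  by rewrite mul1r; move: hy2; rewrite -/P -/r; lr.
have deP : 0 <= 2 * de * P by rewrite !mulr_ge0 // ltW.
have W3 : normc (ip (z *: comb b x - comb a x) (z^* *: e - comb a y))
    <= 2 * de * P * (r * X + Y).
  apply: (le_trans (formCS fip _ _)); rewrite mulrC.
  by apply: ler_pM; rewrite ?nrm_ge0.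
split => //.
- by rewrite vE /X bx !(sqr_nrm fip) (pyth fip pu).
- have := hF (x - y); rewrite !combB.
  have -> : z^* *: (comb b x - comb b y) - (comb a x - comb a y) =
      (z^* *: u - comb a x) - (z^* *: e - comb a y).
    rewrite bx by_ opprD addrACA subrr add0r scalerBr !opprB.
    by rewrite addrACA [RHS]addrACA; congr (_ + _); rewrite addrC.
  rewrite (formBr fip) => h1.
  have h2 : normc (ip (z *: comb b x - comb a x) (z^* *: u - comb a x)) <=
      2 * de * P * (r * X + Y) + F * (Y + de * P).
    set s := ip _ _ in h1 *; set s' := ip _ _ in h1 W3.
    have -> : s = s' + (s - s') by rewrite addrC subrK.
    apply: (le_trans (normc_ler _ _)); apply: lerD => //.
    apply: (le_trans h1); rewrite ler_wpM2l //.
    apply: (le_trans (nrmB fip _ _)); rewrite lerD2l; exact: hy2.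
  have h3 : ip (z *: comb b x - comb a x) (z^* *: u - comb a x) =
     (Y ^+ 2)%:C + (z ^+ 2 * ip u u - z * ip u (comb a x) - z * ip (comb a x) u).
    rewrite bx scalerDr !(formBl fip, formDl fip, formBr fip) !(formZl fip) !(formZr fip) cconjK.
    rewrite pu pa (form_self fip (comb a x)) -(sqr_nrm fip); ring.
  have h4 : Y ^+ 2 <= normc (ip (z *: comb b x - comb a x) (z^* *: u - comb a x)) +
      (r ^+ 2 * v ^+ 2 + 2 * (r * (v * Y))).
    have -> : Y ^+ 2 = normc (Y ^+ 2)%:C by rewrite normcR ger0_norm ?sqr_ge0.
    set t := (z ^+ 2 * ip u u - z * ip u (comb a x) - z * ip (comb a x) u) in h3.
    have -> : (Y ^+ 2)%:C = ip (z *: comb b x - comb a x) (z^* *: u - comb a x) - t.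
      by rewrite h3 addrK.
    apply: (le_trans (normc_ler _ _)); rewrite lerD2l normcN /t.
    have q1 : normc (z ^+ 2 * ip u u) <= r ^+ 2 * v ^+ 2.
      rewrite Normc.normcM normcX ler_wpM2l ?sqr_ge0 //.
      by rewrite (form_self fip) vE -(sqr_nrm fip) normcR ger0_norm ?sqr_ge0.
    have q2 : normc (z * ip u (comb a x)) <= r * (v * Y).
      by rewrite vE Normc.normcM ler_wpM2l // (formCS fip).
    have q3 : normc (z * ip (comb a x) u) <= r * (v * Y).
      by rewrite vE Normc.normcM ler_wpM2l // [nrm u * Y]mulrC (formCS fip).
    apply: (le_trans (normc_ler _ _)); rewrite normcN.
    have := normc_ler (z ^+ 2 * ip u u) (- (z * ip u (comb a x))); rewrite normcN.
    lr.
  have h5 : r ^+ 2 * v ^+ 2 + 2 * (r * (v * Y)) <= Y ^+ 2 / 2.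
    have rv : r * v <= Y / 8.
      apply: (@le_trans _ _ (d0 / 8 * v)); first by rewrite ler_wpM2r.
      by move: gap; lr.
    have rv0 : 0 <= r * v by rewrite mulr_ge0.
    move: rv rv0; set q := r * v; rewrite -exprMn -/q (_ : r * (v * Y) = q * Y); last by rewrite /q; ring.
    by clearbody q; lr'.
  move: h2 h4 h5; lr.
- have := hF y; set s := ip _ _ => h1.
  have sE : s = (z * z * (P ^+ 2)%:C) + ip (z *: comb b x - comb a x) (z^* *: e - comb a y).
    rewrite /s by_ scalerDr -addrA (formDr fip); congr (_ + _).
    rewrite (formZr fip) cconjK (formBl fip) (formZl fip) ap bx (formDl fip) up addr0 subr0.
    by rewrite (form_self fip) -(sqr_nrm fip) mulrA.
  have -> : r ^+ 2 * P ^+ 2 = normc (z * z * (P ^+ 2)%:C).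
    by rewrite !Normc.normcM normcR ger0_norm ?sqr_ge0 // [r ^+ 2]expr2.
  have -> : z * z * (P ^+ 2)%:C = s - ip (z *: comb b x - comb a x) (z^* *: e - comb a y).
    by rewrite sE addrK.
  apply: (le_trans (normc_ler _ _)); rewrite normcN addrC; apply: lerD => //.
  by apply: (le_trans h1); rewrite ler_wpM2l.
Qed.

(** Testing the equation with the spectral approximations of Pi x and of x itself
    gives |z|^2 |P|^2 and |(z - T)x|^2 in terms of de; the gap d0 turns the second
    bound into one on the distance to the kernel. *)
Lemma pencil_eigenvector z x : normc z <= 1 -> normc z <= d0 / 8 -> normc z <= 25 * de ->
  pencil z *m x = 0 -> nrm (comb b x) = 1 -> nrm (comb b x - Pi x) <= 25 * de / d0.
Proof.
move=> z1 zd zde Qx X1.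
have [|X2 gap Y2 _] := @test_bounds z x 0 z1 zd _ (lexx _).
  move=> w; rewrite pencil_form Qx big1 ?mul0r ?Normc.normc0 // => j _.
  by rewrite mxE mulr0.
rewrite ler_pdivlMr //; apply: (le_trans gap).
move: X2 Y2; rewrite X1 expr1n; set Y := nrm (comb a x); set P := nrm _; set v := nrm _.
have := nrm_ge0 (ip := ip) (comb a x); rewrite -/Y => Y0.
have := nrm_ge0 (ip := ip) (Pi x); rewrite -/P => P0.
have := nrm_ge0 (ip := ip) (comb b x - Pi x); rewrite -/v => v0 X2 Y2.
have P1 : P <= 1 by rewrite -(@expr_le1 _ 2) // X2 lerDl sqr_ge0.
have deP : de * P * (normc z * 1 + Y) <= de * (25 * de + Y).
  apply: ler_pM; rewrite ?mulr1 ?mulr_ge0 ?addr_ge0 ?normc_ge0 ?(ltW de_gt0) //.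
    by rewrite -[leRHS]mulr1 ler_pM2l.
  by rewrite lerD2r.
have Y3 : Y ^+ 2 <= 100 * de ^+ 2 + 4 * de * Y by move: Y2 deP; lra.
rewrite leNgt; apply/negP => h; move: de_gt0 h Y3; nra.
Qed.

(** If the pencil had no eigenvalue in the disc of radius 25 de, the solution x(z) of
    pencil z x(z) = pencil 0 x0, where x0 is close to the kernel, would be analytic
    there. By Cramer, the scalar product of x(z) with b x0 is a polynomial over the
    determinant; on the circle it is at most 1/2, and at the centre it equals 1,
    against the maximum principle. *)
Lemma pencil_eigenvalue x0 : 25 * de <= 1 -> 25 * de <= d0 / 8 ->
  nrm (comb b x0) = 1 -> nrm (comb a x0) <= de ->
  exists2 z, normc z <= 25 * de & \det (pencil z) = 0.
Proof.
move=> de1 ded bx0 ax0; apply: contrapT => nz.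
have D0 z : normc z <= 25 * de -> \det (pencil z) != 0.
  by move=> hz; apply/eqP => dz; apply: nz; exists z.
have r0 : 0 <= 25 * de by rewrite mulr_ge0 // ltW.
pose Y := pencil 0 *m x0.
pose c : 'rV[R[i]]_n := \row_k ip (b k) (comb b x0).
pose p := ((map_mx polyC c) *m \adj pencil_poly *m map_mx polyC Y) 0 0.
have evp z : p.[z] = (c *m \adj (pencil z) *m Y) 0 0.
  have -> : p.[z] = (map_mx (horner_eval z)
      (map_mx polyC c *m \adj pencil_poly *m map_mx polyC Y)) 0 0 by rewrite [RHS]mxE.
  rewrite !map_mxM map_mx_adj -pencil_polyE.
  have mapC m k (A : 'M[R[i]]_(m, k)) : map_mx (horner_eval z) (map_mx polyC A) = A.
    by apply/matrixP => i j; rewrite !mxE; apply: hornerC.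
  by rewrite !mapC.
have sol z x : pencil z *m x = Y -> p.[z] = \det (pencil z) * ip (comb b x) (comb b x0).
  move=> h; rewrite evp -h -!mulmxA [\adj _ *m _]mulmxA mul_adj_mx mul_scalar_mx -scalemxAr mxE.
  congr (_ * _); rewrite mxE (form_suml fip); apply: eq_bigr => k _.
  by rewrite mxE (formZl fip) mulrC.
have p0 : p.[0] = \det (pencil 0).
  by rewrite (sol 0 x0) // (form_self fip) -(sqr_nrm fip) bx0 expr1n mulr1.
have circle z : normc z = 25 * de -> normc p.[z] <= 2^-1 * normc (\det (pencil z)).
  move=> hz; have uz : pencil z \in unitmx by rewrite unitmxE unitfE D0 // hz.
  pose x := invmx (pencil z) *m Y.
  have hx : pencil z *m x = Y by rewrite mulKVmx.
  rewrite (sol z x) // Normc.normcM mulrC ler_wpM2r ?normc_ge0 //.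
  apply: (le_trans (formCS fip _ _)); rewrite bx0 mulr1.
  rewrite leNgt; apply/negP => Xbig.
  have [||w||X2 gap Y2 P2] := @test_bounds z x de; rewrite ?hz //; last first.
  - move: X2 gap Y2 P2; rewrite hz.
    set X := nrm (comb b x) in Xbig *; set Z := nrm (comb a x); set P := nrm _; set v := nrm _.
    have X0 : 0 <= X by exact: nrm_ge0. have Z0 : 0 <= Z by exact: nrm_ge0.
    have P0 : 0 <= P by exact: nrm_ge0. have v0 : 0 <= v by exact: nrm_ge0.
    clearbody X Z P v => X2 gap Z2 P2.
    have PX : P <= X.
      by rewrite -(@ler_pXn2r _ 2) ?nnegrE // X2 lerDl sqr_ge0.
    have d1 := ltW de_gt0.
    have a1 : de * P * (25 * de * X + Z) <= de * X * (25 * de * X + Z).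
      by rewrite ler_wpM2r ?addr_ge0 ?mulr_ge0 // ler_wpM2l.
    have X1 : 1 <= 2 * X by move: Xbig; lra.
    have a2 : de * Z <= 2 * (de * X) * Z.
      rewrite (_ : 2 * (de * X) * Z = (de * Z) * (2 * X)); last by ring.
      by rewrite ler_peMr ?mulr_ge0.
    have a3 : de * (de * P) <= 2 * (de * X) ^+ 2.
      rewrite (_ : 2 * _ = de * (de * X) * (2 * X)); last by ring.
      apply: (@le_trans _ _ (de * (de * X))); first by rewrite !ler_wpM2l.
      by rewrite ler_peMr ?mulr_ge0.
    have [t [tE t0]] : exists t, t = de * X /\ 0 <= t by exists (de * X); rewrite mulr_ge0.
    have Z3 : Z ^+ 2 <= 104 * t ^+ 2 + 8 * t * Z.
      by move: Z2 a1 a2 a3; rewrite tE; lra.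
    have Z4 : Z <= 15 * t by rewrite leNgt; apply/negP => h; nra.
    have P3 : 625 * (de ^+ 2 * P ^+ 2) <= 82 * (de ^+ 2 * X ^+ 2).
      have : t * Z <= t * (15 * t) by rewrite ler_wpM2l.
      by move: P2 a1 a3; rewrite tE; lra.
    have P4 : 625 * P ^+ 2 <= 82 * X ^+ 2.
      have de2 : 0 < de ^+ 2 by rewrite exprn_gt0.
      by rewrite -(ler_pM2l de2) mulrCA [leRHS]mulrCA.
    have v4 : v * 200 <= 15 * X.
      have : de * (v * 200) <= de * (15 * X).
        apply: (@le_trans _ _ (v * d0)).
          by rewrite mulrCA ler_wpM2l //; move: ded; lra.
        by apply: (le_trans gap); move: Z4; rewrite tE; lra.
      by rewrite ler_pM2l.
    have v5 : (v * 200) ^+ 2 <= (15 * X) ^+ 2 by rewrite ler_pXn2r ?nnegrE ?mulr_ge0.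
    by rewrite !exprMn in v5; nra.
  - exact: ltW.
  - rewrite pencil_form hx -(pencil_form 0 x0 w) conjC0 !scale0r !sub0r.
    rewrite (formNl fip) (formNr fip) opprK; apply: (le_trans (formCS fip _ _)).
    by rewrite ler_wpM2r ?nrm_ge0.
have [s hs] := closed_field_poly_normal (\det pencil_poly).
have dP0 : \det pencil_poly != 0.
  apply/eqP => h; have := D0 0; rewrite Normc.normc0 => /(_ r0).
  by rewrite det_pencil h horner0 eqxx.
have sroot l : l \in s -> 25 * de < normc l.
  move=> ls; rewrite ltNge; apply/negP => /D0; rewrite det_pencil => /negP; apply.
  by rewrite -/(root _ _) hs rootZ ?lead_coef_eq0 // root_prod_XsubC.
have sN0 l : l \in s -> l != 0.
  by move=> /sroot; apply: contraTneq => ->; rewrite Normc.normc0 -leNgt.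
have fac z : normc (\det (pencil z)) =
    normc (\det (pencil 0)) * \prod_(l <- s) normc (1 - z / l).
  have nprod (F : R[i] -> R[i]) : normc (\prod_(l <- s) F l) = \prod_(l <- s) normc (F l).
    by apply: (big_morph _ (@Normc.normcM R) (Normc.normc1 R)).
  have ev w : (\det pencil_poly).[w] = lead_coef (\det pencil_poly) * \prod_(l <- s) (w - l).
    rewrite {1}hs hornerZ horner_prod; congr (_ * _).
    by apply: eq_bigr => l _; rewrite hornerXsubC.
  rewrite !det_pencil !ev !Normc.normcM !nprod -mulrA -big_split /=; congr (_ * _).
  rewrite !big_seq; apply: eq_bigr => l ls; rewrite -Normc.normcM; congr normc.
  by field; exact: sN0.
have : normc p.[0] <= 2^-1 * normc (\det (pencil 0)).
  apply: (max_modulus_ratio r0 _ sroot); first by rewrite mulr_ge0 ?normc_ge0 ?invr_ge0.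
  by move=> z hz; rewrite -mulrA -fac circle.
rewrite p0; have := D0 0; rewrite Normc.normc0 => /(_ r0) h.
have : 0 < normc (\det (pencil 0)).
  by rewrite lt_def normc_ge0 andbT; apply: contra_neq h => /normc_eq0P.
lra.
Qed.
End Perturbation.
End QuadraticPencil.

(** * Hermitian matrices *)

Section HermitianMatrices.
Context {R : realType}.
Local Notation C := R[i].

Record herm n (A : 'M[C]_n) : Prop := Herm { hermE : A^t* = A }.
Definition qf n (A : 'M[C]_n) (x : 'cV[C]_n) : R := Re ((x^t* *m A *m x) 0 0).
Definition sqn n (x : 'cV[C]_n) : R := \sum_i normc (x i 0) ^+ 2.
Record posdef n (A : 'M[C]_n) : Prop := PosDef {
  posdef_herm : herm A; posdef_gt0 : forall x, x != 0 -> 0 < qf A x }.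

Lemma trC_mul m n p (A : 'M[C]_(m, n)) (B : 'M[C]_(n, p)) : (A *m B)^t* = B^t* *m A^t*.
Proof. by rewrite trmx_mul map_mxM. Qed.
Lemma trCE m n (A : 'M[C]_(m, n)) i j : A^t* i j = (A j i)^*.
Proof. by rewrite !mxE. Qed.
Lemma trCD m n (A B : 'M[C]_(m, n)) : (A + B)^t* = A^t* + B^t*.
Proof. by rewrite linearD map_mxD. Qed.
Lemma trCZ m n (x : R) (A : 'M[C]_(m, n)) : (x%:C *: A)^t* = x%:C *: A^t*.
Proof. by apply/matrixP => i j; rewrite !mxE rmorphM /= -[X in X * _]/(x%:C^*) cconjR. Qed.
Lemma trC1 n : (1%:M : 'M[C]_n)^t* = 1%:M.
Proof. by rewrite trmx1 map_mx1. Qed.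

Lemma conj_conj m n p (Z : 'M[C]_m) (A : 'M[C]_(m, n)) (B : 'M[C]_(n, p)) :
  (A *m B)^t* *m Z *m (A *m B) = B^t* *m (A^t* *m Z *m A) *m B.
Proof. by rewrite trC_mul !mulmxA. Qed.

Lemma herm1 n : herm (1%:M : 'M[C]_n). Proof. by split; exact: trC1. Qed.
Lemma hermD n (A B : 'M[C]_n) : herm A -> herm B -> herm (A + B).
Proof. by move=> [a] [b]; split; rewrite trCD a b. Qed.
Lemma hermZ n (x : R) (A : 'M[C]_n) : herm A -> herm (x%:C *: A).
Proof. by move=> [a]; split; rewrite trCZ a. Qed.
Lemma herm_conj m n (A : 'M[C]_n) (B : 'M[C]_(n, m)) : herm A -> herm (B^t* *m A *m B).
Proof. by move=> [a]; split; rewrite !trC_mul trmxCK a mulmxA. Qed.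

Lemma qfD n (A B : 'M[C]_n) x : qf (A + B) x = qf A x + qf B x.
Proof. by rewrite /qf mulmxDr mulmxDl mxE cReD. Qed.
Lemma qfZ n (a : R) (A : 'M[C]_n) x : qf (a%:C *: A) x = a * qf A x.
Proof. by rewrite /qf -scalemxAr -scalemxAl mxE cReZ. Qed.
Lemma qf1 n x : qf (1%:M : 'M[C]_n) x = sqn x.
Proof.
rewrite /qf mulmx1 mxE /sqn (big_morph _ (@cReD R) (erefl : Re (0 : C) = 0)).
by apply: eq_bigr => i _; rewrite !mxE mulrC mulJc.
Qed.
Lemma qf_conj m n (A : 'M[C]_n) (B : 'M[C]_(n, m)) x : qf (B^t* *m A *m B) x = qf A (B *m x).
Proof. by rewrite /qf trC_mul !mulmxA. Qed.

Lemma sqn_ge0 n (x : 'cV[C]_n) : 0 <= sqn x.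
Proof. by apply: sumr_ge0 => i _; exact: sqr_ge0. Qed.
Lemma sqn_gt0 n (x : 'cV[C]_n) : x != 0 -> 0 < sqn x.
Proof.
move=> x0; rewrite lt_def sqn_ge0 andbT; apply: contra_neq x0 => /eqP.
rewrite psumr_eq0 => [/allP h|i _]; last exact: sqr_ge0.
apply/matrixP => i j; rewrite (ord1 j) mxE; apply: normc_eq0P.
by apply/eqP; have := h i (mem_index_enum _); rewrite /= expf_eq0.
Qed.
Lemma sqn_delta n (i : 'I_n) : sqn (delta_mx i 0) = 1.
Proof.
rewrite /sqn (bigD1 i) //=.
have -> : (delta_mx i 0 : 'cV[C]_n) i 0 = 1 by rewrite mxE !eqxx.
rewrite Normc.normc1 expr1n big1 ?addr0 // => j ji.
by rewrite mxE (negPf ji) Normc.normc0 expr0n.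
Qed.

Lemma trC_delta m n (i : 'I_m) (j : 'I_n) : (delta_mx i j : 'M[C]_(m, n))^t* = delta_mx j i.
Proof. by rewrite trmx_delta map_delta_mx. Qed.

Lemma qf_delta n (A : 'M[C]_n) i : qf A (delta_mx i 0) = Re (A i i).
Proof. by rewrite /qf trC_delta -rowE -colE !mxE. Qed.

Definition cdiag n (d : 'rV[R]_n) : 'M[C]_n := diag_mx (map_mx (real_complex R) d).

Lemma cdiag_herm n (d : 'rV[R]_n) : (cdiag d)^t* = cdiag d.
Proof.
apply/matrixP => i j; rewrite trCE !mxE eq_sym; case: eqP => [->|_] /=.
  by rewrite mulr1n cconjR.
by rewrite mulr0n conjC0.
Qed.
Lemma cdiagM n (d e : 'rV[R]_n) : cdiag d *m cdiag e = cdiag (\row_i (d 0 i * e 0 i)).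
Proof.
rewrite /cdiag mulmx_diag; congr diag_mx; apply/matrixP => i j.
by rewrite !mxE rmorphM.
Qed.
Lemma cdiagD n (d e : 'rV[R]_n) : cdiag d + cdiag e = cdiag (d + e).
Proof. by rewrite /cdiag -raddfD /= map_mxD. Qed.
Lemma cdiagB n (d e : 'rV[R]_n) : cdiag d - cdiag e = cdiag (d - e).
Proof. by rewrite /cdiag -raddfB /= map_mxB. Qed.
Lemma cdiag1 n : cdiag (const_mx 1) = 1%:M :> 'M[C]_n.
Proof. by rewrite /cdiag map_const_mx -diag_const_mx rmorph1. Qed.
Lemma det_cdiag n (d : 'rV[R]_n) : \det (cdiag d) = (\prod_i d 0 i)%:C.
Proof. by rewrite det_diag rmorph_prod; apply: eq_bigr => i _; rewrite mxE. Qed.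
Lemma cdiag_ii n (d : 'rV[R]_n) i : cdiag d i i = (d 0 i)%:C.
Proof. by rewrite !mxE eqxx mulr1n. Qed.

Lemma qf_cdiag n (d : 'rV[R]_n) x : qf (cdiag d) x = \sum_i d 0 i * normc (x i 0) ^+ 2.
Proof.
rewrite /qf -mulmxA mxE (big_morph _ (@cReD R) (erefl : Re (0 : C) = 0)).
apply: eq_bigr => i _; rewrite mul_diag_mx !mxE mulrCA cReZ; congr (_ * _).
by rewrite mulrC mulJc.
Qed.

Lemma herm_spectral n (A : 'M[C]_n) : herm A -> exists (U : 'M[C]_n) (d : 'rV[R]_n),
  [/\ U^t* *m U = 1%:M, U *m U^t* = 1%:M & U^t* *m A *m U = cdiag d].
Proof.
move=> [hA].
have hs : A \is hermsymmx by apply/is_hermitianmxP; rewrite expr0 scale1r hA.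
have /orthomx_spectralP AE := hermitian_normalmx hs.
have := spectral_unitarymx A; set P := spectralmx A in AE *; move=> Pu.
have PP := unitarymxP Pu; have PP' := mulmx1C PP.
have rd := hermitian_spectral_diag_real hs.
move: AE rd; set D := spectral_diag A => AE rd; clearbody D.
exists (P^t*), (map_mx (@complex.Re R) D); rewrite trmxCK; split => //.
rewrite AE invmx_unitary // !mulmxA PP mul1mx -mulmxA PP mulmx1 /cdiag; congr diag_mx.
apply/matrixP => i j; rewrite !mxE RRe_real //.
by have /mxOverP h := rd; apply: h.
Qed.

Lemma simult_diag n (Z Y : 'M[C]_n) : posdef Z -> herm Y ->
  exists (M : 'M[C]_n) (d : 'rV[R]_n),
  [/\ M \in unitmx, M^t* *m Z *m M = 1%:M & M^t* *m Y *m M = cdiag d].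
Proof.
move=> [hZ pZ] hY.
have [U [s [UU UU' US]]] := herm_spectral hZ.
have s0 i : 0 < s 0 i.
  have e : U *m (delta_mx i 0 : 'cV[C]_n) != 0.
    apply/eqP => h; have : (U^t* *m (U *m delta_mx i 0)) i (0 : 'I_1) = 0.
      by rewrite h mulmx0 mxE.
    by rewrite mulmxA UU mul1mx mxE !eqxx => /eqP; rewrite oner_eq0.
  by have := pZ _ e; rewrite -qf_conj US qf_delta cdiag_ii.
pose t : 'rV[R]_n := \row_i (Num.sqrt (s 0 i))^-1.
pose M0 := U *m cdiag t.
have M0Z : M0^t* *m Z *m M0 = 1%:M.
  rewrite /M0 conj_conj US cdiag_herm !cdiagM -cdiag1; congr cdiag; apply/matrixP => i j; rewrite (ord1 i) !mxE.
  by rewrite mulrAC -expr2 exprVn sqr_sqrtr ?(ltW (s0 j)) // mulVf // gt_eqF.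
have [W [d [WW WW' WS]]] := herm_spectral (herm_conj M0 hY).
exists (M0 *m W), d; split.
- have h : (M0 *m W)^t* *m Z *m (M0 *m W) = 1%:M.
    by rewrite conj_conj M0Z mulmx1 WW.
  by have [_] := mulmx1_unit h.
- by rewrite conj_conj M0Z mulmx1 WW.
- by rewrite conj_conj -WS.
Qed.
End HermitianMatrices.

(** * Log-determinants and traces *)

Section LogDet.
Context {R : realType}.
Local Notation C := R[i].
Implicit Types n : nat.

Definition ld n (A : 'M[C]_n) : R := ln (Re (\det A)).
Definition trq n (B A : 'M[C]_n) : R := Re (\tr (B *m invmx A)).
Definition scal n (x : R) : 'M[C]_n := x%:C *: 1%:M.

Lemma herm_scal n (x : R) : herm (scal n x). Proof. exact/hermZ/herm1. Qed.
Lemma qf_scal n (x : R) v : qf (scal n x) v = x * sqn v. Proof. by rewrite qfZ qf1. Qed.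

Lemma posdefP n (A : 'M[C]_n) (e : R) : 0 < e -> herm A ->
  (forall x, e * sqn x <= qf A x) -> posdef A.
Proof.
move=> e0 hA h; split=> // x x0; apply: lt_le_trans (h x).
by rewrite mulr_gt0 // sqn_gt0.
Qed.
Lemma posdef_le n (A B : 'M[C]_n) : posdef A -> herm B ->
  (forall x, qf A x <= qf B x) -> posdef B.
Proof. by case=> _ pA hB h; split=> [//|x x0]; exact: lt_le_trans (pA x x0) (h x). Qed.

Lemma det_cong n (M A : 'M[C]_n) (e : 'rV[R]_n) : M \in unitmx -> M^t* *m A *m M = cdiag e ->
  0 < normc (\det M) /\ \det A = (normc (\det M) ^- 2 * \prod_i e 0 i)%:C.
Proof.
rewrite unitmxE unitfE => uM h.
have dp : 0 < normc (\det M).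
  by rewrite lt_def normc_ge0 andbT; apply: contra_neq uM => /normc_eq0P.
split=> //; have := congr1 determinant h.
rewrite det_cdiag !det_mulmx det_map_mx det_tr mulrAC mulrC [_^* * _]mulrC mulJc => k.
have p2 : (normc (\det M) ^+ 2)%:C != 0 :> C.
  by rewrite (fmorph_eq0 (real_complex R)) expf_eq0 gt_eqF.
apply: (mulIf p2); rewrite k -rmorphM; congr (_%:C).
by rewrite mulrAC mulVf ?mul1r // expf_neq0 // gt_eqF.
Qed.

Lemma inv_cong n (M A : 'M[C]_n) (e : 'rV[R]_n) : M^t* *m A *m M = cdiag e ->
  (forall i, e 0 i != 0) -> invmx A = M *m cdiag (\row_i (e 0 i)^-1) *m M^t*.
Proof.
move=> h e0.
have : M^t* *m (A *m M *m cdiag (\row_i (e 0 i)^-1)) = 1%:M.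
  rewrite !mulmxA h cdiagM -cdiag1; congr cdiag; apply/matrixP => i j.
  by rewrite (ord1 i) !mxE mulfV.
move=> /mulmx1C; rewrite -!mulmxA => k.
have [uA _] := mulmx1_unit k.
by rewrite -[LHS]mulmx1 -k mulKmx // !mulmxA.
Qed.

Lemma trq_cong n (B M A : 'M[C]_n) (e : 'rV[R]_n) : M^t* *m A *m M = cdiag e ->
  (forall i, e 0 i != 0) -> trq B A = \sum_i qf B (M *m delta_mx i 0) / e 0 i.
Proof.
move=> h e0; rewrite /trq (inv_cong h e0) mulmxA mxtrace_mulC !mulmxA /mxtrace.
rewrite (big_morph _ (@cReD R) (erefl : Re (0 : C) = 0)); apply: eq_bigr => i _.
rewrite mul_mx_diag -qf_conj qf_delta !mxE mulrC [RHS]mulrC.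
by rewrite cReZ.
Qed.

Lemma cong_ge n (M A : 'M[C]_n) (e : 'rV[R]_n) : M^t* *m A *m M = cdiag e ->
  forall i, e 0 i = qf A (M *m delta_mx i 0).
Proof. by move=> h i; rewrite -qf_conj h qf_delta cdiag_ii. Qed.

Lemma congD n (M A B : 'M[C]_n) : M^t* *m (A + B) *m M = M^t* *m A *m M + M^t* *m B *m M.
Proof. by rewrite mulmxDr mulmxDl. Qed.
Lemma congZ n (M A : 'M[C]_n) (a : C) : M^t* *m (a *: A) *m M = a *: (M^t* *m A *m M).
Proof. by rewrite -scalemxAr -scalemxAl. Qed.

Lemma unit_col n (M : 'M[C]_n) i : M \in unitmx -> M *m delta_mx i 0 != 0 :> 'cV_n.
Proof.
move=> uM; apply/eqP => h.
have : (delta_mx i 0 : 'cV[C]_n) = 0 by rewrite -[LHS](mulKmx uM) h mulmx0.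
by move=> /matrixP/(_ i 0); rewrite !mxE !eqxx => /eqP; rewrite oner_eq0.
Qed.

Lemma cong_gt0 n (M A : 'M[C]_n) (e : 'rV[R]_n) : M \in unitmx -> posdef A ->
  M^t* *m A *m M = cdiag e -> forall i, 0 < e 0 i.
Proof. by move=> uM [_ pA] h i; rewrite (cong_ge h); apply: pA; exact: unit_col. Qed.

Lemma ln_prod (I : finType) (F : I -> R) : (forall i, 0 < F i) ->
  ln (\prod_i F i) = \sum_i ln (F i).
Proof.
move=> F0; suff [_ ->] : 0 < \prod_i F i /\ ln (\prod_i F i) = \sum_i ln (F i) by [].
elim/big_rec2: _ => [|i y1 y2 _ [p <-]]; first by rewrite ln1.
by rewrite lnM ?posrE // mulr_gt0.
Qed.

Lemma ld_cong n (M A : 'M[C]_n) (e : 'rV[R]_n) : M \in unitmx -> posdef A ->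
  M^t* *m A *m M = cdiag e -> ld A = \sum_i ln (e 0 i) - ln (normc (\det M) ^+ 2).
Proof.
move=> uM pA h; have e0 := cong_gt0 uM pA h.
rewrite /ld; have [dp ->] := det_cong uM h; rewrite /= lnM ?posrE ?invr_gt0 ?exprn_gt0 ?prodr_gt0 //.
by rewrite lnV ?posrE ?exprn_gt0 // addrC ln_prod.
Qed.

Lemma det_posdef n (A : 'M[C]_n) : posdef A -> \det A = (expR (ld A))%:C.
Proof.
move=> pA; have [U [d [UU _ hU]]] := herm_spectral (posdef_herm pA).
have [_ uU] := mulmx1_unit UU; have d0 := cong_gt0 uU pA hU.
rewrite /ld; have [dp ->] := det_cong uU hU.
by rewrite /= lnK // posrE mulr_gt0 ?invr_gt0 ?exprn_gt0 ?prodr_gt0.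
Qed.

Lemma trqZl n (a : R) (B A : 'M[C]_n) : trq (a%:C *: B) A = a * trq B A.
Proof. by rewrite /trq -scalemxAl mxtraceZ cReZ. Qed.

Lemma ld_ratio n (M A B : 'M[C]_n) (e f : 'rV[R]_n) : M \in unitmx -> posdef A -> posdef B ->
  M^t* *m A *m M = cdiag e -> M^t* *m B *m M = cdiag f ->
  ld A - ld B = \sum_i (ln (e 0 i) - ln (f 0 i)).
Proof.
move=> uM pA pB hA hB; rewrite (ld_cong uM pA hA) (ld_cong uM pB hB) sumrB; ring.
Qed.

Lemma ld_mono n (A B : 'M[C]_n) : posdef A -> posdef B ->
  (forall x, qf A x <= qf B x) -> ld A <= ld B.
Proof.
move=> pA pB AB; have [M [d [uM hB hA]]] := simult_diag pB (posdef_herm pA).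
have h1 : M^t* *m B *m M = cdiag (const_mx 1) by rewrite cdiag1.
rewrite -subr_le0 (ld_ratio uM pA pB hA h1); apply: sumr_le0 => i _.
rewrite mxE ln1 subr0 ln_le0 // (cong_ge hA); apply: (le_trans (AB _)).
by rewrite -(cong_ge h1) mxE.
Qed.

(** In a basis where Z becomes the identity and Y diagonal, the product is that of the
    numbers 1 - y_i^2, which lie in [0,1]. *)
Lemma det_pair_le n (Z Y : 'M[C]_n) : posdef Z -> herm Y ->
  (forall x, 0 <= qf (Z + Y) x) -> (forall x, 0 <= qf (Z - Y) x) ->
  exists2 c : R, \det (Z + Y) * \det (Z - Y) = c%:C & 0 <= c <= expR (2 * ld Z).
Proof.
move=> pZ hY h1 h2; have [M [d [uM hZ hM]]] := simult_diag pZ hY.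
have eZ : M^t* *m Z *m M = cdiag (const_mx 1) by rewrite cdiag1.
have eP : M^t* *m (Z + Y) *m M = cdiag (const_mx 1 + d) by rewrite congD eZ hM cdiagD.
have eM : M^t* *m (Z - Y) *m M = cdiag (const_mx 1 - d).
  by rewrite congD -scaleN1r congZ scaleN1r eZ hM cdiagB.
have [dp ->] := det_cong uM eP; have [_ ->] := det_cong uM eM.
rewrite -rmorphM /=; exists (normc (\det M) ^- 2 * (\prod_i (const_mx 1 + d) 0 i) *
  (normc (\det M) ^- 2 * (\prod_i (const_mx 1 - d) 0 i))) => //.
have [_ dZ] := det_cong uM eZ.
have zp : 0 < normc (\det M) ^- 2 by rewrite invr_gt0 exprn_gt0.
have -> : expR (2 * ld Z) = expR (ld Z) * expR (ld Z) by rewrite -expRD; congr expR; ring.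
have p1 : \prod_i (const_mx 1 : 'rV[R]_n) 0 i = 1 by rewrite big1 // => i _; rewrite mxE.
rewrite /ld dZ p1 mulr1 /=.
rewrite lnK ?posrE // mulrACA -big_split /=.
suff Pi i : 0 <= (const_mx 1 + d) 0 i * (const_mx 1 - d) 0 i <= 1.
  apply/andP; split; first by rewrite mulr_ge0 ?prodr_ge0 // => [|i _]; [rewrite ltW ?mulr_gt0 | case/andP: (Pi i)].
  by rewrite -[leRHS]mulr1 ler_pM2l ?mulr_gt0 // prodr_ile1.
have := cong_ge eP i; have := cong_ge eM i; rewrite !mxE => q1 q2.
have := h1 (M *m delta_mx i 0); have := h2 (M *m delta_mx i 0); rewrite -q1 -q2 => k1 k2.
apply/andP; split; first exact: mulr_ge0.
rewrite -subr_ge0 (_ : _ - _ = d 0 i ^+ 2) ?sqr_ge0 //; by ring.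
Qed.

Lemma ln1D_le_frac (S s : R) : 0 <= s -> s <= S -> ln (1 + s) <= (1 + ln (1 + S)) * (s / (1 + s)).
Proof.
move=> s0 sS; have s1 : 0 < 1 + s by rewrite ltr_wpDr.
rewrite mulrA ler_pdivlMr // mulrDr mulr1 mulrDl mul1r; apply: lerD.
  by apply: le_ln1Dx; apply: lt_le_trans s0; rewrite ltrN10.
rewrite ler_wpM2r // ler_ln ?posrE ?lerD2l //; apply: lt_le_trans s1 _; by rewrite lerD2l.
Qed.

(** Adding a form of small relative trace changes the determinant little, even if
   the form is large in few directions. *)
Lemma ld_add n (X B : 'M[C]_n) (S : R) : posdef X -> herm B -> (forall x, 0 <= qf B x) ->
  (forall x, qf B x <= S * qf X x) ->
  ld (X + B) - ld X <= (1 + ln (1 + S)) * trq B (X + B).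
Proof.
move=> pX hB B0 BS; have [M [s [uM hX hM]]] := simult_diag pX hB.
have eX : M^t* *m X *m M = cdiag (const_mx 1) by rewrite cdiag1.
have eS : M^t* *m (X + B) *m M = cdiag (const_mx 1 + s) by rewrite congD eX hM cdiagD.
have pS : posdef (X + B).
  by apply: (posdef_le pX) => [|x]; [apply: hermD; case: pX | rewrite qfD lerDl].
have s0 i : 0 <= s 0 i by rewrite (cong_ge hM).
rewrite (ld_ratio uM pS pX eS eX) (trq_cong _ eS) => [|i]; last first.
  by rewrite !mxE gt_eqF // ltr_wpDr.
rewrite mulr_sumr; apply: ler_sum => i _; rewrite !mxE ln1 subr0 -(cong_ge hM).
apply: ln1D_le_frac => //; rewrite (cong_ge hM); apply: (le_trans (BS _)).
by rewrite -(cong_ge eX) mxE mulr1.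
Qed.

Lemma trq_mono n (B A A' : 'M[C]_n) : posdef A' -> posdef A -> (forall x, 0 <= qf B x) ->
  (forall x, qf A' x <= qf A x) -> trq B A <= trq B A'.
Proof.
move=> pA' pA B0 h; have [M [d [uM hA' hA]]] := simult_diag pA' (posdef_herm pA).
have e1 : M^t* *m A' *m M = cdiag (const_mx 1) by rewrite cdiag1.
have d1 i : 1 <= d 0 i.
  by rewrite (cong_ge hA); apply: le_trans (h _); rewrite -(cong_ge e1) mxE.
rewrite (trq_cong _ hA) ?(trq_cong _ e1) => [|i|i]; last 2 first.
- by rewrite mxE oner_neq0.
- by rewrite gt_eqF // (lt_le_trans ltr01).
apply: ler_sum => i _; rewrite mxE; apply: ler_wpM2l => //.
by rewrite invr1 invf_le1 // (lt_le_trans ltr01).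
Qed.

Lemma trq_add n (K B : 'M[C]_n) (k : R) : 0 < k -> herm K -> herm B ->
  (forall x, 0 <= qf B x) -> (forall x, k * sqn x <= qf K x) ->
  trq 1%:M K <= trq 1%:M (K + B) + k^-1 * trq B (K + B).
Proof.
move=> k0 hK hB B0 kK; have pK := posdefP k0 hK kK.
have [M [s [uM hX hM]]] := simult_diag pK hB.
have eX : M^t* *m K *m M = cdiag (const_mx 1) by rewrite cdiag1.
have eS : M^t* *m (K + B) *m M = cdiag (const_mx 1 + s) by rewrite congD eX hM cdiagD.
have s0 i : 0 <= s 0 i by rewrite (cong_ge hM).
have s1 i : 0 < (const_mx 1 + s) 0 i by rewrite !mxE ltr_wpDr.
rewrite (trq_cong _ eX) ?(trq_cong _ eS) => [|i|i|i]; rewrite ?gt_eqF ?mxE //; try by rewrite ltr_wpDr.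
rewrite mulr_sumr -big_split /=; apply: ler_sum => i _.
rewrite -(cong_ge hM) qf1 /=; set v := M *m delta_mx i 0.
have : k * sqn v <= 1 by rewrite (le_trans (kK _)) // -(cong_ge eX) mxE.
rewrite !mxE; move: (s0 i) (s1 i); rewrite !mxE; move: (s 0 i) => t t0 t1 kv.
rewrite divr1 [k^-1 * _]mulrA -mulrDl ler_pdivlMr // mulrDr mulr1 lerD2l ler_wpM2r //.
by rewrite -(ler_pM2l k0) mulfV // gt_eqF.
Qed.

(** For an eigenvalue a of A, ln (1 + k^2 t / a) is at most k^2 t / a, which suffices
    when a >= k t; otherwise it is at most k, and k (a + k t) <= 2 k^2 t. *)
Lemma ld_shift_le n (A : 'M[C]_n) (k kap t : R) : 0 < kap -> herm A ->
  (forall x, kap * sqn x <= qf A x) -> 0 < t -> 0 < k -> ln (1 + k ^+ 2 * t / kap) <= k ->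
  ld (A + scal n (k ^+ 2 * t)) - ld A <= 2 * k ^+ 2 * t * trq 1%:M (A + scal n (k * t)).
Proof.
move=> kap0 hA kA t0 k0 hk; have pA := posdefP kap0 hA kA.
have [U [d [UU UU' hU]]] := herm_spectral hA.
have [_ uU] := mulmx1_unit UU.
have U1 : U^t* *m 1%:M *m U = cdiag (const_mx 1) by rewrite mulmx1 UU cdiag1.
have eU x : U^t* *m (A + scal n x) *m U = cdiag (d + const_mx x).
  rewrite congD hU congZ U1 -cdiagD; congr (_ + _); apply/matrixP => i j; rewrite !mxE.
  by rewrite mulrnAr -rmorphM mulr1.
have dk i : kap <= d 0 i.
  rewrite (cong_ge hU); apply: le_trans (kA _).
  by rewrite -qf1 -(cong_ge U1) mxE mulr1.
have d0 i : 0 < d 0 i := lt_le_trans kap0 (dk i).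
have pS x : 0 < x -> posdef (A + scal n x).
  move=> x0; apply: (posdef_le pA) => [|v]; first by apply: hermD => //; exact: herm_scal.
  by rewrite qfD qf_scal lerDl mulr_ge0 ?sqn_ge0 // ltW.
have k2t : 0 < k ^+ 2 * t by rewrite mulr_gt0 // exprn_gt0.
have kt : 0 < k * t by rewrite mulr_gt0.
rewrite (ld_ratio uU (pS _ k2t) pA (eU _) hU) (trq_cong _ (eU _)) => [|i]; last first.
  by rewrite !mxE gt_eqF // addr_gt0.
rewrite mulr_sumr; apply: ler_sum => i _; rewrite !mxE -(cong_ge U1) mxE.
move: (d 0 i) (d0 i) (dk i) => a a0 ka.
have akt : 0 < a + k * t by rewrite addr_gt0.
have -> : ln (a + k ^+ 2 * t) - ln a = ln (1 + k ^+ 2 * t / a).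
  rewrite -ln_div ?posrE ?addr_gt0 //; congr ln; field; exact: lt0r_neq0.
rewrite mul1r ler_pdivlMr //.
have [akt1|akt1] := leP a (k * t).
  apply: (@le_trans _ _ (k * (a + k * t))); last first.
    have : k * a <= k * (k * t) by rewrite ler_pM2l.
    rewrite mulrDr expr2 -!mulrA; lra.
  rewrite ler_pM2r //; apply: le_trans hk.
  rewrite ler_ln ?posrE ?addr_gt0 ?divr_gt0 // lerD2l ler_pM2l // lef_pV2 ?posrE //.
apply: (@le_trans _ _ (k ^+ 2 * t / a * (a + k * t))).
  rewrite ler_pM2r //; apply: le_ln1Dx; apply: lt_trans (ltrN10 R) _.
  by rewrite divr_gt0.
rewrite mulrAC ler_pdivrMr // -mulrA [2 * _ * a]mulrC.
have : k ^+ 2 * t * (k * t) <= k ^+ 2 * t * a by rewrite ler_pM2l // ltW.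
lra.
Qed.

Lemma ld_shift_ge n (K : 'M[C]_n) (u : R) : posdef K -> 0 < u ->
  u * trq 1%:M (K + scal n u) <= ld (K + scal n u) - ld K.
Proof.
move=> pK u0.
have [U [d [UU UU' hU]]] := herm_spectral (posdef_herm pK).
have [_ uU] := mulmx1_unit UU.
have U1 : U^t* *m 1%:M *m U = cdiag (const_mx 1) by rewrite mulmx1 UU cdiag1.
have eU x : U^t* *m (K + scal n x) *m U = cdiag (d + const_mx x).
  rewrite congD hU congZ U1 -cdiagD; congr (_ + _); apply/matrixP => i j; rewrite !mxE.
  by rewrite mulrnAr -rmorphM mulr1.
have d0 := cong_gt0 uU pK hU.
have pS : posdef (K + scal n u).
  apply: (posdef_le pK) => [|v]; first by apply: hermD; [exact: posdef_herm | exact: herm_scal].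
  by rewrite qfD qf_scal lerDl mulr_ge0 ?sqn_ge0 // ltW.
rewrite (ld_ratio uU pS pK (eU _) hU) (trq_cong _ (eU _)) => [|i]; last first.
  by rewrite !mxE gt_eqF // addr_gt0.
rewrite mulr_sumr; apply: ler_sum => i _; rewrite !mxE -(cong_ge U1) mxE.
move: (d 0 i) (d0 i) => a a0; have au : 0 < a + u by rewrite addr_gt0.
rewrite mul1r -ln_div ?posrE // -[leRHS]opprK -lnV ?posrE ?divr_gt0 // lerNr invf_div.
have -> : a / (a + u) = 1 + - (u / (a + u)) by field; exact: lt0r_neq0.
by apply: le_ln1Dx; rewrite ltrN2 ltr_pdivrMr // mul1r ltrDr.
Qed.

End LogDet.

(** * The roots of a quadratic pencil *)

Section PencilRoots.
Context {R : realType}.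
Local Notation C := R[i].

Definition hpencil n (L K : 'M[C]_n) (z : C) : 'M[C]_n :=
  z ^+ 2 *: 1%:M - (2 * z) *: L + K.

Definition fro m n (A : 'M[C]_(m, n)) : R := \sum_i \sum_j normc (A i j) ^+ 2.

Lemma fro_tr m n (A : 'M[C]_(m, n)) : fro A = Re (\tr (A *m A^t*)).
Proof.
rewrite /fro /mxtrace (big_morph _ (@cReD R) (erefl : Re (0 : C) = 0)).
apply: eq_bigr => i _; rewrite mxE (big_morph _ (@cReD R) (erefl : Re (0 : C) = 0)).
by apply: eq_bigr => j _; rewrite !mxE mulJc.
Qed.
Lemma fro_col m n (A : 'M[C]_(m, n)) : fro A = \sum_j sqn (A *m delta_mx j 0).
Proof.
rewrite /fro exchange_big; apply: eq_bigr => j _; apply: eq_bigr => i _.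
by rewrite -colE mxE.
Qed.
Lemma fro_block m n (A B D E : 'M[C]_(m, n)) :
  fro (block_mx A B D E) = fro A + fro B + (fro D + fro E).
Proof.
rewrite /fro big_split_ord /=; congr (_ + _); rewrite -big_split; apply: eq_bigr => i _;
rewrite big_split_ord /=; congr (_ + _); apply: eq_bigr => j _;
by rewrite ?block_mxEul ?block_mxEur ?block_mxEdl ?block_mxEdr.
Qed.

(** Schur triangulation: the eigenvalues are the diagonal of a unitarily equivalent
    matrix, which has the same Frobenius norm. *)
Lemma schur_factor n (A : 'M[C]_n) : (0 < n)%N -> exists mu : 'I_n -> C,
  (forall z, \det (1%:M - z *: A) = \prod_i (1 - z * mu i)) /\
  \sum_i normc (mu i) ^+ 2 <= fro A.
Proof.
move=> n0; have [P Pu hP] := Schur A n0.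
have PP := unitarymxP Pu; have PP' := mulmx1C PP.
have [T TE] : exists T, T = P *m A *m P^t* by exists (P *m A *m P^t*).
have Ttrig : is_trig_mx T by move: hP; rewrite /similar_to conjymx // -TE.
exists (fun i => T i i); split.
  move=> z; have -> : \det (1%:M - z *: A) = \det (P *m (1%:M - z *: A) *m P^t*).
    by rewrite !det_mulmx mulrAC -det_mulmx PP det1 mul1r.
  have -> : P *m (1%:M - z *: A) *m P^t* = 1%:M - z *: T.
    by rewrite mulmxBr mulmxBl mulmx1 PP -scalemxAr -scalemxAl TE.
  rewrite det_trig; first by apply: eq_bigr => i _; rewrite !mxE eqxx mulr1n.
  apply/is_trig_mxP => i j ij; rewrite !mxE (elimT is_trig_mxP Ttrig i j ij).
  by rewrite mulr0 subr0 -val_eqE /= ltn_eqF.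
have -> : fro A = fro T.
  rewrite !fro_tr; have -> : T *m T^t* = P *m (A *m A^t*) *m P^t*.
    by rewrite TE !trC_mul trmxCK !mulmxA -(mulmxA (P *m A) (P^t*) P) PP' mulmx1.
  by rewrite [in RHS]mxtrace_mulC [in RHS]mulmxA PP' mul1mx.
apply: ler_sum => i _; rewrite (bigD1 i) //= lerDl; apply: sumr_ge0 => j _; exact: sqr_ge0.
Qed.

(** A linearization of the pencil: after a congruence taking K to the identity, the
    roots are inverses of eigenvalues of a block matrix whose Frobenius norm is
    controlled by the trace of the inverse of K, because L^2 <= K. *)
Lemma hpencil_factor n (L K : 'M[C]_n) : (0 < n)%N -> herm L -> posdef K ->
  (forall x, sqn (L *m x) <= qf K x) -> exists mu : 'I_(n + n) -> C,
  (forall z, \det (hpencil L K z) = \det K * \prod_i (1 - z * mu i)) /\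
  \sum_i normc (mu i) ^+ 2 <= 6 * trq 1%:M K.
Proof.
move=> n0 hL pK LK.
have [U [ka [UU UU' hU]]] := herm_spectral (posdef_herm pK).
have [_ uU] := mulmx1_unit UU.
have k0 := cong_gt0 uU pK hU.
have [t tE] : exists t : 'rV[R]_n, forall i, t 0 i = (Num.sqrt (ka 0 i))^-1.
  by exists (\row_i (Num.sqrt (ka 0 i))^-1) => i; rewrite mxE.
pose W := cdiag t.
have tt i : t 0 i ^+ 2 = (ka 0 i)^-1.
  by rewrite tE exprVn sqr_sqrtr // ltW.
have [M ME] : exists M, M = U *m W by exists (U *m W).
have hM : M^t* *m K *m M = 1%:M.
  rewrite ME conj_conj hU cdiag_herm !cdiagM -cdiag1; congr cdiag.
  apply/matrixP => i j; rewrite (ord1 i) !mxE mulrAC -expr2 tE exprVn sqr_sqrtr ?(ltW (k0 j)) //.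
  by rewrite mulVf // gt_eqF.
pose L' := M^t* *m L *m M.
pose Cm := block_mx (2 *: L') (- W) W 0.
have [mu [mu1 mu2]] := schur_factor Cm (ltn_addr n n0).
exists mu; split=> [z|].
  rewrite -mu1.
  have blk : 1%:M - z *: Cm = block_mx 1%:M (z *: W) 0 1%:M *m
     block_mx (1%:M - (2 * z) *: L' + z ^+ 2 *: (W *m W)) 0 (- (z *: W)) 1%:M.
    rewrite mulmx_block !(mul1mx, mul0mx, mulmx1, mulmx0, add0r, addr0) scalar_mx_block.
    rewrite /Cm scale_block_mx -[- block_mx _ _ _ _]scaleN1r scale_block_mx add_block_mx.
    congr block_mx.
    - have e : (z *: W) *m (z *: W) = z ^+ 2 *: (W *m W).
        by rewrite -scalemxAl -scalemxAr scalerA expr2.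
      by rewrite mulmxN e addrK scaleN1r scalerA [z * 2]mulrC.
    - by rewrite scaleN1r scalerN opprK add0r.
    - by rewrite scaleN1r add0r.
    - by rewrite scaler0 scaler0 addr0.
  have QM : M^t* *m hpencil L K z *m M = 1%:M - (2 * z) *: L' + z ^+ 2 *: (W *m W).
    rewrite /hpencil !congD -[- ((2 * z) *: L)]scaleNr !congZ hM -/L' scaleNr.
    have -> : M^t* *m 1%:M *m M = W *m W.
      by rewrite mulmx1 ME trC_mul -mulmxA [U^t* *m _]mulmxA UU mul1mx cdiag_herm.
    by rewrite [RHS]addrC addrA addrAC.
  have -> : \det (1%:M - z *: Cm) = \det (M^t* *m hpencil L K z *m M).
    by rewrite blk det_mulmx det_ublock det_lblock !det1 !mul1r mulr1 QM.
  have : \det (M^t* *m K *m M) = 1 by rewrite hM det1.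
  rewrite !det_mulmx => h.
  rewrite (_ : _ * _ = (\det (M^t*) * \det K * \det M) * \det (hpencil L K z)); last by ring.
  by rewrite h mul1r.
apply: (le_trans mu2).
have Wd i : sqn (W *m delta_mx i 0) = (ka 0 i)^-1.
  by rewrite -qf1 -qf_conj mulmx1 cdiag_herm cdiagM qf_delta cdiag_ii /= mxE -expr2 tt.
have froW : fro W = \sum_i (ka 0 i)^-1 by rewrite fro_col; apply: eq_bigr => i _; exact: Wd.
have trK : trq 1%:M K = \sum_i (ka 0 i)^-1.
  rewrite (trq_cong _ hU) => [|i]; last by rewrite gt_eqF.
  by apply: eq_bigr => i _; rewrite -qf_conj mulmx1 UU qf1 sqn_delta mul1r.
have froL : fro L' <= \sum_i (ka 0 i)^-1.
  pose m := U^t* *m L *m U.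
  have sU y : sqn (U^t* *m y) = sqn y by rewrite -qf1 -qf_conj trmxCK mulmx1 UU' qf1.
  have mh i j : normc (m i j) = normc (m j i).
    have [hm] : herm m by exact: herm_conj.
    by rewrite -{1}hm trCE normcJ.
  have mk j : \sum_i normc (m i j) ^+ 2 <= ka 0 j.
    have -> : \sum_i normc (m i j) ^+ 2 = sqn (L *m (U *m delta_mx j 0)).
      have -> : sqn (L *m (U *m delta_mx j 0)) = sqn (m *m delta_mx j 0).
        by rewrite /m -!mulmxA sU.
      by rewrite -colE; apply: eq_bigr => i _; rewrite [col j m i 0]mxE.
    by rewrite (cong_ge hU); exact: LK.
  have Lm i j : L' i j = (t 0 i)%:C * m i j * (t 0 j)%:C.
    rewrite /L' ME conj_conj -/m; move: (m) => m'.
    by rewrite cdiag_herm mul_mx_diag mxE mul_diag_mx !mxE.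
  have t0 i : 0 <= t 0 i by rewrite tE invr_ge0 sqrtr_ge0.
  have bound i j : normc (L' i j) ^+ 2 <=
      2^-1 * (normc (m i j) ^+ 2 * (ka 0 i)^-1 ^+ 2 + normc (m i j) ^+ 2 * (ka 0 j)^-1 ^+ 2).
    rewrite Lm !Normc.normcM !normcR !ger0_norm // !exprMn -!tt.
    have := sqr_ge0 (normc (m i j) * (t 0 i ^+ 2 - t 0 j ^+ 2)).
    rewrite exprMn sqrrB; lra.
  apply: (@le_trans _ _ (2^-1 * (\sum_i (ka 0 i)^-1 + \sum_i (ka 0 i)^-1))); last by lra.
  rewrite /fro; apply: (@le_trans _ _ (\sum_i \sum_j 2^-1 * (normc (m i j) ^+ 2 * (ka 0 i)^-1 ^+ 2 + normc (m i j) ^+ 2 * (ka 0 j)^-1 ^+ 2))).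
    by apply: ler_sum => i _; apply: ler_sum => j _.
  under eq_bigr do rewrite -mulr_sumr big_split /=.
  rewrite -mulr_sumr ler_wpM2l ?invr_ge0 // big_split /=; apply: lerD.
    apply: ler_sum => i _; rewrite -mulr_suml.
    under eq_bigr do rewrite mh.
    apply: (le_trans (ler_wpM2r _ (mk i))); first exact: sqr_ge0.
    by rewrite expr2 mulrA mulfV ?mul1r // gt_eqF.
  rewrite exchange_big /=; apply: ler_sum => j _; rewrite -mulr_suml.
  apply: (le_trans (ler_wpM2r _ (mk j))); first exact: sqr_ge0.
  by rewrite expr2 mulrA mulfV ?mul1r // gt_eqF.
rewrite fro_block trK.
have -> : fro (2 *: L') = 4 * fro L'.
  rewrite /fro mulr_sumr; apply: eq_bigr => i _; rewrite mulr_sumr; apply: eq_bigr => j _.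
  by rewrite mxE Normc.normcM normc_nat exprMn; congr (_ * _); ring.
have -> : fro (- W) = fro W.
  by apply: eq_bigr => i _; apply: eq_bigr => j _; rewrite mxE normcN.
have -> : fro (0 : 'M[C]_n) = 0.
  by rewrite /fro big1 // => i _; rewrite big1 // => j _; rewrite mxE Normc.normc0 expr0n.
rewrite froW; lra.
Qed.
End PencilRoots.

(** * Roots against density *)

Section DensityInequality.
Context {R : realType}.
Local Notation C := R[i].

Lemma ln1D_ge (x : R) : `|x| <= 1 / 2 -> x - 2 * x ^+ 2 <= ln (1 + x).
Proof.
rewrite ler_norml => /andP[x1 x2]; have p : 0 < 1 + x by lra.
have -> : ln (1 + x) = - ln (1 + - (x / (1 + x))).
  have -> : 1 + - (x / (1 + x)) = (1 + x)^-1 by field; exact: lt0r_neq0.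
  by rewrite lnV ?posrE // opprK.
have : ln (1 + - (x / (1 + x))) <= - (x / (1 + x)).
  apply: le_ln1Dx; rewrite ltrN2 ltr_pdivrMr //; lra.
suff : x - 2 * x ^+ 2 <= x / (1 + x) by lra.
by rewrite ler_pdivlMr //; nra.
Qed.

(** The real part of the logarithm is linear up to a quadratic error, and the linear
    terms cancel after the factor k^2. *)
Lemma ln_normc_quad (k : R) (w : C) : 1 <= k -> k ^+ 2 * normc w <= 1 / 8 ->
  k ^+ 2 * ln (normc (1 - w)) - 5 * k ^+ 4 * normc w ^+ 2 <= ln (normc (1 - (k ^+ 2)%:C * w)).
Proof.
move=> k1 kw.
have [a [m [aE mE]]] : exists a m, a = Re w /\ m = normc w ^+ 2 by exists (Re w), (normc w ^+ 2).
have m0 : 0 <= m by rewrite mE sqr_ge0.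
have am : a ^+ 2 <= m by rewrite aE mE sqr_normcE lerDl sqr_ge0.
have k2 : 1 <= k ^+ 2 by rewrite exprn_ege1.
have K : exists2 K : R, K = k ^+ 2 & 0 <= K by exists (k ^+ 2) => //; rewrite sqr_ge0.
case: K => K KE K0; rewrite (_ : k ^+ 4 = K ^+ 2); last by rewrite KE; ring.
rewrite -KE in k2 kw *.
have Km : K ^+ 2 * m <= (1 / 8) ^+ 2.
  by rewrite mE -exprMn ler_pXn2r ?nnegrE ?mulr_ge0 ?normc_ge0.
have sq (x : R) : normc (1 - x%:C * w) ^+ 2 = 1 + (- (2 * x * a) + x ^+ 2 * m).
  rewrite sqr_normcE aE mE sqr_normcE; case: (w) => u v /=; ring.
have Ka : (K * a) ^+ 2 <= (1 / 8) ^+ 2.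
  by rewrite exprMn; apply: le_trans Km; rewrite ler_wpM2l ?sqr_ge0.
have Ka' : `|K * a| <= 1 / 8.
  by rewrite -(@ler_pXn2r _ 2) ?nnegrE // real_normK // num_real.
have Ka1 := Ka'; rewrite ler_norml in Ka1; case/andP: Ka1 => Ka1 Ka2.
have Km0 : 0 <= K ^+ 2 * m by rewrite mulr_ge0 ?sqr_ge0.
have lnsq (z : C) : 0 < normc z -> ln (normc z ^+ 2) = 2 * ln (normc z).
  by move=> z0; rewrite lnXn // mulr_natl.
have p1 : 0 < normc (1 - K%:C * w).
  rewrite lt_def normc_ge0 andbT; apply/eqP => h; have := sq K; rewrite h.
  rewrite expr0n /=; lra.
have low : - (2 * K * a) - 9 * K ^+ 2 * m <= 2 * ln (normc (1 - K%:C * w)).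
  rewrite -lnsq // sq.
  have xb : `|- (2 * K * a) + K ^+ 2 * m| <= 1 / 2 by rewrite ler_norml; apply/andP; split; lra.
  apply: le_trans (ln1D_ge xb).
  have : (- (2 * K * a) + K ^+ 2 * m) ^+ 2 <= 5 * (K ^+ 2 * m).
    have : (K * a) ^+ 2 <= K ^+ 2 * m by rewrite exprMn ler_wpM2l ?sqr_ge0.
    have : (K ^+ 2 * m) ^+ 2 <= (1/8) ^+ 2 * (K ^+ 2 * m) by rewrite [leLHS]expr2 ler_wpM2r.
    have : `|(K * a) * (K ^+ 2 * m)| <= 1/8 * (K ^+ 2 * m).
      by rewrite normrM (ger0_norm Km0) ler_wpM2r.
    rewrite ler_norml => /andP[h1 h2] h3 h4; nra.
  lra.
have up : 2 * ln (normc (1 - w)) <= - (2 * a) + m.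
  have [p0|] := ltP 0 (normc (1 - w)).
    rewrite -lnsq //; have := sq 1; rewrite mul1r => ->.
    rewrite mulr1 expr1n mul1r; apply: le_ln1Dx.
    have := sq 1; rewrite mul1r mulr1 expr1n mul1r => h.
    have : 0 < normc (1 - w) ^+ 2 by rewrite exprn_gt0.
    by rewrite h; lra.
  move=> h; have w1 : 1 - w = 0 by apply: normc_eq0P; apply/eqP; rewrite eq_le h normc_ge0.
  have : w = 1 by apply/eqP; rewrite eq_sym -subr_eq0 w1.
  move=> h'; move: kw; rewrite h' Normc.normc1; lra.
have : K * (2 * ln (normc (1 - w))) <= K * (- (2 * a) + m) by rewrite ler_wpM2l.
have : K * m <= K ^+ 2 * m by rewrite ler_wpM2r // expr2 ler_peMl.
rewrite -mE; lra.
Qed.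

Lemma normc_prod (I : finType) (F : I -> C) : normc (\prod_i F i) = \prod_i normc (F i).
Proof. exact: (big_morph _ (@Normc.normcM R) (Normc.normc1 R)). Qed.

(** X is bounded below by Ks only up to the form c1 B, which has small trace relative
    to KB; by ld_add this costs little in the determinant. *)
Lemma ld_lower n (X B KB Ks : 'M[C]_n) (c1 S T : R) : posdef X -> herm B ->
  (forall x, 0 <= qf B x) -> posdef KB -> posdef Ks -> 0 <= c1 -> 0 <= S ->
  (forall x, c1 * qf B x <= S * qf X x) ->
  (forall x, qf KB x <= qf X x + c1 * qf B x) ->
  (forall x, qf Ks x <= qf X x + c1 * qf B x) ->
  trq B KB <= T -> ld Ks - (1 + ln (1 + S)) * (c1 * T) <= ld X.
Proof.
move=> pX hB B0 pKB pKs c10 S0 BX KBX KsX hT.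
have [B1 B1E] : exists B1, B1 = c1%:C *: B by exists (c1%:C *: B).
have qB1 x : qf B1 x = c1 * qf B x by rewrite B1E qfZ.
have hB1 : herm B1 by rewrite B1E; exact: hermZ.
have B10 x : 0 <= qf B1 x by rewrite qB1 mulr_ge0.
have B1X x : qf B1 x <= S * qf X x by rewrite qB1.
have := ld_add pX hB1 B10 B1X.
have [XB XBE] : exists XB, XB = X + B1 by exists (X + B1).
have qXB x : qf XB x = qf X x + c1 * qf B x by rewrite XBE qfD qB1.
have pXB : posdef XB.
  apply: (posdef_le pX) => [|x]; first by rewrite XBE; apply: hermD; [case: pX|exact: hB1].
  by rewrite qXB lerDl mulr_ge0.
have -> : trq B1 (X + B1) = c1 * trq B XB by rewrite {1}B1E trqZl XBE.
rewrite -XBE.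
have : ld Ks <= ld XB by apply: (ld_mono pKs pXB) => x; rewrite qXB.
have H3 : trq B XB <= T.
  by apply: le_trans hT; apply: (trq_mono pKB pXB B0) => x; rewrite qXB.
have L0 : 0 <= 1 + ln (1 + S) by rewrite addr_ge0 ?ln_ge0 ?lerDl.
have : (1 + ln (1 + S)) * (c1 * trq B XB) <= (1 + ln (1 + S)) * (c1 * T).
  by rewrite ler_wpM2l ?ler_wpM2l.
move: (ld Ks) (ld XB) (ld X) (trq B XB) => *; lra.
Qed.

Let arith1 (lS q l1 l2 lK E : R) : lS - q <= l1 -> lS - q <= l2 ->
  l1 + l2 = 2 * lK + E -> 2 * (lS - lK) - 2 * q <= E.
Proof. lra. Qed.
Let arith2 (lS lK E : R) : 2 * lK + E <= 2 * lS -> E <= 2 * (lS - lK). Proof. lra. Qed.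
Let arith3 (a b c d u v t : R) : a - b <= v -> c <= a -> b - d <= u -> v <= t ->
  c - d <= t + u.
Proof. lra. Qed.
Let arith4 (a b E rg : R) : rg / 2 <= a -> 2 * a - b <= E -> rg - b <= E.
Proof. lra. Qed.
Let arith5 (P E1 E2 D a b c : R) : E2 <= 2 * D -> E1 - P <= E2 -> D <= a + b -> c <= E1 ->
  c - P <= 2 * a + 2 * b.
Proof. lra. Qed.

Section Inequality.
Variables (n : nat) (K L B : 'M[C]_n) (kap w c b ep rho k rr T g0 g1 g2 : R).
Hypotheses (n0 : (0 < n)%N) (hK : herm K) (hL : herm L) (hB : herm B).
Hypotheses (kap0 : 0 < kap) (kapK : forall x, kap * sqn x <= qf K x).
Hypothesis LK : forall x, sqn (L *m x) <= qf K x.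
Hypothesis Lwc : forall x, `|qf L x| <= w * sqn x + c * qf B x.
Hypotheses (B0 : forall x, 0 <= qf B x) (Bb : forall x, qf B x <= b * sqn x).
Hypotheses (w0 : 0 <= w) (c0 : 0 <= c) (b0 : 0 <= b) (rho0 : 0 < rho) (wrho : 4 * w <= rho).
Hypotheses (ep0 : 0 < ep) (epL : forall x, ep * sqn x <= sqn (rho%:C *: x - L *m x))
  (epL' : forall x, ep * sqn x <= sqn (rho%:C *: x + L *m x)).
Hypotheses (k1 : 1 <= k) (lnk : ln (1 + k ^+ 2 * rho ^+ 2 / kap) <= k).
Hypotheses (hT : trq B (K + B) <= T) (hg0 : trq 1%:M (K + B) <= g0).
Hypotheses (hg1 : trq 1%:M (K + B + scal n (k * rho ^+ 2)) <= g1).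
Hypothesis hg2 : g2 <= trq 1%:M (K + scal n (rho ^+ 2 / 2)).
Hypotheses (rr0 : 0 < rr) (rrk : k ^+ 2 * (rho ^+ 2 * rr ^+ 2) <= 1 / 8).
Hypothesis noroot : forall z, normc z < rr^-1 -> \det (hpencil L K z) != 0.

Let c1 := 2 * rho * c + 1.
Let pK := posdefP kap0 hK kapK.

Lemma sqnE (x y : 'cV[C]_n) (s : R) : sqn (s%:C *: x + y) =
  s ^+ 2 * sqn x + 2 * s * Re ((x^t* *m y) 0 0) + sqn y.
Proof.
rewrite mxE (big_morph _ (@cReD R) (erefl : Re (0 : C) = 0)) /sqn !mulr_sumr -!big_split /=.
apply: eq_bigr => i _; rewrite !mxE !sqr_normcE !cReD !cImD !cReM !cImM cReJ cImJ /=; ring.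
Qed.

Lemma qf_pencil (s : R) x : qf (hpencil L K s%:C) x = s ^+ 2 * sqn x - 2 * s * qf L x + qf K x.
Proof.
rewrite /hpencil -rmorphXn (_ : 2 * s%:C = (2 * s)%:C); last by rewrite rmorphM rmorph_nat.
by rewrite -scaleNr -rmorphN !qfD !qfZ qf1 mulNr.
Qed.

Lemma herm_pencil (s : R) : herm (hpencil L K s%:C).
Proof.
rewrite /hpencil -rmorphXn (_ : 2 * s%:C = (2 * s)%:C); last by rewrite rmorphM rmorph_nat.
rewrite -scaleNr -rmorphN; apply: hermD => //; apply: hermD; apply: hermZ => //; exact: herm1.
Qed.

Lemma sqnN (x : 'cV[C]_n) : sqn (- x) = sqn x.
Proof. by apply: eq_bigr => i _; rewrite mxE normcN. Qed.

Lemma qf_pencil_ge (s : R) x : sqn (s%:C *: x - L *m x) <= qf (hpencil L K s%:C) x.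
Proof.
rewrite qf_pencil sqnE sqnN.
rewrite mulmxN mxE cReN mulmxA -/(qf L x); have := LK x; lra.
Qed.

Lemma pencil_shift (s : R) :
  hpencil L K s%:C = (K + scal n (s ^+ 2)) + (- (2 * s))%:C *: L.
Proof.
by rewrite /hpencil /scal rmorphXn rmorphN rmorphM rmorph_nat scaleNr addrC addrA; congr (_ - _).
Qed.

Opaque qf sqn ld trq hpencil scal.

Let r20 : 0 <= rho ^+ 2 / 2. Proof. by rewrite divr_ge0 ?sqr_ge0. Qed.

Lemma pos_shift (u : R) : 0 <= u -> posdef (K + scal n u).
Proof.
move=> u0; apply: (posdef_le pK) => [|x]; first exact: (hermD hK (herm_scal _ _)).
by rewrite qfD qf_scal lerDl mulr_ge0 ?sqn_ge0.
Qed.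

Lemma pos_add : posdef (K + B).
Proof. by apply: (posdef_le pK) => [|x]; [exact: (hermD hK hB) | rewrite qfD lerDl]. Qed.

Let low (s : R) : `|s| = rho -> (forall x, ep * sqn x <= sqn (s%:C *: x - L *m x)) ->
  ld (K + scal n (rho ^+ 2 / 2)) - (1 + ln (1 + c1 * b / ep)) * (c1 * T) <= ld (hpencil L K s%:C).
Proof.
move=> sr es; have c10 : 0 < c1 by rewrite /c1 ltr_wpDl ?mulr_ge0 ?(ltW rho0).
have [X XE] : exists X, X = hpencil L K s%:C by exists (hpencil L K s%:C).
have eX x : ep * sqn x <= qf X x by rewrite XE; exact: le_trans (es x) (qf_pencil_ge s x).
have hX : herm X by rewrite XE; exact: herm_pencil.
have pX := posdefP ep0 hX eX.
have main x : qf K x + qf B x + rho ^+ 2 / 2 * sqn x <= qf X x + c1 * qf B x.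
  rewrite XE qf_pencil.
  have s2 : s ^+ 2 = rho ^+ 2 by rewrite -sr real_normK // num_real.
  have h1 : 2 * s * qf L x <= 2 * rho * (w * sqn x + c * qf B x).
    apply: (le_trans (ler_norm _)); rewrite !normrM sr gtr0_norm // ler_wpM2l ?mulr_ge0 ?(ltW rho0) //.
  have h2 : rho * (4 * w * sqn x) <= rho * (rho * sqn x) by rewrite ler_pM2l // ler_wpM2r ?sqn_ge0.
  have h3 := sqn_ge0 x.
  rewrite s2 /c1 expr2; move: h1 h2 h3.
  move: (qf L x) (qf B x) (qf K x) (sqn x) => *; lra.
rewrite -XE; apply: (ld_lower pX hB B0 pos_add (pos_shift r20) (ltW c10) _ _ _ _ hT).
- by rewrite divr_ge0 ?mulr_ge0 ?(ltW c10) ?(ltW ep0).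
- move=> x; rewrite -mulrA -mulrA ler_pM2l //; apply: (le_trans (Bb x)); rewrite ler_wpM2l //.
  by rewrite mulrC ler_pdivlMr // mulrC; exact: eX.
- move=> x; apply: le_trans (main x); rewrite qfD lerDl mulr_ge0 ?sqn_ge0 //.
- move=> x; apply: le_trans (main x); rewrite qfD qf_scal; have := B0 x.
  move: (qf K x) (qf B x) (_ * sqn x) => *; lra.
Qed.

(** Let E(x) be the logarithm of |det Q(x) det Q(-x)| relative to x = 0, a sum over
    the squares of the inverse roots. If all roots are large, E(k rho) is nearly k^2
    E(rho), by Taylor expansion. On the one hand E(rho) is at least about twice ld (K
    + rho^2 / 2) - ld K, as L is small up to B, so at least the density g2; on the
    other hand E(k rho) is at most twice ld (K + k^2 rho^2) - ld K, about k^2 rho^2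
    g1, where g1 is the density at the larger scale k rho^2. *)
Lemma density_inequality :
  k ^+ 2 * (rho ^+ 2 * g2 - 2 * ((1 + ln (1 + c1 * b / ep)) * (c1 * T)))
   - 30 * k ^+ 4 * rho ^+ 4 * rr ^+ 2 * (g0 + T / kap)
  <= 4 * k ^+ 2 * rho ^+ 2 * g1 + 2 * ((1 + ln (1 + b / kap)) * T).
Proof.
have [mu [muE mu2]] := hpencil_factor n0 hL pK LK.
have murr i : normc (mu i) <= rr.
  rewrite leNgt; apply/negP => h.
  have m0 : 0 < normc (mu i) by exact: lt_trans h.
  have mN0 : mu i != 0 by apply: contraTneq m0 => ->; rewrite Normc.normc0 ltxx.
  have /negP := noroot (z := (mu i)^-1) (ltac:(by rewrite Normc.normcV ltf_pV2 ?posrE)).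
  by apply; rewrite muE (bigD1 i) //= mulVf // subrr mul0r mulr0.
have [D DE] : exists D : R -> C, forall x, \det (hpencil L K x%:C) = D x.
  by exists (fun x => \det (hpencil L K x%:C)).
have fE x : D x = (expR (ld K))%:C * \prod_i (1 - x%:C * mu i).
  by rewrite -DE muE (det_posdef pK).
have [E EE] : exists E : R -> R,
    forall x, E x = \sum_i ln (normc (1 - (x ^+ 2)%:C * mu i ^+ 2)) by eexists.
have wE (x : R) i : normc ((x ^+ 2)%:C * mu i ^+ 2) <= x ^+ 2 * rr ^+ 2.
  rewrite Normc.normcM normcR ger0_norm ?sqr_ge0 // ler_wpM2l ?sqr_ge0 // normcX.
  by rewrite ler_pXn2r ?nnegrE ?normc_ge0 // ltW.
have pairE (x : R) : x ^+ 2 * rr ^+ 2 < 1 -> normc (D x * D (- x)) = expR (2 * ld K + E x).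
  move=> x1; rewrite !fE EE; move: (ld K) => l.
  rewrite mulrACA -big_split /= !Normc.normcM normc_prod expRD; congr (_ * _).
    rewrite normcR ger0_norm ?expR_ge0 // -expRD; congr expR; ring.
  have pos i : 0 < normc (1 - (x ^+ 2)%:C * mu i ^+ 2).
    have := normc_ler (1 - (x ^+ 2)%:C * mu i ^+ 2) ((x ^+ 2)%:C * mu i ^+ 2).
    rewrite subrK Normc.normc1; have := wE x i; lra.
  rewrite -ln_prod // lnK ?posrE ?prodr_gt0 //; apply: eq_bigr => i _; congr normc.
  rewrite rmorphN rmorphXn /=; ring.
have k20 : 0 <= k ^+ 2 by exact: sqr_ge0.
have kk : 1 <= k ^+ 2 by rewrite exprn_ege1.
have rr1 : rho ^+ 2 * rr ^+ 2 <= 1 / 8.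
  by apply: le_trans rrk; rewrite ler_peMl // mulr_ge0 ?sqr_ge0.
have rr11 : rho ^+ 2 * rr ^+ 2 < 1.
  by apply: le_lt_trans rr1 _; rewrite ltr_pdivrMr // mul1r ltr1n.
have Erho : 2 * (ld (K + scal n (rho ^+ 2 / 2)) - ld K) -
    2 * ((1 + ln (1 + c1 * b / ep)) * (c1 * T)) <= E rho.
  have eN x : ep * sqn x <= sqn ((- rho)%:C *: x - L *m x).
    by rewrite rmorphN scaleNr -opprD sqnN.
  have h1 := low (s := rho) (gtr0_norm rho0) epL.
  have h2 := low (s := - rho) (ltac:(by rewrite normrN gtr0_norm)).
  have {}h2 := h2 eN.
  have e : ld (hpencil L K rho%:C) + ld (hpencil L K (- rho)%:C) = 2 * ld K + E rho.
    apply: expR_inj; rewrite -(pairE rho rr11).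
    have p1 : posdef (hpencil L K rho%:C).
      apply: (posdefP ep0 (herm_pencil _)) => x; exact: le_trans (epL x) (qf_pencil_ge _ x).
    have p2 : posdef (hpencil L K (- rho)%:C).
      apply: (posdefP ep0 (herm_pencil _)) => x; apply: le_trans (qf_pencil_ge _ x).
      exact: eN.
    have -> : D rho = (expR (ld (hpencil L K rho%:C)))%:C by rewrite -DE; exact: det_posdef p1.
    have -> : D (- rho) = (expR (ld (hpencil L K (- rho)%:C)))%:C.
      by rewrite -DE; exact: det_posdef p2.
    by rewrite -rmorphM normcR ger0_norm ?mulr_ge0 ?expR_ge0 // expRD.
  exact: arith1 h1 h2 e.
have Ek : E (k * rho) <= 2 * (ld (K + scal n ((k * rho) ^+ 2)) - ld K).
  have kr1 : (k * rho) ^+ 2 * rr ^+ 2 < 1 by rewrite exprMn -mulrA; apply: le_lt_trans rrk _; rewrite ltr_pdivrMr // mul1r ltr1n.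
  pose y := k * rho.
  pose Y : 'M[C]_n := (- (2 * y))%:C *: L.
  have hY : herm Y by exact: hermZ.
  have e1 : hpencil L K y%:C = K + scal n (y ^+ 2) + Y by exact: pencil_shift.
  have e2 : hpencil L K (- y)%:C = K + scal n (y ^+ 2) - Y.
    by rewrite pencil_shift sqrrN mulrN rmorphN scaleNr.
  have pKy := pos_shift (sqr_ge0 y).
  have [d dE /andP[d0 d1]] := det_pair_le pKy hY
     (ltac:(move=> x; rewrite -e1; exact: le_trans (sqn_ge0 _) (qf_pencil_ge _ x)))
     (ltac:(move=> x; rewrite -e2; exact: le_trans (sqn_ge0 _) (qf_pencil_ge _ x))).
  have := pairE y kr1; rewrite -!DE e1 e2 dE normcR ger0_norm // => h.
  by apply: arith2; rewrite -ler_expR -h.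
have Ecmp : k ^+ 2 * E rho - 30 * k ^+ 4 * rho ^+ 4 * rr ^+ 2 * (g0 + T / kap) <= E (k * rho).
  have termw i : k ^+ 2 * ln (normc (1 - (rho ^+ 2)%:C * mu i ^+ 2))
      - 5 * k ^+ 4 * (rho ^+ 4 * rr ^+ 2 * normc (mu i) ^+ 2)
      <= ln (normc (1 - ((k * rho) ^+ 2)%:C * mu i ^+ 2)).
    have -> : ((k * rho) ^+ 2)%:C * mu i ^+ 2 = (k ^+ 2)%:C * ((rho ^+ 2)%:C * mu i ^+ 2).
      by rewrite exprMn rmorphM mulrA.
    apply: le_trans (ln_normc_quad k1 _); last first.
      by apply: le_trans rrk; rewrite ler_wpM2l.
    have k4 : 0 <= 5 * k ^+ 4 by rewrite mulr_ge0 ?exprn_ge0 // (le_trans ler01 k1).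
    rewrite lerD2l lerN2; apply: (ler_wpM2l k4).
    rewrite Normc.normcM normcR ger0_norm ?sqr_ge0 // normcX.
    have -> : (rho ^+ 2 * normc (mu i) ^+ 2) ^+ 2 =
      rho ^+ 4 * (normc (mu i) ^+ 2 * normc (mu i) ^+ 2) by ring.
    have r4 : 0 <= rho ^+ 4 by rewrite exprn_ge0 // ltW.
    rewrite -mulrA; apply: (ler_wpM2l r4); apply: (ler_wpM2r (sqr_ge0 _)).
    by rewrite ler_pXn2r ?nnegrE ?normc_ge0 // ltW.
  have trK : trq 1%:M K <= g0 + T / kap.
    apply: (le_trans (trq_add kap0 hK hB B0 kapK)); apply: lerD => //.
    by rewrite mulrC ler_wpM2r // invr_ge0 ltW.
  rewrite [leRHS]EE; apply: le_trans (ler_sum _ (fun i _ => termw i)).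
  rewrite sumrB -mulr_sumr -EE lerD2l lerN2 -!mulr_sumr.
  have -> : 30 * k ^+ 4 * rho ^+ 4 * rr ^+ 2 * (g0 + T / kap) =
    5 * k ^+ 4 * (rho ^+ 4 * rr ^+ 2 * (6 * (g0 + T / kap))) by ring.
  have k4 : 0 <= 5 * k ^+ 4 by rewrite mulr_ge0 ?exprn_ge0 // (le_trans ler01 k1).
  have r4 : 0 <= rho ^+ 4 * rr ^+ 2 by rewrite mulr_ge0 ?sqr_ge0 // exprn_ge0 // ltW.
  apply: (ler_wpM2l k4); apply: (ler_wpM2l r4).
  by apply: (le_trans mu2); rewrite ler_pM2l.
have k0 : 0 < k by exact: lt_le_trans k1.
have up : ld (K + scal n ((k * rho) ^+ 2)) - ld K <=
   2 * k ^+ 2 * rho ^+ 2 * g1 + (1 + ln (1 + b / kap)) * T.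
  have r2p : 0 < rho ^+ 2 by rewrite exprn_gt0.
  have kKB x : kap * sqn x <= qf (K + B) x.
    by rewrite qfD; apply: (le_trans (kapK x)); rewrite lerDl.
  have h1 := ld_shift_le kap0 (hermD hK hB) kKB r2p k0 lnk.
  have h2 : ld (K + scal n ((k * rho) ^+ 2)) <= ld (K + B + scal n (k ^+ 2 * rho ^+ 2)).
    rewrite exprMn; have kr0 : 0 <= k ^+ 2 * rho ^+ 2 by rewrite mulr_ge0 ?sqr_ge0.
    apply: (ld_mono (pos_shift kr0)) => [|x]; last by rewrite !qfD lerD2r lerDl.
    apply: (posdef_le pos_add) => [|x]; first exact: (hermD (hermD hK hB) (herm_scal _ _)).
    by rewrite [leRHS]qfD qf_scal lerDl mulr_ge0 ?sqn_ge0.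
  have h3 : ld (K + B) - ld K <= (1 + ln (1 + b / kap)) * T.
    apply: (le_trans (ld_add (S := b / kap) pK hB B0 _)).
      move=> x; apply: (le_trans (Bb x)); rewrite -mulrA ler_wpM2l //.
      by rewrite mulrC ler_pdivlMr // mulrC.
    by rewrite ler_wpM2l // addr_ge0 // ln_ge0 // lerDl divr_ge0 // ltW.
  have h4 : 2 * k ^+ 2 * rho ^+ 2 * trq 1%:M (K + B + scal n (k * rho ^+ 2)) <= 2 * k ^+ 2 * rho ^+ 2 * g1.
    exact: (ler_wpM2l (mulr_ge0 (mulr_ge0 (ler0n _ 2) (sqr_ge0 _)) (sqr_ge0 _)) hg1).
  exact: arith3 h1 h2 h3 h4.
have lo2 : rho ^+ 2 / 2 * g2 <= ld (K + scal n (rho ^+ 2 / 2)) - ld K.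
  apply: le_trans (ld_shift_ge pK _); last by rewrite divr_gt0 ?exprn_gt0.
  by rewrite ler_wpM2l // divr_ge0 ?sqr_ge0.
have fin : k ^+ 2 * (rho ^+ 2 * g2 - 2 * ((1 + ln (1 + c1 * b / ep)) * (c1 * T))) <= k ^+ 2 * E rho.
  apply: (ler_wpM2l k20); apply: (arith4 _ Erho).
  by rewrite mulrAC; exact: lo2.
have := arith5 Ek Ecmp up fin.
by rewrite !mulrA (_ : 2 * 2 = 4) // -natrM.
Qed.
End Inequality.
End DensityInequality.

(** * A root in a fixed disc *)

Section BoundedRoot.
Context {R : realType}.
Local Notation C := R[i].

Ltac nneg := solve [repeat first [ assumption | (apply: ltW; assumption) | exact: ler0n | exact: ler01
  | exact: sqr_ge0 | apply: exprn_ge0 | apply: addr_ge0 | apply: divr_ge0 | (rewrite invr_ge0)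
  | apply: mulr_ge0 ]].

Lemma log_square_small (A D : R) : 0 <= A -> 0 <= D ->
  exists M0 : nat, forall M : nat, (M0 <= M)%N ->
    D * (1 + ln (1 + A * M%:R ^+ 3)) ^+ 2 < Num.sqrt M%:R.
Proof.
move=> A0 D0.
have [F F0 hF] : exists2 F : R, 0 <= F & forall z, 0 <= z -> z ^+ 16 <= F * expR z.
  have h n (z : R) : 0 <= z -> z ^+ n.+1 <= n.+1`!%:R * expR z.
    move=> z0; have f0 : 0 < n.+1`!%:R :> R by rewrite ltr0n fact_gt0.
    rewrite mulrC -ler_pdivrMr //; apply: le_trans (expR_ge1Dxn n z0); rewrite lerDr.
    exact: ler01.
  exists (15.+1)`!%:R; [exact: ler0n | exact: (h 15%N)].
pose S := D ^+ 8 * (F * (expR 1 * (1 + A))).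
have S0 : 0 <= S.
  by apply: mulr_ge0; [exact: exprn_ge0|apply: mulr_ge0 => //; apply: mulr_ge0; rewrite ?expR_ge0 // addr_ge0].
exists (Num.bound S).+1 => M hM.
have M1 : 1 <= M%:R :> R by rewrite ler1n; apply: leq_ltn_trans hM.
have SM : S < M%:R by apply: (lt_le_trans (archi_boundP S0)); rewrite ler_nat ltnW.
have m3 : 1 <= M%:R ^+ 3 :> R by exact: exprn_ege1.
set y := 1 + A * M%:R ^+ 3; set z := 1 + ln y.
have y1 : 1 <= y by rewrite lerDl mulr_ge0 // exprn_ge0 ?ler0n.
have z0 : 0 <= z by rewrite addr_ge0 // ln_ge0.
have hz : z ^+ 16 <= F * (expR 1 * y).
  have -> : expR 1 * y = expR z by rewrite expRD lnK // posrE (lt_le_trans ltr01).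
  exact: hF.
have yM : y <= (1 + A) * M%:R ^+ 3 by rewrite mulrDl mul1r lerD2r.
have Dz0 : 0 <= D * z ^+ 2 by rewrite mulr_ge0 // exprn_ge0.
rewrite -[ltLHS]ger0_norm // -sqrtr_sqr ltr_sqrt ?(lt_le_trans ltr01) //.
rewrite -(ltr_pXn2r (n := 4)) ?nnegrE ?exprn_ge0 ?ler0n //.
have -> : ((D * z ^+ 2) ^+ 2) ^+ 4 = D ^+ 8 * z ^+ 16 by ring.
apply: (@le_lt_trans _ _ (S * M%:R ^+ 3)).
  rewrite /S -[leRHS]mulrA ler_wpM2l ?exprn_ge0 //; apply: (le_trans hz).
  by rewrite -!mulrA ler_wpM2l // ler_wpM2l ?expR_ge0.
by rewrite [ltRHS]exprS ltr_pM2r // (lt_le_trans ltr01).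
Qed.

Lemma trq_diag n (D G U : 'M[C]_n) (d : 'rV[R]_n) (x y : R) :
  U^t* *m U = 1%:M -> U^t* *m G *m U = cdiag d -> 0 < y -> 0 <= x -> (forall i, 0 <= d 0 i) ->
  trq D (x%:C *: G + scal n y) = \sum_i qf D (U *m delta_mx i 0) / (x * d 0 i + y).
Proof.
move=> UU hU y0 x0 d0.
have e0 i : 0 < x * d 0 i + y by rewrite ltr_wpDl // mulr_ge0.
have h : U^t* *m (x%:C *: G + scal n y) *m U = cdiag (\row_i (x * d 0 i + y)).
  rewrite congD !congZ hU mulmx1 UU; apply/matrixP => i j; rewrite !mxE.
  case: eqP => [->|_] /=; last by rewrite !mulr0n !mulr0 addr0.
  by rewrite !mulr1n mulr1 rmorphD rmorphM.
rewrite (trq_cong _ h) => [|i]; last by rewrite mxE gt_eqF.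
by apply: eq_bigr => i _; rewrite mxE.
Qed.

Lemma qf_unit_col n (U : 'M[C]_n) i : U^t* *m U = 1%:M -> sqn (U *m delta_mx i 0) = 1.
Proof. by move=> UU; rewrite -qf1 -qf_conj mulmx1 UU qf1 sqn_delta. Qed.

(** Pigeonhole on n + 1 equally spaced points of [r, 2r], spaced so widely that a
    given number is close to at most one of them. *)
Lemma pigeonhole_gap n (l : 'I_n -> R) (r : R) : (0 < n)%N -> 0 < r ->
  exists rho, [/\ r <= rho, rho <= 2 * r & forall i, r / (2 * n%:R) <= `| `|l i| - rho|].
Proof.
move=> n0 r0; have np : 0 < n%:R :> R by rewrite ltr0n.
pose p (j : 'I_n.+1) : R := r + r / n%:R * j%:R.
have rn : 0 < r / n%:R by rewrite divr_gt0.
have [[j hj]|no] := pselect (exists j, forall i, r / (2 * n%:R) <= `| `|l i| - p j|).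
  exists (p j); split=> //; first by rewrite lerDl mulr_ge0 // ltW.
  have : r / n%:R * j%:R <= r / n%:R * n%:R by rewrite ler_pM2l // ler_nat -ltnS ltn_ord.
  rewrite /p divfK ?gt_eqF //; lra.
have bad j : exists i, `| `|l i| - p j| < r / (2 * n%:R).
  apply: contrapT => h; apply: no; exists j => i; rewrite leNgt; apply/negP => hi.
  by apply: h; exists i.
have [f hf] := choice bad.
have inj : injective f.
  move=> j k jk; apply: contrapT => ne.
  have h1 := hf j; have h2 := hf k; rewrite -jk in h2.
  have : `|p j - p k| < r / n%:R.
    have -> : p j - p k = (`|l (f j)| - p k) - (`|l (f j)| - p j) by ring.
    apply: (le_lt_trans (ler_normB _ _)).
    have -> : r / n%:R = r / (2 * n%:R) + r / (2 * n%:R) by field; rewrite gt_eqF.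
    exact: ltrD.
  have -> : p j - p k = r / n%:R * (j%:R - k%:R) by rewrite /p; ring.
  rewrite normrM (gtr0_norm rn) gtr_pMr // ltNge => /negP; apply.
  have [jk'|kj|e] := ltngtP j k; last by case: ne; exact: val_inj.
    by rewrite distrC ger0_norm ?subr_ge0 ?ler_nat 1?ltnW // lerBrDr nat1r ler_nat.
  by rewrite ger0_norm ?subr_ge0 ?ler_nat 1?ltnW // lerBrDr nat1r ler_nat.
by have := leq_card f inj; rewrite !card_ord ltnn.
Qed.

(** The pencil at real points is bounded below as soon as these are not eigenvalues of
    L; a lower bound by a negative power of n is enough, as it enters through a
    logarithm. *)
Lemma shift_lower n (L : 'M[C]_n) (r : R) : herm L -> (0 < n)%N -> 0 < r ->
  exists rho, [/\ r <= rho, rho <= 2 * r,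
    forall x, (r / (2 * n%:R)) ^+ 2 * sqn x <= sqn (rho%:C *: x - L *m x) &
    forall x, (r / (2 * n%:R)) ^+ 2 * sqn x <= sqn ((- rho)%:C *: x - L *m x)].
Proof.
move=> hL n0 r0; have [U [d [UU UU' hU]]] := herm_spectral hL.
have [rho [h1 h2 h3]] := pigeonhole_gap (fun i => d 0 i) n0 r0.
have rho0 : 0 < rho by exact: lt_le_trans h1.
have del0 : 0 <= r / (2 * n%:R) by rewrite divr_ge0 ?mulr_ge0 ?ler0n ?(ltW r0).
have main (s : R) : (forall i, r / (2 * n%:R) <= `|s - d 0 i|) -> forall x,
    (r / (2 * n%:R)) ^+ 2 * sqn x <= sqn (s%:C *: x - L *m x).
  move=> hs x; have [y xE] : exists y, x = U *m y by exists (U^t* *m x); rewrite mulmxA UU' mul1mx.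
  have sU z : sqn (U *m z) = sqn z by rewrite -qf1 -qf_conj mulmx1 UU qf1.
  have -> : s%:C *: x - L *m x = U *m (s%:C *: y - cdiag d *m y).
    rewrite mulmxBr -scalemxAr -xE -hU; congr (_ - _).
    by rewrite xE !mulmxA UU' mul1mx.
  rewrite sU xE sU /sqn mulr_sumr; apply: ler_sum => i _.
  have -> : (s%:C *: y - cdiag d *m y) i 0 = (s - d 0 i)%:C * y i 0.
    by rewrite mul_diag_mx !mxE -mulrBl rmorphB.
  rewrite Normc.normcM [leRHS]exprMn ler_wpM2r ?sqr_ge0 //.
  rewrite [normc _%:C](_ : _ = `|s - d 0 i|); last by rewrite /= expr0n addr0 sqrtr_sqr.
  by rewrite ler_pXn2r ?nnegrE //; exact: hs.
exists rho; split=> //; apply: main => i; apply: (le_trans (h3 i)).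
  rewrite distrC; have := ler_dist_dist rho (d 0 i); rewrite (gtr0_norm rho0) distrC.
  by rewrite [in X in _ -> X]distrC [X in _ -> X <= _]distrC.
have := ler_dist_dist (- rho) (d 0 i).
by rewrite normrN (gtr0_norm rho0) [X in X <= _]distrC.
Qed.

(** The order of the choices matters: k is chosen so large that the density at scale k
    rho^2, of order 1 / sqrt k, is small against that at scale rho^2, and the radius Y
    only afterwards. *)
Lemma big_parameters (kap c1 C3 rho1 : R) : 0 < kap -> 0 < c1 -> 0 < C3 -> 1 <= rho1 ->
  exists k Y : R, [/\ 1 <= k, 1 <= Y,
    forall rho, 0 < rho -> rho <= 2 * rho1 -> ln (1 + k ^+ 2 * rho ^+ 2 / kap) <= k &
    [/\ 4 * c1^-1 * (Num.sqrt (1 + k * rho1 ^+ 2 / c1))^-1 <= (12 * C3)^-1,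
    4 * k ^+ 2 * rho1 ^+ 2 * Y^-1 ^+ 2 <= 1 / 8 &
    12 * 10 * k ^+ 2 * rho1 ^+ 2 * Y^-1 ^+ 2 <= c1 * (12 * C3)^-1]].
Proof.
move=> kap0 c10 C30 r1; have r0 : 0 < rho1 by exact: lt_le_trans r1.
pose B := 4 * rho1 ^+ 2 / kap.
have B0 : 0 <= B by rewrite /B; nneg.
pose k := 1 + 6 * (1 + B) + c1 * (48 * C3 / c1) ^+ 2.
have k1 : 1 <= k.
  by rewrite /k -addrA lerDl; nneg.
have kB : 6 * (1 + B) <= k.
  have : 0 <= c1 * (48 * C3 / c1) ^+ 2 by nneg.
  rewrite /k; lra.
have kc : c1 * (48 * C3 / c1) ^+ 2 <= k by rewrite /k; lra.
have k0 : 0 < k by exact: lt_le_trans k1.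
have [u1 u1E] : exists x, x = 32 * k ^+ 2 * rho1 ^+ 2 by eexists.
have [u2 u2E] : exists x, x = 12 * (12 * 10) * k ^+ 2 * rho1 ^+ 2 * C3 / c1 by eexists.
have y1 : 0 <= u1 by rewrite u1E; nneg.
have y2 : 0 <= u2 by rewrite u2E; nneg.
pose Y := 1 + u1 + u2.
have Y1 : 1 <= Y by rewrite /Y -addrA lerDl addr_ge0.
have Y0 : 0 < Y by exact: lt_le_trans Y1.
have YY : Y^-1 ^+ 2 <= Y^-1 by rewrite expr2 ler_piMl ?invr_ge0 ?(ltW Y0) // invf_le1.
exists k, Y; split=> //; last split.
- move=> rho rho0 rhole.
  have Y3 : 1 + k ^+ 2 * rho ^+ 2 / kap <= expR k.
    apply: (@le_trans _ _ (1 + k ^+ 3 / 3`!%:R)); last exact: (expR_ge1Dxn 2 (ltW k0)).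
    rewrite lerD2l (_ : 3`!%:R = 6 :> R) // -mulrA (exprSr k 2) -mulrA ler_wpM2l ?sqr_ge0 //.
    rewrite ler_pdivlMr // mulrC; apply: le_trans kB; rewrite ler_pM2l //.
    apply: (@le_trans _ _ B); last by rewrite lerDr ler01.
    rewrite /B ler_pM2r ?invr_gt0 //.
    have -> : 4 * rho1 ^+ 2 = (2 * rho1) ^+ 2 by ring.
    by rewrite ler_pXn2r ?nnegrE ?(ltW rho0) // mulr_ge0 // ltW.
  rewrite -[leRHS]expRK ler_ln ?posrE ?expR_gt0 //.
  by rewrite (lt_le_trans ltr01) // lerDl; nneg.
- have s : 48 * C3 / c1 <= Num.sqrt (1 + k * rho1 ^+ 2 / c1).
    have q0 : 0 <= 48 * C3 / c1 by rewrite divr_ge0 ?mulr_ge0 ?(ltW C30) ?(ltW c10).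
    rewrite -[leLHS]ger0_norm // -sqrtr_sqr ler_wsqrtr //.
    apply: (@le_trans _ _ (k * rho1 ^+ 2 / c1)); last by rewrite lerDr ler01.
    rewrite ler_pdivlMr // mulrC; apply: (le_trans kc); rewrite ler_peMr ?(ltW k0) //.
    exact: exprn_ege1.
  have q0 : 0 < 48 * C3 / c1 by rewrite divr_gt0 ?mulr_gt0.
  have -> : (12 * C3)^-1 = 4 * c1^-1 * (48 * C3 / c1)^-1.
    by field; rewrite !gt_eqF.
  rewrite ler_pM2l ?mulr_gt0 ?invr_gt0 // lef_pV2 ?posrE //.
  exact: lt_le_trans s.
- have p0 : 0 <= 4 * k ^+ 2 * rho1 ^+ 2 by nneg.
  apply: (le_trans (ler_wpM2l p0 YY)); rewrite ler_pdivrMr // /Y.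
  have -> : 4 * k ^+ 2 * rho1 ^+ 2 = u1 / 8 by rewrite u1E; field.
  by move: y1 y2 => *; lra.
- have p0 : 0 <= 12 * 10 * k ^+ 2 * rho1 ^+ 2 by nneg.
  apply: (le_trans (ler_wpM2l p0 YY)); rewrite ler_pdivrMr //.
  apply: (@le_trans _ _ (c1 * (12 * C3)^-1 * u2)).
    by rewrite u2E le_eqVlt; apply/orP; left; apply/eqP; field; rewrite !gt_eqF.
  apply: ler_wpM2l; first nneg.
  by rewrite /Y; move: y1 => *; lra.
Qed.

(** The density S exceeds all other terms by the assumption on S, which grows like the
    square root of M, while z is logarithmic in M. *)
Lemma density_numbers (k rho rr g0 g1 g2 T kap c1 C3 e z zz1 zz2 S N e1 : R) :
  0 < kap -> 0 < c1 -> 0 < C3 -> 1 <= k -> 1 <= rho -> 0 <= N -> 0 <= e1 -> e1 <= e -> 1 <= z ->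
  T = c1^-1 * (2 * z) -> zz1 <= z -> zz2 <= z ->
  30 * k ^+ 2 * rho ^+ 2 * rr ^+ 2 <= c1 * (12 * C3)^-1 ->
  g0 = c1^-1 * (N + S) -> g1 <= c1^-1 * N + (4^-1 * (12 * C3)^-1) * S -> g2 = S / (3 * C3) ->
  6 * C3 * ((2 * e + 2) * 2 / c1 + N / (12 * C3) + 2 / (12 * C3 * kap) + 4 * N / c1) * z ^+ 2 < S ->
  k ^+ 2 * (rho ^+ 2 * g2 - 2 * (zz1 * (e1 * T))) - 30 * k ^+ 4 * rho ^+ 4 * rr ^+ 2 * (g0 + T / kap)
   <= 4 * k ^+ 2 * rho ^+ 2 * g1 + 2 * (zz2 * T) -> False.
Proof.
move=> kap0 c10 C30 k1 rho1 N0 e10 ee z1 TE hz1 hz2 hr g0E g1le g2E small main.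
have k2 : 1 <= k ^+ 2 by exact: exprn_ege1.
have r2 : 1 <= rho ^+ 2 by exact: exprn_ege1.
have z0 : 0 <= z by exact: le_trans z1.
have T0 : 0 <= T by rewrite TE mulr_ge0 ?invr_ge0 ?(ltW c10) // mulr_ge0.
pose Q := k ^+ 2 * rho ^+ 2.
have Q1 : 1 <= Q by rewrite /Q -[leLHS]mulr1 ler_pM.
have Q0 : 0 < Q by exact: lt_le_trans Q1.
have kQ : k ^+ 2 <= Q by rewrite ler_peMr // (le_trans ler01).
have S0 : 0 <= S.
  by apply: le_trans (ltW small); have e0 := le_trans e10 ee; nneg.
have h1 : k ^+ 2 * (2 * (zz1 * (e1 * T))) <= Q * (2 * (z * (e * T))).
  have t0 : 0 <= 2 * (z * (e * T)) by rewrite mulr_ge0 // mulr_ge0 // mulr_ge0 // (le_trans e10).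
  apply: (@le_trans _ _ (k ^+ 2 * (2 * (z * (e * T))))); last by rewrite ler_wpM2r.
  rewrite ler_wpM2l ?(le_trans ler01) // ler_wpM2l //.
  apply: (@le_trans _ _ (z * (e1 * T))); first by rewrite ler_wpM2r // mulr_ge0.
  by rewrite ler_wpM2l // ler_wpM2r.
have gg : 0 <= g0 + T / kap.
  by rewrite g0E addr_ge0 // ?divr_ge0 ?(ltW kap0) // mulr_ge0 ?invr_ge0 ?(ltW c10) // addr_ge0.
have h2 : 30 * k ^+ 4 * rho ^+ 4 * rr ^+ 2 * (g0 + T / kap) <= Q * (c1 * (12 * C3)^-1 * (g0 + T / kap)).
  have -> : 30 * k ^+ 4 * rho ^+ 4 * rr ^+ 2 * (g0 + T / kap) =
    Q * (30 * k ^+ 2 * rho ^+ 2 * rr ^+ 2 * (g0 + T / kap)) by rewrite /Q; ring.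
  by rewrite ler_pM2l // ler_wpM2r.
have h3 : 2 * (zz2 * T) <= Q * (2 * (z * T)).
  apply: (@le_trans _ _ (2 * (z * T))); first by rewrite ler_wpM2l // ler_wpM2r.
  by rewrite ler_peMl // mulr_ge0 // mulr_ge0.
have h4 : 4 * k ^+ 2 * rho ^+ 2 * g1 <= Q * (4 * (c1^-1 * N + (4^-1 * (12 * C3)^-1) * S)).
  rewrite (_ : 4 * k ^+ 2 * rho ^+ 2 * g1 = Q * (4 * g1)); last by rewrite /Q; ring.
  by rewrite ler_pM2l // ler_pM2l.
have main2 : Q * g2 <= Q * (2 * (z * (e * T)) + c1 * (12 * C3)^-1 * (g0 + T / kap) + 2 * (z * T)
     + 4 * (c1^-1 * N + (4^-1 * (12 * C3)^-1) * S)).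
  rewrite !(mulrDr Q); move: main h1 h2 h3 h4.
  rewrite (_ : k ^+ 2 * (rho ^+ 2 * g2 - 2 * (zz1 * (e1 * T))) = Q * g2 - k ^+ 2 * (2 * (zz1 * (e1 * T)))); last by rewrite /Q; ring.
  lra.
move: main2; rewrite ler_pM2l // => main2.
have zz : z <= z ^+ 2 by rewrite expr2 ler_peMl.
have zz1' : 1 <= z ^+ 2 by exact: exprn_ege1.
have E1 : c1 * (12 * C3)^-1 * (g0 + T / kap) = N / (12 * C3) + S / (12 * C3) + 2 / (12 * C3 * kap) * z.
  by rewrite g0E TE; field; rewrite !gt_eqF.
have E2 : 2 * (z * (e * T)) + 2 * (z * T) = (2 * e + 2) * 2 / c1 * z ^+ 2 by rewrite TE; field; rewrite gt_eqF.
have E3 : 4 * (c1^-1 * N + (4^-1 * (12 * C3)^-1) * S) = 4 * N / c1 + S / (12 * C3).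
  by field; rewrite !gt_eqF.
have E4 : g2 = S / (12 * C3) + S / (12 * C3) + S / (6 * C3) by rewrite g2E; field; rewrite gt_eqF.
have b1 : N / (12 * C3) <= N / (12 * C3) * z ^+ 2 by rewrite ler_peMr // divr_ge0 // mulr_ge0 // ltW.
have b2 : 4 * N / c1 <= 4 * N / c1 * z ^+ 2 by rewrite ler_peMr // divr_ge0 ?mulr_ge0 // ltW.
have b3 : 2 / (12 * C3 * kap) * z <= 2 / (12 * C3 * kap) * z ^+ 2.
  by rewrite ler_wpM2l // divr_ge0 // !mulr_ge0 ?(ltW C30) ?(ltW kap0).
have : S / (6 * C3) <= ((2 * e + 2) * 2 / c1 + N / (12 * C3) + 2 / (12 * C3 * kap) + 4 * N / c1) * z ^+ 2.
  rewrite !(mulrDl _ _ (z ^+ 2)); move: main2 b1 b2 b3; rewrite E4.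
  have -> : 2 * (z * (e * T)) + c1 * (12 * C3)^-1 * (g0 + T / kap) + 2 * (z * T)
     + 4 * (c1^-1 * N + (4^-1 * (12 * C3)^-1) * S) = (2 * (z * (e * T)) + 2 * (z * T)) +
      (c1 * (12 * C3)^-1 * (g0 + T / kap)) + (4 * (c1^-1 * N + (4^-1 * (12 * C3)^-1) * S)) by ring.
  rewrite E1 E2 E3.
  move: (S / (12 * C3)) (S / (6 * C3)) (N / (12 * C3)) (2 / (12 * C3 * kap)) (4 * N / c1) ((2 * e + 2) * 2 / c1) => *; lra.
rewrite ler_pdivrMr ?mulr_gt0 // => h; move: small; rewrite ltNge => /negP; apply.
by apply: (le_trans h); rewrite le_eqVlt; apply/orP; left; apply/eqP; ring.
Qed.

Let shift_arith (c g s kb a b : R) : c * (s + g) <= kb -> a * s <= b * s ->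
  c * g + (c + a) * s <= kb + b * s.
Proof. by move=> *; lra. Qed.
Let shift_arith2 (k C2 g s r q : R) : k <= C2 * (s + g) -> q * s <= r * s -> 0 <= r * g ->
  k + q * s <= (C2 + r) * g + (C2 + r) * s.
Proof. by move=> *; lra. Qed.
Let half_arith (x y : R) : x <= 4 * y -> x / 2 <= 2 * y. Proof. by move=> *; lra. Qed.

(** The density inequality with the traces of the inverses of K and G comparable: the
    density at t behaves like sqrt (M / t), so that it decreases by the factor sqrt k
    between the scales rho^2 and k rho^2, while the trace of B is only logarithmic in
    M. For k and then M large this contradicts density_inequality, unless there is a
    root in the disc of radius Y. *)
Lemma bounded_root (kap w c c1 C2 N A : R) : 0 < kap -> 0 <= w -> 0 <= c -> 0 < c1 -> 0 < C2 ->
  0 <= N -> 0 <= A -> exists (Y : R) (M0 : nat), 0 < Y /\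
  forall (M n : nat) (K L B G U : 'M[C]_n) (d : 'rV[R]_n), (M0 <= M)%N -> (0 < n)%N ->
    n%:R <= A * M%:R -> herm K -> herm L -> herm B ->
    (forall x, kap * sqn x <= qf K x) -> (forall x, sqn (L *m x) <= qf K x) ->
    (forall x, `|qf L x| <= w * sqn x + c * qf B x) ->
    (forall x, 0 <= qf B x) -> (forall x, qf B x <= A * M%:R * sqn x) ->
    (forall x, c1 * (sqn x + qf G x) <= qf K x + qf B x) ->
    (forall x, qf K x <= C2 * (sqn x + qf G x)) -> herm G ->
    U^t* *m U = 1%:M -> U^t* *m G *m U = cdiag d -> (forall i, 0 <= d 0 i) ->
    \sum_i qf B (U *m delta_mx i 0) / (d 0 i + 1) <= 2 * ln (1 + A * M%:R ^+ 3) ->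
    (forall t, 0 < t -> \sum_i (d 0 i + t)^-1 <= N / t + Num.sqrt M%:R * (Num.sqrt t)^-1) ->
    Num.sqrt M%:R <= 3 * \sum_i (d 0 i + 1)^-1 ->
  exists2 z, normc z <= Y & \det (hpencil L K z) = 0.
Proof.
move=> kap0 w0 c0 c10 C20 N0 A0.
pose rho1 := 4 * w + 1.
have r1 : 1 <= rho1 by rewrite lerDr mulr_ge0.
have r0 : 0 < rho1 by exact: lt_le_trans r1.
pose C3 := C2 + 2 * rho1 ^+ 2.
have C30 : 0 < C3 by rewrite ltr_wpDr // mulr_ge0 ?sqr_ge0.
have [k [Y [k1 Y1 hk [hk1 hk2 hk3]]]] := big_parameters kap0 c10 C30 r1.
have Y0 : 0 < Y by exact: lt_le_trans Y1.
have k0 : 0 < k by exact: lt_le_trans k1.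
pose e := 4 * rho1 * c + 1.
have e0 : 0 <= e by rewrite addr_ge0 // !mulr_ge0 // ltW.
pose A' := e * (4 * A ^+ 3) + A / kap + A.
have A3 : 0 <= e * (4 * A ^+ 3) by rewrite !mulr_ge0 ?exprn_ge0.
have Ak : 0 <= A / kap by rewrite divr_ge0 // ltW.
have A'0 : 0 <= A' by rewrite !addr_ge0.
pose D := 6 * C3 * ((2 * e + 2) * 2 / c1 + N / (12 * C3) + 2 / (12 * C3 * kap) + 4 * N / c1).
have D0 : 0 <= D.
  by rewrite /D; nneg.
have [M0 hM0] := log_square_small A'0 D0.
exists Y, M0.+1; split => // M n K L B G U d MM n0 nA hK hL hB kK LK Lw B0 Bb cK KC hG UU hU d0 hT hg hs.
apply: contrapT => no.
have M1 : 1 <= M%:R :> R by rewrite ler1n; apply: leq_ltn_trans MM.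
have M3 : M%:R <= M%:R ^+ 3 :> R by rewrite -[leLHS]expr1 ler_weXn2l.
have np : 0 < n%:R :> R by rewrite ltr0n.
have [rho [hr1 hr2 hp hm]] := shift_lower hL n0 r0.
set ep := (rho1 / (2 * n%:R)) ^+ 2 in hp hm.
have ep0 : 0 < ep by rewrite exprn_gt0 // divr_gt0 ?mulr_gt0.
have rho0 : 0 < rho by exact: lt_le_trans hr1.
have rho1' : 1 <= rho by exact: le_trans hr1.
set z := 1 + ln (1 + A' * M%:R ^+ 3).
have m30 : 0 <= M%:R ^+ 3 :> R by rewrite exprn_ge0 ?ler0n.
have z1 : 1 <= z by rewrite lerDl ln_ge0 // lerDl mulr_ge0.
have lnz (x : R) : 0 <= x -> x <= A' * M%:R ^+ 3 -> 1 + ln (1 + x) <= z.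
  move=> x0 xl; rewrite lerD2l ler_ln ?posrE ?lerD2l //.
    by rewrite ltr_wpDr.
  by rewrite ltr_wpDr // mulr_ge0.
set T : R := c1^-1 * (2 * z).
set Sq := Num.sqrt M%:R : R.
pose e1 := 2 * rho * c + 1.
have e10 : 0 <= e1 by rewrite addr_ge0 // !mulr_ge0 // ltW.
have e1e : e1 <= e.
  by rewrite lerD2r ler_wpM2r //; lra.
set b := A * M%:R.
have b0 : 0 <= b by rewrite mulr_ge0 ?ler0n.
have zz1 : 1 + ln (1 + e1 * b / ep) <= z.
  apply: lnz; first nneg.
  rewrite ler_pdivrMr //.
  apply: (@le_trans _ _ (e * (4 * A ^+ 3) * M%:R ^+ 3 * ep)); last first.
    by rewrite ler_wpM2r ?(ltW ep0) // ler_wpM2r // /A' -addrA lerDl addr_ge0.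
  have nn : 1 <= (2 * (A * M%:R)) ^+ 2 * ep.
    rewrite /ep -exprMn; apply: exprn_ege1.
    have -> : 2 * (A * M%:R) * (rho1 / (2 * n%:R)) = A * M%:R * rho1 / n%:R by field; rewrite gt_eqF.
    by rewrite ler_pdivlMr // mul1r -[leLHS]mulr1 ler_pM ?ler0n.
  rewrite (_ : e * (4 * A ^+ 3) * M%:R ^+ 3 * ep = (e * b) * ((2 * (A * M%:R)) ^+ 2 * ep)); last by rewrite /b; ring.
  apply: (@le_trans _ _ (e * b)); first by rewrite ler_wpM2r.
  by rewrite ler_peMr // mulr_ge0.
have zz2 : 1 + ln (1 + b / kap) <= z.
  apply: lnz; first nneg.
  apply: (@le_trans _ _ (A / kap * M%:R ^+ 3)).
    by rewrite /b mulrAC ler_wpM2l.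
  by rewrite ler_wpM2r // /A' -addrA addrCA lerDl addr_ge0.
have UE i : sqn (U *m delta_mx i 0) = 1 by exact: qf_unit_col.
have G0 x : 0 <= qf G x.
  have -> : x = U *m (U^t* *m x) by rewrite mulmxA (mulmx1C UU) mul1mx.
  by rewrite -qf_conj hU qf_cdiag sumr_ge0 // => i _; rewrite mulr_ge0 ?sqr_ge0.
have posG (x y : R) : 0 <= x -> 0 < y -> posdef (x%:C *: G + scal n y).
  move=> x0 y0; apply: (posdefP y0); first exact: (hermD (hermZ _ hG) (herm_scal _ _)).
  by move=> v; rewrite qfD qfZ qf_scal lerDr mulr_ge0.
have pK := posdefP kap0 hK kK.
have posK (y : R) : 0 <= y -> posdef (K + scal n y).
  move=> y0; apply: (posdef_le pK) => [|v]; first exact: (hermD hK (herm_scal _ _)).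
  by rewrite qfD qf_scal lerDl mulr_ge0 ?sqn_ge0.
have pKB : posdef (K + B).
  by apply: (posdef_le pK) => [|v]; [exact: hermD|rewrite qfD lerDl].
have one_ge0 x : 0 <= qf (1%:M : 'M[C]_n) x by rewrite qf1 sqn_ge0.
have T1 : trq B (K + B) <= T.
  apply: (le_trans (trq_mono (A' := c1%:C *: G + scal n c1) (posG _ _ (ltW c10) c10) pKB B0 _)).
    by move=> v; rewrite !qfD qfZ qf_scal -mulrDr addrC; exact: cK.
  rewrite (trq_diag _ UU hU c10 (ltW c10) d0).
  rewrite (eq_bigr (fun i => c1^-1 * (qf B (U *m delta_mx i 0) / (d 0 i + 1)))); last first.
    by move=> i _; rewrite -[X in _ / (_ + X)]mulr1 -mulrDr invfM mulrCA.
  rewrite -mulr_sumr ler_wpM2l ?invr_ge0 ?(ltW c10) //; apply: (le_trans hT).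
  rewrite ler_wpM2l //; apply: (@le_trans _ _ (1 + ln (1 + A * M%:R ^+ 3))); first by rewrite lerDr.
  apply: lnz; first by rewrite mulr_ge0.
  by rewrite ler_wpM2r // /A' lerDr addr_ge0.
have tr1 (t : R) (X : 'M[C]_n) : 0 < t -> posdef X -> (forall v, c1 * qf G v + c1 * t * sqn v <= qf X v) ->
    trq 1%:M X <= c1^-1 * \sum_i (d 0 i + t)^-1.
  move=> t0 pX hX; have ct : 0 < c1 * t by rewrite mulr_gt0.
  apply: (le_trans (trq_mono (A' := c1%:C *: G + scal n (c1 * t)) (posG _ _ (ltW c10) ct) pX one_ge0 _)).
    by move=> v; rewrite !qfD qfZ qf_scal; exact: hX.
  rewrite (trq_diag _ UU hU ct (ltW c10) d0) mulr_sumr ler_sum // => i _.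
  by rewrite qf1 UE mul1r -mulrDr invfM.
have g0le : trq 1%:M (K + B) <= c1^-1 * (N + Sq).
  apply: (le_trans (tr1 1 _ ltr01 pKB _)).
    by move=> v; rewrite mulr1 -mulrDr addrC qfD.
  rewrite ler_wpM2l ?invr_ge0 ?(ltW c10) //; apply: (le_trans (hg 1 ltr01)).
  by rewrite sqrtr1 invr1 !mulr1.
set t := 1 + k * rho1 ^+ 2 / c1 in hk1.
have t1 : 1 <= t by rewrite lerDl; nneg.
have t0 : 0 < t by exact: lt_le_trans t1.
have g1le : trq 1%:M (K + B + scal n (k * rho ^+ 2)) <= c1^-1 * N + (4^-1 * (12 * C3)^-1) * Sq.
  have kr0 : 0 <= k * rho ^+ 2 by rewrite mulr_ge0 ?sqr_ge0 ?(ltW k0).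
  apply: (le_trans (tr1 t _ t0 _ _)).
  - apply: (posdef_le pKB) => [|v]; first exact: (hermD (hermD hK hB) (herm_scal _ _)).
    by rewrite [leRHS]qfD qf_scal lerDl mulr_ge0 ?sqn_ge0.
  - move=> v; rewrite !qfD qf_scal.
    have -> : c1 * t = c1 + k * rho1 ^+ 2 by rewrite /t; field; rewrite gt_eqF.
    have rr : k * rho1 ^+ 2 * sqn v <= k * rho ^+ 2 * sqn v.
      by rewrite ler_wpM2r ?sqn_ge0 // ler_pM2l // ler_pXn2r ?nnegrE ?(ltW r0) ?(ltW rho0).
    exact: shift_arith (cK v) rr.
  have -> : c1^-1 * N + (4^-1 * (12 * C3)^-1) * Sq = c1^-1 * (N + c1 * ((4^-1 * (12 * C3)^-1) * Sq)).
    by rewrite (mulrDr c1^-1) (mulKf (lt0r_neq0 c10)).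
  have hx : (Num.sqrt t)^-1 <= c1 * (4^-1 * (12 * C3)^-1).
    have := ler_wpM2l (ltW c10) hk1; rewrite (_ : c1 * (4 * c1^-1 * (Num.sqrt t)^-1) = 4 * (Num.sqrt t)^-1).
      by move=> h; clear -h; lra.
    by rewrite mulrA mulrCA mulfV ?mulr1 // gt_eqF.
  rewrite ler_pM2l ?invr_gt0 //; apply: (le_trans (hg t t0)); apply: lerD.
    by rewrite ler_pdivrMr // ler_peMr.
  by rewrite mulrC mulrA; apply: ler_wpM2r; [exact: sqrtr_ge0 | exact: hx].
have rr2 : rho ^+ 2 <= 4 * rho1 ^+ 2.
  rewrite (_ : 4 * rho1 ^+ 2 = (2 * rho1) ^+ 2); last by ring.
  by rewrite ler_pXn2r ?nnegrE ?(ltW rho0) // mulr_ge0 // ltW.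
have g2le : Sq / (3 * C3) <= trq 1%:M (K + scal n (rho ^+ 2 / 2)).
  have rr0 : 0 <= rho ^+ 2 / 2 by rewrite divr_ge0 ?sqr_ge0.
  apply: le_trans (trq_mono (A := C3%:C *: G + scal n C3) (posK _ rr0) (posG _ _ (ltW C30) C30) one_ge0 _).
    rewrite (trq_diag _ UU hU C30 (ltW C30) d0).
    rewrite (eq_bigr (fun i => C3^-1 * (d 0 i + 1)^-1)); last first.
      by move=> i _; rewrite qf1 UE -[X in _ + X]mulr1 -mulrDr invfM mul1r.
    rewrite -mulr_sumr ler_pdivrMr ?mulr_gt0 //; apply: (le_trans hs).
    by rewrite le_eqVlt; apply/orP; left; apply/eqP; field; rewrite gt_eqF.
  move=> v; rewrite !qfD qfZ !qf_scal.
  apply: (shift_arith2 (KC v)); first by rewrite ler_wpM2r ?sqn_ge0 // half_arith.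
  by rewrite mulr_ge0 // mulr_ge0 ?sqr_ge0.
have kY0 : 0 <= k ^+ 2 * Y^-1 ^+ 2 by rewrite mulr_ge0 ?sqr_ge0.
have sm1 : k ^+ 2 * (rho ^+ 2 * Y^-1 ^+ 2) <= 1 / 8.
  apply: le_trans hk2; have := ler_wpM2r kY0 rr2; congr (_ <= _); ring.
have sm2 : 30 * k ^+ 2 * rho ^+ 2 * Y^-1 ^+ 2 <= c1 * (12 * C3)^-1.
  apply: le_trans hk3; have := ler_wpM2l (ler0n R 30) (ler_wpM2r kY0 rr2).
  congr (_ <= _); ring.
have nr : forall z, normc z < Y^-1^-1 -> \det (hpencil L K z) != 0.
  move=> z' hz'; apply/eqP => h; apply: no; exists z' => //; move: hz'; rewrite invrK; exact: ltW.
have w4 : 4 * w <= rho by apply: le_trans hr1; rewrite lerDl ler01.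
have Y'0 : 0 < Y^-1 by rewrite invr_gt0.
have ln_k := hk rho rho0 hr2.
have hm' x : ep * sqn x <= sqn (rho%:C *: x + L *m x).
  have -> : rho%:C *: x + L *m x = - ((- rho)%:C *: x - L *m x).
    by rewrite rmorphN scaleNr opprB opprK addrC.
  by rewrite sqnN; exact: hm.
have DI := density_inequality n0 hK hL hB kap0 kK LK Lw B0 Bb c0 b0 rho0 w4 ep0 hp hm'
  k1 ln_k T1 g0le g1le g2le Y'0 sm1 nr.
have small := hM0 M (ltnW MM).
exact: (density_numbers kap0 c10 C30 k1 rho1' N0 e10 e1e z1 (erefl T) zz1 zz2 sm2 (erefl _) (lexx _)
  (erefl _) small DI).
Qed.
End BoundedRoot.

(** * Real square integrable functions *)

Section RealL2.
Context d (T : measurableType d) (R : realType) (mu : {measure set T -> \bar R}).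
Implicit Types (f g h : T -> R).

Local Notation l2 f := (f \in Lfun mu 2%:E).
Definition rint f : R := \int[mu]_x f x.
Definition rdot f g : R := rint (f \* g).

Lemma l2_measurable f : l2 f -> measurable_fun setT f.
Proof. by move=> /sub_Lfun_mfun; rewrite inE. Qed.

Lemma l2_sqr f : l2 f -> (\int[mu]_x ((f x) ^+ 2)%:E < +oo)%E.
Proof.
move=> /Lfun2_integrable_sqr /integrableP[_].
by under eq_integral => x _ do rewrite /= ger0_norm ?sqr_ge0 //.
Qed.

Lemma l2P f : measurable_fun setT f -> (\int[mu]_x ((f x) ^+ 2)%:E < +oo)%E -> l2 f.
Proof.
move=> mf fi; rewrite inE; apply/andP; split; first by rewrite inE.
rewrite !inE/= /finite_norm unlock /Lnorm poweR_lty//.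
rewrite (_ : (\int[mu]_x _)%E = (\int[mu]_x ((f x) ^+ 2)%:E)%E) //.
apply: eq_integral => x _.
rewrite /= powR_mulrn // -normrX ger0_norm ?sqr_ge0 //.
Qed.

Lemma l2_integrable f g : l2 f -> l2 g -> mu.-integrable setT (EFin \o (f \* g)).
Proof. by move=> lf lg; apply/Lfun1_integrable; exact: Lfun2_mul_Lfun1. Qed.

Lemma l2_closed : GRing.submod_closed (Lfun mu 2%:E).
Proof. by apply: Lfun_submod_closed; rewrite lee_fin ler1n. Qed.
Lemma l2_lin a f g : l2 f -> l2 g -> l2 (fun x => a * f x + g x).
Proof. by move=> lf lg; exact: (l2_closed.2 a f g lf lg). Qed.
Lemma l2_0 : l2 (fun=> 0 : R).
Proof. exact: l2_closed.1. Qed.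
Lemma l2D f g : l2 f -> l2 g -> l2 (f \+ g).
Proof.
move=> lf lg; rewrite (_ : _ \+ _ = fun x => 1 * f x + g x); first exact: l2_lin.
by apply/funext => x; rewrite mul1r.
Qed.
Lemma l2Z a f : l2 f -> l2 (fun x => a * f x).
Proof.
move=> lf; rewrite (_ : (fun x => _) = fun x => a * f x + 0); first exact: (l2_lin a lf l2_0).
by apply/funext => x; rewrite addr0.
Qed.
Lemma l2N f : l2 f -> l2 (\- f).
Proof.
move=> lf; rewrite (_ : (\- f) = fun x => -1 * f x); first exact: l2Z.
by apply/funext => x; rewrite mulN1r.
Qed.
Lemma l2B f g : l2 f -> l2 g -> l2 (f \- g).
Proof. by move=> lf lg; exact: (l2D lf (l2N lg)). Qed.

Lemma rdotC f g : rdot f g = rdot g f.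
Proof. by apply: eq_Rintegral => x _ /=; rewrite mulrC. Qed.
Lemma rdotDl f g h : l2 f -> l2 g -> l2 h -> rdot (f \+ g) h = rdot f h + rdot g h.
Proof.
move=> lf lg lh; rewrite /rdot /rint -RintegralD //; try exact: l2_integrable.
by apply: eq_Rintegral => x _ /=; rewrite mulrDl.
Qed.
Lemma rdotZl a f h : l2 f -> l2 h -> rdot (fun x => a * f x) h = a * rdot f h.
Proof.
move=> lf lh; rewrite /rdot /rint -RintegralZl //; last exact: l2_integrable.
by apply: eq_Rintegral => x _ /=; rewrite mulrA.
Qed.
Lemma rdot_ge0 f : 0 <= rdot f f.
Proof. by apply: Rintegral_ge0 => x _ /=; rewrite -expr2 sqr_ge0. Qed.

Lemma rdotE f : l2 f -> (rdot f f)%:E = (\int[mu]_x ((f x) ^+ 2)%:E)%E.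
Proof.
move=> lf; rewrite /rdot /rint /Rintegral fineK; last first.
  by apply: integrable_fin_num => //; exact: l2_integrable.
by apply: eq_integral => x _; rewrite /= expr2.
Qed.

Lemma rdot_le f g : l2 f -> l2 g -> (forall x, `|f x| <= `|g x|) -> rdot f f <= rdot g g.
Proof.
move=> lf lg h; rewrite /rdot /rint; apply: le_Rintegral => //; try exact: l2_integrable.
by move=> x _ /=; rewrite -!expr2 -(real_normK (num_real (f x))) -(real_normK (num_real (g x)))
  ler_sqr ?nnegrE ?h.
Qed.

Lemma l2_dom f g : measurable_fun setT f -> l2 g -> (forall x, `|f x| <= `|g x|) -> l2 f.
Proof.
move=> mf lg h; apply: l2P => //; apply: le_lt_trans (l2_sqr lg).
apply: ge0_le_integral => //.
- by move=> x _; rewrite lee_fin sqr_ge0.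
- by apply/measurable_EFinP; exact: measurable_funX.
- by apply/measurable_EFinP; apply: measurable_funX; exact: l2_measurable.
by move=> x _; rewrite lee_fin -(real_normK (num_real (f x))) -(real_normK (num_real (g x)))
  ler_sqr ?nnegrE ?h.
Qed.

Lemma rdot_ae f f' g g' : l2 f -> l2 f' -> l2 g -> l2 g' ->
  {ae mu, forall x, f x = f' x} -> {ae mu, forall x, g x = g' x} -> rdot f g = rdot f' g'.
Proof.
move=> lf lf' lg lg' hf hg; congr fine; apply: ae_eq_integral => //.
- exact: (measurable_int mu (l2_integrable lf lg)).
- exact: (measurable_int mu (l2_integrable lf' lg')).
by apply: filterS2 hf hg => x /= -> -> _.
Qed.

Lemma l2_fatou (h : nat -> T -> R) g (C : R) :
  (forall k, l2 (h k)) -> measurable_fun setT g ->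
  {ae mu, forall x, h ^~ x @ \oo --> g x} ->
  (exists K : nat, forall k, (K <= k)%N -> rdot (h k) (h k) <= C) ->
  l2 g /\ rdot g g <= C.
Proof.
move=> lh mg hg [K hK].
have mh k : measurable_fun setT (fun x => ((h (k + K)%N x) ^+ 2)%:E).
  by apply/measurable_EFinP; apply: measurable_funX; exact: l2_measurable.
have h0 k x : setT x -> (0 <= ((h (k + K)%N x) ^+ 2)%:E)%E.
  by rewrite lee_fin sqr_ge0.
have mlim (u : nat -> T -> \bar R) : (forall k, measurable_fun setT (u k)) ->
    measurable_fun setT (fun x => limn_einf (u ^~ x)).
  move=> mu'; rewrite (_ : (fun x => _) = (fun x => - limn_esup (fun k => - u k x))%E).
    apply: measurableT_comp => //; apply: measurable_fun_limn_esup => k.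
    exact: measurableT_comp.
  apply/funext => x; rewrite -limn_einfN; congr limn_einf.
  by apply/funext => k /=; rewrite oppeK.
have key : (\int[mu]_x ((g x) ^+ 2)%:E <= C%:E)%E.
  rewrite (_ : (\int[mu]_x _)%E =
     (\int[mu]_x limn_einf (fun k => ((h (k + K)%N x) ^+ 2)%:E))%E); last first.
    apply: ge0_ae_eq_integral => //.
    - by apply/measurable_EFinP; exact: measurable_funX.
    - exact: (mlim (fun k x => ((h (k + K)%N x) ^+ 2)%:E) mh).
    - by move=> x _; rewrite lee_fin sqr_ge0.
    - move=> x _; rewrite limn_einf_lim; apply: lime_ge; first exact: is_cvg_einfs.
      by near=> k; apply: le_ereal_inf_tmp => _ [m /= _ <-]; rewrite lee_fin sqr_ge0.
    apply: filterS hg => x hx _.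
    have : (fun k => ((h (k + K)%N x) ^+ 2)%:E) @ \oo --> ((g x) ^+ 2)%:E.
      apply: cvg_EFin; first by near=> k.
      rewrite (_ : _ \o _ = fun k => h (k + K)%N x * h (k + K)%N x); last first.
        by apply/funext => k /=; rewrite expr2.
      by rewrite expr2; apply: cvgM; rewrite (cvg_shiftn K (h ^~ x)).
    by move=> /cvg_limn_einf_sup [-> _].
  apply: (le_trans (fatou mu measurableT mh h0)).
  rewrite limn_einf_lim; apply: lime_le; first exact: is_cvg_einfs.
  near=> k; apply: ge_ereal_inf; exists (\int[mu]_x ((h (k + K)%N x) ^+ 2)%:E)%E.
    by exists k => //=.
  by rewrite -rdotE // lee_fin hK // leq_addl.
have lg : l2 g by apply: l2P => //; apply: (le_lt_trans key); rewrite ltry.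
by split => //; rewrite -lee_fin rdotE.
Unshelve. all: by end_near.
Qed.

(** A subsequence with summable differences converges almost everywhere to some g, and
    the Fatou lemma bounds the distance to g. *)
Lemma riesz_fischer (f : nat -> T -> R) :
  (forall n, l2 (f n)) ->
  (forall e, 0 < e -> exists N : nat, forall m n, (N <= n)%N -> (n <= m)%N ->
     rdot (f m \- f n) (f m \- f n) < e) ->
  exists2 g, l2 g & forall e, 0 < e -> exists N : nat, forall n, (N <= n)%N ->
     rdot (f n \- g) (f n \- g) <= e.
Proof.
move=> lf cf.
have e8 k : 0 < (8^-1 : R) ^+ k by rewrite exprn_gt0 // invr_gt0.
have [N hN] := choice (fun k => cf _ (e8 k)).
pose phi k := (\sum_(i < k.+1) N i + k)%N.
have phiN k : (N k <= phi k)%N by rewrite /phi big_ord_recr /= addnAC leq_addl.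
have phiS k : (phi k <= phi k.+1)%N.
  by rewrite /phi (big_ord_recr k.+1) /= leq_add // leq_addr.
have phik k : (k <= phi k)%N by rewrite leq_addl.
pose D k := f (phi k.+1) \- f (phi k).
have lD k : l2 (D k) by exact: l2B.
have hD k : rdot (D k) (D k) < (8^-1) ^+ k by apply: hN.
pose G k x := (4 ^+ k * D k x ^+ 2)%:E.
have mG k : measurable_fun setT (G k).
  apply/measurable_EFinP; apply: measurable_funM => //.
  by apply: measurable_funX; exact: l2_measurable.
have G0 k x : (0 <= G k x)%E by rewrite lee_fin mulr_ge0 ?sqr_ge0 ?exprn_ge0.
have mS : measurable_fun setT (fun x => \sum_(k <oo) G k x)%E.
  by apply: ge0_emeasurable_sum => // k x _ _; exact: G0.
have iS : (\int[mu]_x (\sum_(k <oo) G k x) <= 2%:E)%E.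
  rewrite integral_nneseries //; apply: lime_le.
    apply: is_cvg_nneseries => k _ _; exact: integral_ge0.
  near=> n.
  apply: (@le_trans _ _ (\sum_(0 <= k < n) ((2^-1) ^+ k)%:E)%E).
    apply: lee_sum => k _.
    rewrite (_ : (\int[mu]_x G k x)%E = (4 ^+ k)%:E * (rdot (D k) (D k))%:E)%E.
      rewrite -EFinM lee_fin (_ : 2^-1 = 4 * 8^-1 :> R); last by field.
      by rewrite exprMn ler_wpM2l ?exprn_ge0 // ltW.
    rewrite rdotE // -ge0_integralZl_EFin ?exprn_ge0 //.
    - by move=> x _; rewrite lee_fin sqr_ge0.
    - by apply/measurable_EFinP; apply: measurable_funX; exact: l2_measurable.
  rewrite sumEFin lee_fin.
  suff -> : \sum_(0 <= k < n) (2^-1 : R) ^+ k = 2 - 2 * 2^-1 ^+ n.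
    by rewrite gerBl mulr_ge0 ?exprn_ge0 ?invr_ge0.
  elim: (n) => [|m IH]; first by rewrite big_geq // expr0; ring.
  by rewrite big_nat_recr //= IH exprS; field.
pose Z := [set x | (\sum_(k <oo) G k x)%E \is a fin_num].
have mZ : measurable Z.
  by have := emeasurable_fin_num measurableT mS; rewrite setTI.
have aeZ : {ae mu, forall x, Z x}.
  have iS' : mu.-integrable setT (fun x => \sum_(k <oo) G k x)%E.
    apply/integrableP; split => //.
    rewrite (_ : (\int[mu]_x _)%E = (\int[mu]_x (\sum_(k <oo) G k x))%E).
      by apply: le_lt_trans iS _; rewrite ltry.
    by apply: eq_integral => x _; rewrite gee0_abs // nneseries_ge0.
  by have := integrable_ae measurableT iS'; apply: filterS => x /(_ I).
pose h k x := \1_Z x * f (phi k) x.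
have mh k : measurable_fun setT (h k).
  by apply: measurable_funM; [exact: measurable_indic | exact: l2_measurable].
have cvh x : cvgn (h ^~ x).
  have [xZ|xZ] := pselect (Z x); last first.
    rewrite (_ : h ^~ x = fun=> 0); first exact: is_cvg_cst.
    by apply/funext => k; rewrite /h indicE memNset // mul0r.
  rewrite (_ : h ^~ x = fun k => f (phi k) x); last first.
    by apply/funext => k; rewrite /h indicE mem_set // mul1r.
  pose S := fine (\sum_(k <oo) G k x)%E.
  have S0 : 0 <= S by apply: fine_ge0; exact: nneseries_ge0.
  have GS k : 4 ^+ k * D k x ^+ 2 <= S.
    rewrite -lee_fin fineK // -/(G k x).
    rewrite (@nneseries_split _ _ 0 k.+1) => [|j _]; last exact: G0.
    rewrite add0n big_nat_recr //= [X in (_ <= X + _)%E]addeC -addeA leeDl //.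
    by apply: adde_ge0; [exact: sume_ge0 | exact: nneseries_ge0].
  have DS k : `|D k x| <= Num.sqrt S * (2^-1) ^+ k.
    rewrite -(ler_pXn2r (n := 2)) ?nnegrE ?mulr_ge0 ?sqrtr_ge0 ?exprn_ge0 ?invr_ge0 //.
    rewrite real_normK ?num_real // exprMn sqr_sqrtr // -exprM mulnC exprM.
    rewrite (_ : 2^-1 ^+ 2 = 4^-1 :> R); last by field.
    by rewrite exprVn ler_pdivlMr ?exprn_gt0 // mulrC.
  have sC : cvgn (series (fun k => D k x)).
    apply: normed_cvg.
    apply: (@series_le_cvg _ _ (geometric (Num.sqrt S) (2^-1))) => //.
    - by move=> k; rewrite normr_ge0.
    - by move=> k; rewrite /geometric mulr_ge0 ?sqrtr_ge0 ?exprn_ge0 ?invr_ge0.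
    by apply: is_cvg_geometric_series; rewrite ger0_norm ?invr_ge0 // invf_lt1 // ltr1n.
  rewrite (_ : (fun k => _) = (fun k => f (phi 0%N) x + series (fun k => D k x) k)).
    by apply: is_cvgD => //; exact: is_cvg_cst.
  apply/funext; elim => [|k IH]; first by rewrite /series /= big_geq // addr0.
  by rewrite /series /= big_nat_recr //= addrA -[X in X + _]IH /D /=; ring.
pose g x := limn (h ^~ x).
have hg x : h ^~ x @ \oo --> g x by exact: cvh.
have mg : measurable_fun setT g.
  by apply: (@measurable_fun_cvg _ _ _ setT h) => // x _; exact: hg.
have key e n : 0 < e -> (forall m, (n <= m)%N -> rdot (f m \- f n) (f m \- f n) < e) ->
    l2 (f n \- g) /\ rdot (f n \- g) (f n \- g) <= e.
  move=> e0 H; apply: (@l2_fatou (fun k => f n \- f (phi k))).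
  - by move=> k; exact: l2B.
  - by apply: measurable_funB => //; exact: l2_measurable.
  - apply: filterS aeZ => x xZ; apply: cvgB; first exact: cvg_cst.
    have := hg x; rewrite (_ : h ^~ x = fun k => f (phi k) x) //.
    by apply/funext => k; rewrite /h indicE mem_set // mul1r.
  exists n => k nk; rewrite (_ : rdot _ _ = rdot (f (phi k) \- f n) (f (phi k) \- f n)).
    by apply/ltW/H; exact: leq_trans nk (phik k).
  by apply: eq_Rintegral => x _ /=; ring.
exists g.
  have [N1 hN1] := cf 1 ltr01.
  have [lfg _] := key 1 N1 ltr01 (fun m => hN1 m N1 (leqnn _)).
  have := l2B (lf N1) lfg; rewrite (_ : _ \- _ = g) //.
  by apply/funext => x /=; ring.
move=> e e0; have [N1 hN1] := cf e e0; exists N1 => n Nn.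
by apply: (key e n e0 (fun m => hN1 m n Nn)).2.
Unshelve. all: by end_near.
Qed.
End RealL2.

(** * The Hilbert space of spinors *)

Section SpinorSpace.
Context {R : realType}.
Local Notation mu := (@half_line R).
Local Notation spinor := (@spinor R).
Local Notation l2 f := (f \in Lfun mu 2%:E).
Implicit Types (f g : R -> R[i]) (u v w : spinor).

Definition cdot f g : R[i] := cintegral mu setT (fun r => f r * (g r)^*).

Definition rre f : measurableTypeR R -> R := fun r => Re (f r).
Definition rim f : measurableTypeR R -> R := fun r => Im (f r).

Lemma cL2D f g : cL2 f -> cL2 g -> cL2 (fun r => f r + g r).
Proof.
move=> [f1 f2] [g1 g2]; split.
  rewrite (_ : (fun r => _) = rre f \+ rre g); first exact: l2D.
  by apply/funext => r; rewrite /= cReD.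
rewrite (_ : (fun r => _) = rim f \+ rim g); first exact: l2D.
by apply/funext => r; rewrite /= cImD.
Qed.

Lemma cL2Z (a : R[i]) f : cL2 f -> cL2 (fun r => a * f r).
Proof.
move=> [f1 f2]; split.
  rewrite (_ : (fun r => _) = (fun r => Re a * rre f r) \+ (fun r => (- Im a) * rim f r)).
    by apply: l2D; exact: l2Z.
  by apply/funext => r; rewrite /= cReM mulNr.
rewrite (_ : (fun r => _) = (fun r => Re a * rim f r) \+ (fun r => Im a * rre f r)).
  by apply: l2D; exact: l2Z.
by apply/funext => r; rewrite /= cImM.
Qed.

Lemma cL20 : cL2 (fun=> 0 : R[i]).
Proof. by split; exact: l2_0. Qed.

Lemma cL2R (h : R -> R) : l2 h -> cL2 (fun r => (h r)%:C).
Proof. by move=> lh; split => //; exact: l2_0. Qed.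

Lemma cdotE f g : cL2 f -> cL2 g -> cdot f g =
  (rdot mu (rre f) (rre g) + rdot mu (rim f) (rim g)) +i*
  (rdot mu (rim f) (rre g) - rdot mu (rre f) (rim g)).
Proof.
move=> [f1 f2] [g1 g2]; rewrite /cdot /cintegral; congr (_ +i* _).
  rewrite /rdot /rint -RintegralD //; try exact: l2_integrable.
  by apply: eq_Rintegral => r _; rewrite cReM cReJ cImJ /= mulrN opprK.
rewrite /rdot /rint -RintegralB //; try exact: l2_integrable.
by apply: eq_Rintegral => r _; rewrite cImM cReJ cImJ /= mulrN addrC.
Qed.

Lemma cdot_int f g : cL2 f -> cL2 g ->
  mu.-integrable setT (EFin \o (fun r => Re (f r * (g r)^*))) /\
  mu.-integrable setT (EFin \o (fun r => Im (f r * (g r)^*))).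
Proof.
move=> [f1 f2] [g1 g2]; split.
  rewrite (_ : _ \o _ = (EFin \o (rre f \* rre g)%R) \+ (EFin \o (rim f \* rim g)%R))%E.
    by apply: integrableD => //; exact: l2_integrable.
  by apply/funext => r; rewrite /= -EFinD cReM cReJ cImJ mulrN opprK.
rewrite (_ : _ \o _ = (EFin \o (rim f \* rre g)%R) \- (EFin \o (rre f \* rim g)%R))%E.
  by apply: integrableB => //; exact: l2_integrable.
by apply/funext => r; rewrite /= -EFinB cImM cReJ cImJ mulrN addrC.
Qed.

Lemma innerE u v : L2 u -> L2 v -> inner u v = cdot u.1 v.1 + cdot u.2 v.2.
Proof.
move=> [u1 u2] [v1 v2]; rewrite /inner /cdot /cintegral.
have [a1 a2] := cdot_int u1 v1; have [b1 b2] := cdot_int u2 v2.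
apply: complexP; rewrite ?cReD ?cImD /= -RintegralD //.
  by apply: eq_Rintegral => r _; rewrite cReD.
by apply: eq_Rintegral => r _; rewrite cImD.
Qed.

Lemma cdotDl f g h : cL2 f -> cL2 g -> cL2 h ->
  cdot (fun r => f r + g r) h = cdot f h + cdot g h.
Proof.
move=> lf lg lh; rewrite !cdotE //; last exact: cL2D.
rewrite (_ : rre _ = rre f \+ rre g); last by apply/funext => r; rewrite /rre /= cReD.
rewrite (_ : rim _ = rim f \+ rim g); last by apply/funext => r; rewrite /rim /= cImD.
move: lf lg lh => [f1 f2] [g1 g2] [h1 h2].
by rewrite !rdotDl //; apply: complexP => /=; ring.
Qed.

Lemma cdotZl a f h : cL2 f -> cL2 h -> cdot (fun r => a * f r) h = a * cdot f h.
Proof.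
move=> lf lh; rewrite !cdotE //; last exact: cL2Z.
rewrite (_ : rre (fun r => a * f r) = (fun r => Re a * rre f r) \+ (fun r => (- Im a) * rim f r)); last first.
  by apply/funext => r; rewrite /rre /= cReM mulNr.
rewrite (_ : rim (fun r => a * f r) = (fun r => Re a * rim f r) \+ (fun r => Im a * rre f r)); last first.
  by apply/funext => r; rewrite /rim /= cImM.
move: lf lh => [f1 f2] [h1 h2].
rewrite !rdotDl //; try exact: l2Z.
by rewrite !rdotZl //; apply: complexP; rewrite ?cReM ?cImM /=; ring.
Qed.

Lemma cdotC f g : cL2 f -> cL2 g -> cdot g f = (cdot f g)^*.
Proof.
move=> lf lg; rewrite !cdotE //; apply: complexP; rewrite ?cReJ ?cImJ /=.
  by rewrite (rdotC mu (rre g)) (rdotC mu (rim g) (rim f)).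
by rewrite (rdotC mu (rim g) (rre f)) (rdotC mu (rre g) (rim f)); ring.
Qed.

Lemma cdot_ge0 f : cL2 f -> 0 <= Re (cdot f f).
Proof. by move=> lf; rewrite cdotE //= addr_ge0 ?rdot_ge0. Qed.

Definition L2pred : {pred spinor} := mem [set u : spinor | L2 u].

Lemma L2_submod : GRing.submod_closed L2pred.
Proof.
split; first by rewrite inE; split; exact: cL20.
move=> a u v; rewrite !inE => -[u1 u2] [v1 v2].
by split; apply: cL2D => //; exact: cL2Z.
Qed.
HB.instance Definition _ := GRing.isSubmodClosed.Build _ _ L2pred L2_submod.

(** Square integrable spinors, with functions not identified when equal almost
    everywhere: the scalar product is only semidefinite, and values at points keep
    their meaning. *)
Record hs := Hs { hval :> spinor ; _ : hval \in L2pred }.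
HB.instance Definition _ := [isSub for hval].
HB.instance Definition _ := [Choice of hs by <:].
HB.instance Definition _ := [SubChoice_isSubLmodule of hs by <:].

Lemma hsP (u : hs) : L2 (hval u).
Proof. by case: u => u /=; rewrite inE. Qed.
Definition mkhs u (lu : L2 u) : hs := Hs (mem_set lu).

Definition hip (u v : hs) : R[i] := inner (hval u) (hval v).

Lemma hvalD (u v : hs) : hval (u + v) = hval u + hval v. Proof. by []. Qed.
Lemma hvalB (u v : hs) : hval (u - v) = hval u - hval v. Proof. by []. Qed.
Lemma hvalZ a (u : hs) : hval (a *: u) = a *: hval u. Proof. by []. Qed.
Lemma hval_sum I r (P : pred I) (F : I -> hs) :
  hval (\sum_(i <- r | P i) F i) = \sum_(i <- r | P i) hval (F i).
Proof. exact: (big_morph hval hvalD erefl). Qed.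

Lemma hval1Z a (u : hs) : (hval (a *: u)).1 = fun r => a * (hval u).1 r.
Proof. by rewrite hvalZ. Qed.
Lemma hval2Z a (u : hs) : (hval (a *: u)).2 = fun r => a * (hval u).2 r.
Proof. by rewrite hvalZ. Qed.
Lemma hval1D (u v : hs) : (hval (u + v)).1 = fun r => (hval u).1 r + (hval v).1 r.
Proof. by rewrite hvalD. Qed.
Lemma hval2D (u v : hs) : (hval (u + v)).2 = fun r => (hval u).2 r + (hval v).2 r.
Proof. by rewrite hvalD. Qed.

Lemma form_hip : is_form hip.
Proof.
split.
- move=> u v w; have [[u1 u2] [v1 v2] [w1 w2]] := And3 (hsP u) (hsP v) (hsP w).
  rewrite /hip !innerE //; try exact: hsP.
  by rewrite hval1D hval2D !cdotDl //; exact: addrACA.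
- move=> a u w; have [[u1 u2] [w1 w2]] := conj (hsP u) (hsP w).
  rewrite /hip !innerE //; try exact: hsP.
  by rewrite hval1Z hval2Z !cdotZl // mulrDr.
- move=> u w; have [[u1 u2] [w1 w2]] := conj (hsP u) (hsP w).
  rewrite /hip !innerE //; try exact: hsP.
  by rewrite rmorphD /= (cdotC u1) // (cdotC u2).
move=> u; have [u1 u2] := hsP u.
by rewrite /hip innerE //; try (split => //); rewrite cReD addr_ge0 ?cdot_ge0.
Qed.

Lemma nrm_hnorm (u : hs) : nrm hip u = hnorm (hval u). Proof. by []. Qed.

Lemma nrm2E (u : hs) : nrm2 hip u =
  rdot mu (rre (hval u).1) (rre (hval u).1) + rdot mu (rim (hval u).1) (rim (hval u).1) +
  (rdot mu (rre (hval u).2) (rre (hval u).2) + rdot mu (rim (hval u).2) (rim (hval u).2)).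
Proof. by have [u1 u2] := hsP u; rewrite /nrm2 /hip innerE // cReD !cdotE. Qed.

Lemma complete_hip : complete_form hip.
Proof.
move=> u cu.
have H (p : hs -> measurableTypeR R -> R) :
    (forall v : hs, l2 (p v)) -> (forall v w : hs, p (v - w) = p v \- p w) ->
    (forall v : hs, rdot mu (p v) (p v) <= nrm2 hip v) ->
    exists2 g, l2 g & forall e, 0 < e -> exists N : nat, forall n, (N <= n)%N ->
       rdot mu (p (u n) \- g) (p (u n) \- g) <= e.
  move=> lp pB pn; apply: riesz_fischer => // e e0.
  have se : 0 < Num.sqrt e by rewrite sqrtr_gt0.
  have [N hN] := cu _ se; exists N => m n Nn nm.
  rewrite -pB; apply: (le_lt_trans (pn _)).
  by have := hN m n Nn nm; rewrite /nrm ltr_sqrt.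
have nn (a b c e : R) : 0 <= a -> 0 <= b -> 0 <= c -> 0 <= e ->
    [/\ a <= a + b + (c + e), b <= a + b + (c + e), c <= a + b + (c + e)
      & e <= a + b + (c + e)] by move=> *; split; lra.
have nl (v : hs) := nn _ _ _ _ (rdot_ge0 mu (rre (hval v).1)) (rdot_ge0 mu (rim (hval v).1))
  (rdot_ge0 mu (rre (hval v).2)) (rdot_ge0 mu (rim (hval v).2)).
have [|||g1 lg1 h1] := H (fun v : hs => rre (hval v).1).
- by move=> v; case: (hsP v) => -[].
- by move=> v w; apply/funext => r; rewrite /rre /= cReD cReN.
- by move=> v; rewrite nrm2E; case: (nl v).
have [|||g2 lg2 h2] := H (fun v : hs => rim (hval v).1).
- by move=> v; case: (hsP v) => -[].
- by move=> v w; apply/funext => r; rewrite /rim /= cImD cImN.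
- by move=> v; rewrite nrm2E; case: (nl v).
have [|||g3 lg3 h3] := H (fun v : hs => rre (hval v).2).
- by move=> v; case: (hsP v) => _ [].
- by move=> v w; apply/funext => r; rewrite /rre /= cReD cReN.
- by move=> v; rewrite nrm2E; case: (nl v).
have [|||g4 lg4 h4] := H (fun v : hs => rim (hval v).2).
- by move=> v; case: (hsP v) => _ [].
- by move=> v w; apply/funext => r; rewrite /rim /= cImD cImN.
- by move=> v; rewrite nrm2E; case: (nl v).
have lg : L2 ((fun r => g1 r +i* g2 r), (fun r => g3 r +i* g4 r)) by split; split.
exists (mkhs lg) => e e0.
have e8 : 0 < e ^+ 2 / 8 by rewrite divr_gt0 ?exprn_gt0.
have [[N1 k1] [N2 k2] [N3 k3] [N4 k4]] := And4 (h1 _ e8) (h2 _ e8) (h3 _ e8) (h4 _ e8).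
exists (N1 + N2 + N3 + N4)%N => n Nn.
have [n1 n2 n3 n4] : [/\ (N1 <= n)%N, (N2 <= n)%N, (N3 <= n)%N & (N4 <= n)%N].
  by clear -Nn; split; lia.
have {}k1 := k1 n n1; have {}k2 := k2 n n2; have {}k3 := k3 n n3; have {}k4 := k4 n n4.
rewrite -(ltr_pXn2r (n := 2)) ?nnegrE ?sqrtr_ge0 ?(ltW e0) //.
rewrite /nrm sqr_sqrtr ?(form_ge0 form_hip) // nrm2E.
have E1 : rre (hval (u n - mkhs lg)).1 = rre (hval (u n)).1 \- g1.
  by apply/funext => r; rewrite /rre /= cReD cReN.
have E2 : rim (hval (u n - mkhs lg)).1 = rim (hval (u n)).1 \- g2.
  by apply/funext => r; rewrite /rim /= cImD cImN.
have E3 : rre (hval (u n - mkhs lg)).2 = rre (hval (u n)).2 \- g3.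
  by apply/funext => r; rewrite /rre /= cReD cReN.
have E4 : rim (hval (u n - mkhs lg)).2 = rim (hval (u n)).2 \- g4.
  by apply/funext => r; rewrite /rim /= cImD cImN.
by rewrite E1 E2 E3 E4; move: k1 k2 k3 k4 e8; lra.
Qed.

Definition hrel (T : @operator R) (u w : hs) : Prop := T (hval u) (hval w).

End SpinorSpace.

(** * Integration on the half line *)

Section HalfLine.
Context {R : realType}.
Local Notation mu := (@half_line R).
Local Notation leb := (@lebesgue_measure R).
Local Notation l2 f := (f \in Lfun mu 2%:E).
Local Notation D := (`]0%R, +oo[%classic : set (measurableTypeR R)).

Lemma mD : measurable D. Proof. exact: measurable_itv. Qed.

Lemma half_lineC : mu (~` D) = 0%E.
Proof. by rewrite /half_line /= /mrestr setICl measure0. Qed.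

Lemma ae_half_line (P : R -> Prop) : (forall r, 0 < r -> P r) -> {ae mu, forall r, P r}.
Proof.
move=> h; exists (~` D); split; [exact: measurableC mD|exact: half_lineC|].
move=> r /= nP Dr; apply: nP; apply: h.
by move: Dr; rewrite in_itv /= andbT.
Qed.

Lemma integral_half_line (f : measurableTypeR R -> \bar R) : measurable_fun setT f ->
  (\int[mu]_x f x = \int[leb]_(x in D) f x)%E.
Proof.
move=> mf; have mD := mD.
rewrite (@eq_measure_integral _ _ _ D mu leb f); last first.
  by move=> A mA AD; rewrite /half_line /= /mrestr setIidl.
rewrite [RHS]integral_mkcond; apply: ae_eq_integral => //.
  by apply/(measurable_restrictT _ mD); exact: measurable_funTS.
have := @ae_half_line (fun r => setT r -> f r = (f \_ D) r); apply => r r0 _.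
by rewrite patchE mem_set //= in_itv /= r0.
Qed.

Lemma half_line_FTC_ge0 (f F : R -> R) (l : R) :
  continuous f -> (forall x : R, is_derive x 1 F (f x)) -> (forall x, 0 <= x -> 0 <= f x) ->
  F x @[x --> +oo] --> l -> (\int[mu]_x (f x)%:E = (l - F 0)%:E)%E.
Proof.
move=> cf dF f0 Fl.
have mf : measurable_fun setT f by exact: continuous_measurable_fun.
rewrite integral_half_line; last exact/measurable_EFinP.
rewrite integral_itv_obnd_cbnd; last first.
  by apply/measurable_EFinP; exact: measurable_funTS.
have dF' x : derivable F x 1 by have := dF x.
have cF x : {for x, continuous F}.
  by apply: differentiable_continuous; apply/derivable1_diffP.
rewrite (@ge0_continuous_FTC2y _ f F 0 l) //.
- exact: continuous_subspaceT.
- by apply: cvg_at_right_filter; exact: cF.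
by move=> x _; rewrite derive1E (derive_val (is_derive := dF x)).
Qed.

Lemma cvg_expN (C : R) : C * expR (- x) @[x --> +oo] --> 0.
Proof. by rewrite -(mulr0 C); apply: cvgM; [exact: cvg_cst | exact: cvgr_expR]. Qed.

Lemma is_derive_expN (C x : R) : is_derive x (1 : R) (fun x => C * expR (- x)) (- (C * expR (- x))).
Proof. by apply: is_derive_eq; rewrite /GRing.scale /=; ring. Qed.

Lemma continuous_expN (C : R) : continuous (fun x => C * expR (- x)).
Proof.
move=> x; apply: differentiable_continuous; apply/derivable1_diffP.
by have := is_derive_expN C x.
Qed.

Lemma expN_FTC (C : R) : 0 <= C -> (\int[mu]_x (C * expR (- x))%:E = C%:E)%E.
Proof.
move=> C0; have dF (x : R) : is_derive x (1 : R) (fun x => - C * expR (- x)) (C * expR (- x)).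
  by have := is_derive_expN (- C) x; rewrite mulNr opprK.
have f0 (x : R) : 0 <= x -> 0 <= C * expR (- x) by move=> _; rewrite mulr_ge0 // expR_ge0.
rewrite (half_line_FTC_ge0 (@continuous_expN C) dF f0 (@cvg_expN (- C))).
by rewrite oppr0 expR0; congr (_%:E); ring.
Qed.

Lemma expN_int (C : R) : 0 <= C -> mu.-integrable setT (EFin \o (fun x => C * expR (- x))).
Proof.
move=> C0; apply/integrableP; split.
  by apply/measurable_EFinP; exact: continuous_measurable_fun (@continuous_expN C).
under eq_integral => x _ do rewrite /= ger0_norm ?mulr_ge0 ?expR_ge0 //.
by rewrite expN_FTC // ltry.
Qed.

Lemma dom_integrable (f : R -> R) (g : R -> R) : measurable_fun setT (f : measurableTypeR R -> R) ->
  mu.-integrable setT (EFin \o g) -> (forall x, 0 < x -> `|f x| <= g x) ->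
  mu.-integrable setT (EFin \o f).
Proof.
move=> mf ig h; have /integrableP[/measurable_EFinP mg gi] := ig.
apply/integrableP; split; first exact/measurable_EFinP.
apply: le_lt_trans gi.
apply: ae_ge0_le_integral => //.
- by apply: measurableT_comp => //; exact/measurable_EFinP.
- by apply: measurableT_comp => //; exact/measurable_EFinP.
have := @ae_half_line (fun x => setT x -> (`|(EFin \o f) x| <= `|(EFin \o g) x|)%E).
by apply => r /h fg _; rewrite /= lee_fin (le_trans fg) // ler_norm.
Qed.

(** Adding C exp(-x) makes f nonnegative. *)
Lemma half_line_FTC (f F : R -> R) (C : R) :
  continuous f -> (forall x : R, is_derive x 1 F (f x)) ->
  (forall x, 0 <= x -> `|f x| <= C * expR (- x)) ->
  (forall x, 0 <= x -> `|F x| <= C * expR (- x)) ->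
  mu.-integrable setT (EFin \o f) /\ rint mu f = - F 0.
Proof.
move=> cf dF hf hF.
have C0 : 0 <= C by have := hf 0 (lexx _); rewrite oppr0 expR0 mulr1; exact: le_trans.
have mf : measurable_fun setT (f : measurableTypeR R -> R) by exact: continuous_measurable_fun.
have intf : mu.-integrable setT (EFin \o f).
  by apply: (dom_integrable mf (expN_int C0)) => x /ltW; exact: hf.
split=> //.
have Fl : F x @[x --> +oo] --> 0.
  apply: (@squeeze_cvgr _ _ _ _ (fun x => - (C * expR (- x))) (fun x => C * expR (- x))).
  - near=> x; rewrite -ler_norml; apply: hF.
    by near: x; apply: nbhs_pinfty_ge; rewrite num_real.
  - by rewrite -oppr0; apply: cvgN; exact: cvg_expN.
  - exact: cvg_expN.
have key : (\int[mu]_x (f x + C * expR (- x))%:E = (0 - (F 0 - C * expR (- 0)))%:E)%E.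
  apply: (@half_line_FTC_ge0 _ (fun x => F x - C * expR (- x))).
  - by move=> x; apply: cvgD; [exact: cf|exact: continuous_expN].
  - move=> x; have h1 := dF x; have h2 := is_derive_expN C x.
    by apply: is_derive_eq; rewrite opprK.
  - move=> x x0; have := hf x x0; rewrite ler_norml => /andP[+ _].
    by rewrite -subr_ge0 opprK addrC.
  by rewrite -(subr0 0); apply: cvgB => //; exact: cvg_expN.
have e : rint mu f + rint mu (fun x => C * expR (- x)) = - F 0 + C.
  rewrite /rint -RintegralD //; last exact: expN_int.
  by rewrite /Rintegral key /= oppr0 expR0; ring.
have eC : rint mu (fun x => C * expR (- x)) = C by rewrite /rint /Rintegral expN_FTC.
by apply: (addIr C); rewrite -{1}eC.
Unshelve. all: by end_near.
Qed.

(** All functions of the Hermite basis, their derivatives and products are of this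
    form, so that integration and differentiation become polynomial algebra. *)
Definition gw (a : R) (p : {poly R}) (r : R) : R := p.[r] * expR (- (a * r ^+ 2)).

Lemma gwD a p q : gw a (p + q) = gw a p \+ gw a q.
Proof. by apply/funext => r; rewrite /gw hornerD mulrDl. Qed.
Lemma gwB a p q : gw a (p - q) = gw a p \- gw a q.
Proof. by apply/funext => r; rewrite /gw hornerD hornerN mulrBl. Qed.
Lemma gwZ a c p : gw a (c *: p) = (fun r => c * gw a p r).
Proof. by apply/funext => r; rewrite /gw hornerZ mulrA. Qed.

Lemma is_derive_gw a p (x : R) : is_derive x 1 (gw a p) (gw a (p^`() - (2 * a) *: ('X * p)) x).
Proof.
have h1 := is_derive_poly p x.
have h2 : is_derive x 1 (fun r => expR (- (a * r ^+ 2)))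
     (- (2 * a) * x * expR (- (a * x ^+ 2))).
  have h3 : is_derive x 1 (fun r : R => - (a * r ^+ 2)) (- (a * (2 * x))).
    by apply: is_derive_eq; rewrite /GRing.scale /=; ring.
  have := @is_derive1_comp _ expR (fun r : R => - (a * r ^+ 2)) x _ _ (is_derive_expR _) h3.
  by move=> h; apply: is_derive_eq; rewrite /GRing.scale /=; ring.
have h4 := @is_deriveM _ _ (horner p) (fun r => expR (- (a * r ^+ 2))) x 1 _ _ h1 h2.
apply: is_derive_eq; rewrite /gw hornerD hornerN hornerZ hornerM hornerX /GRing.scale /=.
ring.
Qed.

Lemma continuous_gw a p : continuous (gw a p).
Proof.
move=> x; apply: differentiable_continuous; apply/derivable1_diffP.
by have := is_derive_gw a p x.
Qed.

Lemma measurable_gw a p : measurable_fun setT (gw a p : measurableTypeR R -> R).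
Proof. exact: continuous_measurable_fun (@continuous_gw a p). Qed.

Lemma gwM a b p q r : gw a p r * gw b q r = gw (a + b) (p * q) r.
Proof.
rewrite /gw hornerM mulrACA -expRD; congr (_ * expR _); ring.
Qed.

Lemma poly_exp_bound (p : {poly R}) :
  exists2 C, 0 <= C & forall r, 0 <= r -> `|p.[r]| <= C * expR r.
Proof.
elim/poly_ind: p => [|p c _].
  by exists 0 => // r _; rewrite horner0 normr0 mul0r.
move: (p * 'X + c%:P) => {p c} p.
exists (\sum_(i < size p) (`|p`_i| * i`!%:R)); first by apply: sumr_ge0 => i _; rewrite mulr_ge0.
move=> r r0; rewrite horner_coef (le_trans (ler_norm_sum _ _ _)) // mulr_suml ler_sum // => i _.
rewrite normrM -mulrA ler_wpM2l // ger0_norm ?exprn_ge0 //.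
have f0 : (0 : R) < i`!%:R by rewrite ltr0n fact_gt0.
move: (nat_of_ord i) f0 => {i} [|i] f0.
  by rewrite expr0 fact0 mul1r -expR0 ler_expR.
rewrite mulrC -ler_pdivrMr //; by apply: le_trans (expR_ge1Dxn i r0); rewrite lerDr.
Qed.

Lemma gw_bound a p : 0 < a ->
  exists2 C, 0 <= C & forall r, 0 <= r -> `|gw a p r| <= C * expR (- r).
Proof.
move=> a0; have [C C0 hC] := poly_exp_bound p.
exists (C * expR (a^-1)); first by rewrite mulr_ge0 ?expR_ge0.
move=> r r0; rewrite normrM (ger0_norm (expR_ge0 _)).
apply: (@le_trans _ _ (C * expR r * expR (a^-1 - 2 * r))).
  apply: ler_pM; [by [] | exact: expR_ge0 | exact: hC |].
  rewrite ler_expR -subr_ge0.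
  rewrite (_ : _ - _ = a * (r - a^-1) ^+ 2); first by rewrite mulr_ge0 ?sqr_ge0 ?(ltW a0).
  by field; rewrite gt_eqF.
rewrite -!mulrA ler_wpM2l // -!expRD ler_expR; lra.
Qed.

Lemma gw_int a p : 0 < a -> mu.-integrable setT (EFin \o gw a p).
Proof.
move=> a0; have [C C0 hC] := gw_bound p a0.
by apply: (dom_integrable (measurable_gw a p) (expN_int C0)) => x /ltW; exact: hC.
Qed.

Lemma gw_FTC a p : 0 < a -> rint mu (gw a (p^`() - (2 * a) *: ('X * p))) = - p.[0].
Proof.
move=> a0; set q := _ - _.
have [C C0 hC] := gw_bound p a0; have [C' C0' hC'] := gw_bound q a0.
have [||//|//|_ ->] := @half_line_FTC (gw a q) (gw a p) (C + C').
- exact: continuous_gw.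
- by move=> x; exact: is_derive_gw.
- move=> x x0; apply: (le_trans (hC' x x0)); rewrite ler_wpM2r ?expR_ge0 // lerDr //.
- move=> x x0; apply: (le_trans (hC x x0)); rewrite ler_wpM2r ?expR_ge0 // lerDl //.
by rewrite /gw expr0n mulr0 oppr0 expR0 mulr1.
Qed.

Lemma l2_gw a p : 0 < a -> l2 (gw a p).
Proof.
move=> a0; apply: l2P; first exact: measurable_gw.
have := gw_int (p * p) (addr_gt0 a0 a0) => /integrableP[_].
congr (_ < _)%E; apply: eq_integral => x _.
by rewrite /comp -(gwM a a p p) -expr2 /= ger0_norm ?sqr_ge0.
Qed.

Lemma gw_gauss : rint mu (gw 1 1) = Num.sqrt pi / 2.
Proof.
rewrite /rint /Rintegral integral_half_line; last first.
  by apply/measurable_EFinP; exact: measurable_gw.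
rewrite integral_itv_obnd_cbnd; last first.
  by apply/measurable_EFinP; apply: measurable_funTS; exact: measurable_gw.
have := @integral0y_gauss R; rewrite /gauss_fun => h.
rewrite (_ : (\int[_]_(x in _) _)%E = (Num.sqrt pi / 2)%:E) // -h.
by apply: eq_integral => x _; rewrite /gw hornerC !mul1r.
Qed.

End HalfLine.

(** * Hermite functions *)

Section Hermite.
Context {R : realType}.
Local Notation mu := (@half_line R).
Local Notation l2 f := (f \in Lfun mu 2%:E).
Implicit Types (p q s : {poly R}) (n j k : nat).

Fixpoint Hp n : {poly R} :=
  if n is m.+1 then 2 *: ('X * Hp m) - (Hp m)^`() else 1.

Lemma HpS n : Hp n.+1 = 2 *: ('X * Hp n) - (Hp n)^`(). Proof. by []. Qed.

Lemma deriv_Hp n : (Hp n.+1)^`() = (2 * n.+1%:R) *: Hp n.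
Proof.
elim: n => [|n IH].
  by rewrite /= mulr1 -[X in _ - X^`()]polyC1 derivC subr0 derivZ derivX mulr1.
rewrite HpS derivB derivZ derivM derivX mul1r IH !derivZ.
have -> : 2 * n.+2%:R = 2 * n.+1%:R + 2 :> R by rewrite -[n.+2%:R]natr1; ring.
by rewrite (HpS n) -!mul_polyC polyCD; ring.
Qed.

Lemma Hp_rec n : Hp n.+2 = 2 *: ('X * Hp n.+1) - (2 * n.+1%:R) *: Hp n.
Proof. by rewrite HpS deriv_Hp. Qed.

Lemma Hp_odd0 n : odd n -> (Hp n).[0] = 0.
Proof.
have H m : (Hp m.*2.+1).[0] = 0.
  elim: m => [|m IH].
    by rewrite /= mulr1 -[X in _ - X^`()]polyC1 derivC subr0 hornerZ hornerX mulr0.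
  by rewrite doubleS Hp_rec hornerD hornerN !hornerZ hornerM hornerX IH mul0r !mulr0 subr0.
by move=> no; rewrite -(odd_double_half n) no add1n.
Qed.

Lemma hermiteE n z : hermite n z = (Hp n).[z].
Proof.
have H : derive1n n (fun x : R => expR (- x ^+ 2)) = (fun x => (-1) ^+ n * gw 1 (Hp n) x).
  elim: n => [|n IH].
    by apply/funext => x; rewrite derive1n0 /gw hornerC expr0 !mul1r.
  rewrite derive1nS IH; apply/funext => x.
  have h := is_derive_gw 1 (Hp n) x.
  have h2 : is_derive x (1 : R) (fun x => (-1) ^+ n * gw 1 (Hp n) x)
     ((-1) ^+ n * gw 1 ((Hp n)^`() - (2 * 1) *: ('X * Hp n)) x).
    by apply: is_derive_eq; rewrite /GRing.scale /=; ring.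
  rewrite derive1E (derive_val (is_derive := h2)) exprS mulN1r mulNr mulr1.
  by rewrite -mulrN HpS /gw !hornerD !hornerN; congr (_ * _); ring.
rewrite /hermite H /gw mul1r mulrACA -expr2 -exprM mulnC exprM sqrrN expr1n expr1n mul1r.
by rewrite mulrC -mulrA -expRD addNr expR0 mulr1.
Qed.

Definition gI q := rint mu (gw 1 q).

Lemma gID p q : gI (p + q) = gI p + gI q.
Proof. by rewrite /gI gwD /rint RintegralD //; exact: gw_int. Qed.
Lemma gIZ c p : gI (c *: p) = c * gI p.
Proof. by rewrite /gI gwZ /rint RintegralZl //; exact: gw_int. Qed.
Lemma gIB p q : gI (p - q) = gI p - gI q.
Proof. by rewrite -scaleN1r gID gIZ mulN1r. Qed.
Lemma gI_ibp p : gI (p^`() - 2 *: ('X * p)) = - p.[0].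
Proof. by rewrite -(gw_FTC p ltr01) mulr1. Qed.

Lemma rdot_gw p q : rdot mu (gw 2^-1 p) (gw 2^-1 q) = gI (p * q).
Proof.
apply: eq_Rintegral => x _ /=; rewrite gwM (_ : 2^-1 + 2^-1 = 1) //.
by rewrite -[RHS]mulr1; field.
Qed.

(** Integration by parts. In the orthogonality relations the boundary term vanishes,
    because one of the two factors is odd. *)
Lemma gI_Hp_step j q : gI (Hp j.+1 * q) = (Hp j * q).[0] + gI (Hp j * q^`()).
Proof.
have -> : Hp j.+1 * q = Hp j * q^`() - ((Hp j * q)^`() - 2 *: ('X * (Hp j * q))).
  by rewrite derivM HpS -!mul_polyC; ring.
by rewrite gIB gI_ibp opprK addrC.
Qed.

Lemma gI_Hp0 j : odd j -> gI (Hp j.+1) = 0.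
Proof.
move=> jo; rewrite -(mulr1 (Hp j.+1)) gI_Hp_step -polyC1 derivC mulr0 hornerM Hp_odd0 //.
by rewrite mul0r add0r -(scale0r 0) gIZ mul0r.
Qed.

Lemma gI_Hp j k : odd j = odd k ->
  gI (Hp j * Hp k) = (j == k)%:R * (2 ^+ k * k`!%:R * (Num.sqrt pi / 2)).
Proof.
elim: k j => [|k IH] [|j] //= jk.
- by rewrite mulr1 /gI gw_gauss expr0 fact0; ring.
- by rewrite mulr1 -HpS gI_Hp0 ?mul0r //; move: jk => /negbFE.
- by rewrite mul1r -HpS gI_Hp0 ?mul0r //; move: jk => /esym/negbFE.
rewrite -!HpS gI_Hp_step deriv_Hp.
have jk' : odd j = odd k by apply: negb_inj.
rewrite hornerM (_ : _ * _ = 0) ?add0r; last first.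
  have [jo|je] := boolP (odd j); first by rewrite Hp_odd0 // mul0r.
  by rewrite (@Hp_odd0 k.+1) ?mulr0 //= -jk'.
rewrite -scalerAr gIZ IH // eqSS factS natrM exprS; ring.
Qed.

(** The norm on the half line is the same for both parities. Even functions are needed
    because the derivatives of the odd ones are even. *)
Definition hnc n : R := Num.sqrt (2 ^+ n * n`!%:R * (Num.sqrt pi / 2)).

Lemma hnc_gt0 n : 0 < hnc n.
Proof.
by rewrite sqrtr_gt0 !mulr_gt0 ?exprn_gt0 ?ltr0n ?fact_gt0 ?sqrtr_gt0 ?pi_gt0 ?invr_gt0.
Qed.

Lemma sqr_hnc n : hnc n ^+ 2 = 2 ^+ n * n`!%:R * (Num.sqrt pi / 2).
Proof. by rewrite sqr_sqrtr // !mulr_ge0 ?exprn_ge0 ?sqrtr_ge0 ?invr_ge0. Qed.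

Lemma hncS n : hnc n.+1 = Num.sqrt (2 * n.+1%:R) * hnc n.
Proof. by rewrite /hnc -sqrtrM ?mulr_ge0 //; congr Num.sqrt; rewrite exprS factS natrM; ring. Qed.

Definition psi n : R -> R := gw 2^-1 ((hnc n)^-1 *: Hp n).

Lemma rdot_psi j k : odd j = odd k -> rdot mu (psi j) (psi k) = (j == k)%:R.
Proof.
move=> jk; rewrite rdot_gw -scalerAl -scalerAr !gIZ gI_Hp //.
have [->|_] := eqVneq j k; last by rewrite mul0r !mulr0.
by rewrite [true%:R]mulr1n mul1r -sqr_hnc; field; rewrite gt_eqF ?hnc_gt0.
Qed.

Lemma half_gt0 : 0 < 2^-1 :> R. Proof. by rewrite invr_gt0. Qed.

Lemma l2_psi n : l2 (psi n).
Proof. exact: l2_gw half_gt0. Qed.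

Lemma Phi_psi k : Phi k = psi k.*2.+1.
Proof.
apply/funext => r; rewrite /Phi /psi /gw hermiteE hornerZ /hnc /hermite_const /=.
rewrite [r ^+ 2 / 2]mulrC; congr (_^-1 * _ * _); congr Num.sqrt.
by rewrite exprS; field.
Qed.

Definition dpsi n : R -> R := gw 2^-1 (((hnc n)^-1 *: Hp n)^`() - 'X * ((hnc n)^-1 *: Hp n)).

Lemma dpsiE n : dpsi n.+1 =
  (fun x => Num.sqrt (n.+1%:R / 2) * psi n x - Num.sqrt (n.+2%:R / 2) * psi n.+2 x).
Proof.
apply/funext => x; rewrite /dpsi /psi.
have gwL a b p q : a * gw 2^-1 p x - b * gw 2^-1 q x = gw 2^-1 (a *: p - b *: q) x.
  by rewrite gwB /= !gwZ.
rewrite gwL; congr gw.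
have sp m : 0 < Num.sqrt (2 * m.+1%:R) :> R by rewrite sqrtr_gt0 mulr_gt0.
have sE m : Num.sqrt (m.+1%:R / 2) = Num.sqrt (2 * m.+1%:R) / 2 :> R.
  rewrite (_ : m.+1%:R / 2 = (2 * m.+1%:R) * 2^-1 ^+ 2 :> R); last by field.
  have h : 0 <= 2 * m.+1%:R :> R by rewrite mulr_ge0.
  by rewrite (sqrtrM (2^-1 ^+ 2) h) sqrtr_sqr ger0_norm ?invr_ge0.
have ss m : Num.sqrt (2 * m.+1%:R) ^+ 2 = 2 * m.+1%:R :> R by rewrite sqr_sqrtr ?mulr_ge0.
have c0 := hnc_gt0 n.
rewrite derivZ deriv_Hp [Hp n.+2]HpS deriv_Hp !hncS !sE -[in LHS]scalerAr.
rewrite -/(hnc n); move: (sp n) (sp n.+1) (ss n); set x1 := Num.sqrt _; set x2 := Num.sqrt _ => x1p x2p <-.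
set A := Hp n; set B := 'X * _; set c := hnc n.
apply/polyP => i; rewrite !(coefB, coefZ); move: A`_i B`_i => u v.
by field; rewrite !gt_eqF.
Qed.
End Hermite.

(** * Kinetic and potential energy of Hermite functions *)

Section HermiteSpan.
Context {R : realType}.
Local Notation mu := (@half_line R).
Local Notation l2 f := (f \in Lfun mu 2%:E).
Implicit Types (p q s b : {poly R}) (n j k : nat).
Local Notation hw := (gw (2^-1 : R)).

(** [dp p] is the polynomial factor of the derivative of p(r) exp(-r^2/2). *)
Definition dp p : {poly R} := p^`() - 'X * p.
Definition psp n : {poly R} := (hnc n)^-1 *: Hp n.

Lemma psiE n : psi n = hw (psp n). Proof. by []. Qed.

Lemma dpD p q : dp (p + q) = dp p + dp q.
Proof. by rewrite /dp derivD mulrDr opprD addrACA. Qed.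
Lemma dpZ (c : R) p : dp (c *: p) = c *: dp p.
Proof. by rewrite /dp derivZ -scalerAr -scalerBr. Qed.

Lemma l2_hw p : l2 (hw p). Proof. exact: l2_gw half_gt0. Qed.

Lemma is_derive_hw p (x : R) : is_derive x (1 : R) (hw p) (hw (dp p) x).
Proof.
have h := is_derive_gw 2^-1 p x; apply: is_derive_eq.
by rewrite mulfV ?scale1r // pnatr_eq0.
Qed.

Lemma rdot_hw_ibp p b : p.[0] = 0 -> rdot mu (hw (dp p)) (hw b) = - rdot mu (hw p) (hw (dp b)).
Proof.
move=> p0; apply/eqP; rewrite -subr_eq0 opprK !rdot_gw -gID.
have -> : dp p * b + p * dp b = (p * b)^`() - 2 *: ('X * (p * b)).
  by rewrite /dp derivM -!mul_polyC; ring.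
by rewrite gI_ibp hornerM p0 mul0r oppr0.
Qed.

(** Hardy inequality for g = r s(r) exp(-r^2/2). The difference of the squares of the
    derivative of g and of r times the derivative of s(r) exp(-r^2/2) is itself a
    derivative vanishing at the ends, so that both have the same norm; and s(r)
    exp(-r^2/2) is their difference. *)
Lemma hardy s : rdot mu (hw s) (hw s) <= 4 * rdot mu (hw (dp ('X * s))) (hw (dp ('X * s))).
Proof.
set d := dp ('X * s); set t := 'X * dp s.
have E1 : d = s + t by rewrite /d /t /dp derivM derivX mul1r; ring.
have E2 : gI (d * d) = gI (t * t).
  apply/eqP; rewrite -subr_eq0 -gIB.
  have -> : d * d - t * t = ('X * (s * s))^`() - 2 *: ('X * ('X * (s * s))).
    by rewrite E1 /t /dp !derivM derivX mul1r -!mul_polyC; ring.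
  by rewrite gI_ibp hornerM hornerX mul0r oppr0.
have G0 p : 0 <= gI (p * p) by rewrite -rdot_gw rdot_ge0.
rewrite !rdot_gw.
have -> : s * s = 2 *: (d * d) + 2 *: (t * t) - (d + t) * (d + t).
  by rewrite E1 -!mul_polyC; ring.
by rewrite gIB gID !gIZ -E2; have := G0 (d + t); lra.
Qed.

Lemma hermite_ode n : (Hp n)^`()^`() = 2 *: ('X * (Hp n)^`()) - (2 * n%:R) *: Hp n :> {poly R}.
Proof.
have := @deriv_Hp R n; rewrite HpS derivB derivZ derivM derivX mul1r => h.
have -> : (Hp n)^`()^`() = 2 *: (Hp n + 'X * (Hp n)^`()) - (2 * n.+1%:R) *: Hp n :> {poly R}.
  by rewrite -h; ring.
by rewrite -[n.+1%:R]natr1 mulrDr mulr1 scalerDl -!mul_polyC; ring.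
Qed.

Lemma dp_dp_psp n : dp (dp (psp n)) = 'X * ('X * psp n) - (n.*2.+1%:R) *: psp n.
Proof.
have nE : n.*2.+1%:R = 2 * n%:R + 1 :> R by rewrite -natr1 -muln2 natrM; ring.
rewrite /psp !dpZ -!scalerAr [_ *: (_ *: _)]scalerA [_ * _^-1]mulrC -scalerA -scalerBr; congr (_ *: _).
rewrite /dp derivB derivM derivX mul1r hermite_ode nE scalerDl scale1r -!mul_polyC; ring.
Qed.

Lemma psp_odd0 k : (psp k.*2.+1).[0] = 0.
Proof. by rewrite hornerZ Hp_odd0 ?mulr0 //= odd_double. Qed.

Opaque psp.

Definition ev k : R := (4 * k + 3)%:R.

Lemma ev_gt0 k : 0 < ev k. Proof. by rewrite ltr0n addn3. Qed.

Definition hsum M (a : 'I_M -> R) : {poly R} := \sum_k a k *: psp k.*2.+1.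

Lemma hsum0 M (a : 'I_M -> R) : (hsum a).[0] = 0.
Proof. by rewrite horner_sum big1 // => k _; rewrite hornerZ psp_odd0 mulr0. Qed.

Lemma gI_suml (I : finType) (F : I -> {poly R}) q : gI ((\sum_k F k) * q) = \sum_k gI (F k * q).
Proof.
rewrite mulr_suml; elim/big_ind2 : _ => //; first by rewrite -(scale0r 0) gIZ mul0r.
by move=> x y z t <- <-; rewrite gID.
Qed.

Lemma gI_Phi j k : gI (psp j.*2.+1 * psp k.*2.+1) = (j == k)%:R.
Proof.
rewrite -rdot_gw -!psiE rdot_psi /= ?odd_double //.
by rewrite eqSS -!muln2 eqn_pmul2r.
Qed.

Lemma gI_hsum_Phi M (a : 'I_M -> R) (k : 'I_M) : gI (hsum a * psp k.*2.+1) = a k.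
Proof.
rewrite gI_suml (bigD1 k) //= -scalerAl gIZ gI_Phi eqxx mulr1 big1 ?addr0 // => j jk.
by rewrite -scalerAl gIZ gI_Phi (negbTE (_ : (j : nat) != k)) ?mulr0.
Qed.

Lemma gI_hsum M (a b : 'I_M -> R) : gI (hsum a * hsum b) = \sum_(k < M) a k * b k.
Proof.
rewrite [X in _ * X]/hsum mulrC gI_suml; apply: eq_bigr => k _.
by rewrite -scalerAl gIZ [psp _ * _]mulrC gI_hsum_Phi mulrC.
Qed.

(** The odd Hermite functions diagonalize the quadratic form of the oscillator with
    eigenvalues 4 k + 3. *)
Lemma oscillator_form M (a : 'I_M -> R) :
  gI (dp (hsum a) * dp (hsum a)) + gI (('X * hsum a) * ('X * hsum a)) = \sum_(k < M) ev k * a k ^+ 2.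
Proof.
rewrite -(rdot_gw (dp _)) rdot_hw_ibp ?hsum0 // rdot_gw.
have -> : dp (dp (hsum a)) = 'X * ('X * hsum a) - hsum (fun k : 'I_M => ev k * a k).
  rewrite {1 2}/hsum (big_morph dp dpD (_ : _ = 0)) ?(big_morph dp dpD (_ : _ = 0));
    try by rewrite /dp derivC mulr0 subr0.
  rewrite !mulr_sumr /hsum -sumrB; apply: eq_bigr => k _.
  have e : k.*2.+1.*2.+1%:R = ev k :> R by rewrite /ev; congr (_%:R); rewrite -!muln2; lia.
  rewrite dpZ dpZ dp_dp_psp e -!mul_polyC polyCM.
  ring.
rewrite mulrBr gIB gI_hsum [gI (hsum a * _)](_ : _ = gI ('X * hsum a * ('X * hsum a))); last first.
  by congr gI; ring.
rewrite opprB addrNK; apply: eq_bigr => k _; ring.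
Qed.

Lemma gI_sqr_ge0 p : 0 <= gI (p * p).
Proof. by rewrite -rdot_gw rdot_ge0. Qed.

Lemma kinetic_le M (a : 'I_M -> R) :
  gI (dp (hsum a) * dp (hsum a)) <= \sum_(k < M) ev k * a k ^+ 2.
Proof. by rewrite -oscillator_form lerDl gI_sqr_ge0. Qed.

(** The derivative of an odd Hermite function combines two adjacent even ones, so that
    this matrix is tridiagonal. *)
Definition kin j k : R := gI (dp (psp j.*2.+1) * dp (psp k.*2.+1)).

Lemma kin_hsum M (a b : 'I_M -> R) :
  gI (dp (hsum a) * dp (hsum b)) = \sum_(j < M) \sum_(k < M) a j * b k * kin j k.
Proof.
have dps (c : 'I_M -> R) : dp (hsum c) = \sum_k c k *: dp (psp k.*2.+1).
  rewrite /hsum (big_morph dp dpD (_ : _ = 0)); last by rewrite /dp derivC mulr0 subr0.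
  by apply: eq_bigr => k _; rewrite dpZ.
rewrite !dps gI_suml; apply: eq_bigr => j _.
rewrite mulrC gI_suml; apply: eq_bigr => k _.
by rewrite -scalerAl -scalerAr !gIZ [gI (_ * _)](_ : _ = kin j k) ?mulrA ?[b k * _]mulrC // mulrC.
Qed.

Lemma kinC j k : kin j k = kin k j.
Proof. by rewrite /kin mulrC. Qed.

Lemma kinE j k : kin j k =
  rdot mu (dpsi j.*2.+1) (dpsi k.*2.+1).
Proof. by rewrite rdot_gw. Qed.

Lemma rdot_psi_even j k : rdot mu (psi j.*2) (psi k.*2) = (j == k)%:R.
Proof. by rewrite rdot_psi ?odd_double // -!muln2 eqn_pmul2r. Qed.

Lemma kin_val j k : kin j k =
  Num.sqrt (j.*2.+1%:R / 2) * Num.sqrt (k.*2.+1%:R / 2) * (j == k)%:R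
  - Num.sqrt (j.*2.+1%:R / 2) * Num.sqrt (k.*2.+2%:R / 2) * (j == k.+1)%:R
  - Num.sqrt (j.*2.+2%:R / 2) * Num.sqrt (k.*2.+1%:R / 2) * (j.+1 == k)%:R
  + Num.sqrt (j.*2.+2%:R / 2) * Num.sqrt (k.*2.+2%:R / 2) * (j == k)%:R.
Proof.
have := rdot_psi_even j k; have := rdot_psi_even j k.+1.
have := rdot_psi_even j.+1 k; have := rdot_psi_even j.+1 k.+1.
rewrite kinE !dpsiE !doubleS eqSS /rdot.
have gwL (a b : R) n m : (fun x => a * psi n x - b * psi m x) = hw (a *: psp n - b *: psp m).
  by apply/funext => x; rewrite !psiE gwB (gwZ _ a) (gwZ _ b).
rewrite !gwL -!/(rdot _ _ _) !psiE !rdot_gw => h1 h2 h3 h4.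
have gL (x y z t : R) p q p' q' : gI ((x *: p - y *: q) * (z *: p' - t *: q')) =
    x * z * gI (p * p') - x * t * gI (p * q') - y * z * gI (q * p') + y * t * gI (q * q').
  rewrite -!gIZ -!gIB -!gID; congr gI.
  by rewrite -!mul_polyC !polyCM; ring.
by rewrite gL h1 h2 h3 h4; ring.
Qed.

Lemma neq_nat n : [/\ (n == n.+1) = false, (n.+1 == n) = false, (n == n.+2) = false & (n.+2 == n) = false].
Proof. by split; apply/eqP; lia. Qed.

Lemma kin_diag k : kin k k = (4 * k + 3)%:R / 2.
Proof.
rewrite kin_val eqxx !mulr1 -!expr2 !sqr_sqrtr ?divr_ge0 //.
have [-> -> _ _] := neq_nat k.
rewrite !mulr0 !subr0 -mulrDl -natrD; congr (_%:R / _); rewrite -!muln2; lia.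
Qed.

Lemma kin_next k : kin k k.+1 ^+ 2 = (k.+1%:R * (k.+1%:R + 2^-1)).
Proof.
rewrite kin_val eqxx !mulr1.
have [-> _ -> _] := neq_nat k.
rewrite !mulr0 !subr0 add0r addr0 sqrrN exprMn !sqr_sqrtr ?divr_ge0 //.
have -> : k.*2.+2%:R = 2 * k.+1%:R :> R by rewrite -doubleS -muln2 natrM mulrC.
have -> : k.+1.*2.+1%:R = 2 * k.+1%:R + 1 :> R by rewrite -natr1 -muln2 natrM mulrC.
by field.
Qed.

Lemma kin_far j k : (j.+1 < k)%N -> kin j k = 0.
Proof.
move=> jk; have [h1 h2 h3] : [/\ (j == k) = false, (j == k.+1) = false & (j.+1 == k) = false].
  by split; apply/eqP; lia.
rewrite kin_val h1 h2 h3.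
by rewrite !mulr0 !subr0 addr0.
Qed.

(** Pointwise bounds near the origin.  The energy Phi'^2 + (e - r^2) Phi^2 has
   derivative - 2 r Phi^2, so it decreases from Phi'(0)^2 = 2 int r Phi^2. *)
Lemma Phi_near0 k r : 0 <= r <= 1 -> Phi k r ^+ 2 <= r ^+ 2 * (1 + ev k).
Proof.
pose p := psp k.*2.+1; pose en := dp p * dp p + (ev k *: (p * p) - 'X * ('X * (p * p))).
have e3 : 3 <= ev k by rewrite ler_nat leq_addl.
have Een : en^`() - 2 *: ('X * en) = - (2 *: ('X * (p * p))).
  have h : dp (dp p) = 'X * ('X * p) - ev k *: p.
    by rewrite /p dp_dp_psp; congr (_ - _ *: _); congr (_%:R); rewrite -!muln2; lia.
  have h1 : (dp p)^`() = dp (dp p) + 'X * dp p by rewrite {2}/dp addrNK.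
  have h2 : p^`() = dp p + 'X * p by rewrite /dp addrNK.
  rewrite /en derivD derivB derivZ !derivM derivX !mul1r h1 h2 h -!mul_polyC; ring.
have E0 : en.[0] = (dp p).[0] ^+ 2.
  have p0 : p.[0] = 0 by exact: psp_odd0.
  rewrite /en; move: (dp p) => d'; rewrite hornerD hornerD hornerN hornerZ !hornerM hornerX p0; ring.
have D0 : (dp p).[0] ^+ 2 <= 1 + ev k.
  have := gI_ibp en; rewrite Een -scaleN1r gIZ mulN1r E0 => /oppr_inj.
  rewrite gIZ => <-.
  have k1 : gI (p * p) = 1 by rewrite gI_Phi eqxx.
  have k2 : gI ('X * p * ('X * p)) <= ev k.
    have := @oscillator_form k.+1 (fun i => (i == ord_max)%:R).
    have -> : hsum (fun i : 'I_k.+1 => (i == ord_max)%:R) = p.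
      rewrite /hsum (bigD1 ord_max) //= eqxx scale1r big1 ?addr0 // => i /negbTE ->.
      by rewrite scale0r.
    rewrite (bigD1 ord_max) //= eqxx expr1n mulr1 big1 => [|i /negbTE ->].
      by rewrite addr0 => <-; rewrite lerDr gI_sqr_ge0.
    by rewrite expr0n mulr0.
  have := gI_sqr_ge0 (p - 'X * p).
  have -> : (p - 'X * p) * (p - 'X * p) = p * p + 'X * p * ('X * p) - 2 *: ('X * (p * p)).
    by rewrite -!mul_polyC; ring.
  by rewrite gIB gID gIZ k1; lra.
have dE (x : R) : is_derive x (1 : R) (gw 1 en) (gw 1 (- (2 *: ('X * (p * p)))) x).
  by have := is_derive_gw 1 en x; rewrite mulr1 Een.
have enle x : 0 <= x <= 1 -> hw (dp p) x ^+ 2 <= 1 + ev k.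
  move=> /andP[x0 x1]; apply: (@le_trans _ _ (gw 1 en x)).
    have Ex : en.[x] = (dp p).[x] ^+ 2 + (ev k - x ^+ 2) * p.[x] ^+ 2.
      by rewrite /en; move: (dp p) => d'; rewrite hornerD hornerD hornerN hornerZ !hornerM hornerX; ring.
    rewrite /gw Ex exprMn.
    rewrite (_ : expR (- (2^-1 * x ^+ 2)) ^+ 2 = expR (- (1 * x ^+ 2))); last first.
      by rewrite -expRM_natl; congr expR; field.
    rewrite ler_wpM2r ?expR_ge0 // lerDl mulr_ge0 ?sqr_ge0 // subr_ge0 (le_trans _ e3) //.
    by apply: (le_trans (exprn_ile1 2 x0 x1)); rewrite ler1n.
  apply: (le_trans _ D0); rewrite -E0.
  have -> : en.[0] = gw 1 en 0 by rewrite /gw expr0n mulr0 oppr0 expR0 mulr1.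
  have cE : {within `[0, x], continuous (gw 1 en)}.
    by apply: continuous_subspaceT; exact: continuous_gw.
  have := @MVT_segment R (gw 1 en) _ 0 x x0 (fun y _ => dE y) cE => -[y].
  rewrite in_itv /= => /andP[y0 yx] h.
  rewrite -subr_le0 h subr0 mulr_le0_ge0 // /gw hornerN hornerZ !hornerM hornerX mulNr oppr_le0.
  have q0 : 0 <= p.[y] * p.[y] by rewrite -expr2 sqr_ge0.
  by do !apply: mulr_ge0 => //; exact: expR_ge0.
move=> /andP[r0 r1]; rewrite Phi_psi psiE -/p.
have cE : {within `[0, r], continuous (hw p)}.
  by apply: continuous_subspaceT; exact: continuous_gw.
have := @MVT_segment R (hw p) _ 0 r r0 (fun y _ => is_derive_hw p y) cE => -[y].
rewrite in_itv /= subr0 => /andP[y0 yr] h.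
have p0 : hw p 0 = 0 by rewrite /gw /p psp_odd0 mul0r.
move: h; rewrite p0 subr0 => ->; rewrite exprMn mulrC ler_wpM2l ?sqr_ge0 // enle //.
by rewrite y0 (le_trans yr).
Qed.

End HermiteSpan.

(** * The spectrum of the compressed kinetic energy *)

Section RealMatrices.
Context {R : realType}.
Local Notation C := R[i].

Definition rmx n (F : 'I_n -> 'I_n -> R) : 'M[C]_n := \matrix_(i, j) (F i j)%:C.

Lemma rmx_herm n (F : 'I_n -> 'I_n -> R) : (forall i j, F i j = F j i) -> herm (rmx F).
Proof. by move=> FC; split; apply/matrixP => i j; rewrite trCE !mxE cconjR FC. Qed.

Lemma cRe_sum (I : finType) (F : I -> C) : Re (\sum_i F i) = \sum_i Re (F i).
Proof. exact: (big_morph _ (@cReD R) (erefl : Re (0 : C) = 0)). Qed.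
Lemma cIm_sum (I : finType) (F : I -> C) : Im (\sum_i F i) = \sum_i Im (F i).
Proof. exact: (big_morph _ (@cImD R) (erefl : Im (0 : C) = 0)). Qed.

Lemma qf_rmx n (F : 'I_n -> 'I_n -> R) x : qf (rmx F) x =
  \sum_i \sum_j F i j * (Re (x i 0) * Re (x j 0) + Im (x i 0) * Im (x j 0)).
Proof.
rewrite /qf -mulmxA mxE cRe_sum; apply: eq_bigr => i _.
rewrite [(rmx F *m x) i 0]mxE mulr_sumr cRe_sum; apply: eq_bigr => j _.
rewrite trCE [rmx F i j]mxE mulrCA cReZ; congr (_ * _).
by rewrite cReM cReJ cImJ mulNr opprK.
Qed.
End RealMatrices.

Section TridiagonalDet.
Variables (A : comNzRingType) (a : nat -> nat -> A).
Hypothesis a0 : forall i j, (i.+1 < j)%N \/ (j.+1 < i)%N -> a i j = 0.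
Definition tri n : 'M[A]_n := \matrix_(i, j) a i j.

Lemma det_tri n : \det (tri n.+2) =
  a n.+1 n.+1 * \det (tri n.+1) - a n n.+1 * a n.+1 n * \det (tri n).
Proof.
rewrite (expand_det_row _ ord_max) big_ord_recr /= big_ord_recr /= big1 ?add0r; last first.
  by move=> i _; rewrite mxE a0 ?mul0r //=; right; rewrite ltnS ltn_ord.
rewrite addrC; congr (_ + _).
  rewrite mxE /=; congr (_ * _); rewrite /cofactor /= -signr_odd oddD addbb expr0 mul1r.
  by congr (\det _); apply/matrixP => i j; rewrite !mxE !lift_max.
rewrite mxE /= /cofactor /= -signr_odd oddD /= addNb addbb expr1 mulN1r mulrN; congr (- _).
rewrite [a n n.+1 * _]mulrC -mulrA; congr (_ * _).
set B := row' _ _.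
have BE (i k : 'I_n.+1) : B i k = a i (bump n k) by rewrite !mxE lift_max.
rewrite (expand_det_col _ ord_max) big_ord_recr /= big1 ?add0r; last first.
  move=> i _; rewrite BE /= /bump leqnn a0 ?mul0r // add1n ltnS.
  by left; exact: ltn_ord.
rewrite BE /= /bump leqnn add1n /cofactor /= -signr_odd oddD addbb expr0 mul1r.
congr (_ * \det _); apply/matrixP => i k; rewrite !mxE !lift_max /= /bump.
have -> : (n <= k)%N = false by rewrite leqNgt ltn_ord.
by rewrite add0n leqNgt ltn_ord.
Qed.
End TridiagonalDet.

Section Laguerre.
Context {R : realType}.
Implicit Types (t : R) (n M : nat).

Lemma poly_horner_inj (p q : {poly R}) : (forall u, p.[u] = q.[u]) -> p = q.
Proof.
move=> h; apply/eqP; rewrite -subr_eq0; apply/eqP.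
apply: (@roots_geq_poly_eq0 _ _ [seq i%:R | i <- iota 0 (size (p - q))]).
- by apply/allP => x _; rewrite /root hornerD hornerN h subrr.
- by rewrite map_inj_uniq ?iota_uniq //; exact: (@mulrIn R 1 (oner_neq0 _)).
by rewrite size_map size_iota.
Qed.

Fixpoint lagp n : {poly R} * {poly R} :=
  if n is m.+1 then ((lagp m).2,
    ('X + ((4 * m + 7)%:R / 2)%:P) * (lagp m).2 - (m.+1%:R * (m.+1%:R + 2^-1)) *: (lagp m).1)
  else (1, 'X + (3 / 2)%:P).
Definition lag n := (lagp n).1.

Lemma lag0 : lag 0 = 1. Proof. by []. Qed.
Lemma lag1 : lag 1 = 'X + (3 / 2)%:P. Proof. by []. Qed.
Lemma lagSS n : lag n.+2 = ('X + ((4 * n + 7)%:R / 2)%:P) * lag n.+1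
  - (n.+1%:R * (n.+1%:R + 2^-1)) *: lag n.
Proof. by []. Qed.

(** The characteristic polynomials of the kinetic matrices are Laguerre
   polynomials of order 1/2, here at the argument -t. *)
Lemma lag_structure n t :
  t * (lag n.+1)^`().[t] = n.+1%:R * (lag n.+1).[t] - n.+1%:R * (n.+1%:R + 2^-1) * (lag n).[t]
  /\ t * (lag n)^`().[t] = (lag n.+1).[t] - (t + n%:R + 3 / 2) * (lag n).[t].
Proof.
elim: n => [|n [IH1 IH2]].
  rewrite lag0 lag1 derivD derivX derivC addr0 -polyC1 derivC !hornerE.
  by split; [field | ring].
have e4 : (4 * n + 7)%:R = 4 * n%:R + 7 :> R by rewrite natrD natrM.
have eS : n.+1%:R = n%:R + 1 :> R by rewrite natr1.
have eSS : n.+2%:R = n%:R + 2 :> R by rewrite -natr1 eS; ring.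
have rec : (lag n.+2).[t] = (t + (4 * n%:R + 7) / 2) * (lag n.+1).[t]
    - ((n%:R + 1) * (n%:R + 1 + 2^-1)) * (lag n).[t].
  by rewrite lagSS e4 eS !hornerE.
have drec : (lag n.+2)^`().[t] = (lag n.+1).[t] + (t + (4 * n%:R + 7) / 2) * (lag n.+1)^`().[t]
    - ((n%:R + 1) * (n%:R + 1 + 2^-1)) * (lag n)^`().[t].
  rewrite lagSS e4 eS derivB derivM derivD derivX derivC addr0 mul1r derivZ.
  by rewrite hornerD hornerN hornerZ hornerD hornerM hornerD hornerX hornerC.
move: IH1 IH2 rec drec; rewrite eSS eS.
move: (lag n.+2).[t] (lag n.+2)^`().[t] (lag n.+1).[t] (lag n.+1)^`().[t] (lag n).[t] (lag n)^`().[t].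
move: (n%:R : R) => k z dz y dy x dx IH1 IH2 -> ->; split.
  transitivity (t * y + (t + (4 * k + 7) / 2) * (t * dy)
    - ((k + 1) * (k + 1 + 2^-1)) * (t * dx)); first by ring.
  by rewrite IH1 IH2; field.
by rewrite IH1; field.
Qed.

(** The Laguerre equation, obtained from the two relations of lag_structure. *)
Lemma lag_ode n t : t != 0 ->
  t * (lag n)^`()^`().[t] + (t + 3 / 2) * (lag n)^`().[t] = n%:R * (lag n).[t].
Proof.
move=> t0.
have E : 'X * (lag n)^`() = lag n.+1 - ('X + (n%:R + 3 / 2)%:P) * lag n.
  apply: poly_horner_inj => u; have [_ e] := lag_structure n u.
  rewrite hornerM hornerX e hornerD hornerN hornerM hornerD hornerX hornerC; ring.
have /(congr1 (fun p => p^`().[t])) := E.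
rewrite derivM derivX mul1r derivB derivM derivD derivX derivC addr0 mul1r.
rewrite hornerD hornerM hornerX hornerD hornerN hornerD hornerM hornerD hornerX hornerC => E'.
have [h1 h2] := lag_structure n t.
apply: (mulfI t0).
have := congr1 (fun x => t * x) E' => {}E'.
have eS : n.+1%:R = n%:R + 1 :> R by rewrite natr1.
move: h1 h2 E'; rewrite eS.
move: (lag n.+1).[t] (lag n.+1)^`().[t] (lag n).[t] (lag n)^`().[t] (lag n)^`()^`().[t].
move: (n%:R : R) => k y dy x dx ddx h1 h2 E'.
have {}h1 : t * dy = (k + 1) * t * dx + (k + 1) * t * x.
  rewrite h1 (_ : y = t * dx + (t + k + 3 / 2) * x); last by rewrite h2; ring.
  by field.
have -> : t * (t * ddx + (t + 3 / 2) * dx) =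
  t * (dx + t * ddx) + t * (t + 2^-1) * dx by field.
by rewrite E' !mulrBr h1; field.
Qed.

Lemma prod_logderiv (s : seq R) t : (forall x, x \in s -> x + t != 0) ->
  let P : {poly R} := \prod_(x <- s) ('X + x%:P) in
  let g := \sum_(x <- s) (x + t)^-1 in let g2 := \sum_(x <- s) (x + t) ^- 2 in
  [/\ P.[t] != 0, P^`().[t] = P.[t] * g & P^`()^`().[t] = P.[t] * (g ^+ 2 - g2)].
Proof.
elim: s => [|x s IH] h /=.
  have d1 : (1 : {poly R})^`() = 0 by rewrite -polyC1 derivC.
  have d0 : (0 : {poly R})^`() = 0 by rewrite -polyC0 derivC.
  rewrite !big_nil d1 d0 horner0 -polyC1 hornerC expr0n subrr !mulr0.
  by split => //; exact: oner_neq0.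
have [|P0 P1 P2] := IH; first by move=> y ys; apply: h; rewrite inE ys orbT.
have xt := h x (mem_head _ _).
rewrite !big_cons; move: (\prod_(y <- s) _) P0 P1 P2 => P P0 P1 P2.
have D1 (Q : {poly R}) : (('X + x%:P) * Q)^`() = Q + ('X + x%:P) * Q^`().
  by rewrite derivM derivD derivX derivC addr0 mul1r.
have H (Q : {poly R}) : (('X + x%:P) * Q).[t] = (x + t) * Q.[t].
  by rewrite hornerM hornerD hornerX hornerC addrC.
rewrite D1 derivD D1 !hornerD !H P1 P2; split; first by rewrite mulf_neq0.
  by field.
by field.
Qed.

(** In terms of g and of g2, the sum of (d_i + t)^-2, the Laguerre equation divided by
    the polynomial reads t (g^2 - g2) + (t + 3/2) g = M, where 0 <= t g2 <= g. *)
Lemma lag_trace M (d : 'I_M -> R) : (forall i, 0 <= d i) ->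
  (forall t, \prod_i (d i + t) = (lag M).[t]) ->
  forall t, 0 < t -> let g := \sum_i (d i + t)^-1 in
  t * g ^+ 2 <= M%:R /\ M%:R <= t * g ^+ 2 + (3 / 2 + t) * g.
Proof.
move=> d0 hd t t0 /=.
set s := [seq d i | i <- enum 'I_M].
have sE (F : R -> R) : \sum_(x <- s) F x = \sum_i F (d i).
  by rewrite big_map big_enum.
have PE : \prod_(x <- s) ('X + x%:P) = lag M.
  apply: poly_horner_inj => u; rewrite horner_prod big_map big_enum -hd.
  by apply: eq_bigr => i _; rewrite hornerD hornerX hornerC addrC.
have dt i : 0 < d i + t by rewrite ltr_wpDl.
have [|] := @prod_logderiv s t; first by move=> _ /mapP[i _ ->]; rewrite gt_eqF.
rewrite PE !sE; set g := \sum_i _; set g2 := \sum_i _ => P0 P1 P2.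
have := lag_ode M (lt0r_neq0 t0); rewrite P1 P2 => E.
have {}E : t * (g ^+ 2 - g2) + (t + 3 / 2) * g = M%:R.
  by apply: (mulfI P0); rewrite [RHS]mulrC -E; ring.
have g20 : 0 <= g2 by apply: sumr_ge0 => i _; rewrite invr_ge0 exprn_ge0 // ltW.
have g2g : t * g2 <= g.
  rewrite mulr_sumr; apply: ler_sum => i _; rewrite -exprVn expr2 mulrA -[leRHS]mul1r.
  rewrite ler_wpM2r ?invr_ge0 ?(ltW (dt i)) // ler_pdivrMr // mul1r lerDr //.
have g0 : 0 <= g by apply: sumr_ge0 => i _; rewrite invr_ge0 ltW.
have tg2 : 0 <= t * g2 by rewrite mulr_ge0 // ltW.
have tg : 0 <= t * g by rewrite mulr_ge0 // ltW.
by split; move: g2g tg2 tg g0 E; rewrite mulrBr; nra.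
Qed.

End Laguerre.

Section KineticMatrix.
Context {R : realType}.
Local Notation C := R[i].

Definition Jmx M : 'M[C]_M := rmx (fun j k : 'I_M => kin j k).

Lemma det_Jmx M t : \det (Jmx M + scal M t) = ((lag M).[t])%:C.
Proof.
pose a (j k : nat) : C := (kin j k + (j == k)%:R * t)%:C.
have a0 i j : (i.+1 < j)%N \/ (j.+1 < i)%N -> a i j = 0.
  move=> ij; rewrite /a (_ : (i == j) = false); last by apply/eqP => e; move: ij; rewrite e; lia.
  rewrite mul0r addr0; case: ij => ij; first by rewrite kin_far.
  by rewrite kinC kin_far.
have -> : Jmx M + scal M t = tri a M.
  apply/matrixP => i j; rewrite !mxE /a rmorphD /=; congr (_ + _).
  by rewrite rmorphM /= -val_eqE /=; case: eqP => _ /=; rewrite ?mulr1n ?mulr0n mulrC.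
have [H _] : \det (tri a M) = ((lag M).[t])%:C /\ \det (tri a M.+1) = ((lag M.+1).[t])%:C.
  elim: M => [|M [IH1 IH2]].
    split; first by rewrite det_mx00 lag0 hornerC.
    rewrite det_mx11 mxE -[LHS]/(a 0%N 0%N) lag1 /a kin_diag eqxx mul1r !hornerE addrC.
    by [].
  split => //; rewrite det_tri // IH1 IH2 lagSS /a !eqxx mul1r.
  have [-> -> _ _] := neq_nat M.
  rewrite mul0r !addr0 [kin M.+1 M]kinC -!rmorphM -rmorphB /=; congr (_%:C).
  rewrite -expr2 kin_next kin_diag !hornerE; congr (_ * _ - _); rewrite addrC; congr (_ + _ / _).
  by congr (_%:R); lia.
by [].
Qed.

Lemma Jmx_herm M : herm (Jmx M).
Proof. by apply: rmx_herm => i j; exact: kinC. Qed.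

Lemma qf_Jmx M x : qf (Jmx M) x =
  gI (dp (hsum (fun i => Re (x i 0))) * dp (hsum (fun i => Re (x i 0)))) +
  gI (dp (hsum (fun i => Im (x i 0))) * dp (hsum (fun i => Im (x i 0)))).
Proof.
rewrite qf_rmx !kin_hsum -big_split; apply: eq_bigr => i _ /=.
by rewrite -big_split; apply: eq_bigr => j _ /=; ring.
Qed.

(** The eigenvalues of the compressed kinetic energy have the density of a Laplacian:
    the sum behaves like sqrt (M / t), by lag_trace. *)
Lemma kinetic_spectrum M : exists (U : 'M[C]_M) (d : 'rV[R]_M),
  [/\ U^t* *m U = 1%:M, U^t* *m Jmx M *m U = cdiag d, forall i, 0 <= d 0 i,
     forall t, 0 < t -> t * (\sum_i (d 0 i + t)^-1) ^+ 2 <= M%:R &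
     (0 < M)%N -> Num.sqrt M%:R <= 3 * \sum_i (d 0 i + 1)^-1].
Proof.
have [U [d [UU UU' hU]]] := herm_spectral (Jmx_herm M).
have d0 i : 0 <= d 0 i.
  by rewrite (cong_ge hU) qf_Jmx addr_ge0 // gI_sqr_ge0.
have dE t : \prod_i (d 0 i + t) = (lag M).[t].
  have : \det (Jmx M + scal M t) = (\prod_i (d 0 i + t))%:C.
    transitivity (\det (U^t* *m (Jmx M + scal M t) *m U)).
      by rewrite !det_mulmx mulrAC -det_mulmx UU det1 mul1r.
    rewrite congD hU /scal congZ mulmx1 UU -cdiag1.
    have -> : t%:C *: cdiag (const_mx 1) = cdiag (const_mx t) :> 'M[C]_M.
      apply/matrixP => i j; rewrite !mxE; case: (i == j); last by rewrite !mulr0n mulr0.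
      by rewrite !mulr1n -rmorphM mulr1.
    by rewrite cdiagD det_cdiag; congr (_%:C); apply: eq_bigr => i _; rewrite !mxE.
  by rewrite det_Jmx => /(congr1 (fun z : R[i] => Re z)) /= ->.
have H := lag_trace d0 dE.
exists U, d; split => // [t t0|M0]; first by have [] := H t t0.
have [_] := H 1 ltr01; rewrite mul1r; set g := \sum_i _.
have g0 : 0 <= g by apply: sumr_ge0 => i _; rewrite invr_ge0 addr_ge0.
have s1 : 1 <= Num.sqrt M%:R :> R by rewrite -[leLHS]sqrtr1 ler_wsqrtr // ler1n.
have sE : Num.sqrt M%:R ^+ 2 = M%:R :> R by rewrite sqr_sqrtr.
move: (Num.sqrt M%:R) sE s1 => x <- s1 h; rewrite leNgt; apply/negP => gx.
have h1 : g * g <= x / 3 * (x / 3) by apply: ler_pM => //; lra.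
have h2 : x <= x * x by rewrite ler_peMl //; lra.
by move: h gx h1 h2; rewrite !expr2; lra.
Qed.

End KineticMatrix.

(** * Smooth bump functions *)

Section Bump.
Context {R : realType}.
Implicit Types (P Q : {poly R}) (x : R).

(** P(1/x) exp(-1/x) for x > 0, extended by zero: a class of flat functions
   closed under differentiation. *)
Definition flat P x : R := if 0 < x then P.[x^-1] * expR (- x^-1) else 0.
Definition dflat P : {poly R} := 'X ^+ 2 * (P - P^`()).

Lemma flat_le0 P x : x <= 0 -> flat P x = 0.
Proof. by rewrite /flat leNgt => /negbTE ->. Qed.

Lemma is_derive_flat P x : is_derive x (1 : R) (flat P) (flat (dflat P) x).
Proof.
have [x0|x0|->] := ltgtP x 0.
- have nx : \forall y \near x, cst 0 y = flat P y.
    by near=> y; rewrite flat_le0 //; apply/ltW; near: y; exact: lt_nbhsl.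
  rewrite flat_le0 ?ltW //.
  have h := is_derive_cst (0 : R) x (1 : R).
  apply: (near_eq_is_derive nx).
- have nx : \forall y \near x, P.[y^-1] * expR (- y^-1) = flat P y.
    by near=> y; rewrite /flat ifT //; near: y; exact: lt_nbhsr.
  have xn0 : x != 0 by rewrite gt_eqF.
  have h1 : is_derive x (1 : R) (fun y : R => y^-1) (- x ^- 2).
    have := @is_deriveV _ id x 1 1 xn0 (is_derive_id x 1).
    by move=> h; apply: is_derive_eq; rewrite /GRing.scale /= mulr1.
  have h2 := @is_derive1_comp _ (horner P) (fun y : R => y^-1) x _ _ (is_derive_poly P _) h1.
  have h3 : is_derive x (1 : R) (fun y : R => - y^-1) (x ^- 2).
    by apply: is_derive_eq; rewrite opprK.
  have h4 := @is_derive1_comp _ expR (fun y : R => - y^-1) x _ _ (is_derive_expR _) h3.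
  have h5 := @is_deriveM _ _ (horner P \o (fun y : R => y^-1)) (expR \o (fun y : R => - y^-1)) x 1 _ _ h2 h4.
  have E : flat (dflat P) x = P.[x^-1] *: (expR (- x^-1) * x ^- 2) + (expR (- x^-1)) *: (P^`().[x^-1] * - x ^- 2).
    rewrite /flat x0 /dflat hornerM hornerXn hornerD hornerN /GRing.scale /= exprVn.
    by ring.
  rewrite E.
  have h6 : is_derive x (1 : R) (fun y : R => P.[y^-1] * expR (- y^-1))
     (P.[x^-1] *: (expR (- x^-1) * x ^- 2) + (expR (- x^-1)) *: (P^`().[x^-1] * - x ^- 2)).
    exact: h5.
  apply: (near_eq_is_derive nx).
rewrite flat_le0 //.
have [C C0 hC] := poly_exp_bound ('X ^+ 2 * P).
have key : (fun h : R => h^-1 *: (flat P (h + 0) - flat P 0)) @ 0^' --> (0 : R).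
  apply/cvgrPdist_le => /= e e0; near=> h.
  rewrite sub0r normrN addr0 [flat P 0]flat_le0 // subr0 /GRing.scale /=.
  have [h0|h0] := leP h 0; first by rewrite flat_le0 // mulr0 normr0 ltW.
  have hp : 0 < h^-1 by rewrite invr_gt0.
  have := hC _ (ltW hp); rewrite hornerM hornerXn normrM (ger0_norm (exprn_ge0 _ (ltW hp))) => hb.
  rewrite /flat h0 !normrM (ger0_norm (ltW hp)) (ger0_norm (expR_ge0 _)) mulrA.
  rewrite expRN ler_pdivrMr ?expR_gt0 //.
  apply: (@le_trans _ _ (h * (h^-1 ^+ 2 * `|P.[h^-1]|))).
    by rewrite mulrA expr2 mulrA mulfV ?gt_eqF // mul1r.
  apply: (@le_trans _ _ (h * (C * expR h^-1))); first by rewrite ler_wpM2l // ltW.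
  rewrite mulrA ler_wpM2r ?expR_ge0 //.
  apply: (@le_trans _ _ (h * (C + 1))); first by rewrite ler_wpM2l ?(ltW h0) // lerDl.
  rewrite -ler_pdivlMr ?ltr_wpDl //; apply: ltW; near: h.
  exists (e / (C + 1)) => /=; first by rewrite divr_gt0 // ltr_wpDl.
  by move=> y /=; rewrite sub0r normrN => yl _; apply: le_lt_trans (ler_norm _) yl.
have key2 : (fun h : R => h^-1 *: ((flat P \o shift 0) (h *: 1) - flat P 0)) @ 0^' --> (0 : R).
  rewrite (_ : (fun h => _) = (fun h : R => h^-1 *: (flat P (h + 0) - flat P 0))) //.
  by apply/funext => h; rewrite /= /shift /= [h *: 1]mulr1.
by split; [apply/cvg_ex; exists 0 | exact/cvg_lim].
Unshelve. all: by end_near.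
Qed.

Fixpoint flats (a b : R) (s : seq ({poly R} * {poly R})) x : R :=
  if s is (P, Q) :: s' then flat P (x - a) * flat Q (b - x) + flats a b s' x else 0.
Fixpoint dflats (s : seq ({poly R} * {poly R})) :=
  if s is (P, Q) :: s' then (dflat P, Q) :: (- P, dflat Q) :: dflats s' else [::].

Lemma flatN P x : flat (- P) x = - flat P x.
Proof. by rewrite /flat; case: ifP => _; rewrite ?oppr0 // hornerN mulNr. Qed.

Lemma is_derive_flats a b s x : is_derive x (1 : R) (flats a b s) (flats a b (dflats s) x).
Proof.
elim: s => [|[P Q] s IH]; first exact: is_derive_cst.
have h1 : is_derive x (1 : R) (fun y : R => flat P (y - a)) (flat (dflat P) (x - a)).
  have g : is_derive x (1 : R) (fun y : R => y - a) 1 by apply: is_derive_eq; rewrite subr0.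
  have := @is_derive1_comp _ (flat P) (fun y : R => y - a) x _ _ (is_derive_flat P _) g.
  by rewrite mulr1.
have h2 : is_derive x (1 : R) (fun y : R => flat Q (b - y)) (- flat (dflat Q) (b - x)).
  have g : is_derive x (1 : R) (fun y : R => b - y) (- 1) by have := @is_deriveB _ _ _ _ _ x 1 _ _ (is_derive_cst b x (1 : R)) (is_derive_id x (1 : R)); rewrite sub0r.
  have := @is_derive1_comp _ (flat Q) (fun y : R => b - y) x _ _ (is_derive_flat Q _) g.
  by rewrite mulrN1.
have h3 := @is_deriveM _ _ (fun y : R => flat P (y - a)) (fun y : R => flat Q (b - y)) x 1 _ _ h1 h2.
have := @is_deriveD _ _ _ _ _ x 1 _ _ h3 IH => h.
apply: is_derive_eq; rewrite /= flatN /GRing.scale /=; ring.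
Qed.

Lemma smooth_flats a b s : smooth (flats a b s).
Proof.
move=> n x; have -> : derive1n n (flats a b s) = flats a b (iter n dflats s).
  elim: n s => [|n IH] s //; rewrite derive1nS IH; apply/funext => y.
  by rewrite derive1E (derive_val (is_derive := is_derive_flats a b (iter n dflats s) y)).
by have := is_derive_flats a b (iter n dflats s) x.
Qed.

Definition bump a b := flats a b [:: (1, 1)].

Lemma bumpE a b x : bump a b x = flat 1 (x - a) * flat 1 (b - x).
Proof. by rewrite /bump /= addr0. Qed.

Lemma bump_gt0 a b x : a < x < b -> 0 < bump a b x.
Proof.
move=> /andP[ax xb]; rewrite bumpE /flat !subr_gt0 ax xb !hornerC !mul1r.
by rewrite mulr_gt0 ?expR_gt0.
Qed.

Lemma flats_out a b s x : x <= a \/ b <= x -> flats a b s x = 0.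
Proof.
move=> h; elim: s => [|[P Q] s IH] //=; rewrite IH addr0.
case: h => h; first by rewrite flat_le0 ?mul0r // subr_le0.
by rewrite mulrC flat_le0 ?mul0r // subr_le0.
Qed.

Lemma test_flats a b s : 0 < a -> test_function (fun x => (flats a b s x)%:C).
Proof.
move=> a0; split; first exact: smooth_flats.
  rewrite (_ : (fun x => _) = flats a b [::]); first exact: smooth_flats.
  by apply/funext.
exists a, b; split=> // x h; rewrite flats_out //.
by case: h => /ltW h; [left|right].
Qed.

Lemma test_function0 : test_function (fun=> 0 : R[i]).
Proof.
have := test_flats 1 [::] (@ltr01 R).
by rewrite (_ : (fun x => _) = fun=> 0 : R[i]) //; apply/funext.
Qed.

(** Dividing by the bumps on [1/n, n], which exhaust the half line, recovers V as a
    pointwise limit. *)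
Lemma measurable_by_bumps (V : R -> R) :
  (forall a b, 0 < a -> measurable_fun setT ((fun x => V x * bump a b x) : measurableTypeR R -> R)) ->
  measurable_fun setT ((fun x => (0 < x)%R%:R * V x) : measurableTypeR R -> R).
Proof.
move=> mV.
pose h (n : nat) (x : measurableTypeR R) : R :=
  (V x * bump n.+1%:R^-1 n.+1%:R x) * (bump n.+1%:R^-1 n.+1%:R x `^ (-1)).
have mb a b : 0 < a -> measurable_fun setT (bump a b : measurableTypeR R -> R).
  move=> a0; apply: continuous_measurable_fun => x.
  apply: differentiable_continuous; apply/derivable1_diffP.
  by have := is_derive_flats a b [:: (1, 1)] x.
apply: (@measurable_fun_cvg _ _ _ setT h).
  move=> n; have n0 : 0 < n.+1%:R^-1 :> R by rewrite invr_gt0.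
  apply: measurable_funM; first exact: mV.
  apply: (@measurableT_comp _ _ _ _ _ _ (fun y : R => y `^ (-1))); last exact: mb.
  exact: measurable_powR.
move=> x _; have [x0|x0] := leP x 0.
  rewrite mul0r (_ : (h ^~ x) = fun=> 0); first exact: cvg_cst.
  by apply/funext => n; rewrite /h bumpE flat_le0 ?mul0r ?mulr0 ?mul0r // subr_le0 (le_trans x0).
rewrite mul1r; apply: cvg_near_cst.
near=> n; rewrite /h -mulrA.
have bp : 0 < bump n.+1%:R^-1 n.+1%:R x.
  apply: bump_gt0; apply/andP; split.
    rewrite invf_plt ?posrE //; apply: (@lt_trans _ _ n%:R); last by rewrite ltr_nat.
    by near: n; exact: nbhs_infty_gtr.
  apply: (@lt_trans _ _ n%:R); last by rewrite ltr_nat.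
  by near: n; exact: nbhs_infty_gtr.
by rewrite powR_inv1 ?(ltW bp) // mulfV ?mulr1 // gt_eqF.
Unshelve. all: by end_near.
Qed.

End Bump.

(** * The self-adjoint Dirac operator and its potentials *)

Section AlmostEverywhere.
Context {R : realType}.
Local Notation mu := (@half_line R).

Lemma hlS (P Q : R -> Prop) : {ae mu, forall r, P r} -> (forall r, P r -> Q r) ->
  {ae mu, forall r, Q r}.
Proof.
move=> [N [mN N0 sub]] h; exists N; split=> // r /= nQ.
by apply: sub => /= Pr; apply: nQ; exact: h.
Qed.

Lemma hlI (P Q : R -> Prop) : {ae mu, forall r, P r} -> {ae mu, forall r, Q r} ->
  {ae mu, forall r, P r /\ Q r}.
Proof.
move=> [N [mN N0 sub]] [N' [mN' N0' sub']]; exists (N `|` N'); split.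
- exact: measurableU.
- by rewrite measureU0.
move=> r /= nPQ; have [Pr|nP] := pselect (P r); last by left; exact: sub.
by right; apply: sub' => Qr; exact: nPQ.
Qed.
End AlmostEverywhere.

Section SelfAdjointRelation.
Context {R : realType}.
Variables (T : @operator R).
Hypothesis Tsa : selfadjoint (closure_op T).
Local Notation H := (closure_op T).
Local Notation ip := (@hip R).

Let fip := @form_hip R.

Lemma sa_sym_rel : symmetric_rel (ip := ip) (hrel H).
Proof. by move=> u w v x Huw /Tsa.2[_ _]; exact. Qed.

Lemma sa_linear_rel : linear_rel (hrel H).
Proof.
move=> a u w v x /Tsa.2[_ _ h1] /Tsa.2[_ _ h2]; apply/Tsa.2; split; try exact: hsP.
move=> y z Hyz; have [ly lz _] := Hyz.
have E1 := h1 _ _ Hyz; have E2 := h2 _ _ Hyz.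
have := @formDr _ _ _ fip (mkhs lz) (a *: u) v; have := @formDr _ _ _ fip (mkhs ly) (a *: w) x.
rewrite !(formZr fip) => F1 F2.
transitivity (ip (mkhs lz) (a *: u + v)); first by [].
transitivity (ip (mkhs ly) (a *: w + x)); last by [].
by rewrite F1 F2; congr (_ * _ + _); [exact: E1 | exact: E2].
Qed.

Lemma sa_ae : ae_invariant (ip := ip) (hrel H).
Proof.
move=> u w u' w' /Tsa.2[_ _ h] uu ww; apply/Tsa.2; split; try exact: hsP.
move=> y z Hyz; have [ly lz _] := Hyz.
have E := h _ _ Hyz.
have F1 : ip (mkhs lz) (u - u') = 0 by apply: (nrm_eq0_formr fip).
have F2 : ip (mkhs ly) (w - w') = 0 by apply: (nrm_eq0_formr fip).
move: F1 F2; rewrite !(formBr fip) => /eqP; rewrite subr_eq0 => /eqP F1 /eqP.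
rewrite subr_eq0 => /eqP F2.
by move: E; rewrite -[inner z u]/(ip (mkhs lz) u) -[inner y w]/(ip (mkhs ly) w) F1 F2.
Qed.

Lemma closure_L2 u w : H u w -> L2 u /\ L2 w.
Proof. by case. Qed.

Lemma closure_value u w : H u w -> L2 (value H u).
Proof.
move=> h; have [] // : H u (value H u).
by apply: (@xgetPex _ 0 [set w | H u w]); exists w.
Qed.

Lemma nrm_mkB u w (lu : L2 u) (lw : L2 w) : nrm ip (mkhs lu - mkhs lw) = hnorm (u - w).
Proof. by rewrite nrm_hnorm hvalB. Qed.

(** A self-adjoint operator equals its adjoint, and the pairing with a graph is
    determined by a core of it. *)
Lemma sa_core (f g : hs) : (forall u w, T u w -> L2 u /\ L2 w) ->
  (forall u w, T u w -> inner w f = inner u g) -> H f g.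
Proof.
move=> TL2 hT; apply/Tsa.2; split; try exact: hsP.
move=> u w [lu lw ap]; apply/eqP; rewrite -subr_eq0; apply/eqP/normc_eq0P.
apply: eq0_small; first exact: normc_ge0.
move=> e e0; pose B := nrm ip f + nrm ip g + 1.
have B0 : 0 < B by rewrite ltr_wpDl // addr_ge0 // nrm_ge0.
have [u' [w' [Tu hu hw]]] := ap _ (divr_gt0 e0 B0).
have [lu' lw'] := TL2 _ _ Tu.
have E : ip (mkhs lw') f = ip (mkhs lu') g by exact: hT.
have -> : inner w f - inner u g = ip (mkhs lw - mkhs lw') f - ip (mkhs lu - mkhs lu') g.
  by rewrite !(formBl fip) E; rewrite opprB addrA subrK.
apply: (le_trans (normc_ler _ _)); rewrite normcN.
have c1 := formCS fip (mkhs lw - mkhs lw') f.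
have c2 := formCS fip (mkhs lu - mkhs lu') g.
have {}hu : nrm ip (mkhs lu - mkhs lu') <= e / B by apply: ltW.
have {}hw : nrm ip (mkhs lw - mkhs lw') <= e / B by apply: ltW.
apply: (@le_trans _ _ (e / B * nrm ip f + e / B * nrm ip g)).
  by apply: lerD; [apply: (le_trans c1)|apply: (le_trans c2)]; rewrite ler_wpM2r // nrm_ge0.
rewrite -mulrDr -mulrA ler_piMr ?(ltW e0) // mulrC ler_pdivrMr // mul1r /B lerDl //.
Qed.

(** A self-adjoint operator has a single value up to null sets, because its domain is
    dense. *)
Lemma sa_value u w : H u w -> hnorm (value H u - w) = 0.
Proof.
move=> Huw; have [lu lw _] := Huw.
have Hv : H u (value H u) by apply: (@xgetPex _ 0 [set w | H u w]); exists w.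
have [_ lv _] := Hv.
have := sa_linear_rel (-1) (u := mkhs lu) (w := mkhs lw) (v := mkhs lu) (x := mkhs lv) Huw Hv.
rewrite !scaleN1r addNr => H0.
(* an element (0, y) of the graph is orthogonal to a dense set *)
set y := - mkhs lw + mkhs lv in H0.
have yperp v z : hrel H v z -> ip y v = 0.
  by move=> Hvz; rewrite (sa_sym_rel H0 Hvz) (form0l fip).
have y0 : nrm ip y = 0.
  apply: eq0_small; first exact: nrm_ge0.
  move=> e e0; have [v [z Hvz] hv] := Tsa.1 _ (hsP y) _ e0.
  have [lv' lz' _] := Hvz.
  have Py := pyth fip (u := y) (v := - mkhs lv').
  rewrite (formNr fip) (yperp (mkhs lv') (mkhs lz') Hvz) oppr0 in Py.
  apply: (@le_trans _ _ (nrm ip (y - mkhs lv'))); last exact: ltW.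
  by rewrite /nrm ler_wsqrtr // Py // lerDl (form_ge0 fip).
have E : mkhs lv - mkhs lw = y by rewrite /y addrC.
by rewrite -(nrm_mkB lv lw) E.
Qed.

End SelfAdjointRelation.

Section Potentials.
Context {R : realType}.
Variables (kappa : int) (phisc phiel phiam : R -> R).
Local Notation mu := (@half_line R).
Local Notation l2 f := (f \in Lfun mu 2%:E).
Local Notation T0 := (dirac_min_op kappa phisc phiel phiam).
Local Notation H := (dirac_op kappa phisc phiel phiam).

(** The hypotheses on the potentials hold up to null sets and say nothing on
    measurability. Here V, W and a are measurable representatives of the entries of
    the potential matrix, with one constant for their singularity at 0. *)
Record regular_potentials (V W a : R -> R) (K : R) : Prop := {
  rp_mV : measurable_fun setT (V : measurableTypeR R -> R);
  rp_mW : measurable_fun setT (W : measurableTypeR R -> R);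
  rp_ma : measurable_fun setT (a : measurableTypeR R -> R);
  rp_K : 0 <= K;
  rp_bV : forall r, 0 < r -> `|V r| <= K * (1 + r^-1);
  rp_bW : forall r, 0 < r -> `|W r| <= K * (1 + r^-1);
  rp_ba : forall r, 0 < r -> `|a r| <= K * (1 + r^-1);
  rp_ae : {ae mu, forall r, [/\ V r = 1 + phisc r + phiel r,
     W r = - 1 - phisc r + phiel r & a r = kappa%:~R / r + phiam r]} }.

Lemma coulomb_bound c (phi : R -> R) : coulomb_plus_bounded c phi -> exists2 M, 0 <= M &
  {ae mu, forall r, 0 < r -> `|phi r| <= `|c| / r + M}.
Proof.
move=> [chi [psi [h1 h2 h3]]].
have : (ess_sup mu (fun r => `|(psi r)%:E|) < +oo)%E.
  move: h3; rewrite inE => /andP[_]; rewrite inE /= /finite_norm unlock /=.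
  case: ifPn => // m0 _.
  apply: (@le_lt_trans _ _ 0%E) => //; apply/ess_supP.
  exists setT; split=> //; apply/eqP; rewrite eq_le measure_ge0 andbT leNgt; exact: m0.
move=> h; have [M hM] := @ess_supr_bounded _ _ _ mu (fun r : measurableTypeR R => `|psi r|) h.
exists `|M| => //; apply: (hlS hM) => r hr r0.
rewrite h1 // (le_trans (ler_normD _ _)) // lerD //.
  by apply: (le_trans (h2 r r0)); rewrite ler_wpM2r ?invr_ge0 ?(ltW r0) // ler_norm.
by apply: (le_trans hr); exact: ler_norm.
Qed.

Lemma truncate_potential (V : R -> R) K :
  measurable_fun setT ((fun x => (0 < x)%R%:R * V x) : measurableTypeR R -> R) ->
  {ae mu, forall r, 0 < r -> `|V r| <= K * (1 + r^-1)} -> 0 <= K ->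
  exists V', [/\ measurable_fun setT (V' : measurableTypeR R -> R),
    forall r, 0 < r -> `|V' r| <= K * (1 + r^-1) & {ae mu, forall r, V' r = V r}].
Proof.
move=> mV hV K0.
pose U (x : measurableTypeR R) := (0 < x)%R%:R * V x.
pose m (x : measurableTypeR R) := K * (1 + x `^ (-1)).
have mm : measurable_fun setT m.
  apply: measurable_funM => //; apply: measurable_funD => //; exact: measurable_powR.
have m0 r : 0 <= m r by rewrite mulr_ge0 // addr_ge0 // powR_ge0.
have mE r : 0 < r -> m r = K * (1 + r^-1) by move=> r0; rewrite /m powR_inv1 // ltW.
exists (fun x => Num.max (- m x) (Num.min (U x) (m x))); split.
- by apply: measurable_maxr; [exact: measurableT_comp | exact: measurable_minr].
- move=> r r0; rewrite -mE // ler_norml le_max lexx /= ge_max ge_min lexx orbT andbT.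
  by rewrite (le_trans _ (m0 r)) // oppr_le0.
have hp := @ae_half_line R (fun r => 0 < r) (fun r h => h).
apply: (hlS (hlI hV hp)) => r [h r0].
rewrite /U r0 mul1r; have := h r0; rewrite -mE // ler_norml => /andP[h1 h2].
by rewrite (min_idPl h2) (max_idPr h1).
Qed.

Hypothesis ess : ess_selfadjoint T0.

Lemma core_L2 u : test_function u.1 -> test_function u.2 ->
  L2 (dirac_expr kappa phisc phiel phiam u).
Proof. by move=> t1 t2; have [] := ess.1 u (dirac_expr kappa phisc phiel phiam u). Qed.

Lemma derive1_0 (x : R) : derive1 (fun=> 0 : R) x = 0.
Proof. by rewrite derive1E derive_val. Qed.

(** Applying the operator to bump functions must give square integrable, hence
    measurable, functions. *)
Lemma measurable_potentials :
  [/\ measurable_fun setT ((fun x => (0 < x)%R%:R * (1 + phisc x + phiel x)) : measurableTypeR R -> R),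
      measurable_fun setT ((fun x => (0 < x)%R%:R * (- 1 - phisc x + phiel x)) : measurableTypeR R -> R) &
      measurable_fun setT ((fun x => (0 < x)%R%:R * (kappa%:~R / x + phiam x)) : measurableTypeR R -> R)].
Proof.
have tb a b a0 := @test_flats R a b [:: (1, 1)] a0.
have t0 := @test_function0 R.
split; apply: measurable_by_bumps => a b a0; have t := tb a b a0.
- have [[+ _] _] := @core_L2 ((fun x => (bump a b x)%:C), fun=> 0) t t0.
  move=> /l2_measurable; congr (measurable_fun _ _); apply/funext => r.
  by rewrite /dirac_expr /cderive /= derive1_0; ring.
- have [_ [+ _]] := @core_L2 ((fun=> 0), (fun x => (bump a b x)%:C)) t0 t.
  move=> /l2_measurable; congr (measurable_fun _ _); apply/funext => r.
  by rewrite /cderive /= derive1_0 !mulr0 !subr0 !add0r.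
have [_ [+ _]] := @core_L2 ((fun x => (bump a b x)%:C), fun=> 0) t t0.
move=> /l2_measurable mh.
have md : measurable_fun setT (flats a b (dflats [:: (1, 1)]) : measurableTypeR R -> R).
  apply: continuous_measurable_fun => x.
  apply: differentiable_continuous; apply/derivable1_diffP.
  by have := is_derive_flats a b (dflats [:: (1, 1)]) x.
have := measurable_funB mh md; congr (measurable_fun _ _); apply/funext => r.
rewrite /cderive /= derive1E (derive_val (is_derive := is_derive_flats a b [:: (1, 1)] r)).
by rewrite -/(bump a b r) /=; ring.
Qed.

Lemma potentials_regular c : coulomb_plus_bounded c phisc -> coulomb_plus_bounded c phiel ->
  coulomb_plus_bounded c phiam -> exists V W a K, regular_potentials V W a K.
Proof.
move=> /coulomb_bound[M1 M10 h1] /coulomb_bound[M2 M20 h2] /coulomb_bound[M3 M30 h3].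
pose K := 1 + 2 * `|c| + `|kappa%:~R : R| + M1 + M2 + M3.
have K0 : 0 <= K by rewrite /K !addr_ge0 // mulr_ge0.
have [mV mW ma] := measurable_potentials.
have nV r : `|phisc r| <= `|c| / r + M1 -> `|phiel r| <= `|c| / r + M2 ->
    `|phiam r| <= `|c| / r + M3 -> 0 < r ->
    [/\ `|1 + phisc r + phiel r| <= K * (1 + r^-1), `|- 1 - phisc r + phiel r| <= K * (1 + r^-1)
      & `|kappa%:~R / r + phiam r| <= K * (1 + r^-1)].
  move=> a1 a2 a3 r0; have ri : 0 < r^-1 by rewrite invr_gt0.
  have KE : 1 + 2 * (`|c| * r^-1) + `|kappa%:~R : R| * r^-1 + M1 + M2 + M3 <= K * (1 + r^-1).
    have p0 : 0 <= (1 + M1 + M2 + M3) * r^-1 by rewrite mulr_ge0 ?addr_ge0 // ltW.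
    have p1 : 0 <= 2 * `|c| + `|kappa%:~R : R| by rewrite addr_ge0 // mulr_ge0.
    move: p0 p1; rewrite /K; lra.
  have ci : 0 <= `|c| / r by rewrite mulr_ge0 // ltW.
  have ki : 0 <= `|kappa%:~R : R| * r^-1 by rewrite mulr_ge0 // ltW.
  split; apply: le_trans KE.
  - apply: (le_trans (ler_normD _ _)); apply: (le_trans (lerD (ler_normD _ _) (lexx _))).
    by rewrite normr1; lra.
  - apply: (le_trans (ler_normD _ _)); apply: (le_trans (lerD (ler_normB _ _) (lexx _))).
    by rewrite normrN normr1; lra.
  - apply: (le_trans (ler_normD _ _)); rewrite normrM (ger0_norm (ltW ri)); lra.
have hK : {ae mu, forall r, 0 < r -> [/\ `|1 + phisc r + phiel r| <= K * (1 + r^-1),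
    `|- 1 - phisc r + phiel r| <= K * (1 + r^-1) & `|kappa%:~R / r + phiam r| <= K * (1 + r^-1)]}.
  by apply: (hlS (hlI h1 (hlI h2 h3))) => r [a1 [a2 a3]] r0; apply: nV => //; [exact: a1|exact: a2|exact: a3].
have [|V [mV' bV eV]] := truncate_potential mV _ K0.
  by apply: (hlS hK) => r h r0; have [] := h r0.
have [|W [mW' bW eW]] := truncate_potential mW _ K0.
  by apply: (hlS hK) => r h r0; have [] := h r0.
have [|a [ma' ba ea]] := truncate_potential ma _ K0.
  by apply: (hlS hK) => r h r0; have [] := h r0.
exists V, W, a, K; split => //.
by apply: (hlS (hlI eV (hlI eW ea))) => r [-> [-> ->]].
Qed.

End Potentials.

(** * Hermite functions in the domain *)

Section HermiteDomain.
Context {R : realType}.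
Local Notation mu := (@half_line R).
Local Notation l2 f := (f \in Lfun mu 2%:E).
Local Notation hw := (gw (2^-1 : R)).
Implicit Types (p q s : {poly R}).

Lemma contM (f g : R -> R) : continuous f -> continuous g -> continuous (fun x => f x * g x).
Proof. by move=> cf cg x; apply: cvgM; [exact: cf | exact: cg]. Qed.
Lemma contD (f g : R -> R) : continuous f -> continuous g -> continuous (fun x => f x + g x).
Proof. by move=> cf cg x; apply: cvgD; [exact: cf | exact: cg]. Qed.
Lemma contB (f g : R -> R) : continuous f -> continuous g -> continuous (fun x => f x - g x).
Proof. by move=> cf cg x; apply: cvgB; [exact: cf | exact: cg]. Qed.

Lemma compact_bound (F : R -> R) (a b : R) : continuous F ->
  (forall x, x < a \/ b < x -> F x = 0) ->
  exists2 C, 0 <= C & forall x, 0 <= x -> `|F x| <= C * expR (- x).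
Proof.
move=> cF F0; have [ab|ba] := leP a b; last first.
  exists 0 => // x _; rewrite F0 ?normr0 ?mul0r //.
  by have [xa|ax] := ltP x a; [left | right; exact: lt_le_trans ba ax].
have cn : {within `[a, b], continuous (fun x => `|F x|)}.
  apply: continuous_subspaceT => x; apply: (@continuous_comp _ _ _ F Num.norm); first exact: cF.
  exact: norm_continuous.
have [c _ hc] := EVT_max ab cn.
exists (`|F c| * expR b); first by rewrite mulr_ge0 ?expR_ge0.
move=> x _; have [xab|xab] := boolP (x \in `[a, b]).
  rewrite -mulrA -expRD -[leLHS]mulr1 ler_pM //; first exact: hc.
  by rewrite -expR0 ler_expR subr_ge0; move: xab; rewrite in_itv => /andP[].
rewrite F0 ?normr0 ?mulr_ge0 ?expR_ge0 //.
by move: xab; rewrite in_itv /= negb_and -!ltNge => /orP.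
Qed.

Lemma compact_FTC (F F' : R -> R) (a b : R) : 0 < a ->
  (forall x : R, is_derive x (1 : R) F (F' x)) -> continuous F' ->
  (forall x, x < a \/ b < x -> F x = 0) -> (forall x, x < a \/ b < x -> F' x = 0) ->
  rint mu F' = 0.
Proof.
move=> a0 dF cF' F0 F'0.
have cF : continuous F.
  move=> x; apply: differentiable_continuous; apply/derivable1_diffP.
  by have := dF x.
have [C C0 hC] := compact_bound cF F0; have [C' C0' hC'] := compact_bound cF' F'0.
have h1 x : 0 <= x -> `|F' x| <= (C + C') * expR (- x).
  by move=> x0; apply: (le_trans (hC' x x0)); rewrite ler_wpM2r ?expR_ge0 // lerDr.
have h2 x : 0 <= x -> `|F x| <= (C + C') * expR (- x).
  by move=> x0; apply: (le_trans (hC x x0)); rewrite ler_wpM2r ?expR_ge0 // lerDl.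
have [_ ->] := half_line_FTC cF' dF h1 h2.
by rewrite F0 ?oppr0 //; left.
Qed.

Lemma l2_bound (A : R) (f g1 g2 : R -> R) : 0 <= A ->
  measurable_fun setT (f : measurableTypeR R -> R) -> l2 g1 -> l2 g2 ->
  (forall r, 0 < r -> f r ^+ 2 <= A * (g1 r ^+ 2 + g2 r ^+ 2)) ->
  l2 f /\ rdot mu f f <= A * (rdot mu g1 g1 + rdot mu g2 g2).
Proof.
move=> A0 mf l1 l2' h.
have m1 := l2_measurable l1; have m2 := l2_measurable l2'.
have msq (k : measurableTypeR R -> R) : measurable_fun setT k ->
    measurable_fun setT (fun x => (k x ^+ 2)%:E).
  by move=> mk; apply/measurable_EFinP; exact: measurable_funX.
have key : (\int[mu]_x ((f x) ^+ 2)%:E <= (A * (rdot mu g1 g1 + rdot mu g2 g2))%:E)%E.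
  rewrite EFinM EFinD !rdotE // -ge0_integralD //; try exact: msq;
    try (by move=> x _; rewrite lee_fin sqr_ge0).
  rewrite -ge0_integralZl_EFin //; first last.
  - by apply: emeasurable_funD; exact: msq.
  - by move=> x _; rewrite adde_ge0 // lee_fin sqr_ge0.
  apply: ae_ge0_le_integral => //.
  - by move=> x _; rewrite lee_fin sqr_ge0.
  - exact: msq.
  - by move=> x _; rewrite mule_ge0 ?adde_ge0 ?lee_fin ?sqr_ge0.
  - by apply: emeasurable_funM => //; apply: emeasurable_funD; exact: msq.
  have := @ae_half_line R (fun r => setT r -> ((f r ^+ 2)%:E <= A%:E * ((g1 r ^+ 2)%:E + (g2 r ^+ 2)%:E))%E).
  by apply => r r0 _; rewrite -EFinD -EFinM lee_fin h.
have lf : l2 f by apply: l2P => //; apply: (le_lt_trans key); rewrite ltry.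
by split => //; rewrite -lee_fin rdotE.
Qed.

Lemma rdot_add_le (f g : measurableTypeR R -> R) : l2 f -> l2 g ->
  rdot mu (f \+ g) (f \+ g) <= 2 * rdot mu f f + 2 * rdot mu g g.
Proof.
move=> lf lg; have := rdot_ge0 mu (f \- g).
have lN := l2N lg.
rewrite (_ : (f \- g) = f \+ (fun x => -1 * g x)); last by apply/funext => x /=; rewrite mulN1r.
have lN1 := l2Z (-1) lg.
rewrite !rdotDl //; try exact: l2D.
rewrite ![rdot mu _ (_ \+ _)]rdotC !rdotDl //.
by rewrite !rdotZl // ![rdot mu _ (fun x => -1 * g x)]rdotC !rdotZl // [rdot mu g f]rdotC; lra.
Qed.

(** The bounded part is trivial; for the part 1/r this is Hardy, as p(0) = 0. *)
Lemma potential_bound (U : R -> R) K p : 0 <= K ->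
  measurable_fun setT (U : measurableTypeR R -> R) ->
  (forall r, 0 < r -> `|U r| <= K * (1 + r^-1)) -> p.[0] = 0 ->
  l2 (fun r => U r * hw p r) /\
  rdot mu (fun r => U r * hw p r) (fun r => U r * hw p r) <=
    (2 * K ^+ 2) * (gI (p * p) + 4 * gI (dp p * dp p)).
Proof.
move=> K0 mU hU p0.
have [s ps] : exists s, p = 'X * s.
  have /factor_theorem [s ->] : root p 0 by rewrite /root p0.
  by exists s; rewrite subr0 mulrC.
have A0 : 0 <= 2 * K ^+ 2 by rewrite mulr_ge0 ?sqr_ge0.
have mf : measurable_fun setT ((fun r => U r * hw p r) : measurableTypeR R -> R).
  by apply: measurable_funM => //; exact: measurable_gw.
have hpt r : 0 < r -> (U r * hw p r) ^+ 2 <= 2 * K ^+ 2 * (hw p r ^+ 2 + hw s r ^+ 2).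
  move=> r0; have hp : hw p r = r * hw s r by rewrite ps /gw hornerM hornerX -mulrA.
  rewrite exprMn hp.
  have : U r ^+ 2 <= K ^+ 2 * (1 + r^-1) ^+ 2.
    rewrite -(real_normK (num_real (U r))) -exprMn ler_sqr ?nnegrE //; first exact: hU.
    by rewrite mulr_ge0 // addr_ge0 // invr_ge0 ltW.
  have h2 : 0 <= (r * hw s r) ^+ 2 by rewrite sqr_ge0.
  move=> /(ler_wpM2r h2) /le_trans; apply.
  rewrite [leLHS](_ : _ = K ^+ 2 * ((r + 1) * hw s r) ^+ 2); last by field; rewrite gt_eqF.
  rewrite -subr_ge0 (_ : _ - _ = K ^+ 2 * ((r - 1) * hw s r) ^+ 2); last by ring.
  by rewrite mulr_ge0 ?sqr_ge0.
have [l b] := l2_bound A0 mf (l2_hw p) (l2_hw s) hpt.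
split => //; apply: (le_trans b); rewrite ler_wpM2l ?mulr_ge0 ?sqr_ge0 // rdot_gw lerD //.
by apply: (le_trans (hardy s)); rewrite rdot_gw -ps.
Qed.

Lemma weight_arith (k x y : R) : 0 <= k * x -> (2 * k) * (x + 4 * y) <= 8 * k * (x + y).
Proof. by move=> *; lra. Qed.

Lemma D_arith (k ep eq dq' dp' v ap aq w n m : R) :
  n <= 2 * dq' + 2 * aq -> m <= 2 * dp' + 2 * ap ->
  v <= 8 * k * ep -> ap <= 8 * k * ep -> aq <= 8 * k * eq -> w <= 8 * k * eq ->
  0 <= k * ep -> 0 <= k * eq -> dp' <= ep -> dq' <= eq ->
  2 * v + 2 * n + (2 * m + 2 * w) <= (80 * k + 4) * (ep + eq).
Proof. by move=> *; lra. Qed.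

Section Regular.
Variables (kappa : int) (phisc phiel phiam : R -> R) (V W a : R -> R) (K : R).
Hypothesis rp : regular_potentials kappa phisc phiel phiam V W a K.
Local Notation T0 := (dirac_min_op kappa phisc phiel phiam).
Local Notation H := (dirac_op kappa phisc phiel phiam).

Definition D1 p q (r : measurableTypeR R) : R := V r * hw p r + (- hw (dp q) r + a r * hw q r).
Definition D2 p q (r : measurableTypeR R) : R := (hw (dp p) r + a r * hw p r) + W r * hw q r.
(** The squared norm of the Sobolev space of first order, which dominates the graph
    norm of the Dirac operator on functions vanishing at 0. *)
Definition energy p : R := gI (p * p) + gI (dp p * dp p).

Lemma energy_ge0 p : 0 <= energy p.
Proof. by rewrite addr_ge0 // gI_sqr_ge0. Qed.

Lemma D_bound p q : p.[0] = 0 -> q.[0] = 0 -> [/\ l2 (D1 p q), l2 (D2 p q) &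
  rdot mu (D1 p q) (D1 p q) + rdot mu (D2 p q) (D2 p q) <=
   (80 * K ^+ 2 + 4) * (energy p + energy q)].
Proof.
move=> p0 q0.
have [lVp bVp] := potential_bound (rp_K rp) (rp_mV rp) (rp_bV rp) p0.
have [lap bap] := potential_bound (rp_K rp) (rp_ma rp) (rp_ba rp) p0.
have [laq baq] := potential_bound (rp_K rp) (rp_ma rp) (rp_ba rp) q0.
have [lWq bWq] := potential_bound (rp_K rp) (rp_mW rp) (rp_bW rp) q0.
have lN := l2N (l2_hw (dp q)).
have lp := l2_hw (dp p).
have l1 : l2 (D1 p q) by apply: l2D => //; exact: l2D.
have l2' : l2 (D2 p q) by apply: l2D => //; exact: l2D.
split=> //.
have i1 := rdot_add_le lVp (l2D lN laq); have i2 := rdot_add_le lN laq.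
have i3 := rdot_add_le (l2D lp lap) lWq; have i4 := rdot_add_le lp lap.
have eN : rdot mu (\- hw (dp q)) (\- hw (dp q)) = gI (dp q * dp q).
  by rewrite -rdot_gw; apply: eq_Rintegral => x _ /=; rewrite mulrNN.
rewrite eN in i2; rewrite rdot_gw in i4.
have g1 := gI_sqr_ge0 p; have g2 := gI_sqr_ge0 q.
have g3 := gI_sqr_ge0 (dp p); have g4 := gI_sqr_ge0 (dp q).
have kp x y : 0 <= x -> 0 <= y -> (2 * K ^+ 2) * (x + 4 * y) <= 8 * K ^+ 2 * (x + y).
  move=> x0 y0; have k0 := sqr_ge0 K.
  exact: weight_arith (mulr_ge0 k0 x0).
have {}bVp := le_trans bVp (kp _ _ g1 g3); have {}bap := le_trans bap (kp _ _ g1 g3).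
have {}baq := le_trans baq (kp _ _ g2 g4); have {}bWq := le_trans bWq (kp _ _ g2 g4).
have k0 := sqr_ge0 K.
have E0 := mulr_ge0 k0 (energy_ge0 p); have F0 := mulr_ge0 k0 (energy_ge0 q).
rewrite -/(energy p) -/(energy q) in bVp bap baq bWq.
have e1 : gI (dp p * dp p) <= energy p by rewrite lerDr.
have e2 : gI (dp q * dp q) <= energy q by rewrite lerDr.
apply: (le_trans (lerD i1 i3)).
exact: (D_arith i2 i4 bVp bap baq bWq E0 F0 e1 e2).
Qed.

Definition rsp (f g : R -> R) : @spinor R := ((fun r => (f r)%:C), (fun r => (g r)%:C)).

Lemma L2_rsp (f g : R -> R) : l2 f -> l2 g -> L2 (rsp f g).
Proof. by move=> lf lg; split; exact: cL2R. Qed.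

Lemma cdot_real (h : R -> R[i]) (g : R -> R) : cL2 h -> l2 g ->
  cdot h (fun r => (g r)%:C) = rdot mu (rre h) g +i* rdot mu (rim h) g.
Proof.
move=> lh lg; rewrite cdotE //; last exact: cL2R.
have e0 k : rdot mu k (rim (fun r => (g r)%:C)) = 0.
  by rewrite /rdot /rint (_ : _ \* _ = fun=> 0) ?Rintegral_cst ?mul0r //;
    apply/funext => r; rewrite /= mulr0.
by rewrite !e0 addr0 subr0.
Qed.

Lemma core_ibp (al be w1 w2 : R -> R) (x0 x1 : R) p q : p.[0] = 0 -> q.[0] = 0 ->
  0 < x0 -> smooth al -> smooth be ->
  (forall x, x < x0 \/ x1 < x -> al x = 0) -> (forall x, x < x0 \/ x1 < x -> be x = 0) ->
  l2 al -> l2 be -> l2 w1 -> l2 w2 ->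
  (forall r, w1 r = (1 + phisc r + phiel r) * al r + (- derive1 be r + (kappa%:~R / r + phiam r) * be r)) ->
  (forall r, w2 r = (derive1 al r + (kappa%:~R / r + phiam r) * al r) + (- 1 - phisc r + phiel r) * be r) ->
  rdot mu w1 (hw p) + rdot mu w2 (hw q) = rdot mu al (D1 p q) + rdot mu be (D2 p q).
Proof.
move=> p0 q0 x00 sa sb a0 b0 la lb lw1 lw2 e1 e2.
have [lD1 lD2 _] := D_bound p0 q0.
have lp := l2_hw p; have lq := l2_hw q.
have da (x : R) : is_derive x (1 : R) al (derive1 al x).
  by rewrite derive1E; apply: derivableP; exact: (sa 0%N).
have db (x : R) : is_derive x (1 : R) be (derive1 be x).
  by rewrite derive1E; apply: derivableP; exact: (sb 0%N).
have ca : continuous (derive1 al).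
  by move=> x; apply: differentiable_continuous; apply/derivable1_diffP; exact: (sa 1%N).
have cb : continuous (derive1 be).
  by move=> x; apply: differentiable_continuous; apply/derivable1_diffP; exact: (sb 1%N).
have cal : continuous al.
  by move=> x; apply: differentiable_continuous; apply/derivable1_diffP; exact: (sa 0%N).
have cbe : continuous be.
  by move=> x; apply: differentiable_continuous; apply/derivable1_diffP; exact: (sb 0%N).
pose F x := al x * hw q x - be x * hw p x.
pose F' x := (al x * hw (dp q) x + derive1 al x * hw q x) - (be x * hw (dp p) x + derive1 be x * hw p x).
have dF (x : R) : is_derive x (1 : R) F (F' x).
  have h1 := @is_deriveM _ _ al (hw q) x 1 _ _ (da x) (is_derive_hw q x).
  have h2 := @is_deriveM _ _ be (hw p) x 1 _ _ (db x) (is_derive_hw p x).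
  have := @is_deriveB _ _ _ _ _ x 1 _ _ h1 h2; move=> h; apply: is_derive_eq.
  by rewrite /F' /GRing.scale /=; ring.
have cF' : continuous F'.
  have cgw (s : {poly R}) : continuous (hw s) by exact: continuous_gw.
  exact: contB (contD (contM cal (cgw _)) (contM ca (cgw _)))
    (contD (contM cbe (cgw _)) (contM cb (cgw _))).
have d0 (g : R -> R) : smooth g -> (forall x, x < x0 \/ x1 < x -> g x = 0) ->
    forall x, x < x0 \/ x1 < x -> derive1 g x = 0.
  move=> sg g0 x hx; rewrite derive1E.
  have nx : \forall y \near x, cst 0 y = g y.
    case: hx => hx; near=> y; rewrite g0 //; [left|right]; near: y.
      exact: lt_nbhsl.
    exact: lt_nbhsr.
  have := near_eq_is_derive nx (is_derive_cst (0 : R) x (1 : R)).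
  by move=> h; rewrite (derive_val (is_derive := h)).
have F0 x : x < x0 \/ x1 < x -> F x = 0 by move=> hx; rewrite /F a0 // b0 // !mul0r subr0.
have F'0 x : x < x0 \/ x1 < x -> F' x = 0.
  by move=> hx; rewrite /F' (d0 al) // (d0 be) // a0 // b0 // !mul0r !addr0 subr0.
have := compact_FTC x00 dF cF' F0 F'0; rewrite /rint => I0.
apply/eqP; rewrite -subr_eq0 opprD addrA; apply/eqP.
rewrite /rdot /rint -RintegralD //; try exact: l2_integrable.
have int1 : mu.-integrable setT (EFin \o (fun x => (w1 \* hw p) x + (w2 \* hw q) x)).
  by apply: (integrableD measurableT (l2_integrable lw1 lp) (l2_integrable lw2 lq)).
rewrite -RintegralB //; try exact: l2_integrable.
have int2 : mu.-integrable setT (EFin \o (fun x => (w1 \* hw p) x + (w2 \* hw q) x - (al \* D1 p q) x)).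
  exact: (integrableB measurableT int1 (l2_integrable la lD1)).
rewrite -RintegralB //; try exact: l2_integrable.
have int3 : mu.-integrable setT (EFin \o (fun x => (w1 \* hw p) x + (w2 \* hw q) x - (al \* D1 p q) x - (be \* D2 p q) x)).
  exact: (integrableB measurableT int2 (l2_integrable lb lD2)).
rewrite -[RHS]I0; congr fine; apply: ae_eq_integral => //.
- exact: (measurable_int mu int3).
- by apply/measurable_EFinP; exact: continuous_measurable_fun.
apply: (hlS (rp_ae rp)) => r [eV eW ea] _; congr (_%:E).
by rewrite /= e1 e2 /D1 /D2 /F' -eV -eW -ea; ring.
Unshelve. all: by end_near.
Qed.

Hypothesis ess : ess_selfadjoint T0.

(** By integration by parts such a spinor is in the domain of the adjoint, which is
    the operator itself. *)
Lemma rsp_in_dom p q : p.[0] = 0 -> q.[0] = 0 ->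
  H (rsp (hw p) (hw q)) (rsp (D1 p q) (D2 p q)).
Proof.
move=> p0 q0; have [lD1 lD2 _] := D_bound p0 q0.
have lf := L2_rsp (l2_hw p) (l2_hw q); have lg := L2_rsp lD1 lD2.
apply: (sa_core ess.2 (f := mkhs lf) (g := mkhs lg) ess.1) => u w T0u.
have [lu lw] := ess.1 _ _ T0u; have [t1 t2 we] := T0u.
have [[lu1r lu1i] [lu2r lu2i]] := lu; have [[lw1r lw1i] [lw2r lw2i]] := lw.
rewrite (innerE lw lf) (innerE lu lg) !cdot_real //; try exact: l2_hw.
have [s1 s2 [x0 [x1 [x00 z1]]]] := t1; have [s3 s4 [y0 [y1 [y00 z2]]]] := t2.
pose m0 := Num.min x0 y0; pose m1 := Num.max x1 y1.
have m00 : 0 < m0 by rewrite lt_min x00 y00.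
have z1' x : x < m0 \/ m1 < x -> u.1 x = 0.
  by rewrite lt_min gt_max => h; apply: z1; case: h => /andP[]; [left|right].
have z2' x : x < m0 \/ m1 < x -> u.2 x = 0.
  by rewrite lt_min gt_max => h; apply: z2; case: h => /andP[]; [left|right].
apply: complexP; rewrite ?cReD ?cImD /=.
  apply: (@core_ibp (rre u.1) (rre u.2) (rre w.1) (rre w.2) m0 m1 p q p0 q0 m00 s1 s3 _ _ lu1r lu2r lw1r lw2r).
  - by move=> x hx; rewrite /rre z1'.
  - by move=> x hx; rewrite /rre z2'.
  - by move=> r; rewrite we /rre /dirac_expr /= !cReD cReN !cReZ.
  - by move=> r; rewrite we /rre /dirac_expr /= !cReD !cReZ.
apply: (@core_ibp (rim u.1) (rim u.2) (rim w.1) (rim w.2) m0 m1 p q p0 q0 m00 s2 s4 _ _ lu1i lu2i lw1i lw2i).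
- by move=> x hx; rewrite /rim z1'.
- by move=> x hx; rewrite /rim z2'.
- by move=> r; rewrite we /rim /dirac_expr /= !cImD cImN !cImM /= !mul0r !addr0.
- by move=> r; rewrite we /rim /dirac_expr /= !cImD !cImM /= !mul0r !addr0.
Qed.
End Regular.
End HermiteDomain.

(** * Completeness of the odd Hermite functions *)

Section Completeness.
Context {R : realType}.
Local Notation mu := (@half_line R).
Local Notation leb := (@lebesgue_measure R).
Local Notation l2 f := (f \in Lfun mu 2%:E).
Local Notation hw := (gw (2^-1 : R)).

Lemma rint_DCT (f_ : nat -> R -> R) (f g : R -> R) :
  (forall n, measurable_fun setT (f_ n : measurableTypeR R -> R)) ->
  measurable_fun setT (f : measurableTypeR R -> R) ->
  {ae mu, forall r, (fun n => f_ n r) @ \oo --> f r} ->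
  mu.-integrable setT (EFin \o g) -> (forall n r, 0 < r -> `|f_ n r| <= g r) ->
  (forall n, rint mu (f_ n) = 0) -> rint mu f = 0.
Proof.
move=> mf_ mf cf ig fg f0.
have [] := @dominated_convergence _ _ _ mu setT measurableT (fun n r => (f_ n r)%:E)
  (fun r => (f r)%:E) (fun r => (g r)%:E).
- by move=> n; apply/measurable_EFinP.
- exact/measurable_EFinP.
- by apply: (hlS cf) => r h _; apply: cvg_EFin => //; near=> n.
- exact: ig.
- have := @ae_half_line R (fun r => forall n, setT r -> (`|(f_ n r)%:E| <= (g r)%:E)%E).
  by apply => r r0 n _; rewrite lee_fin fg.
move=> _ _ h; rewrite /rint /Rintegral.
have e n : (\int[mu]_x (f_ n x)%:E = 0)%E.
  have int_n : mu.-integrable setT (EFin \o f_ n) by apply: (dom_integrable (mf_ n) ig) => r; exact: fg.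
  rewrite -[LHS]fineK; last exact: integrable_fin_num.
  by have := f0 n; rewrite /rint /Rintegral => ->.
have h0 : [sequence (\int[mu]_x (f_ n x)%:E)%E]_n @ \oo --> (0 : \bar R)%E.
  rewrite (_ : [sequence _]_n = fun=> 0%E); first exact: cvg_cst.
  by apply/funext => n /=; rewrite e.
by rewrite (cvg_unique _ h h0).
Unshelve. all: by end_near.
Qed.

Lemma X2_Hp1 : 'X^2 * Hp 1 = 4^-1 *: Hp 3 + (3 / 2) *: Hp 1 :> {poly R}.
Proof.
rewrite (Hp_rec 1) [Hp 2]Hp_rec; set h := Hp 1.
have -> : h = 2 *: 'X by rewrite /h /= mulr1 -[X in _ - X^`()]polyC1 derivC subr0.
by apply/polyP => i; rewrite !(coefZ, coefB, coefD, coefXM, coefXnM, coefX, coefZ, coef1);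
  case: i => [|[|[|[|i]]]] /=; field.
Qed.

Lemma X2_Hp n : 'X^2 * Hp n.+2 = 4^-1 *: Hp n.+4 + (n.+2%:R + 2^-1) *: Hp n.+2
  + (n.+2%:R * n.+1%:R) *: Hp n :> {poly R}.
Proof.
move: (@Hp_rec R n.+2) (@Hp_rec R n.+1) (@Hp_rec R n).
move: (Hp n.+4) (Hp n.+3) (Hp n.+2) (Hp n.+1) (Hp n) => h4 h3 h2 h1 h0 -> -> ->.
apply: poly_horner_inj => u.
rewrite !(hornerD, hornerN, hornerZ, hornerM, hornerXn, hornerX).
rewrite -[n.+3%:R]natr1 -[n.+2%:R]natr1 -[n.+1%:R]natr1.
by field.
Qed.

Lemma normr_gw (a : R) p r : `|gw a p r| = `|p.[r]| * expR (- (a * r ^+ 2)).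
Proof. by rewrite normrM [X in _ * X]ger0_norm ?expR_ge0. Qed.

Variable f : R -> R.
Hypothesis lf : l2 f.

Lemma f_gw_int a p : 0 < a -> mu.-integrable setT (EFin \o (fun r => f r * gw a p r)).
Proof. by move=> a0; exact: (l2_integrable lf (l2_gw p a0)). Qed.

Lemma rint_fD a p q : 0 < a -> rint mu (fun r => f r * gw a (p + q) r) =
  rint mu (fun r => f r * gw a p r) + rint mu (fun r => f r * gw a q r).
Proof.
move=> a0; rewrite /rint -RintegralD //; try exact: f_gw_int.
by apply: eq_Rintegral => r _; rewrite gwD mulrDr.
Qed.

Lemma rint_fZ a c p : 0 < a -> rint mu (fun r => f r * gw a (c *: p) r) =
  c * rint mu (fun r => f r * gw a p r).
Proof.
move=> a0; rewrite /rint -RintegralZl //; last exact: f_gw_int.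
by apply: eq_Rintegral => r _; rewrite gwZ mulrCA.
Qed.

Hypothesis perp : forall k, rdot mu f (Phi k) = 0.

Lemma perp_Hp j : rint mu (fun r => f r * hw (Hp j.*2.+1) r) = 0.
Proof.
have -> : Hp j.*2.+1 = hnc j.*2.+1 *: psp j.*2.+1 :> {poly R}.
  by rewrite /psp scalerA mulfV ?scale1r // gt_eqF ?hnc_gt0.
have := perp j; rewrite Phi_psi => h.
by rewrite rint_fZ ?half_gt0 // [X in _ * X](_ : _ = 0) ?mulr0.
Qed.

Lemma perp_XHp k j : rint mu (fun r => f r * hw ('X^(k.*2) * Hp j.*2.+1) r) = 0.
Proof.
elim: k j => [|k IH] j; first by rewrite expr0 mul1r perp_Hp.
have h0 := @half_gt0 R.
have eX : 'X^(k.+1.*2) = 'X^(k.*2) * 'X^2 :> {poly R} by rewrite -exprD addn2 -doubleS.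
rewrite eX -mulrA; case: j => [|j].
  rewrite X2_Hp1 mulrDr -!scalerAr rint_fD // !rint_fZ //.
  by rewrite (IH 1%N) (IH 0%N) !mulr0 addr0.
rewrite doubleS X2_Hp !mulrDr -!scalerAr !rint_fD // !rint_fZ //.
have := IH j.+2; have := IH j.+1; rewrite !doubleS => -> ->.
by rewrite IH !mulr0 !addr0.
Qed.

Definition moments (a : R) := forall k, rint mu (fun r => f r * gw a 'X^(k.*2.+1) r) = 0.

Lemma moments_half : moments 2^-1.
Proof.
move=> k; have h0 := @half_gt0 R.
have := perp_XHp k 0; rewrite /= mulr1 -[X in _ - X^`()]polyC1 derivC subr0 -scalerAr rint_fZ //.
by move/eqP; rewrite mulf_eq0 pnatr_eq0 /= -exprSr => /eqP.
Qed.

Lemma exp_partial (x : R) n : 0 <= x -> `|series (exp_coeff (- x)) n| <= expR x.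
Proof.
move=> x0; apply: (le_trans (ler_norm_sum _ _ _)).
apply: (@le_trans _ _ (series (exp_coeff x) n)).
  apply: ler_sum => i _; rewrite /exp_coeff /= normrM normrX normrN (ger0_norm x0).
  by rewrite ger0_norm // invr_ge0.
apply: nondecreasing_cvgn_le; last exact: is_cvg_series_exp_coeff.
apply/nondecreasing_seqP => m; rewrite /series /= big_nat_recr //= lerDl.
by rewrite /exp_coeff /= divr_ge0 ?exprn_ge0.
Qed.

(** Multiplication by exp(-s r^2), expanded into its power series; for s <= 1/4 the
    Gaussian factor, of exponent a >= 1/2, dominates the partial sums. *)
Lemma moments_step a s : 2^-1 <= a -> 0 <= s <= 4^-1 -> moments a -> moments (a + s).
Proof.
move=> ha /andP[s0 s4] ma k.
have a0 : 0 < a by apply: lt_le_trans ha; rewrite invr_gt0.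
have q0 : 0 < 4^-1 :> R by rewrite invr_gt0.
have mf := l2_measurable lf.
pose f_ n r := f r * gw a 'X^(k.*2.+1) r * series (exp_coeff (- (s * r ^+ 2))) n.
have f_E n r : f_ n r = \sum_(0 <= i < n) ((- s) ^+ i / i`!%:R) * (f r * gw a 'X^((k + i).*2.+1) r).
  rewrite /f_ /series /= mulr_sumr; apply: eq_bigr => i _.
  rewrite /exp_coeff /= -mulNr exprMn /gw !hornerXn doubleD -addSn exprD -exprM mul2n.
  by ring.
have mf_ n : measurable_fun setT (f_ n : measurableTypeR R -> R).
  rewrite (_ : f_ n = fun r => \sum_(0 <= i < n) ((- s) ^+ i / i`!%:R) * (f r * gw a 'X^((k + i).*2.+1) r)).
    apply: measurable_sum => i; apply: measurable_funM => //; apply: measurable_funM => //.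
    exact: measurable_gw.
  by apply/funext => r; rewrite f_E.
apply: (@rint_DCT f_ _ (fun r => `|f r * gw 4^-1 'X^(k.*2.+1) r|)) => //.
- by apply: measurable_funM => //; exact: measurable_gw.
- have := @ae_half_line R (fun r => f_ n r @[n --> \oo] --> f r * gw (a + s) 'X^(k.*2.+1) r).
  apply => r _; rewrite (_ : f r * _ = f r * gw a 'X^(k.*2.+1) r * expR (- (s * r ^+ 2))).
    apply: cvgM; first exact: cvg_cst.
    exact: is_cvg_series_exp_coeff.
  by rewrite /gw -!mulrA -expRD; congr (_ * (_ * expR _)); ring.
- have := integrable_abse (f_gw_int 'X^(k.*2.+1) q0); congr (integrable _ _ _).
- move=> n r r0; rewrite /f_ normrM normrM [leRHS]normrM -mulrA ler_wpM2l // !normr_gw -mulrA ler_wpM2l //.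
  have x0 : 0 <= s * r ^+ 2 by rewrite mulr_ge0 ?sqr_ge0.
  apply: (le_trans (ler_wpM2l (expR_ge0 _) (exp_partial n x0))).
  rewrite -expRD ler_expR.
  have : 0 <= (a - s - 4^-1) * r ^+ 2.
    by rewrite mulr_ge0 ?sqr_ge0 //; move: ha s4; lra.
  lra.
move=> n; rewrite /rint (_ : (fun r => f_ n r) = fun r => \sum_(0 <= i < n) ((- s) ^+ i / i`!%:R) * (f r * gw a 'X^((k + i).*2.+1) r)); last by apply/funext => r; rewrite f_E.
elim: n => [|n IH].
  under eq_Rintegral => r _ do rewrite big_geq //.
  by rewrite Rintegral_cst ?mul0r.
have intn : mu.-integrable setT (EFin \o (fun r => \sum_(0 <= i < n) ((- s) ^+ i / i`!%:R) * (f r * gw a 'X^((k + i).*2.+1) r))).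
  have -> : EFin \o (fun r => \sum_(0 <= i < n) ((- s) ^+ i / i`!%:R) * (f r * gw a 'X^((k + i).*2.+1) r))
    = (fun r => \sum_(i <- index_iota 0 n) (((- s) ^+ i / i`!%:R) * (f r * gw a 'X^((k + i).*2.+1) r))%:E)%E.
    by apply/funext => r; rewrite /= sumEFin.
  apply: integrable_sum => // i _.
  have := integrableZl measurableT ((- s) ^+ i / i`!%:R) (f_gw_int 'X^((k + i).*2.+1) a0).
  by congr (integrable _ _ _).
under eq_Rintegral => r _ do rewrite big_nat_recr //=.
rewrite RintegralD //.
  rewrite IH RintegralZl //; last exact: f_gw_int.
  by have := ma (k + n)%N; rewrite /rint => ->; rewrite mulr0 addr0.
have := integrableZl measurableT ((- s) ^+ n / n`!%:R) (f_gw_int 'X^((k + n).*2.+1) a0).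
by congr (integrable _ _ _).
Qed.

Definition G r := f r * hw 'X r.

Lemma G_int : mu.-integrable setT (EFin \o G).
Proof. by apply: f_gw_int; exact: half_gt0. Qed.

Lemma G_exp s m : 0 <= s <= 4^-1 -> rint mu (fun r => G r * expR (- (s * r ^+ 2)) ^+ m) = 0.
Proof.
move=> hs; have hm : moments (2^-1 + m%:R * s).
  elim: m => [|m IH]; first by rewrite mul0r addr0; exact: moments_half.
  have -> : 2^-1 + m.+1%:R * s = 2^-1 + m%:R * s + s by rewrite -natr1; ring.
  apply: moments_step => //; rewrite lerDl mulr_ge0 //.
  by case/andP: hs.
have := hm 0%N; rewrite expr1 /rint => h; rewrite -[RHS]h.
apply: eq_Rintegral => r _; rewrite /G /gw -!mulrA -expRM_natl -expRD.
congr (_ * (_ * expR _)); ring.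
Qed.

Lemma G_expbnd (s r : R) : 0 <= s -> 0 <= expR (- (s * r ^+ 2)) <= 1.
Proof. by move=> s0; rewrite expR_ge0 -expR0 ler_expR oppr_le0 mulr_ge0 ?sqr_ge0. Qed.

Lemma measurable_expsq (s : R) : measurable_fun setT ((fun r => expR (- (s * r ^+ 2))) : measurableTypeR R -> R).
Proof.
have := measurable_gw s (1 : {poly R}); congr (measurable_fun _ _).
by apply/funext => r; rewrite /gw hornerC mul1r.
Qed.

Lemma G_poly_int s (P : {poly R}) : 0 <= s ->
  mu.-integrable setT (EFin \o (fun r => G r * P.[expR (- (s * r ^+ 2))])).
Proof.
move=> s0.
have mP : measurable_fun setT ((fun r => P.[expR (- (s * r ^+ 2))]) : measurableTypeR R -> R).
  apply: (@measurableT_comp _ _ _ _ _ _ (horner P : measurableTypeR R -> R)); last exact: measurable_expsq.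
  by apply: continuous_measurable_fun; exact: continuous_horner.
have /integrableP[/measurable_EFinP mG _] := G_int.
pose C := \sum_(i < size P) `|P`_i|.
apply: (@dom_integrable _ _ (fun r => C * `|G r|)).
- exact: measurable_funM.
- have := integrableZl measurableT C (integrable_abse G_int); congr (integrable _ _ _).
move=> r _; rewrite normrM mulrC ler_wpM2r //.
rewrite horner_coef (le_trans (ler_norm_sum _ _ _)) // ler_sum // => i _.
have /andP[e0 e1] := G_expbnd r s0.
by rewrite normrM ler_piMr // ger0_norm ?exprn_ge0 // exprn_ile1.
Qed.

Lemma G_poly s (P : {poly R}) : 0 <= s <= 4^-1 ->
  rint mu (fun r => G r * P.[expR (- (s * r ^+ 2))]) = 0.
Proof.
move=> hs; have s0 : 0 <= s by case/andP: hs.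
suff H n : rint mu (fun r => G r * (\sum_(i < n) P`_i *: 'X^i).[expR (- (s * r ^+ 2))]) = 0.
  have := H (size P); congr (rint _ _ = _); apply/funext => r; congr (_ * _).
  by rewrite horner_sum horner_coef; apply: eq_bigr => i _; rewrite hornerZ hornerXn.
elim: n => [|n IH].
  rewrite /rint; under eq_Rintegral => r _ do rewrite big_ord0 horner0 mulr0.
  by rewrite Rintegral_cst ?mul0r.
rewrite /rint; under eq_Rintegral => r _ do rewrite big_ord_recr /= hornerD mulrDr.
rewrite RintegralD //; try exact: G_poly_int.
rewrite -/(rint mu _) IH add0r.
under eq_Rintegral => r _ do rewrite hornerZ hornerXn mulrCA.
rewrite RintegralZl //; first by rewrite -/(rint mu _) G_exp // mulr0.
have := G_poly_int 'X^n s0; congr (integrable _ _ _); apply/funext => r.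
by rewrite /= hornerXn.
Qed.

Lemma bernoulli_le (t : R) n : 0 <= t <= 1 -> 1 - n%:R * t <= (1 - t) ^+ n.
Proof.
move=> /andP[t0 t1]; elim: n => [|n IH]; first by rewrite mul0r subr0 expr0.
have u0 : 0 <= 1 - t by rewrite subr_ge0.
rewrite exprS; apply: le_trans (ler_wpM2l u0 IH).
have h : 0 <= n%:R * t * t by rewrite !mulr_ge0.
by rewrite -natr1; move: h; lra.
Qed.

Lemma bernoulli_ge (t : R) n : 0 <= t <= 1 -> (1 - t) ^+ n * (1 + n%:R * t) <= 1.
Proof.
move=> /andP[t0 t1]; have u0 : 0 <= 1 - t by rewrite subr_ge0.
elim: n => [|n IH]; first by rewrite mul0r addr0 expr0 mulr1.
apply: le_trans IH; rewrite exprS -mulrA mulrCA ler_wpM2l ?exprn_ge0 //.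
have h : 0 <= n%:R * t * t by rewrite !mulr_ge0.
by rewrite -natr1; have := mulr_ge0 t0 t0; move: h; lra.
Qed.

(** By the Bernoulli inequality, as (2 y)^n tends to 0 or to infinity. *)
Lemma cvg_threshold (y : R) : 0 <= y <= 1 -> y != 2^-1 ->
  (fun n => (1 - y ^+ n) ^+ (2 ^ n)) @ \oo --> ((y < 2^-1)%R%:R : R).
Proof.
move=> /andP[y0 y1] yh.
have t01 n : 0 <= y ^+ n <= 1 by rewrite exprn_ge0 //= exprn_ile1.
have u0 n : 0 <= (1 - y ^+ n) ^+ (2 ^ n).
  by apply: exprn_ge0; rewrite subr_ge0; case/andP: (t01 n).
have u1 n : (1 - y ^+ n) ^+ (2 ^ n) <= 1.
  by apply: exprn_ile1; case/andP: (t01 n) => *; lra.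
have e2 n : (2 ^ n)%:R * y ^+ n = (2 * y) ^+ n :> R by rewrite natrX exprMn.
have [yl|yg] := ltP y 2^-1.
  apply: (@squeeze_cvgr _ _ _ _ (fun n => 1 - (2 * y) ^+ n) (fun=> 1)).
  - near=> n; rewrite u1 andbT -e2; exact: bernoulli_le.
  - rewrite -[X in _ --> X]subr0; apply: cvgB; first exact: cvg_cst.
    by apply: cvg_expr; rewrite ger0_norm ?mulr_ge0 //; move: yl; lra.
  - exact: cvg_cst.
have yg' : 2^-1 < y by rewrite lt_neqAle eq_sym yh.
apply: (@squeeze_cvgr _ _ _ _ (fun=> 0) (fun n => ((2 * y)^-1) ^+ n)).
- near=> n; rewrite u0 /=.
  have p : 0 < (2 * y) ^+ n by rewrite exprn_gt0 //; move: yg'; lra.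
  rewrite exprVn -[leRHS]mul1r ler_pdivlMr //; apply: le_trans (bernoulli_ge (2 ^ n) (t01 n)).
  by rewrite ler_wpM2l // e2 lerDr.
- exact: cvg_cst.
- apply: cvg_expr; have p : 1 < 2 * y by move: yg'; lra.
  by rewrite ger0_norm ?invr_ge0 ?(le_trans ler01 (ltW p)) // invf_lt1 // (lt_trans ltr01).
Unshelve. all: by end_near.
Qed.

Lemma G_tail b : 0 < b -> rint mu (fun r => G r * (b < r)%R%:R) = 0.
Proof.
move=> b0; have l0 : 0 < ln 2 :> R by rewrite ln_gt0 // ltr1n.
have b2 : 0 < b ^+ 2 by rewrite exprn_gt0.
have [m hm] : exists m : nat, 4 * ln 2 / b ^+ 2 < m.+1%:R.
  have x0 : 0 <= 4 * ln 2 / b ^+ 2 by rewrite divr_ge0 ?mulr_ge0 ?ltW.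
  by exists (Num.bound (4 * ln 2 / b ^+ 2)); apply: (lt_trans (archi_boundP x0)); rewrite ltr_nat.
pose s := ln 2 / b ^+ 2 / m.+1%:R.
have hs : 0 <= s <= 4^-1.
  apply/andP; split; first by rewrite !divr_ge0 ?ltW.
  by rewrite /s ler_pdivrMr //; move: hm; lra.
have s0 : 0 <= s by case/andP: hs.
pose y r := expR (- (s * r ^+ 2)) ^+ m.+1.
have yE r : y r = expR (- (ln 2 * (r / b) ^+ 2)).
  rewrite /y -expRM_natl; congr expR; rewrite /s; field.
  by rewrite !gt_eqF // ltr0n.
have y01 r : 0 <= y r <= 1.
  have /andP[e0 e1] := G_expbnd r s0.
  by rewrite /y exprn_ge0 //= exprn_ile1.
have half : 2^-1 = expR (- ln 2) :> R by rewrite expRN lnK // posrE.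
have ylt r : 0 < r -> (y r < 2^-1) = (b < r).
  move=> r0; rewrite yE half ltr_expR ltrN2 -[X in X < _]mulr1 ltr_pM2l //.
  by rewrite -[X in X < _](expr1n _ 2) ltr_pXn2r ?nnegrE ?divr_ge0 ?(ltW r0) ?(ltW b0) // ltr_pdivlMr // mul1r.
have mG : measurable_fun setT (G : measurableTypeR R -> R).
  by have /integrableP[/measurable_EFinP] := G_int.
have mI : measurable_fun setT ((fun r => (b < r)%R%:R) : measurableTypeR R -> R).
  have := @measurable_indic _ (measurableTypeR R) R setT (`]b, +oo[)%classic (measurable_itv _).
  congr (measurable_fun _ _); apply/funext => r; rewrite indicE.
  have -> // : (r \in (`]b, +oo[%classic : set (measurableTypeR R))) = (b < r).
  by apply/idP/idP; rewrite inE /= in_itv /= andbT.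
pose Pn (n : nat) : {poly R} := (1%:P - 'X^(m.+1 * n)) ^+ (2 ^ n)%N.
have PnE n r : (Pn n).[expR (- (s * r ^+ 2))] = (1 - y r ^+ n) ^+ (2 ^ n).
  by rewrite /Pn horner_exp hornerD hornerN hornerC hornerXn exprM.
apply: (@rint_DCT (fun n r => G r * (Pn n).[expR (- (s * r ^+ 2))]) _ (fun r => `|G r|)).
- by move=> n; have /integrableP[/measurable_EFinP] := G_poly_int (Pn n) s0.
- exact: measurable_funM.
- have nb : {ae mu, forall r, r != b}.
    exists [set b]; split; first exact: measurable_set1.
      rewrite /half_line /= /mrestr; apply: (@subset_measure0 _ _ _ leb _ [set b]) => //.
      - by apply: measurableI => //; exact: measurable_set1.
      - exact: lebesgue_measure_set1.
    by move=> r /= /negP; rewrite negbK => /eqP.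
  have h0 := @ae_half_line R (fun r => 0 < r) (fun r h => h).
  apply: (hlS (hlI nb h0)) => r [rb r0].
  under eq_cvg do rewrite PnE.
  rewrite -(ylt r r0); apply: cvgM; first exact: cvg_cst.
  apply: cvg_threshold => //; apply: contraNneq rb => yh.
  apply/eqP; have h1 := ylt r r0; rewrite yh ltxx in h1.
  have : y r = expR (- ln 2) by rewrite -half.
  rewrite yE => /expR_inj /oppr_inj /eqP; rewrite -[X in _ == X]mulr1 (inj_eq (mulfI (lt0r_neq0 l0))).
  rewrite sqrf_eq1 => /orP[/eqP e|/eqP e].
    by rewrite -(divfK (lt0r_neq0 b0) r) e mul1r.
  by have : 0 < r / b by [rewrite divr_gt0]; rewrite e oppr_gt0 ltr10.
- have := integrable_abse G_int; congr (integrable _ _ _).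
- move=> n r r0; rewrite normrM ler_piMr // PnE.
  have /andP[a0 a1] := y01 r.
  have t0 : 0 <= 1 - y r ^+ n <= 1.
    by rewrite subr_ge0 exprn_ile1 //= gerBl exprn_ge0.
  by rewrite ger0_norm; [rewrite exprn_ile1 //; case/andP: t0 | rewrite exprn_ge0 //; case/andP: t0].
by move=> n; apply: G_poly.
Qed.

(** A function orthogonal to all odd Hermite functions has vanishing integral against
    r exp(-(1/2 + s m) r^2) for all m, hence against polynomials in exp(-s r^2) and,
    in the limit, indicators of all half lines ]b, oo[. *)
Lemma hermite_total : {ae mu, forall r, f r = 0}.
Proof.
pose g (r : measurableTypeR R) := G r * (0 < r)%R%:R.
have mG : measurable_fun setT (G : measurableTypeR R -> R).
  by have /integrableP[/measurable_EFinP] := G_int.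
have mI b : measurable_fun setT ((fun r => (b < r)%R%:R) : measurableTypeR R -> R).
  have := @measurable_indic _ (measurableTypeR R) R setT (`]b, +oo[)%classic (measurable_itv _).
  congr (measurable_fun _ _); apply/funext => r; rewrite indicE.
  have -> // : (r \in (`]b, +oo[%classic : set (measurableTypeR R))) = (b < r).
  by apply/idP/idP; rewrite inE /= in_itv /= andbT.
have mg : measurable_fun setT g by exact: measurable_funM.
have gD : EFin \o g = (EFin \o G) \_ (`]0%R, +oo[%classic : set (measurableTypeR R)).
  apply/funext => r; rewrite /= patchE /g.
  case: ifPn; rewrite ?inE ?notin_setE /= in_itv /= andbT => h; first by rewrite h mulr1.
  by rewrite (negbTE (introN idP h)) mulr0.
have ig : leb.-integrable setT (EFin \o g).
  have /integrableP[mG' iG] := G_int; apply/integrableP; split; first exact/measurable_EFinP.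
  rewrite integral_half_line in iG; last by apply: measurableT_comp => //; exact/measurable_EFinP.
  rewrite integral_mkcond in iG; apply: le_lt_trans iG; rewrite le_eqVlt; apply/orP; left.
  apply/eqP; apply: eq_integral => r _.
  rewrite -[(EFin \o g) r]/((EFin \o g) r) gD !patchE; case: ifP => // _.
  by rewrite /= normr0.
pose F x := (\int[leb]_(t in [set` `]-oo, x]]) g t).
have Fc x : 0 < x -> F x = \int[leb]_t g t.
  move=> x0; have h := G_tail x0.
  rewrite /rint /Rintegral integral_half_line in h; last first.
    by apply/measurable_EFinP; exact: measurable_funM.
  have mxi : measurable_fun setT (fun r : measurableTypeR R => g r * (x < r)%R%:R).
    exact: measurable_funM.
  have ixg : leb.-integrable setT (EFin \o (fun r => g r * (x < r)%R%:R)).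
    apply: (le_integrable measurableT _ _ ig); first exact/measurable_EFinP.
    move=> r _; rewrite /= lee_fin normrM ler_piMr //.
    by case: (x < r); rewrite ?normr1 ?normr0.
  have h' : \int[leb]_t (g t * (x < t)%R%:R) = 0.
    rewrite -[RHS]h; congr fine; rewrite [RHS]integral_mkcond; apply: eq_integral => r _.
    rewrite patchE /g; case: ifPn; rewrite ?inE ?notin_setE /= in_itv /= andbT => hr.
      by rewrite hr mulr1.
    by rewrite (negbTE (introN idP hr)) mulr0 mul0r.
  rewrite -[RHS]subr0 -h' -RintegralB // /F Rintegral_mkcond.
  apply: eq_Rintegral => r _; rewrite patchE.
  case: ifPn; rewrite ?inE ?notin_setE /= in_itv /= => hr.
    by rewrite ltNge hr mulr0 subr0.
  by rewrite ltNge (negbTE (introN idP hr)) mulr1 subrr.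
have dF : {ae leb, forall x, derivable F x 1 /\ derive1 F x = g x}.
  apply: FTC1Ny; first by move=> y; apply: integrableS ig.
  have := integrable_locally measurableT ig; rewrite (_ : g \_ setT = g) //.
  by apply/funext => x; rewrite patchE in_setT.
have [N [mN N0 sub]] := dF; exists (N `|` ~` (`]0%R, +oo[%classic : set (measurableTypeR R))).
have mC := measurableC (@mD R).
split; first exact: measurableU.
  rewrite measureU0 //; last exact: half_lineC.
  rewrite /half_line /= /mrestr; apply: (@subset_measure0 _ _ _ leb _ N) => //.
  by apply: measurableI => //; exact: mD.
move=> x /= nf; have [x0|x0] := pselect (0 < x); last first.
  by right => /=; rewrite in_itv /= andbT.
left; apply: sub => /= -[_ e]; apply: nf.
have nx : \forall y \near x, cst (\int[leb]_t g t) y = F y.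
  by near=> y; rewrite Fc //; near: y; exact: lt_nbhsr.
have := near_eq_is_derive nx (is_derive_cst (\int[leb]_t g t) x (1 : R)).
move=> hd; move: e; rewrite derive1E (derive_val (is_derive := hd)) /g x0 mulr1 /G /gw hornerX.
move=> /esym/eqP; rewrite !mulf_eq0 expR_eq0 orbF (gt_eqF x0) orbF => /eqP.
by [].
Unshelve. all: by end_near.
Qed.

End Completeness.

(** * Spectral calculus of the oscillator *)

Section SpectralDecay.
Context {R : realType}.
Local Notation mu := (@half_line R).
Local Notation leb := (@lebesgue_measure R).
Local Notation l2 f := (f \in Lfun mu 2%:E).
Local Notation hw := (gw (2^-1 : R)).
Local Notation ip := (@hip R).
Let fip := @form_hip R.

Lemma itv_FTC (f F : R -> R) (r : R) : continuous f ->
  (forall x : R, is_derive x (1 : R) F (f x)) -> 0 <= r ->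
  leb.-integrable `[0, r] (EFin \o f) /\ \int[leb]_(x in `[0, r]) f x = F r - F 0.
Proof.
move=> cf dF r0; have cfw : {within `[0, r], continuous f} by exact: continuous_subspaceT.
have int : leb.-integrable `[0, r] (EFin \o f).
  by apply: continuous_compact_integrable => //; exact: segment_compact.
split => //; have [r1|r1] := eqVneq r 0.
  by rewrite r1 subrr set_itv1 /Rintegral integral_set1.
have rp : 0 < r by rewrite lt_neqAle eq_sym r1.
have dF' x : derivable F x 1 by have := dF x.
have cF x : {for x, continuous F}.
  by apply: differentiable_continuous; apply/derivable1_diffP.
rewrite /Rintegral (@continuous_FTC2 _ f F 0 r rp cfw) //.
  split; first by move=> x _; exact: dF'.
    by apply: cvg_at_right_filter; exact: cF.
  by apply: cvg_at_left_filter; exact: cF.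
by move=> x _; rewrite derive1E (derive_val (is_derive := dF x)).
Qed.

Lemma oscillator_Phi k : oscillator (fun r => (Phi k r)%:C) (fun r => (ev k * Phi k r)%:C : R[i]).
Proof.
have lPhi : l2 (Phi k : R -> R) by rewrite Phi_psi; exact: l2_psi.
split; [exact: cL2R | by apply: cL2R; exact: l2Z |].
pose p := psp k.*2.+1 : {poly R}.
have eE : k.*2.+1.*2.+1%:R = ev k :> R by rewrite /ev; congr (_%:R); rewrite -!muln2; lia.
pose s := hw (dp (dp p)).
have d1 (x : R) : is_derive x (1 : R) (hw p) (hw (dp p) x) by exact: is_derive_hw.
have d2 (x : R) : is_derive x (1 : R) (hw (dp p)) (s x) by exact: is_derive_hw.
have PhiE : Phi k = hw p by rewrite Phi_psi.
have z0 r : \int[leb]_(x in `[0, r]) Im (0 : R[i]) = 0.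
  by rewrite Rintegral_cst //= mul0r.
exists (fun r => (hw (dp p) r)%:C), (fun r => (s r)%:C), (hw (dp p) 0)%:C.
split.
- move=> r; have [r0|r0] := leP 0 r; last first.
    by rewrite set_itv_ge -?ltNge ?bnd_simp //; split; exact: integrable_set0.
  have [] := itv_FTC (@continuous_gw R _ _) d2 r0; move=> int _; split; first exact: int.
  by apply: integrable0 => //; exact: measurable_itv.
- move=> r r0; have [_ e] := itv_FTC (@continuous_gw R _ _) d2 r0.
  by rewrite /cintegral /= e Rintegral_cst // mul0r; apply: complexP; rewrite /= ?addr0 //; ring.
- have := @ae_half_line R (fun r => (Phi k r)%:C = cintegral leb `[0, r] (fun r => (hw (dp p) r)%:C)).
  apply => r r0; have [_ e] := itv_FTC (@continuous_gw R _ _) d1 (ltW r0).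
  rewrite /cintegral /= e Rintegral_cst // mul0r PhiE [hw p 0](_ : _ = 0) ?subr0 //.
  by rewrite /gw psp_odd0 mul0r.
have := @ae_half_line R (fun r => (ev k * Phi k r)%:C = - (s r)%:C + (r ^+ 2)%:C * (Phi k r)%:C).
apply => r r0; rewrite -rmorphN -rmorphM -rmorphD /=; congr (_%:C).
rewrite PhiE /s dp_dp_psp eE gwB /= gwZ; rewrite /gw !hornerM !hornerX -/p; ring.
Qed.

Lemma oscillator0 : @oscillator R (fun=> 0) (fun=> 0).
Proof.
have i0 r : \int[leb]_(x in `[0, r]) (0 : R) = 0 by rewrite Rintegral_cst //= mul0r.
split; [exact: cL20 | exact: cL20 |].
exists (fun=> 0), (fun=> 0), 0; split.
- move=> r; have h : leb.-integrable `[0, r] (fun x : R => (0 : R)%:E).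
    by apply: integrable0 => //; exact: measurable_itv.
  by split.
- by move=> r _; rewrite /cintegral /= i0 add0r.
- have := @ae_half_line R (fun r => 0 = cintegral leb `[0, r] (fun=> 0 : R[i])); apply => r _.
  by rewrite /cintegral /= i0.
- have := @ae_half_line R (fun r => (0 : R[i]) = - 0 + (r ^+ 2)%:C * 0); apply => r _.
  by rewrite mulr0 addr0 oppr0.
Qed.

Variables (P : set R -> @spinor R -> @spinor R)
  (nu : @spinor R -> {measure set (measurableTypeR R) -> \bar R}).
Hypothesis sm : spectral_measure oscillator2 P nu.

(** The integral of x - e against the spectral measure of an eigenfunction vanishes
    over every set, so that there is no mass on either side of e. *)
Lemma eigen_projection (phi : hs) (e : R) : oscillator2 phi (e%:C *: hval phi) ->
  exists2 pphi : hs, hval pphi = P [set e] phi & nrm ip (pphi - phi) = 0.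
Proof.
move=> osc; have lphi := hsP phi.
have m1 : measurable ([set e] : set (measurableTypeR R)) by exact: measurable_set1.
pose r (S : set (measurableTypeR R)) := Re (inner (P S phi) phi).
have nuE S : measurable S -> nu phi S = (r S)%:E by move=> mS; exact: (spectral_scalar sm).
have fin S : measurable S -> (nu phi S < +oo)%E by move=> mS; rewrite nuE // ltry.
have sq : (\int[nu phi]_x (x ^+ 2)%:E < +oo)%E.
  by apply/(spectral_dom sm lphi); exists (e%:C *: hval phi).
have msq : measurable_fun setT (fun x : measurableTypeR R => x ^+ 2).
  exact: measurable_funX.
have isq : (nu phi).-integrable setT (EFin \o (fun x : measurableTypeR R => x ^+ 2)).
  apply/integrableP; split; first exact/measurable_EFinP.
  by under eq_integral => x _ do rewrite /= ger0_norm ?sqr_ge0 //.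
have icst (c : R) : (nu phi).-integrable setT (EFin \o (fun _ : measurableTypeR R => c)).
  apply/integrableP; split; first exact/measurable_EFinP.
  rewrite (eq_integral (fun _ => `|c|%:E)) // integral_cst //.
  by rewrite lte_mul_pinfty // ?lee_fin //; exact: fin.
have ix : (nu phi).-integrable setT (EFin \o (fun x : measurableTypeR R => x)).
  apply: (le_integrable measurableT _ _ (integrableD measurableT (icst 1) isq)).
    exact/measurable_EFinP.
  move=> x _; rewrite /= lee_fin [leRHS]ger0_norm ?addr_ge0 ?sqr_ge0 //.
  rewrite -subr_ge0; have := sqr_ge0 (`|x| - 1); have := real_normK (num_real x); have := normr_ge0 x; nra.
have eI S : measurable S -> e * r S = \int[nu phi]_(x in S) x.
  move=> mS; have := spectral_value sm mS osc; rewrite /r => h.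
  have lP : L2 (P S phi) by exact: (spectral_L2 sm).
  have h2 : Re (inner (e%:C *: hval phi) (P S phi)) = \int[nu phi]_(x in S) x by rewrite h.
  rewrite -h2 -[inner (e%:C *: _) _]/(ip (e%:C *: phi) (mkhs lP)) (formZl fip) cReZ.
  by rewrite (formC fip (mkhs lP) phi) cReJ.
have null (S : set (measurableTypeR R)) : measurable S -> (forall x, S x -> x != e) ->
   (forall x, S x -> e <= x) \/ (forall x, S x -> x <= e) -> nu phi S = 0%E.
  move=> mS Se Ssgn.
  have iS := integrableS measurableT mS (@subsetT _ S).
  have I0 : \int[nu phi]_(x in S) (x - e) = 0.
    rewrite RintegralB //; [|exact: iS ix | exact: iS (icst e)].
    rewrite -eI // Rintegral_cst // nuE //= subrr //.
  have I1 : (\int[nu phi]_(x in S) `|(x - e)%:E| = 0)%E.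
    have ii : (nu phi).-integrable S (EFin \o (fun x : measurableTypeR R => x - e)).
      exact: (integrableB mS (iS _ _ _ ix) (iS _ _ _ (icst e))).
    have J0 : (\int[nu phi]_(x in S) (x - e)%:E = 0)%E.
      by rewrite -[LHS]fineK ?(integrable_fin_num mS ii) //; congr EFin.
    case: Ssgn => Ssgn.
      rewrite -[RHS]J0; apply: eq_integral => x /set_mem Sx.
      by rewrite /= ger0_norm // subr_ge0 Ssgn.
    rewrite (eq_integral (fun x : measurableTypeR R => (- ((x - e)%R%:E))%E)); last first.
      by move=> x /set_mem Sx; rewrite /= ler0_norm // subr_le0 Ssgn.
    by rewrite integralN ?J0 ?oppe0 //; exact: integrable_add_def.
  have mf : measurable_fun S (fun x : measurableTypeR R => (x - e)%:E).
    by apply/measurable_EFinP; apply: measurable_funB.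
  have [N [mN N0 sub]] := (ae_eq_integral_abs (nu phi) mS mf).1 I1.
  apply: (@subset_measure0 _ _ _ (nu phi) S N) => // x Sx; apply: sub => /= /(_ Sx) [] /eqP.
  by rewrite subr_eq0; apply/negP; exact: Se.
have n1 : nu phi (`]e, +oo[%classic : set (measurableTypeR R)) = 0%E.
  apply: null; first exact: measurable_itv.
    by move=> x; rewrite /= in_itv /= andbT => /gt_eqF ->.
  by left => x; rewrite /= in_itv /= andbT => /ltW.
have n2 : nu phi (`]-oo, e[%classic : set (measurableTypeR R)) = 0%E.
  apply: null; first exact: measurable_itv.
    by move=> x; rewrite /= in_itv /= => /lt_eqF ->.
  by right => x; rewrite /= in_itv /= => /ltW.
have rT : r [set e] = r setT.
  suff : nu phi [set e] = nu phi setT by rewrite !nuE // => -[].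
  have -> : setT = [set e] `|` (`]-oo, e[ `|` `]e, +oo[) :> set (measurableTypeR R).
    apply/seteqP; split => // x _; rewrite /= !in_itv /= andbT.
    by case: (ltgtP x e) => h; [right; left|right; right|left].
  have mA : measurable (`]-oo, e[%classic : set (measurableTypeR R)) by exact: measurable_itv.
  have mB : measurable (`]e, +oo[%classic : set (measurableTypeR R)) by exact: measurable_itv.
  rewrite measureU0 //; first exact: measurableU.
  by rewrite -[RHS]n1 setUC; exact: (measureU0 mB mA n2).
have lPT : L2 (P setT phi) by exact: (spectral_L2 sm).
have lP : L2 (P [set e] phi) by exact: (spectral_L2 sm).
exists (mkhs lP) => //.
have ET : r setT = nrm2 ip phi.
  have h : nrm ip (mkhs lPT - phi) = 0 by rewrite nrm_hnorm hvalB; exact: (spectral_one sm).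
  have := nrm_eq0_form fip phi h; rewrite (formBl fip) => /eqP; rewrite subr_eq0 => /eqP.
  by move=> /(congr1 (fun z : R[i] => Re z)).
have EP : nrm2 ip (mkhs lP) = r [set e].
  have lPP : L2 (P [set e] (P [set e] phi)) by exact: (spectral_L2 sm).
  have := spectral_sym sm m1 lP lphi.
  rewrite -[inner (P [set e] phi) (P [set e] phi)]/(ip (mkhs lP) (mkhs lP)).
  have h : nrm ip (mkhs lPP - mkhs lP) = 0.
    rewrite nrm_hnorm hvalB; have := spectral_mul sm m1 m1 lphi; rewrite setIid; exact.
  have := nrm_eq0_form fip phi h; rewrite (formBl fip) => /eqP; rewrite subr_eq0 => /eqP h1 h2.
  rewrite /nrm2 -h2; have := congr1 (fun z : R[i] => Re z) h1; exact.
suff : nrm2 ip (mkhs lP - phi) = 0 by rewrite /nrm => ->; rewrite sqrtr0.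
rewrite (nrm2B fip) EP -[Re (ip _ _)]/(r [set e]) rT ET; ring.
Qed.

(** The spectral measure of u has mass at least the square of the coefficient at each
    eigenvalue, so that the sum is at most the integral over these points. *)
Lemma spectral_decay (q : R) (u : hs) (n : nat) (phi : 'I_n -> hs) (e : 'I_n -> R) :
  injective e -> (forall k, oscillator2 (phi k) ((e k)%:C *: hval (phi k))) ->
  (forall k, nrm ip (phi k) = 1) ->
  (\sum_k ((e k `^ q) ^+ 2 * normc (ip u (phi k)) ^+ 2)%:E <=
     \int[nu u]_x ((x `^ q) ^+ 2)%:E)%E.
Proof.
move=> einj osc n1; have lu := hsP u.
have m1 (x : R) : measurable ([set x] : set (measurableTypeR R)) by exact: measurable_set1.
have mg : measurable_fun setT (fun x : measurableTypeR R => ((x `^ q) ^+ 2)%:E).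
  by apply/measurable_EFinP; apply: measurable_funX; exact: measurable_powR.
have g0 (x : measurableTypeR R) : (0 <= ((x `^ q) ^+ 2)%:E)%E by rewrite lee_fin sqr_ge0.
have mass k : ((normc (ip u (phi k)) ^+ 2)%:E <= nu u [set e k])%E.
  rewrite (spectral_scalar sm) // lee_fin.
  have [pp ppE pp0] := eigen_projection (osc k).
  have lP : L2 (P [set e k] u) by exact: (spectral_L2 sm).
  have lPP : L2 (P [set e k] (P [set e k] u)) by exact: (spectral_L2 sm).
  have s1 : ip (mkhs lP) (phi k) = ip u (phi k).
    have h := spectral_sym sm (m1 (e k)) lu (hsP (phi k)); rewrite -ppE in h.
    have := nrm_eq0_formr fip u pp0; rewrite (formBr fip) => /eqP; rewrite subr_eq0 => /eqP <-.
    exact: h.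
  have s2 : Re (inner (P [set e k] u) u) = nrm2 ip (mkhs lP).
    have h := spectral_sym sm (m1 (e k)) lP lu.
    have hh : nrm ip (mkhs lPP - mkhs lP) = 0.
      rewrite nrm_hnorm hvalB; have := spectral_mul sm (m1 (e k)) (m1 (e k)) lu; rewrite setIid; exact.
    have := nrm_eq0_form fip u hh; rewrite (formBl fip) => /eqP; rewrite subr_eq0 => /eqP h1.
    have := congr1 (fun z : R[i] => Re z) h; have := congr1 (fun z : R[i] => Re z) h1.
    by rewrite /nrm2 => <- <-.
  rewrite s2 -s1 -(sqr_nrm fip) ler_sqr ?nnegrE ?normc_ge0 ?nrm_ge0 //.
  by apply: (le_trans (formCS fip _ _)); rewrite n1 mulr1.
have tr : trivIset setT (fun k : 'I_n => [set e k] : set (measurableTypeR R)).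
  by apply/trivIsetP => i j _ _ ij; apply/seteqP; split => // x [-> /einj] /eqP; rewrite (negbTE ij).
pose D := \big[setU/set0]_(k <- index_enum 'I_n) ([set e k] : set (measurableTypeR R)).
have mD : measurable D by apply: bigsetU_measurable => k _; exact: m1.
apply: (@le_trans _ _ (\int[nu u]_(x in D) ((x `^ q) ^+ 2)%:E)%E); last first.
  by apply: ge0_subset_integral.
rewrite ge0_integral_bigsetU //; first last.
- exact: measurable_funTS.
- exact: sub_trivIset tr.
- exact: index_enum_uniq.
apply: lee_sum => k _.
rewrite (eq_integral (cst ((e k `^ q) ^+ 2)%:E)); last by move=> x /set_mem ->.
by rewrite integral_cst // EFinM lee_wpmul2l // lee_fin sqr_ge0.
Qed.

End SpectralDecay.

(** * Real spans and compressions *)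

Section RealSpan.
Context {R : realType}.
Local Notation mu := (@half_line R).
Local Notation l2 f := (f \in Lfun mu 2%:E).
Local Notation hw := (gw (2^-1 : R)).
Local Notation ip := (@hip R).
Let fip := @form_hip R.

Definition rc n (c : 'I_n -> @hs R) (y : 'I_n -> R) : @hs R := \sum_j (y j)%:C *: c j.

(** All matrices of the problem are real, so that the real and the imaginary parts of
    a coefficient vector contribute separately to quadratic forms. *)
Lemma comb_re_im n (c : 'I_n -> @hs R) (x : 'cV[R[i]]_n) :
  comb c x = rc c (fun j => Re (x j 0)) + 'i *: rc c (fun j => Im (x j 0)).
Proof.
rewrite /comb /rc scaler_sumr -big_split; apply: eq_bigr => j _ /=.
rewrite scalerA -scalerDl; congr (_ *: _).
by apply: complexP; rewrite ?cReD ?cImD ?cReM ?cImM /=; ring.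
Qed.

Lemma ip_rc n m (c : 'I_n -> @hs R) (d : 'I_m -> @hs R) (F : 'I_n -> 'I_m -> R) y z :
  (forall j k, ip (c j) (d k) = (F j k)%:C) ->
  ip (rc c y) (rc d z) = (\sum_j \sum_k y j * z k * F j k)%:C.
Proof.
move=> hF; rewrite /rc (form_suml fip) rmorph_sum /=; apply: eq_bigr => j _.
rewrite (form_sumr fip) rmorph_sum /=; apply: eq_bigr => k _.
by rewrite (formZl fip) (formZr fip) cconjR hF !rmorphM mulrA.
Qed.

Lemma nrm2_comb n (c : 'I_n -> @hs R) (F : 'I_n -> 'I_n -> R) x :
  (forall j k, ip (c j) (c k) = (F j k)%:C) ->
  nrm2 ip (comb c x) = nrm2 ip (rc c (fun j => Re (x j 0))) + nrm2 ip (rc c (fun j => Im (x j 0))).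
Proof.
move=> hF; rewrite comb_re_im (nrm2D fip) (formZr fip).
rewrite (ip_rc _ _ hF) (nrm2Z fip) [normc 'i](_ : _ = 1); last first.
  by rewrite /= expr0n add0r expr1n sqrtr1.
rewrite expr1n mul1r [Re (_ * _)](_ : _ = 0) ?mulr0 ?addr0 //.
by rewrite cReM cReJ cImJ /= mul0r mulr0 subr0.
Qed.

Variables (V W a : R -> R) (K : R) (kappa : int) (phisc phiel phiam : R -> R).
Hypothesis rp : regular_potentials kappa phisc phiel phiam V W a K.
Local Notation D1 := (D1 V a).
Local Notation D2 := (D2 W a).

Variables (n : nat) (pf pg : 'I_n -> {poly R}).
Hypothesis pf0 : forall j, (pf j).[0] = 0.
Hypothesis pg0 : forall j, (pg j).[0] = 0.

Definition lp (p : 'I_n -> {poly R}) (y : 'I_n -> R) : {poly R} := \sum_j y j *: p j.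

Lemma lp0 p y : (forall j, (p j).[0] = 0) -> (lp p y).[0] = 0.
Proof. by move=> p0; rewrite horner_sum big1 // => j _; rewrite hornerZ p0 mulr0. Qed.

Lemma dp_lp p y : dp (lp p y) = lp (fun j => dp (p j)) y.
Proof.
rewrite /lp (big_morph dp dpD (_ : dp 0 = 0)); last by rewrite /dp derivC mulr0 subr0.
by apply: eq_bigr => j _; rewrite dpZ.
Qed.

Lemma hw_lp p y r : hw (lp p y) r = \sum_j y j * hw (p j) r.
Proof.
rewrite /lp /gw horner_sum mulr_suml; apply: eq_bigr => j _.
by rewrite hornerZ -mulrA.
Qed.

Definition hb j : @hs R := mkhs (L2_rsp (l2_hw (pf j)) (l2_hw (pg j))).

Lemma D_L2 j : L2 (rsp (D1 (pf j) (pg j)) (D2 (pf j) (pg j))).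
Proof. by have [h1 h2 _] := D_bound rp (pf0 j) (pg0 j); exact: L2_rsp. Qed.
Definition ha j : @hs R := mkhs (D_L2 j).

Lemma D1_lp y r : D1 (lp pf y) (lp pg y) r = \sum_j y j * D1 (pf j) (pg j) r.
Proof.
rewrite /D1 dp_lp !hw_lp !mulr_sumr -sumrN -!big_split /=.
by apply: eq_bigr => j _; ring.
Qed.
Lemma D2_lp y r : D2 (lp pf y) (lp pg y) r = \sum_j y j * D2 (pf j) (pg j) r.
Proof.
rewrite /D2 dp_lp !hw_lp !mulr_sumr -!big_split /=.
by apply: eq_bigr => j _; ring.
Qed.

Lemma rsp_sum (y : 'I_n -> R) (F G : 'I_n -> R -> R) :
  \sum_j (y j)%:C *: rsp (F j) (G j) =
  rsp (fun r => \sum_j y j * F j r) (fun r => \sum_j y j * G j r) :> @spinor R.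
Proof.
elim: (index_enum _) => [|j s IH].
  rewrite big_nil; congr (_, _); apply/funext => r; by rewrite big_nil.
rewrite big_cons IH; congr (_, _); apply/funext => r; rewrite big_cons rmorphD rmorphM //.
Qed.

Lemma ip_rsp (f g f' g' : R -> R) : l2 f -> l2 g -> l2 f' -> l2 g' ->
  inner (rsp f g) (rsp f' g') = (rdot mu f f' + rdot mu g g')%:C.
Proof.
move=> lf lg lf' lg'; rewrite innerE; try exact: L2_rsp.
rewrite /= !cdot_real //; try exact: cL2R.
have z (h k : R -> R) : rdot mu (rim (fun r => (h r)%:C)) k = 0.
  by rewrite /rdot /rint (_ : _ \* _ = fun=> 0) ?Rintegral_cst ?mul0r //;
    apply/funext => r; rewrite /= mul0r.
by rewrite !z; apply: complexP; rewrite ?cReD ?cImD /= ?addr0.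
Qed.

Lemma l2D1 j : l2 (D1 (pf j) (pg j)). Proof. by have [] := D_bound rp (pf0 j) (pg0 j). Qed.
Lemma l2D2 j : l2 (D2 (pf j) (pg j)). Proof. by have [] := D_bound rp (pf0 j) (pg0 j). Qed.

Lemma ip_hb j k : ip (hb j) (hb k) = (gI (pf j * pf k) + gI (pg j * pg k))%:C.
Proof. by rewrite /hip ip_rsp ?rdot_gw //; exact: l2_hw. Qed.

Lemma ip_ha j k : ip (ha j) (ha k) =
  (rdot mu (D1 (pf j) (pg j)) (D1 (pf k) (pg k)) + rdot mu (D2 (pf j) (pg j)) (D2 (pf k) (pg k)))%:C.
Proof. by rewrite /hip ip_rsp //; (exact: l2D1 || exact: l2D2). Qed.

Lemma ip_ha_hb j k : ip (ha j) (hb k) =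
  (rdot mu (D1 (pf j) (pg j)) (hw (pf k)) + rdot mu (D2 (pf j) (pg j)) (hw (pg k)))%:C.
Proof. by rewrite /hip ip_rsp //; (exact: l2D1 || exact: l2D2 || exact: l2_hw). Qed.

Lemma rc_hb y : hval (rc hb y) = rsp (hw (lp pf y)) (hw (lp pg y)).
Proof.
rewrite /rc hval_sum (eq_bigr (fun j => (y j)%:C *: rsp (hw (pf j)) (hw (pg j)))) // rsp_sum.
by congr (rsp _ _); apply/funext => r; rewrite hw_lp.
Qed.

Lemma rc_ha y : hval (rc ha y) = rsp (D1 (lp pf y) (lp pg y)) (D2 (lp pf y) (lp pg y)).
Proof.
rewrite /rc hval_sum (eq_bigr (fun j => (y j)%:C *: rsp (D1 (pf j) (pg j)) (D2 (pf j) (pg j)))) // rsp_sum.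
by congr (rsp _ _); apply/funext => r; rewrite ?D1_lp ?D2_lp.
Qed.

Lemma nrm2_rc_hb y : nrm2 ip (rc hb y) = gI (lp pf y * lp pf y) + gI (lp pg y * lp pg y).
Proof. by rewrite /nrm2 /hip rc_hb ip_rsp /= ?rdot_gw //; exact: l2_hw. Qed.

Lemma nrm2_rc_ha y : nrm2 ip (rc ha y) =
  rdot mu (D1 (lp pf y) (lp pg y)) (D1 (lp pf y) (lp pg y)) +
  rdot mu (D2 (lp pf y) (lp pg y)) (D2 (lp pf y) (lp pg y)).
Proof.
have [h1 h2 _] := D_bound rp (lp0 y pf0) (lp0 y pg0).
by rewrite /nrm2 /hip rc_ha ip_rsp.
Qed.

Lemma nrm2_comb_ha x : nrm2 ip (comb ha x) <= (80 * K ^+ 2 + 4) *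
  ((energy (lp pf (fun j => Re (x j 0))) + energy (lp pg (fun j => Re (x j 0)))) +
   (energy (lp pf (fun j => Im (x j 0))) + energy (lp pg (fun j => Im (x j 0))))).
Proof.
rewrite (nrm2_comb x ip_ha) !nrm2_rc_ha mulrDr.
have [_ _ h1] := D_bound rp (lp0 (fun j => Re (x j 0)) pf0) (lp0 (fun j => Re (x j 0)) pg0).
have [_ _ h2] := D_bound rp (lp0 (fun j => Im (x j 0)) pf0) (lp0 (fun j => Im (x j 0)) pg0).
exact: lerD.
Qed.

Hypothesis ess : ess_selfadjoint (dirac_min_op kappa phisc phiel phiam).
Local Notation H := (dirac_op kappa phisc phiel phiam).

Lemma H_hb j : hrel H (hb j) (ha j).
Proof. exact: (rsp_in_dom rp ess (pf0 j) (pg0 j)). Qed.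

Lemma H_comb x : hrel H (comb hb x) (comb ha x).
Proof.
rewrite /comb; elim/big_rec2 : _ => [|j u v _ h]; last first.
  exact: (sa_linear_rel ess.2 (x j 0) (H_hb j) h).
have t0 := @test_function0 R.
have T00 : dirac_min_op kappa phisc phiel phiam 0 (dirac_expr kappa phisc phiel phiam 0) by split.
have l0 : L2 (0 : @spinor R) by split; exact: cL20.
apply: (sa_core ess.2 (f := 0) (g := 0) ess.1) => u w T0u.
have [lu lw] := ess.1 _ _ T0u.
rewrite -[inner w _]/(ip (mkhs lw) 0) -[inner u _]/(ip (mkhs lu) 0).
by rewrite !(form0r fip).
Qed.

End RealSpan.

(** * Approximation of eigenvectors *)

Section Approximation.
Context {R : realType}.
Local Notation mu := (@half_line R).
Local Notation l2 f := (f \in Lfun mu 2%:E).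
Local Notation hw := (gw (2^-1 : R)).
Local Notation ip := (@hip R).
Let fip := @form_hip R.

Lemma powR_small (p e : R) : 0 < p -> 0 < e ->
  exists N0 : nat, forall N, (N0 <= N)%N -> N%:R `^ (- p) <= e.
Proof.
move=> p0 e0; exists (Num.bound (e^-1 `^ p^-1)).+1 => N hN.
have x0 : 0 <= e^-1 `^ p^-1 by exact: powR_ge0.
have xN : e^-1 `^ p^-1 <= N%:R.
  by rewrite ltW // (lt_le_trans (archi_boundP x0)) // ler_nat ltnW.
have Np : 0 < N%:R :> R by rewrite ltr0n; exact: leq_ltn_trans hN.
rewrite powRN invf_ple ?posrE ?powR_gt0 //.
have -> : e^-1 = (e^-1 `^ p^-1) `^ p.
  by rewrite -powRrM mulVf ?gt_eqF // powRr1 // invr_ge0 ltW.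
by rewrite ge0_ler_powR ?nnegrE // ltW.
Qed.

(** Of the power 2 q of the eigenvalue, the part q - 1 is at least N^(q-1), and the
    part q + 1 dominates the eigenvalue. *)
Lemma ev_power (q : R) k N : 1 < q -> (1 <= N)%N -> (N <= k)%N ->
  1 + ev k <= 2 * N%:R `^ (- (q - 1)) * (ev k `^ q) ^+ 2 :> R.
Proof.
move=> q1 N1 Nk; have e0 := @ev_gt0 R k.
have eN : N%:R <= ev k :> R by rewrite ler_nat; lia.
have Np : 0 < N%:R :> R by rewrite ltr0n.
have e1 : 1 <= ev k :> R by apply: le_trans eN; rewrite ler1n.
have q10 : 0 <= q - 1 by rewrite subr_ge0 ltW.
have h1 : (ev k `^ q) ^+ 2 = ev k `^ (q - 1) * (ev k `^ q * ev k).
  have pD (x y : R) : ev k `^ (x + y) = ev k `^ x * ev k `^ y by rewrite powRD // (gt_eqF e0) implybT.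
  rewrite expr2 -[X in _ = _ * (_ * X)](powRr1 (ltW e0)) -!pD.
  by congr (_ `^ _); ring.
have h2 : N%:R `^ (q - 1) <= ev k `^ (q - 1) by rewrite ge0_ler_powR ?nnegrE // ltW.
have h3 : 1 <= ev k `^ q.
  rewrite -(powRr0 (ev k)) ler_powR //; lra.
have h4 : 0 < N%:R `^ (q - 1) by rewrite powR_gt0.
rewrite powRN h1 -mulrA; apply: (@le_trans _ _ (2 * ev k)).
  by move: e1; lra.
have h5 : 1 <= (N%:R `^ (q - 1))^-1 * ev k `^ (q - 1) by rewrite mulrC ler_pdivlMr // mul1r.
rewrite ler_wpM2l // mulrA -[leLHS]mul1r ler_pM ?(ltW e0) //.
by rewrite ler_peMl // ltW.
Qed.

Variables (V W a : R -> R) (K : R) (kappa : int) (phisc phiel phiam : R -> R).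
Hypothesis rp : regular_potentials kappa phisc phiel phiam V W a K.
Hypothesis ess : ess_selfadjoint (dirac_min_op kappa phisc phiel phiam).
Local Notation H := (dirac_op kappa phisc phiel phiam).

(** A self-adjoint operator is closed, being its own adjoint. *)
Lemma sa_closed (u w : @hs R) :
  (forall e, 0 < e -> exists f g : @hs R, [/\ hrel H f g, nrm ip (f - u) <= e & nrm ip (g - w) <= e]) ->
  hrel H u w.
Proof.
move=> h; apply/ess.2.2; split; try exact: hsP.
move=> y z Hyz; have [ly lz _] := Hyz.
rewrite -[inner z u]/(ip (mkhs lz) u) -[inner y w]/(ip (mkhs ly) w).
apply/eqP; rewrite -subr_eq0; apply/eqP/normc_eq0P.
apply: eq0_small; first exact: normc_ge0.
move=> e e0; pose B := nrm ip (mkhs lz) + nrm ip (mkhs ly) + 1.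
have B0 : 0 < B by rewrite ltr_wpDl // addr_ge0 // nrm_ge0.
have [f [g [Hfg fu gw]]] := h _ (divr_gt0 e0 B0).
have E : ip (mkhs lz) f = ip (mkhs ly) g by exact: (sa_sym_rel ess.2 (u := mkhs ly) (w := mkhs lz) Hyz Hfg).
have -> : ip (mkhs lz) u - ip (mkhs ly) w = ip (mkhs ly) (g - w) - ip (mkhs lz) (f - u).
  by rewrite !(formBr fip) E; ring.
apply: (le_trans (normc_ler _ _)); rewrite normcN.
have c1 := formCS fip (mkhs ly) (g - w); have c2 := formCS fip (mkhs lz) (f - u).
apply: (@le_trans _ _ (nrm ip (mkhs ly) * (e / B) + nrm ip (mkhs lz) * (e / B))).
  by apply: lerD; [apply: (le_trans c1)|apply: (le_trans c2)]; rewrite ler_wpM2l // nrm_ge0.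
rewrite -mulrDl mulrCA ler_piMr ?(ltW e0) // ler_pdivrMr // mul1r /B [X in _ <= X + _]addrC lerDl; exact: ler01.
Qed.

Lemma sa_uniq (u w u' w' : @hs R) : hrel H u w -> hrel H u' w' -> nrm ip (u - u') = 0 ->
  nrm ip (w - w') = 0.
Proof.
move=> h h' uu.
have h2 : hrel H u w'.
  apply: (sa_ae ess.2 h'); first by rewrite -(nrmN fip) opprB.
  by rewrite subrr (nrm0 fip).
have v1 := sa_value ess.2 h; have v2 := sa_value ess.2 h2.
have lv : L2 (value H u) := closure_value (T := dirac_min_op kappa phisc phiel phiam) h.
have n1 : nrm ip (mkhs lv - w) = 0 by rewrite nrm_hnorm hvalB.
have n2 : nrm ip (mkhs lv - w') = 0 by rewrite nrm_hnorm hvalB.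
apply/eqP; rewrite eq_le nrm_ge0 andbT.
have -> : w - w' = (mkhs lv - w') - (mkhs lv - w) by rewrite opprB [RHS]addrC addrA subrK.
by apply: (le_trans (nrmB fip _ _)); rewrite n1 n2 addr0.
Qed.

(** The index i selects the component, true for the upper one, in which the vector is
    supported. *)
Definition sf (i : bool) k : {poly R} := if i then psp k.*2.+1 else 0.
Lemma sf0 i k : (sf i k).[0] = 0.
Proof. by case: i; rewrite /= ?horner0 // psp_odd0. Qed.

Definition bv (i : bool) k : @hs R := mkhs (L2_rsp (l2_hw (sf i k)) (l2_hw (sf (~~ i) k))).
Lemma av_L2 i k : L2 (rsp (D1 V a (sf i k) (sf (~~ i) k)) (D2 W a (sf i k) (sf (~~ i) k))).
Proof. by have [h1 h2 _] := D_bound rp (sf0 i k) (sf0 (~~ i) k); exact: L2_rsp. Qed.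
Definition av (i : bool) k : @hs R := mkhs (av_L2 i k).

Lemma H_bv i k : hrel H (bv i k) (av i k).
Proof. exact: (rsp_in_dom rp ess (sf0 i k) (sf0 (~~ i) k)). Qed.

Lemma ip_bv i k i' k' : ip (bv i k) (bv i' k') = ((i == i') && (k == k'))%:R%:C.
Proof.
have lw p := @l2_hw R p.
rewrite /hip ip_rsp // !rdot_gw /sf; congr (_%:C).
have m0 (p : {poly R}) : gI (0 * p) = 0 by rewrite mul0r -(scale0r 0) gIZ mul0r.
by case: i; case: i' => /=; rewrite ?m0 ?[_ * 0]mulrC ?m0 ?gI_Phi ?add0r ?addr0.
Qed.

Lemma sum_energy n (c : 'I_n -> R[i]) :
  energy (lp (fun k : 'I_n => psp k.*2.+1) (fun k => Re (c k))) +
  energy (lp (fun k : 'I_n => psp k.*2.+1) (fun k => Im (c k))) <=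
  \sum_(k < n) (1 + ev k) * normc (c k) ^+ 2.
Proof.
have h (y : 'I_n -> R) : energy (lp (fun k : 'I_n => psp k.*2.+1) y) <= \sum_(k < n) (1 + ev k) * y k ^+ 2.
  have -> : lp (fun k : 'I_n => psp k.*2.+1) y = hsum y by [].
  rewrite /energy gI_hsum; apply: (le_trans (lerD (lexx _) (kinetic_le y))).
  by rewrite -big_split ler_sum // => k _ /=; rewrite mulrDl mul1r -expr2.
apply: (le_trans (lerD (h _) (h _))); rewrite -big_split ler_sum // => k _ /=.
by rewrite sqr_normcE mulrDr.
Qed.

Lemma energy_lp0 n (y : 'I_n -> R) : energy (lp (fun=> 0) y) = 0.
Proof.
have -> : lp (fun _ : 'I_n => 0 : {poly R}) y = 0.
  by rewrite /lp big1 // => k _; rewrite scaler0.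
have m0 (p : {poly R}) : gI (0 * p) = 0 by rewrite mul0r -(scale0r 0) gIZ mul0r.
have dp0 : dp (0 : {poly R}) = 0 by rewrite /dp derivC mulr0 subr0.
by rewrite /energy dp0 !m0 addr0.
Qed.

Lemma nrm2_av i n (c : 'I_n -> R[i]) :
  nrm2 ip (\sum_k c k *: av i k) <= (80 * K ^+ 2 + 4) * \sum_(k < n) (1 + ev k) * normc (c k) ^+ 2.
Proof.
pose pf (k : 'I_n) := sf i k; pose pg (k : 'I_n) := sf (~~ i) k.
have f0 k : (pf k).[0] = 0 by exact: sf0.
have g0 k : (pg k).[0] = 0 by exact: sf0.
pose x : 'cV[R[i]]_n := \col_k c k.
have -> : \sum_k c k *: av i k = comb (ha rp f0 g0) x.
  by apply: eq_bigr => k _; rewrite mxE; congr (_ *: _); exact: val_inj.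
apply: (le_trans (nrm2_comb_ha rp f0 g0 x)); have C0 : 0 <= 80 * K ^+ 2 + 4 :> R by have := sqr_ge0 K; lra.
rewrite (ler_wpM2l C0) //.
have xE1 : (fun j => Re (x j 0)) = (fun j => Re (c j)) by apply/funext => j; rewrite mxE.
have xE2 : (fun j => Im (x j 0)) = (fun j => Im (c j)) by apply/funext => j; rewrite mxE.
rewrite xE1 xE2; apply: le_trans (sum_energy c).
have [[-> ->]|[-> ->]] : (pf = (fun k => psp k.*2.+1) /\ pg = fun=> 0) \/
    (pf = (fun=> 0) /\ pg = (fun k => psp k.*2.+1)).
- by rewrite /pf /pg; case: (i); [left|right].
- by rewrite !energy_lp0 !addr0.
- by rewrite !energy_lp0 !add0r.
Qed.

Lemma nrm2_bv i n (c : 'I_n -> R[i]) :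
  nrm2 ip (\sum_k c k *: bv i k) = \sum_k normc (c k) ^+ 2.
Proof.
rewrite /nrm2 (form_suml fip) cRe_sum; apply: eq_bigr => k _.
rewrite (formZl fip) (form_sumr fip) (bigD1 k) //= (formZr fip) ip_bv !eqxx big1 => [|j jk].
  by rewrite addr0 mulr1 mulJc.
by rewrite (formZr fip) ip_bv eqxx /= (negbTE (_ : k != j :> nat)) ?mulr0 // eq_sym.
Qed.

Section Eigenvector.
Variables (E : R[i]) (u : @hs R) (q Cu : R).
Hypothesis q1 : 1 < q.
Hypothesis Hu : hrel H u (E *: u).
Hypothesis Cu0 : 0 <= Cu.
Hypothesis decay : forall i n, \sum_(k < n) (ev k `^ q) ^+ 2 * normc (ip u (bv i k)) ^+ 2 <= Cu.

Definition SS i n : @hs R := \sum_(k < n) ip u (bv i k) *: bv i k.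
Definition XX i n : @hs R := \sum_(k < n) ip u (bv i k) *: av i k.
Local Notation rate := (fun N : nat => N%:R `^ (- ((q - 1) / 2)) : R).
Definition DD : R := Num.sqrt (2 * Cu * (80 * K ^+ 2 + 4)).

Let C0 : 0 <= 80 * K ^+ 2 + 4 :> R.
Proof. by rewrite addr_ge0 // mulr_ge0 ?sqr_ge0. Qed.

(** Energies of partial sums are dominated by weighted sums of squares of the
    coefficients, and the power q of the weight controls the tail. *)
Lemma tail_bound i N N' : (1 <= N)%N -> (N <= N')%N ->
  nrm ip (SS i N' - SS i N) <= DD * rate N /\ nrm ip (XX i N' - XX i N) <= DD * rate N.
Proof.
move=> N1 NN; pose c (k : 'I_N') := if (N <= k)%N then ip u (bv i k) else 0.
have diff (d : nat -> @hs R) :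
    \sum_(k < N') ip u (bv i k) *: d k - \sum_(k < N) ip u (bv i k) *: d k = \sum_(k < N') c k *: d k.
  rewrite (big_ord_widen _ (fun k => ip u (bv i k) *: d k) NN) [X in X - _](bigID (fun k : 'I_N' => (k < N)%N)) /=.
  rewrite addrAC subrr add0r big_mkcond; apply: eq_bigr => k _.
  by rewrite /c -leqNgt; case: ifP => // _; rewrite scale0r.
have rN : rate N ^+ 2 = N%:R `^ (- (q - 1)).
  rewrite expr2 -powRD; last by rewrite pnatr_eq0 -lt0n N1 implybT.
  by congr (_ `^ _); field.
have sE : \sum_(k < N') (1 + ev k) * normc (c k) ^+ 2 <= 2 * Cu * N%:R `^ (- (q - 1)).
  apply: (@le_trans _ _ (\sum_(k < N') (2 * N%:R `^ (- (q - 1))) * ((ev k `^ q) ^+ 2 * normc (ip u (bv i k)) ^+ 2))).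
    apply: ler_sum => k _; rewrite /c; case: ifP => Nk; last first.
      rewrite Normc.normc0 expr0n /= mulr0; apply: mulr_ge0; first by apply: mulr_ge0; rewrite ?powR_ge0.
      by apply: mulr_ge0; rewrite sqr_ge0.
    by rewrite mulrA ler_wpM2r ?sqr_ge0 // ev_power.
  rewrite -mulr_sumr mulrAC ler_wpM2r ?powR_ge0 // ler_wpM2l // decay.
have bd (v : @hs R) : nrm2 ip v <= (80 * K ^+ 2 + 4) * \sum_(k < N') (1 + ev k) * normc (c k) ^+ 2 ->
    nrm ip v <= DD * rate N.
  move=> hv; rewrite -(ler_pXn2r (n := 2)) ?nnegrE ?nrm_ge0 ?mulr_ge0 ?sqrtr_ge0 ?powR_ge0 //.
  rewrite (sqr_nrm fip) exprMn sqr_sqrtr ?mulr_ge0 // rN.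
  apply: (le_trans hv); rewrite [leRHS]mulrAC [leRHS]mulrC ler_wpM2l //.
split; apply: bd; rewrite diff; last exact: nrm2_av.
rewrite nrm2_bv -[leLHS]mul1r ler_pM // ?sumr_ge0 //.
- by move=> k _; rewrite sqr_ge0.
- by have := sqr_ge0 K; lra.
apply: ler_sum => k _; rewrite mulrDl mul1r lerDl mulr_ge0 ?sqr_ge0 //.
Qed.

Lemma limit_exists (S : nat -> @hs R) : (forall N N', (1 <= N)%N -> (N <= N')%N ->
    nrm ip (S N' - S N) <= DD * rate N) ->
  exists l, forall N, (1 <= N)%N -> nrm ip (l - S N) <= DD * rate N.
Proof.
move=> hS; have q2 : 0 < (q - 1) / 2 by rewrite divr_gt0 // subr_gt0.
have D0 : 0 <= DD by rewrite sqrtr_ge0.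
have [|l hl] := @complete_hip R S.
  move=> e e0; have D1' : 0 < DD + 1 by rewrite ltr_wpDl.
  have [N0 hN] := powR_small q2 (divr_gt0 e0 D1').
  exists N0.+1 => m n Nn nm; have n1 : (1 <= n)%N by apply: leq_trans Nn.
  apply: (le_lt_trans (hS n m n1 nm)).
  apply: (@le_lt_trans _ _ (DD * (e / (DD + 1)))).
    by rewrite ler_wpM2l // hN // ltnW.
  by rewrite mulrCA gtr_pMr // ltr_pdivrMr // mul1r ltrDl.
exists l => N N1; rewrite leNgt; apply/negP => lt.
have e0 : 0 < nrm ip (l - S N) - DD * rate N by rewrite subr_gt0.
have [N2 hN2] := hl _ e0.
have h1 := hN2 (maxn N2 N) (leq_maxl _ _); have h2 := hS N (maxn N2 N) N1 (leq_maxr _ _).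
have : nrm ip (l - S N) <= nrm ip (l - S (maxn N2 N)) + nrm ip (S (maxn N2 N) - S N).
  rewrite (_ : l - S N = (l - S (maxn N2 N)) + (S (maxn N2 N) - S N)); last by rewrite addrA subrK.
  exact: (nrmD fip).
have -> : nrm ip (l - S (maxn N2 N)) = nrm ip (S (maxn N2 N) - l) by rewrite -(nrmN fip) opprB.
move=> h3; have := le_lt_trans h3 (ltr_leD h1 h2).
by rewrite subrK ltxx.
Qed.

Lemma hermite_total_hs (v : @hs R) : (forall i k, ip v (bv i k) = 0) -> nrm ip v = 0.
Proof.
move=> hv; have [lv1 lv2] := hsP v; have [[a1 a2] [b1 b2]] := (lv1, lv2).
have lP k : l2 (Phi k : R -> R) by rewrite Phi_psi; exact: l2_psi.
have hz (h : R -> R[i]) : (cdot h (fun r => (hw 0 r)%:C) : R[i]) = 0.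
  have z : (fun r => (hw 0 r)%:C) = (fun=> 0 : R[i]).
    by apply/funext => r; rewrite /gw horner0 mul0r.
  rewrite z /cdot /cintegral; apply: complexP => /=.
    by under eq_Rintegral => r _ do rewrite rmorph0 mulr0 /=; rewrite Rintegral_cst ?mul0r.
  by under eq_Rintegral => r _ do rewrite rmorph0 mulr0 /=; rewrite Rintegral_cst ?mul0r.
have h1 k : rdot mu (rre (hval v).1) (Phi k) = 0 /\ rdot mu (rim (hval v).1) (Phi k) = 0.
  have := hv true k; rewrite /hip innerE //; last exact: hsP.
  rewrite /= hz addr0 -psiE -Phi_psi cdot_real // => h.
  by split; [have := congr1 (fun z : R[i] => Re z) h | have := congr1 (fun z : R[i] => Im z) h].
have h2 k : rdot mu (rre (hval v).2) (Phi k) = 0 /\ rdot mu (rim (hval v).2) (Phi k) = 0.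
  have := hv false k; rewrite /hip innerE //; last exact: hsP.
  rewrite /= hz add0r -psiE -Phi_psi cdot_real // => h.
  by split; [have := congr1 (fun z : R[i] => Re z) h | have := congr1 (fun z : R[i] => Im z) h].
have Z (f : R -> R) : l2 f -> (forall k, rdot mu f (Phi k) = 0) -> rdot mu f f = 0.
  move=> lf hf; have h := hermite_total lf hf.
  rewrite (rdot_ae lf (l2_0 mu) lf (l2_0 mu) h h) /rdot /rint.
  by rewrite (_ : _ \* _ = fun=> 0) ?Rintegral_cst ?mul0r //; apply/funext => r; rewrite /= mulr0.
rewrite /nrm nrm2E !Z ?addr0 ?sqrtr0 // => k; by have [] := h1 k; have [] := h2 k.
Qed.

(** The partial sums of the Hermite expansion and their images are Cauchy sequences
    with the given rate. Their limits are u, by completeness of the basis, and E u,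
    because the operator is closed. *)
Lemma eigen_approx : exists D : R, 0 <= D /\ forall N M, (1 <= N)%N -> (1 <= M)%N ->
  nrm ip (u - (SS true N + SS false M)) <= D * (rate N + rate M) /\
  nrm ip ((XX true N + XX false M) - E *: (SS true N + SS false M)) <= D * (rate N + rate M).
Proof.
have D0 : 0 <= DD by rewrite sqrtr_ge0.
have [s hs'] : exists s, forall i N, (1 <= N)%N -> nrm ip (s i - SS i N) <= DD * rate N.
  have L i : exists l, forall N, (1 <= N)%N -> nrm ip (l - SS i N) <= DD * rate N.
    by apply: limit_exists => N N' N1 NN; have [] := tail_bound i N1 NN.
  have [s1 h1] := L true; have [s2 h2] := L false.
  by exists (fun i : bool => if i then s1 else s2) => -[].
have [t ht] : exists t, forall i N, (1 <= N)%N -> nrm ip (t i - XX i N) <= DD * rate N.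
  have L i : exists l, forall N, (1 <= N)%N -> nrm ip (l - XX i N) <= DD * rate N.
    by apply: limit_exists => N N' N1 NN; have [] := tail_bound i N1 NN.
  have [s1 h1] := L true; have [s2 h2] := L false.
  by exists (fun i : bool => if i then s1 else s2) => -[].
have q2 : 0 < (q - 1) / 2 by rewrite divr_gt0 // subr_gt0.
have small e : 0 < e -> exists2 N, (1 <= N)%N & DD * rate N <= e.
  move=> e0; have D1' : 0 < DD + 1 by rewrite ltr_wpDl.
  have [N0 hN] := powR_small q2 (divr_gt0 e0 D1').
  exists N0.+1 => //; apply: (@le_trans _ _ (DD * (e / (DD + 1)))).
    by rewrite ler_wpM2l // hN.
  by rewrite mulrCA ler_piMr ?(ltW e0) // ler_pdivrMr // mul1r lerDl.
have HSX i N : hrel H (SS i N) (XX i N).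
  rewrite /SS /XX; elim: N => [|N IH].
    rewrite !big_ord0; have := relB (sa_linear_rel ess.2) (H_bv i 0) (H_bv i 0).
    by rewrite !subrr.
  rewrite !big_ord_recr /=; apply: (relD (sa_linear_rel ess.2) IH).
  exact: (relZ (sa_linear_rel ess.2) _ (H_bv i N)).
have add2 e (x y x' y' : @hs R) : nrm ip (x - x') <= e / 2 -> nrm ip (y - y') <= e / 2 ->
    nrm ip ((x + y) - (x' + y')) <= e.
  move=> h1 h2; rewrite opprD addrACA; apply: (le_trans (nrmD fip _ _)); rewrite [leRHS]splitr; exact: lerD.
have Hst : hrel H (s true + s false) (t true + t false).
  apply: sa_closed => e e0; have [N N1 hN] := small _ (divr_gt0 e0 (ltr0n R 2)).
  exists (SS true N + SS false N), (XX true N + XX false N); split.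
  - exact: (relD (sa_linear_rel ess.2) (HSX true N) (HSX false N)).
  - by apply: add2; rewrite -(nrmN fip) opprB; apply: le_trans (hs' _ _ N1) hN.
  - by apply: add2; rewrite -(nrmN fip) opprB; apply: le_trans (ht _ _ N1) hN.
have us : nrm ip (u - (s true + s false)) = 0.
  apply: hermite_total_hs => i k; apply: normc_eq0P; apply: eq0_small; first exact: normc_ge0.
  move=> e e0; have [N N1 hN] := small _ (divr_gt0 e0 (ltr0n R 2)).
  pose M := maxn N k.+1.
  have M1 : (1 <= M)%N by rewrite (leq_trans N1) // leq_maxl.
  have rM : DD * rate M <= e / 2.
    apply: le_trans hN; rewrite ler_wpM2l // !powRN lef_pV2 ?posrE ?powR_gt0 ?ltr0n //.
    by rewrite ge0_ler_powR ?nnegrE ?(ltW q2) // ler_nat leq_maxl.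
  have SE j : ip (SS j M) (bv i k) = (j == i)%:R%:C * ip u (bv i k).
    rewrite /SS (form_suml fip) (bigD1 (Ordinal (leq_maxr N k.+1))) //= (formZl fip) ip_bv eqxx andbT.
    rewrite big1 ?addr0 => [|l lk].
      by case: eqVneq => [->|_]; rewrite ?mulr1 ?mul1r ?mulr0 ?mul0r.
    by rewrite (formZl fip) ip_bv [l == k :> nat](_ : _ = false) ?andbF ?mulr0 //;
      apply: contra_neqF lk => /eqP lk; apply: val_inj.
  have -> : ip (u - (s true + s false)) (bv i k) =
     ip (- ((s true + s false) - (SS true M + SS false M))) (bv i k).
    rewrite !(formNl fip) !(formBl fip) !(formDl fip) !SE.
    have [c1 [c2 [-> -> e1]]] : exists c1 c2 : R[i],
        [/\ (true == i)%:R%:C = c1, (false == i)%:R%:C = c2 & c1 + c2 = 1].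
      exists (true == i)%:R%:C, (false == i)%:R%:C; split=> //.
      by case: (i); rewrite /= ?addr0 ?add0r.
    move: (ip u _) (ip (s true) _) (ip (s false) _) => x y z.
    by rewrite -[X in X - (y + z)]mul1r -e1; ring.
  apply: (le_trans (formCS fip _ _)).
  have -> : nrm ip (bv i k) = 1 by rewrite /nrm /nrm2 ip_bv !eqxx /= sqrtr1.
  rewrite mulr1 (nrmN fip); apply: add2; exact: le_trans (hs' _ _ M1) rM.
have ut : nrm ip (E *: u - (t true + t false)) = 0 by exact: (sa_uniq Hu Hst us).
have E0 : 0 <= normc E by exact: normc_ge0.
exists (DD * (1 + normc E)); split; first by rewrite mulr_ge0 // addr_ge0.
move=> N M N1 M1.
have r0 : 0 <= rate N + rate M by rewrite addr_ge0 ?powR_ge0.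
have p1 : nrm ip (u - (SS true N + SS false M)) <= DD * (rate N + rate M).
  have -> : u - (SS true N + SS false M) = (u - (s true + s false)) + ((s true + s false) - (SS true N + SS false M)).
    by rewrite addrA subrK.
  apply: (le_trans (nrmD fip _ _)); rewrite us add0r opprD addrACA mulrDr.
  by apply: (le_trans (nrmD fip _ _)); apply: lerD; exact: hs'.
have p2 : nrm ip (E *: u - (XX true N + XX false M)) <= DD * (rate N + rate M).
  have -> : E *: u - (XX true N + XX false M) = (E *: u - (t true + t false)) + ((t true + t false) - (XX true N + XX false M)).
    by rewrite addrA subrK.
  apply: (le_trans (nrmD fip _ _)); rewrite ut add0r opprD addrACA mulrDr.
  by apply: (le_trans (nrmD fip _ _)); apply: lerD; exact: ht.
have dr0 : 0 <= DD * (rate N + rate M) by rewrite mulr_ge0.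
split.
  by apply: (le_trans p1); rewrite mulrAC ler_peMr // lerDl.
have -> : XX true N + XX false M - E *: (SS true N + SS false M) =
    E *: (u - (SS true N + SS false M)) - (E *: u - (XX true N + XX false M)).
  by rewrite [in RHS]scalerBr [in RHS]opprB [RHS]addrC [RHS]addrA subrK.
apply: (le_trans (nrmB fip _ _)); rewrite (nrmZ fip).
apply: (le_trans (lerD (ler_wpM2l E0 p1) p2)).
by rewrite le_eqVlt; apply/orP; left; apply/eqP; ring.
Qed.

End Eigenvector.
End Approximation.

(** * Quadratic forms with one component in a fixed space *)

Section SmallComponent.
Context {R : realType}.
Local Notation mu := (@half_line R).
Local Notation leb := (@lebesgue_measure R).
Local Notation l2 f := (f \in Lfun mu 2%:E).
Local Notation hw := (gw (2^-1 : R)).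
Local Notation C := R[i].

Lemma measurable_cut (q : R -> R) (r : R) : measurable_fun setT (q : measurableTypeR R -> R) ->
  measurable_fun setT ((q \_ `]0%R, r]) : measurableTypeR R -> R).
Proof.
move=> mq; have mA : measurable (`]0%R, r]%classic : set (measurableTypeR R)) by exact: measurable_itv.
by apply/(measurable_restrictT _ mA); exact: measurable_funTS.
Qed.

Lemma int_cut (q : R -> R) (r : R) : continuous q -> 0 <= r ->
  (\int[mu]_x ((q \_ `]0%R, r]) x)%:E = \int[leb]_(x in `[0%R, r]) (q x)%:E)%E.
Proof.
move=> cq r0.
have mq : measurable_fun setT (q : measurableTypeR R -> R) by exact: continuous_measurable_fun.
rewrite integral_half_line; last by apply/measurable_EFinP; exact: measurable_cut.
have -> : (\int[leb]_(x in `]0%R, +oo[) ((q \_ `]0%R, r]) x)%:E =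
    \int[leb]_(x in `]0%R, +oo[) (((EFin \o q) \_ `]0%R, r]) x))%E.
  by apply: eq_integral => x _; rewrite /patch; case: ifP.
rewrite -integral_mkcondr.
have -> : (`]0%R, +oo[%classic `&` `]0%R, r]%classic)%classic = `]0%R, r]%classic :> set R.
  by apply/seteqP; split => x /=; rewrite !in_itv /= andbT; [case|move=> /andP[-> ->]].
by apply: integral_itv_obnd_cbnd; apply/measurable_EFinP; exact: measurable_funTS.
Qed.

Lemma cut_integrable (q : R -> R) (r : R) : continuous q -> 0 <= r ->
  mu.-integrable setT (EFin \o (q \_ `]0%R, r])).
Proof.
move=> cq r0; apply/integrableP; split.
  by apply/measurable_EFinP; apply: measurable_cut; exact: continuous_measurable_fun.
have cn : continuous (fun x => `|q x|).
  by move=> x; apply: (@continuous_comp _ _ _ q Num.norm); [exact: cq | exact: norm_continuous].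
have -> : (\int[mu]_x `|(EFin \o (q \_ `]0%R, r])) x| = \int[mu]_x (((fun x => `|q x|) \_ `]0%R, r]) x)%:E)%E.
  by apply: eq_integral => x _; rewrite /= /patch; case: ifP => //; rewrite normr0.
rewrite int_cut //.
have ic : leb.-integrable `[0%R, r] (EFin \o q).
  apply: continuous_compact_integrable; first exact: segment_compact.
  exact: continuous_subspaceT.
by case/integrableP: ic.
Qed.

Lemma rint_cut (q F : R -> R) (r : R) : continuous q ->
  (forall x : R, is_derive x (1 : R) F (q x)) -> 0 <= r -> rint mu (q \_ `]0%R, r]) = F r - F 0.
Proof.
move=> cq dF r0; have [_ <-] := itv_FTC cq dF r0.
by rewrite /rint /Rintegral int_cut.
Qed.

(** Cauchy-Schwarz for p(r) exp(-r^2/2), the integral of its derivative over [0,r]. *)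
Lemma hw_pointwise p r : p.[0] = 0 -> 0 <= r -> hw p r ^+ 2 <= r * gI (dp p * dp p).
Proof.
move=> p0 r0; have h0 : hw p 0 = 0 by rewrite /gw p0 mul0r.
have [->|rn] := eqVneq r 0; first by rewrite h0 mul0r expr0n.
have rp : 0 < r by rewrite lt_neqAle eq_sym rn.
have key (t : R) : 2 * t * hw p r - t ^+ 2 * r <= gI (dp p * dp p).
  pose q (x : R) := 2 * t * hw (dp p) x - t ^+ 2.
  have cq : continuous q.
    apply: contB; last by move=> x; exact: cvg_cst.
    apply: contM; [by move=> x; exact: cvg_cst | exact: continuous_gw].
  have dF (x : R) : is_derive x (1 : R) (fun x => 2 * t * hw p x - t ^+ 2 * x) (q x).
    have := is_derive_hw p x => h1; apply: is_derive_eq; rewrite /q /GRing.scale /=; ring.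
  have := rint_cut cq dF r0; rewrite h0 !mulr0 subrr subr0 => <-.
  rewrite -rdot_gw /rdot /rint; apply: le_Rintegral => //.
  - exact: cut_integrable.
  - by apply: l2_integrable; exact: l2_hw.
  move=> x _; rewrite /patch /=; case: ifP => _; last by rewrite -expr2 sqr_ge0.
  by rewrite /q; have := sqr_ge0 (hw (dp p) x - t); rewrite sqrrB -expr2; lra.
have := key (hw p r / r).
have -> : 2 * (hw p r / r) * hw p r - (hw p r / r) ^+ 2 * r = hw p r ^+ 2 / r by field.
by rewrite ler_pdivrMr // mulrC.
Qed.

Lemma rdot_amgm (u v : measurableTypeR R -> R) : l2 u -> l2 v ->
  `|rdot mu u v| <= (rdot mu u u + rdot mu v v) / 2.
Proof.
move=> lu lv; have E (c : R) : 0 <= c ^+ 2 * rdot mu u u + 2 * c * rdot mu u v + rdot mu v v.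
  have lc := l2Z c lu; have lw := l2D lc lv.
  have := rdot_ge0 mu ((fun x => c * u x) \+ v).
  rewrite rdotDl // rdotZl // [rdot mu u _]rdotC [rdot mu v _]rdotC !rdotDl // !rdotZl //.
  rewrite [rdot mu v u]rdotC; lra.
by rewrite ler_norml; have := E 1; have := E (-1); rewrite sqrrN expr1n => *; apply/andP; split; lra.
Qed.

Definition cs p : measurableTypeR R -> R := hw p \_ `]0, 1].

Lemma l2_cs p : l2 (cs p).
Proof.
have := @l2_dom _ (measurableTypeR R) R mu (cs p) (hw p); apply.
- by rewrite /cs; apply: (@measurable_cut (hw p) 1); exact: measurable_gw.
- exact: l2_hw.
by move=> x; rewrite /cs /patch; case: ifP => // _; rewrite normr0.
Qed.

Lemma energy_arith (CN F f' G g' : R) : F + f' <= CN * F -> G + g' <= CN * (G + g') ->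
  F + f' + (G + g') <= CN * (F + G + g').
Proof. by move=> *; lra. Qed.

Section Forms.
Variables (V W a : R -> R) (K : R) (kappa : int) (phisc phiel phiam : R -> R).
Hypothesis rp : regular_potentials kappa phisc phiel phiam V W a K.
Local Notation D1 := (D1 V a).
Local Notation D2 := (D2 W a).

(** Off the origin a Coulomb potential is bounded; near the origin r U(r) is. *)
Lemma cut_potential (U : R -> R) s : measurable_fun setT (U : measurableTypeR R -> R) ->
  (forall r, 0 < r -> `|U r| <= K * (1 + r^-1)) ->
  l2 (fun r => U r * hw ('X * s) r) /\
  rdot mu (fun r => U r * hw ('X * s) r) (fun r => U r * hw ('X * s) r) <=
    4 * K ^+ 2 * (rdot mu (cs s) (cs s) + gI (('X * s) * ('X * s))).
Proof.
move=> mU hU; have K0 := rp_K rp; rewrite -rdot_gw; apply: l2_bound.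
- by rewrite mulr_ge0 ?sqr_ge0.
- by apply: measurable_funM => //; exact: measurable_gw.
- exact: l2_cs.
- exact: l2_hw.
move=> r r0; have gE : hw ('X * s) r = r * hw s r by rewrite /gw hornerM hornerX -mulrA.
have U2 : U r ^+ 2 <= K ^+ 2 * (1 + r^-1) ^+ 2.
  rewrite -(real_normK (num_real (U r))) -exprMn ler_sqr ?nnegrE //; first exact: hU.
  by rewrite mulr_ge0 // addr_ge0 // invr_ge0 ltW.
have k4 : 0 <= 4 * K ^+ 2 by rewrite mulr_ge0 ?sqr_ge0.
have [r1|r1] := leP r 1.
  have -> : cs s r = hw s r.
    by rewrite /cs /patch ifT // inE /= in_itv /= r0 r1.
  apply: (@le_trans _ _ (4 * K ^+ 2 * hw s r ^+ 2)); last by rewrite ler_wpM2l // lerDl sqr_ge0.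
  rewrite gE exprMn; apply: (@le_trans _ _ (K ^+ 2 * (1 + r^-1) ^+ 2 * (r * hw s r) ^+ 2)).
    by rewrite ler_wpM2r ?sqr_ge0.
  have -> : K ^+ 2 * (1 + r^-1) ^+ 2 * (r * hw s r) ^+ 2 = (1 + r) ^+ 2 * (K ^+ 2 * hw s r ^+ 2).
    by field; rewrite gt_eqF.
  have kk : 0 <= K ^+ 2 * hw s r ^+ 2 by apply: mulr_ge0; exact: sqr_ge0.
  rewrite -[leRHS]mulrA; apply: (ler_wpM2r kk); rewrite -subr_ge0.
  by rewrite (_ : 4 - (1 + r) ^+ 2 = (1 - r) * (3 + r)); [apply: mulr_ge0; lra | ring].
apply: (@le_trans _ _ (4 * K ^+ 2 * hw ('X * s) r ^+ 2)); last by rewrite ler_wpM2l // lerDr sqr_ge0.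
rewrite exprMn ler_wpM2r ?sqr_ge0 //; apply: (le_trans U2).
rewrite mulrC ler_wpM2r ?sqr_ge0 //.
have ri : r^-1 <= 1 by rewrite invf_le1 // ltW.
have ri0 : 0 <= r^-1 by rewrite invr_ge0 ltW.
rewrite -subr_ge0 (_ : 4 - (1 + r^-1) ^+ 2 = (1 - r^-1) * (3 + r^-1)); last by ring.
by apply: mulr_ge0; lra.
Qed.

Lemma forms_arith (k CN F G f' vf af ag wg b d1 d2 p1 l1 l2' l3 : R) : 0 <= k -> 1 <= CN ->
  0 <= F -> 0 <= G -> 0 <= b -> F + f' <= CN * F ->
  vf <= 2 * k * (F + 4 * f') -> af <= 2 * k * (F + 4 * f') ->
  ag <= 4 * k * (b + G) -> wg <= 4 * k * (b + G) ->
  p1 <= 2 * vf + 2 * ag -> d2 <= 2 * (2 * f' + 2 * af) + 2 * wg ->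
  `|l1| <= (p1 + F) / 2 -> `|l2'| <= (G + f') / 2 -> `|l3| <= (d2 + G) / 2 ->
  `|l1 + l2' + l3| <= (24 * k * CN + 8 * k + 3 * CN + 2) * (F + G) + 8 * k * b /\
  2 * p1 + 2 * d1 <= (32 * k * CN + 16 * k + 2) * (F + G + b) + 2 * d1.
Proof.
move=> k0 CN1 F0 G0 b0 E hvf haf hag hwg hp hd h1 h2 h3.
have kF : k * (F + 4 * f') <= k * (4 * CN * F) by rewrite ler_wpM2l //; lra.
have kG : 0 <= k * G by rewrite mulr_ge0.
have kb : 0 <= k * b by rewrite mulr_ge0.
have kCF : 0 <= k * CN * F by rewrite !mulr_ge0 //; lra.
have kCG : 0 <= k * CN * G by rewrite !mulr_ge0 //; lra.
have kCb : 0 <= k * CN * b by rewrite !mulr_ge0 //; lra.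
have kF0 : 0 <= k * F by rewrite mulr_ge0.
have CF : 0 <= CN * F by rewrite mulr_ge0 //; lra.
have CG : 0 <= CN * G by rewrite mulr_ge0 //; lra.
have FF : F <= CN * F by rewrite ler_peMl.
split; last by lra.
apply: (le_trans (ler_normD _ _)); apply: (@le_trans _ _ (`|l1| + `|l2'| + `|l3|)).
  by rewrite lerD2r ler_normD.
lra.
Qed.

(** The first component f has bounded energy, being taken from a fixed finite-
    dimensional space; the potential terms of the second component g = r s are bounded
    except near the origin, where b measures them. Hence the form of the operator is
    bounded up to b, and that of its square is comparable to the Dirichlet form of g. *)
Lemma form_bounds (f s : {poly R}) (CN : R) : f.[0] = 0 -> 1 <= CN -> energy f <= CN * gI (f * f) ->
  let g := 'X * s in let b := rdot mu (cs s) (cs s) in let k := K ^+ 2 in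
  let E := rdot mu (D1 f g) (D1 f g) + rdot mu (D2 f g) (D2 f g) in
  [/\ `|rdot mu (D1 f g) (hw f) + rdot mu (D2 f g) (hw g)| <=
       (24 * k * CN + 8 * k + 3 * CN + 2) * (gI (f * f) + gI (g * g)) + 8 * k * b,
     gI (dp g * dp g) <= (32 * k * CN + 16 * k + 2) * (gI (f * f) + gI (g * g) + b) + 2 * E,
     E <= (80 * k + 4) * CN * (gI (f * f) + gI (g * g) + gI (dp g * dp g)) &
     b <= 4 * gI (dp g * dp g)].
Proof.
move=> f0 CN1 ef g b k E.
have g0 : g.[0] = 0 by rewrite /g hornerM hornerX mul0r.
have [l1 l2' bE] := D_bound rp f0 g0.
have [lVf bVf] := potential_bound (rp_K rp) (rp_mV rp) (rp_bV rp) f0.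
have [laf baf] := potential_bound (rp_K rp) (rp_ma rp) (rp_ba rp) f0.
have [lag bag] := cut_potential s (rp_ma rp) (rp_ba rp).
have [lWg bWg] := cut_potential s (rp_mW rp) (rp_bW rp).
have F0 := gI_sqr_ge0 f; have G0 := gI_sqr_ge0 g; have f'0 := gI_sqr_ge0 (dp f).
have g'0 := gI_sqr_ge0 (dp g).
have b0 : 0 <= b by exact: rdot_ge0.
have k0 : 0 <= k by exact: sqr_ge0.
pose P1 := (fun r => V r * hw f r) \+ (fun r => a r * hw g r).
have lP1 : l2 P1 by exact: l2D.
have lf := l2_hw f; have lg := l2_hw g; have lf' := l2_hw (dp f); have lg' := l2_hw (dp g).
have D1E : D1 f g = P1 \- hw (dp g) by apply/funext => r; rewrite /D1 /P1 /=; ring.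
have hp1 := rdot_add_le lVf lag; rewrite -/P1 in hp1.
have ld2 : l2 (hw (dp f) \+ (fun r => a r * hw f r)) by exact: l2D.
have hd2 : rdot mu (D2 f g) (D2 f g) <= 2 * (2 * gI (dp f * dp f) + 2 *
    rdot mu (fun r => a r * hw f r) (fun r => a r * hw f r)) +
    2 * rdot mu (fun r => W r * hw g r) (fun r => W r * hw g r).
  apply: (le_trans (rdot_add_le ld2 lWg)); rewrite lerD2r ler_pM2l //.
  by rewrite -rdot_gw; exact: rdot_add_le.
have n1 := rdot_amgm lP1 lf; have n2 := rdot_amgm lg lf'; have n3 := rdot_amgm l2' lg.
rewrite !rdot_gw in n1 n2 n3.
have LE : rdot mu (D1 f g) (hw f) + rdot mu (D2 f g) (hw g) =
    rdot mu P1 (hw f) + gI (g * dp f) + rdot mu (D2 f g) (hw g).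
  congr (_ + _); rewrite D1E rdotDl //; last exact: l2N.
  congr (_ + _); rewrite -rdot_gw.
  have -> : rdot mu (\- hw (dp g)) (hw f) = - rdot mu (hw (dp g)) (hw f).
    by rewrite -[RHS]mulN1r -rdotZl //; congr (rdot mu _ _); apply/funext => x; rewrite mulN1r.
  by rewrite rdot_hw_ibp // opprK.
have [A1 A2] := forms_arith (rdot mu (D1 f g) (D1 f g)) k0 CN1 F0 G0 b0 ef bVf baf bag bWg hp1 hd2 n1 n2 n3.
split; first by rewrite LE.
- have e1 : gI (dp g * dp g) <= 2 * rdot mu P1 P1 + 2 * rdot mu (D1 f g) (D1 f g).
    have -> : gI (dp g * dp g) = rdot mu (P1 \+ (\- D1 f g)) (P1 \+ (\- D1 f g)).
      by rewrite -rdot_gw D1E; congr (rdot mu _ _); apply/funext => x /=; ring.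
    apply: (le_trans (rdot_add_le lP1 (l2N l1))); rewrite lerD2l.
    by rewrite le_eqVlt; apply/orP; left; apply/eqP; congr (_ * _); apply: eq_Rintegral => x _ /=; rewrite mulrNN.
  apply: (le_trans e1); apply: (le_trans A2); rewrite lerD2l ler_pM2l // lerDl; exact: rdot_ge0.
- apply: (le_trans bE); rewrite -mulrA ler_wpM2l //.
    by rewrite addr_ge0 // mulr_ge0.
  have : gI (g * g) + gI (dp g * dp g) <= CN * (gI (g * g) + gI (dp g * dp g)) by rewrite ler_peMl // addr_ge0.
  exact: energy_arith ef.
- have := hardy s; rewrite [X in _ <= 4 * X -> _]rdot_gw; apply: le_trans.
  have := @rdot_le _ (measurableTypeR R) R mu (cs s) (hw s); apply; [exact: l2_cs|exact: l2_hw|].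
  by move=> x; rewrite /cs /patch; case: ifP => // _; rewrite normr0.
Qed.
End Forms.

Section Gram.
Variable n : nat.
Implicit Types (F H : 'I_n -> measurableTypeR R -> R) (y z : 'I_n -> R).
Definition lf F y : measurableTypeR R -> R := fun r => \sum_j y j * F j r.
Definition gram F H : 'M[C]_n := rmx (fun j k => rdot mu (F j) (H k)).

Lemma lf_dot F y (h : measurableTypeR R -> R) : (forall j, l2 (F j)) -> l2 h ->
  l2 (lf F y) /\ rdot mu (lf F y) h = \sum_j y j * rdot mu (F j) h.
Proof.
move=> lF lh; rewrite /lf; elim: (index_enum _) => [|j s [l1 IH]].
  have E : (fun r => \sum_(j <- [::]) y j * F j r) = fun=> 0 by apply/funext => r; rewrite big_nil.
  rewrite E big_nil; split; first exact: l2_0.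
  have -> : (fun=> 0 : R) = (fun x => 0 * h x) by apply/funext => x; rewrite mul0r.
  by rewrite rdotZl // mul0r.
have E : (fun r => \sum_(k <- j :: s) y k * F k r) =
    (fun r => y j * F j r) \+ (fun r => \sum_(k <- s) y k * F k r).
  by apply/funext => r; rewrite big_cons.
have lj := l2Z (y j) (lF j).
by rewrite E big_cons rdotDl // rdotZl // IH; split=> //; exact: l2D.
Qed.

Lemma qf_gram F H (x : 'cV[C]_n) : (forall j, l2 (F j)) -> (forall j, l2 (H j)) ->
  qf (gram F H) x = rdot mu (lf F (fun j => Re (x j 0))) (lf H (fun j => Re (x j 0))) +
    rdot mu (lf F (fun j => Im (x j 0))) (lf H (fun j => Im (x j 0))).
Proof.
move=> lF lH; rewrite qf_rmx.
have E (y : 'I_n -> R) : rdot mu (lf F y) (lf H y) = \sum_i \sum_j rdot mu (F i) (H j) * (y i * y j).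
  have [lHy _] := lf_dot y lH (l2_0 mu).
  have [_ ->] := lf_dot y lF lHy; apply: eq_bigr => i _.
  rewrite rdotC; have [_ ->] := lf_dot y lH (lF i); rewrite mulr_sumr; apply: eq_bigr => j _.
  by rewrite rdotC; ring.
by rewrite !E -big_split; apply: eq_bigr => i _; rewrite -big_split; apply: eq_bigr => j _ /=; ring.
Qed.
End Gram.
End SmallComponent.

(** * Trace of the Coulomb term *)

Section TraceBound.
Context {R : realType}.
Local Notation mu := (@half_line R).
Local Notation l2 f := (f \in Lfun mu 2%:E).
Local Notation hw := (gw (2^-1 : R)).
Local Notation C := R[i].

Lemma rint_sum (I : finType) (F : I -> measurableTypeR R -> R) :
  (forall i, mu.-integrable setT (EFin \o F i)) ->
  mu.-integrable setT (EFin \o (fun r => \sum_i F i r)) /\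
  rint mu (fun r => \sum_i F i r) = \sum_i rint mu (F i).
Proof.
move=> iF; elim: (index_enum _) => [|j s [i1 IH]].
  have E : (fun r => \sum_(j <- [::]) F j r) = fun=> 0 by apply/funext => r; rewrite big_nil.
  rewrite E big_nil; split; last by rewrite /rint Rintegral_cst // mul0r.
  by have := l2_integrable (l2_0 mu) (l2_0 mu); rewrite (_ : _ \* _ = fun=> 0) //;
    apply/funext => r /=; rewrite mulr0.
have E : (fun r => \sum_(k <- j :: s) F k r) = F j \+ (fun r => \sum_(k <- s) F k r).
  by apply/funext => r; rewrite big_cons.
rewrite E big_cons; split; last by rewrite /rint RintegralD // -IH.
exact: (integrableD measurableT (iF j) i1).
Qed.

Lemma lf_cs n (ps : 'I_n -> {poly R}) (y : 'I_n -> R) : lf (fun j => cs (ps j)) y = cs (lp ps y).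
Proof.
apply/funext => r; rewrite /lf /cs /patch; case: ifP => _; first by rewrite hw_lp.
by rewrite big1 // => j _; rewrite mulr0.
Qed.
Lemma lf_hw n (p : 'I_n -> {poly R}) (y : 'I_n -> R) : lf (fun j => hw (p j)) y = hw (lp p y).
Proof. by apply/funext => r; rewrite /lf hw_lp. Qed.
Lemma lp_X n (ps : 'I_n -> {poly R}) (y : 'I_n -> R) : lp (fun j => 'X * ps j) y = 'X * lp ps y.
Proof. by rewrite /lp mulr_sumr; apply: eq_bigr => j _; rewrite scalerAr. Qed.

(** The majorant is the logarithmic derivative of 1 + P x + P^2 x^2; its integral over
    [0,1] is logarithmic in P because min (P, 1/r) is. *)
Lemma log_majorant (P : R) : 0 <= P -> exists q F : R -> R,
  [/\ continuous q, forall x : R, is_derive x (1 : R) F (q x), F 1 - F 0 <= 2 * ln (1 + P) &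
   forall r h, 0 < r -> 0 <= h -> h <= P -> r * h <= 1 -> h <= q r].
Proof.
move=> P0; pose u (x : R) : R := 1 + P * x + P ^+ 2 * x ^+ 2; pose v (x : R) : R := P + 2 * P ^+ 2 * x.
have u0 x : 0 < u x.
  have -> : u x = 3 / 4 + (P * x + 2^-1) ^+ 2 by rewrite /u; field.
  by rewrite ltr_wpDr // sqr_ge0.
have du (x : R) : is_derive x (1 : R) u (v x).
  by apply: is_derive_eq; rewrite /v /GRing.scale /=; ring.
have dv (x : R) : is_derive x (1 : R) v (2 * P ^+ 2).
  by apply: is_derive_eq; rewrite /GRing.scale /=; ring.
have cont (f f' : R -> R) : (forall x : R, is_derive x (1 : R) f (f' x)) -> continuous f.
  move=> df x; apply: differentiable_continuous; apply/derivable1_diffP.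
  by have := df x.
exists (fun x => v x / u x), (fun x => ln (u x)); split.
- move=> x; apply: cvgM; first exact: (cont _ _ dv).
  by apply: cvgV; [rewrite gt_eqF | exact: (cont _ _ du)].
- move=> x; have d1 := is_derive1_ln (u0 x).
  have d2 := @is_derive1_comp R (@ln R) u x _ _ d1 (du x).
  by apply: is_derive_eq; rewrite mulrC.
- have -> : u 0 = 1 by rewrite /u; ring.
  rewrite ln1 subr0 (_ : 2 * ln (1 + P) = ln ((1 + P) ^+ 2)); last first.
    by rewrite lnXn ?mulr_natl // ltr_pwDl.
  rewrite ler_ln ?posrE ?u0 // ?exprn_gt0 ?ltr_pwDl // /u.
  have -> : (1 + P) ^+ 2 = 1 + P * 1 + P ^+ 2 * 1 ^+ 2 + P by ring.
  by rewrite lerDl.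
- move=> r h r0 h0 hP rh; rewrite ler_pdivlMr //.
  have hy : h * (P * r) <= P by rewrite mulrCA ler_piMr // mulrC.
  have y0 : 0 <= P * r by rewrite mulr_ge0 // ltW.
  have -> : h * u r = h + h * (P * r) + h * (P * r) * (P * r) by rewrite /u; ring.
  have -> : v r = P + 2 * (P * (P * r)) by rewrite /v; ring.
  have h2 : h * (P * r) * (P * r) <= P * (P * r) by rewrite ler_wpM2r.
  have [y1|y1] := leP (P * r) 1.
    have h3 : h * (P * r) <= P * (P * r) by rewrite ler_wpM2r.
    lra.
  have h3 : P <= P * (P * r) by rewrite ler_peMr // ltW.
  lra.
Qed.

Variables (n : nat) (ps : 'I_n -> {poly R}) (U : 'M[C]_n) (d : 'rV[R]_n) (P : R).
Local Notation pg := (fun j => 'X * ps j).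
Local Notation B := (gram (fun j => cs (ps j)) (fun j => cs (ps j))).
Local Notation G := (gram (fun j => hw (dp (pg j))) (fun j => hw (dp (pg j)))).
Hypothesis UU : U^t* *m U = 1%:M.
Hypothesis hU : U^t* *m G *m U = cdiag d.
Hypothesis d0 : forall i, 0 <= d 0 i.
Hypothesis P0 : 0 <= P.
Hypothesis point : forall r, 0 < r -> r <= 1 -> \sum_j hw (pg j) r ^+ 2 <= r ^+ 2 * P.

(** The sum S is the kernel of (1 + G)^-1 at (r,r). It is at most r^2 P, because the
    inverse is at most 1; and the pointwise bound f(r)^2 <= r |f prime|^2, for f the
    kernel itself with f(r) = S, gives S^2 <= r S. *)
Lemma trace_pointwise (r : R) : 0 < r -> r <= 1 ->
  let S := \sum_i (hw (lp pg (fun j => Re (U j i))) r ^+ 2 + hw (lp pg (fun j => Im (U j i))) r ^+ 2)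
     / (d 0 i + 1) in S <= r ^+ 2 * P /\ S <= r.
Proof.
move=> r0 r1 S; have e0 i : 0 < d 0 i + 1 by rewrite ltr_wpDl.
pose w : 'cV[C]_n := \col_j (hw (pg j) r)%:C.
have [hc hcE] : exists hc : 'cV[C]_n, hc = U^t* *m w by eexists.
have nE i : normc (hc i 0) ^+ 2 = hw (lp pg (fun j => Re (U j i))) r ^+ 2 + hw (lp pg (fun j => Im (U j i))) r ^+ 2.
  rewrite sqr_normcE; congr (_ + _).
    rewrite hcE mxE cRe_sum hw_lp; congr (_ ^+ 2); apply: eq_bigr => j _.
    by rewrite trCE mxE cReM cReJ cImJ /= mulr0 subr0.
  rewrite hcE mxE cIm_sum hw_lp -[RHS]sqrrN -sumrN; congr (_ ^+ 2); apply: eq_bigr => j _.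
  by rewrite trCE mxE cImM cReJ cImJ /= mulr0 add0r mulNr.
have SE : S = \sum_i normc (hc i 0) ^+ 2 / (d 0 i + 1) by apply: eq_bigr => i _; rewrite nE.
have S0 : 0 <= S by rewrite SE sumr_ge0 // => i _; rewrite divr_ge0 ?sqr_ge0 // ltW.
split.
  apply: (@le_trans _ _ (sqn hc)).
    rewrite SE /sqn ler_sum // => i _; rewrite ler_pdivrMr // ler_peMr ?sqr_ge0 //.
    by rewrite lerDr.
  have -> : sqn hc = sqn w.
    have VV := mulmx1C UU.
    have UUc : (U^t*)^t* *m 1%:M *m U^t* = 1%:M.
      by rewrite mulmx1 (_ : (U^t*)^t* = U) //; apply/matrixP => i j; rewrite !trCE conjCK.
    by rewrite hcE -[LHS]qf1 -qf_conj UUc qf1.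
  apply: le_trans (point r0 r1); rewrite /sqn ler_sum // => j _.
  by rewrite mxE /= expr0n addr0 sqrtr_sqr real_normK // num_real.
pose c : 'cV[C]_n := \col_i (((d 0 i + 1)^-1)%:C * hc i 0).
pose v := U *m c.
have vS : hw (lp pg (fun j => Re (v j 0))) r = S.
  have -> : hw (lp pg (fun j => Re (v j 0))) r = Re ((w^t* *m v) 0 0).
    rewrite hw_lp mxE cRe_sum; apply: eq_bigr => j _.
    by rewrite trCE [w j 0]mxE cconjR cReZ mulrC.
  have -> : w^t* *m v = hc^t* *m c.
    rewrite /v mulmxA hcE trC_mul; congr (_ *m _ *m _).
    by apply/matrixP => i j; rewrite !trCE conjCK.
  rewrite mxE cRe_sum SE; apply: eq_bigr => i _.
  by rewrite trCE [c i 0]mxE mulrCA cReZ mulrC [_^* * _]mulrC mulJc.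
have dc : d 0 = d 0 by [].
have gv : gI (dp (lp pg (fun j => Re (v j 0))) * dp (lp pg (fun j => Re (v j 0)))) <= S.
  have l2g j : l2 (hw (dp (pg j))) by exact: l2_hw.
  apply: (@le_trans _ _ (qf G v)).
    by rewrite qf_gram // !(lf_hw (fun j => dp (pg j))) -!dp_lp !rdot_gw lerDl gI_sqr_ge0.
  rewrite /v -qf_conj hU qf_cdiag SE ler_sum // => i _.
  rewrite mxE Normc.normcM exprMn (_ : normc _%:C = (d 0 i + 1)^-1); last first.
    by rewrite /= expr0n addr0 sqrtr_sqr ger0_norm // invr_ge0 ltW.
  rewrite mulrA mulrC ler_wpM2l ?sqr_ge0 // expr2 mulrA ler_pdivrMr // mulVf ?gt_eqF //.
  by rewrite ler_pdivrMr // mul1r lerDl.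
have pg0 : (lp pg (fun j => Re (v j 0))).[0] = 0.
  by apply: lp0 => j; rewrite hornerM hornerX mul0r.
have := hw_pointwise pg0 (ltW r0); rewrite vS => h.
have {}h := le_trans h (ler_wpM2l (ltW r0) gv).
have [->|Sn] := eqVneq S 0; first exact: ltW.
have Sp : 0 < S by rewrite lt_neqAle eq_sym Sn.
by move: h; rewrite expr2 ler_pM2r.
Qed.

(** By trace_pointwise the kernel of (1 + G)^-1 divided by r^2 is at most min (P, 1/r)
    on the diagonal; integrating over [0,1] gives a logarithm. *)
Lemma trace_bound : \sum_i qf B (U *m delta_mx i 0) / (d 0 i + 1) <= 2 * ln (1 + P).
Proof.
have e0 i : 0 < d 0 i + 1 by rewrite ltr_wpDl.
pose aR i := lp ps (fun j => Re (U j i)); pose aI i := lp ps (fun j => Im (U j i)).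
pose F i (r : measurableTypeR R) := (d 0 i + 1)^-1 * (cs (aR i) r * cs (aR i) r) +
   (d 0 i + 1)^-1 * (cs (aI i) r * cs (aI i) r).
have iF i : mu.-integrable setT (EFin \o F i) /\
    rint mu (F i) = qf B (U *m delta_mx i 0) / (d 0 i + 1).
  have l1 := l2_cs (aR i); have l2' := l2_cs (aI i).
  have z1 := l2Z ((d 0 i + 1)^-1) l1; have z2 := l2Z ((d 0 i + 1)^-1) l2'.
  have E : F i = ((fun r => (d 0 i + 1)^-1 * cs (aR i) r) \* cs (aR i)) \+
     ((fun r => (d 0 i + 1)^-1 * cs (aI i) r) \* cs (aI i)).
    by apply/funext => r; rewrite /F /= !mulrA.
  have i1 := l2_integrable z1 l1; have i2 := l2_integrable z2 l2'.
  split.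
    by rewrite E; exact: (integrableD measurableT i1 i2).
  rewrite E /rint RintegralD // -!/(rint mu _) -!/(rdot mu _ _) !rdotZl // -mulrDr mulrC; congr (_ / _).
  rewrite qf_gram; try by move=> j; exact: l2_cs.
  by rewrite !lf_cs; congr (rdot mu _ _ + rdot mu _ _); congr (cs (lp ps _)); apply/funext => j; rewrite -colE mxE.
have [q [Q [cq dQ Q1 hq]]] := log_majorant P0.
have [iS rS] := rint_sum (fun i => (iF i).1).
rewrite -(eq_bigr _ (fun i _ => (iF i).2)) -rS; apply: le_trans Q1.
rewrite -(rint_cut cq dQ ler01) /rint; apply: le_Rintegral => //.
  exact: cut_integrable.
move=> r _; rewrite /patch; case: ifP => rA; last first.
  have cz p : cs p r = 0 by rewrite /cs /patch rA.
  by rewrite [leRHS](_ : _ = 0) // big1 // => i _; rewrite /F !cz; ring.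
move: (rA); rewrite inE /= in_itv /= => /andP[r0 r1].
have [h1 h2] := trace_pointwise r0 r1.
set S := \sum_i _ in h1 h2.
have SE : S = r ^+ 2 * \sum_i F i r.
  rewrite /S mulr_sumr; apply: eq_bigr => i _; rewrite !lp_X /F /cs /patch rA.
  have hX s : hw ('X * s) r = r * hw s r by rewrite /gw hornerM hornerX -mulrA.
  by rewrite !hX -/(aR i) -/(aI i); field; rewrite gt_eqF.
have r2 : 0 < r ^+ 2 by rewrite exprn_gt0.
apply: hq => //.
- by rewrite sumr_ge0 // => i _; rewrite /F addr_ge0 // mulr_ge0 ?invr_ge0 ?(ltW (e0 i)) // -expr2 sqr_ge0.
- by move: h1; rewrite SE ler_pM2l.
- by move: h2; rewrite SE expr2 -mulrA -[X in _ <= X]mulr1 ler_pM2l.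
Qed.
End TraceBound.

Section SmallComponentRoot.
Context {R : realType}.
Local Notation mu := (@half_line R).
Local Notation l2 f := (f \in Lfun mu 2%:E).
Local Notation hw := (gw (2^-1 : R)).
Local Notation C := R[i].
Variables (V W a : R -> R) (K : R) (kappa : int) (phisc phiel phiam : R -> R).
Hypothesis rp : regular_potentials kappa phisc phiel phiam V W a K.
Local Notation D1 := (D1 V a).
Local Notation D2 := (D2 W a).

(** The quadratic forms of the square and of the operator itself on real combinations
    of the spinors with components pf and pg; together they give the pencil. *)
Definition sqmx n (pf pg : 'I_n -> {poly R}) : 'M[C]_n :=
  gram (fun j => D1 (pf j) (pg j)) (fun j => D1 (pf j) (pg j)) +
  gram (fun j => D2 (pf j) (pg j)) (fun j => D2 (pf j) (pg j)).
Definition opmx n (pf pg : 'I_n -> {poly R}) : 'M[C]_n :=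
  gram (fun j => D1 (pf j) (pg j)) (fun j => hw (pf j)) +
  gram (fun j => D2 (pf j) (pg j)) (fun j => hw (pg j)).
Definition kinmx n (pg : 'I_n -> {poly R}) : 'M[C]_n :=
  gram (fun j => hw (dp (pg j))) (fun j => hw (dp (pg j))).

Lemma gram_herm n (F : 'I_n -> measurableTypeR R -> R) : herm (gram F F).
Proof. by apply: rmx_herm => i j; rewrite rdotC. Qed.

Let kinetic_arith (A1 q n g e b : R) : (1 + A1) * n <= q * e -> g <= A1 * (n + b) + 2 * e ->
  0 <= q * b -> 0 <= A1 * e -> 0 <= b -> n + g <= (e + b) * (q + A1 + 2).
Proof. by move=> *; lra. Qed.
Let sum_arith (A1 n1 n2 b1 b2 e1 e2 g1 g2 : R) : g1 <= A1 * (n1 + b1) + 2 * e1 ->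
  g2 <= A1 * (n2 + b2) + 2 * e2 -> g1 + g2 <= A1 * (n1 + n2 + (b1 + b2)) + 2 * (e1 + e2).
Proof. by move=> *; lra. Qed.
Let hardy_arith (N n : R) : 0 <= n -> 0 <= N * n -> 4 * (4 * n) <= N * n + 17 * n.
Proof. by move=> *; lra. Qed.

(** The assumptions of bounded_root for the compressed operator: K and L are the
    matrices of the square and of the operator, B is the Coulomb term near 0 and G the
    kinetic energy of the second component. *)
Lemma small_component (kap CN : R) (N : nat) : 0 < kap -> 1 <= CN ->
  exists (Y : R) (M0 : nat), 0 < Y /\
  forall (M n : nat) (pf ps : 'I_n -> {poly R}) (U : 'M[C]_n) (d : 'rV[R]_n),
  let pg := fun j => 'X * ps j in
  (M0 <= M)%N -> (0 < n)%N -> (n <= N.+1 * M)%N ->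
  (forall j, (pf j).[0] = 0) ->
  (forall y, gI (lp pf y * lp pf y) + gI (lp pg y * lp pg y) = \sum_j y j ^+ 2) ->
  (forall y, energy (lp pf y) <= CN * gI (lp pf y * lp pf y)) ->
  (forall y, gI (dp (lp pg y) * dp (lp pg y)) <= 4 * M%:R * \sum_j y j ^+ 2) ->
  (forall r, 0 < r -> r <= 1 -> \sum_j hw (pg j) r ^+ 2 <= r ^+ 2 * (4 * M%:R ^+ 2)) ->
  herm (opmx pf pg) -> (forall x, kap * sqn x <= qf (sqmx pf pg) x) ->
  (forall x, sqn (opmx pf pg *m x) <= qf (sqmx pf pg) x) ->
  U^t* *m U = 1%:M -> U^t* *m kinmx pg *m U = cdiag d -> (forall i, 0 <= d 0 i) ->
  (forall t, 0 < t -> \sum_i (d 0 i + t)^-1 <= N%:R / t + Num.sqrt M%:R * (Num.sqrt t)^-1) ->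
  Num.sqrt M%:R <= 3 * \sum_i (d 0 i + 1)^-1 ->
  exists2 z, normc z <= Y & \det (hpencil (opmx pf pg) (sqmx pf pg) z) = 0.
Proof.
move=> kap0 CN1; have k0 : 0 <= K ^+ 2 by exact: sqr_ge0.
have CN0 : 0 <= CN by exact: le_trans CN1.
have [w wE] : exists w, w = 24 * K ^+ 2 * CN + 8 * K ^+ 2 + 3 * CN + 2 by eexists.
have [c cE] : exists c, c = 8 * K ^+ 2 by eexists.
have [A1 A1E] : exists A1, A1 = 32 * K ^+ 2 * CN + 16 * K ^+ 2 + 2 by eexists.
have [C2 C2E] : exists C2, C2 = (80 * K ^+ 2 + 4) * CN by eexists.
have kC : 0 <= K ^+ 2 * CN by rewrite mulr_ge0.
have w0 : 0 <= w by rewrite wE; lra.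
have c0 : 0 <= c by rewrite cE; lra.
have A10 : 0 <= A1 by rewrite A1E; lra.
have C20 : 0 < C2 by rewrite C2E; lra.
pose c1 := ((1 + A1) / kap + A1 + 2)^-1.
have q0 : 0 <= (1 + A1) / kap by rewrite divr_ge0 ?addr_ge0 // ltW.
have s0 : 0 < (1 + A1) / kap + A1 + 2 by lra.
have c10 : 0 < c1 by rewrite invr_gt0.
have N0 : 0 <= N%:R :> R by exact: ler0n.
have A0 : 0 <= N%:R + 17 :> R by rewrite addr_ge0.
have [Y [M0 [Y0 BR]]] := bounded_root kap0 w0 c0 c10 C20 N0 A0.
exists Y, M0; split=> // M n pf ps U d pg MM n0 nN pf0 ortho small big point hL kK LK UU hU d0 hg hs.
pose B := gram (fun j => cs (ps j)) (fun j => cs (ps j)).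
have pg0 j : (pg j).[0] = 0 by rewrite hornerM hornerX mul0r.
have M0' : (0 < M)%N by case: (M) nN => //; rewrite muln0 leqn0 => /eqP h; rewrite h in n0.
have M1 : 1 <= M%:R :> R by rewrite ler1n.
pose N2 (y : 'I_n -> R) := gI (lp pf y * lp pf y) + gI (lp pg y * lp pg y).
pose Ef (y : 'I_n -> R) := rdot mu (D1 (lp pf y) (lp pg y)) (D1 (lp pf y) (lp pg y)) +
   rdot mu (D2 (lp pf y) (lp pg y)) (D2 (lp pf y) (lp pg y)).
pose Lf (y : 'I_n -> R) := rdot mu (D1 (lp pf y) (lp pg y)) (hw (lp pf y)) +
   rdot mu (D2 (lp pf y) (lp pg y)) (hw (lp pg y)).
pose Gf (y : 'I_n -> R) := gI (dp (lp pg y) * dp (lp pg y)).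
pose Bf (y : 'I_n -> R) := rdot mu (cs (lp ps y)) (cs (lp ps y)).
have fb y : [/\ `|Lf y| <= w * N2 y + c * Bf y, Gf y <= A1 * (N2 y + Bf y) + 2 * Ef y,
    Ef y <= C2 * (N2 y + Gf y) & Bf y <= 4 * Gf y].
  have := @form_bounds R V W a K kappa phisc phiel phiam rp (lp pf y) (lp ps y) CN (lp0 y pf0) CN1 (small y).
  by rewrite /= -lp_X -wE -A1E -cE -C2E.
pose re (x : 'cV[C]_n) := fun j => Re (x j 0); pose im (x : 'cV[C]_n) := fun j => Im (x j 0).
have lD1 j : l2 (D1 (pf j) (pg j)) by have [] := D_bound rp (pf0 j) (pg0 j).
have lD2 j : l2 (D2 (pf j) (pg j)) by have [] := D_bound rp (pf0 j) (pg0 j).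
have lh (p : 'I_n -> {poly R}) j : l2 (hw (p j)) by exact: l2_hw.
have lfD1 y : lf (fun j => D1 (pf j) (pg j)) y = D1 (lp pf y) (lp pg y).
  by apply/funext => r; rewrite D1_lp.
have lfD2 y : lf (fun j => D2 (pf j) (pg j)) y = D2 (lp pf y) (lp pg y).
  by apply/funext => r; rewrite D2_lp.
have KE x : qf (sqmx pf pg) x = Ef (re x) + Ef (im x).
  rewrite /sqmx qfD !qf_gram // !lfD1 !lfD2 /Ef /re /im; ring.
have LE x : qf (opmx pf pg) x = Lf (re x) + Lf (im x).
  rewrite /opmx qfD !qf_gram //; try exact: lh.
  rewrite !lfD1 !lfD2 !lf_hw /Lf /re /im; ring.
have BE x : qf B x = Bf (re x) + Bf (im x).
  by rewrite /B qf_gram; [rewrite !lf_cs | move=> j; exact: l2_cs | move=> j; exact: l2_cs].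
have GE x : qf (kinmx pg) x = Gf (re x) + Gf (im x).
  rewrite /kinmx qf_gram; try (by move=> j; exact: l2_hw).
  by rewrite !(lf_hw (fun j => dp (pg j))) -!dp_lp !rdot_gw.
have SE x : sqn x = N2 (re x) + N2 (im x).
  by rewrite /N2 !ortho /sqn -big_split; apply: eq_bigr => j _; rewrite sqr_normcE.
have B0 y : 0 <= Bf y by exact: rdot_ge0.
have hK : herm (sqmx pf pg) by apply: hermD; exact: gram_herm.
apply: (BR M n _ _ B _ U d MM n0 _ hK hL _ kK LK _ _ _ _ _ _ UU hU d0 _ hg hs).
- apply: (@le_trans _ _ ((N.+1 * M)%N)%:R); first by rewrite ler_nat.
  by rewrite natrM ler_wpM2r ?ler0n // -natr1 lerD2l; lra.
- exact: gram_herm.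
- move=> x; rewrite LE SE BE; have [h1 _ _ _] := fb (re x); have [h2 _ _ _] := fb (im x).
  apply: (le_trans (ler_normD _ _)); apply: (le_trans (lerD h1 h2)).
  by rewrite le_eqVlt; apply/orP; left; apply/eqP; ring.
- by move=> x; rewrite BE addr_ge0.
- move=> x; have bb y : Bf y <= (N%:R + 17) * M%:R * N2 y.
    have [_ _ _ h] := fb y; apply: (le_trans h).
    apply: (@le_trans _ _ (4 * (4 * M%:R * N2 y))); first by rewrite ler_pM2l // /N2 ortho; exact: big.
    have n2 : 0 <= M%:R * N2 y by rewrite mulr_ge0 ?ler0n // /N2 addr_ge0 // gI_sqr_ge0.
    by have := hardy_arith n2 (mulr_ge0 N0 n2); rewrite -mulrDl !mulrA.
  by rewrite BE SE mulrDr lerD.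
- move=> x; rewrite /c1 mulrC ler_pdivrMr //.
  have [_ h1 _ _] := fb (re x); have [_ h2 _ _] := fb (im x).
  have e0 : 0 <= qf (sqmx pf pg) x by apply: le_trans (kK x); rewrite mulr_ge0 ?sqn_ge0 // ltW.
  move: e0 (kK x); rewrite KE SE GE BE; move: h1 h2 (B0 (re x)) (B0 (im x)).
  move: (N2 (re x)) (N2 (im x)) (Ef (re x)) (Ef (im x)) (Gf (re x)) (Gf (im x)) (Bf (re x)) (Bf (im x)).
  move=> n1 n2 e1 e2 g1 g2 b1 b2 h1 h2 b10 b20 e12 hk.
  have h3 : (1 + A1) * (n1 + n2) <= (1 + A1) / kap * (e1 + e2).
    rewrite -mulrA ler_wpM2l ?addr_ge0 // mulrC ler_pdivlMr // mulrC; exact: hk.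
  have h4 := mulr_ge0 q0 (addr_ge0 b10 b20).
  have h5 := mulr_ge0 A10 e12.
  by apply: (kinetic_arith h3 (sum_arith h1 h2) h4 h5); rewrite addr_ge0.
- move=> x; rewrite KE SE GE; have [_ _ h1 _] := fb (re x); have [_ _ h2 _] := fb (im x).
  apply: (le_trans (lerD h1 h2)).
  by rewrite le_eqVlt; apply/orP; left; apply/eqP; ring.
- exact: gram_herm.
- have P0 : 0 <= 4 * M%:R ^+ 2 :> R by rewrite mulr_ge0 ?sqr_ge0.
  apply: (le_trans (trace_bound UU hU d0 P0 point)).
  rewrite ler_pM2l // ler_ln ?posrE ?lerD2l ?ltr_pwDl ?mulr_ge0 ?exprn_ge0 ?ler0n //.
  rewrite [M%:R ^+ 3]exprS mulrA ler_wpM2r ?sqr_ge0 //.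
  apply: (@le_trans _ _ ((N%:R + 17) * 1)); last by rewrite ler_wpM2l.
  rewrite mulr1; lra.
Qed.
End SmallComponentRoot.

(** * The Hermite basis as a block basis *)

Section HermiteBasis.
Context {R : realType}.
Local Notation mu := (@half_line R).
Local Notation l2 f := (f \in Lfun mu 2%:E).
Local Notation hw := (gw (2^-1 : R)).
Local Notation ip := (@hip R).
Local Notation C := R[i].
Let fip := @form_hip R.

Section Shapes.
Variables N M : nat.
Definition pfb (j : 'I_(N + M)) : {poly R} :=
  match fintype.split j with inl k => psp k.*2.+1 | inr _ => 0 end.
Definition pgb (j : 'I_(N + M)) : {poly R} :=
  match fintype.split j with inl _ => 0 | inr k => psp k.*2.+1 end.

Lemma pfbl k : pfb (lshift M k) = psp k.*2.+1. Proof. by rewrite /pfb (unsplitK (inl k)). Qed.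
Lemma pfbr k : pfb (rshift N k) = 0. Proof. by rewrite /pfb (unsplitK (inr k)). Qed.
Lemma pgbl k : pgb (lshift M k) = 0. Proof. by rewrite /pgb (unsplitK (inl k)). Qed.
Lemma pgbr k : pgb (rshift N k) = psp k.*2.+1. Proof. by rewrite /pgb (unsplitK (inr k)). Qed.
Lemma pfb0 j : (pfb j).[0] = 0.
Proof. by rewrite /pfb; case: fintype.split => k; rewrite ?horner0 // psp_odd0. Qed.
Lemma pgb0 j : (pgb j).[0] = 0.
Proof. by rewrite /pgb; case: fintype.split => k; rewrite ?horner0 // psp_odd0. Qed.

Lemma lp_pfb y : lp pfb y = hsum (fun k : 'I_N => y (lshift M k)).
Proof.
rewrite /lp big_split_ord /= [X in _ + X]big1 ?addr0 => [|k _]; last by rewrite pfbr scaler0.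
by apply: eq_bigr => k _; rewrite pfbl.
Qed.
Lemma lp_pgb y : lp pgb y = hsum (fun k : 'I_M => y (rshift N k)).
Proof.
rewrite /lp big_split_ord /= big1 ?add0r => [|k _]; last by rewrite pgbl scaler0.
by apply: eq_bigr => k _; rewrite pgbr.
Qed.

Lemma hw0 : hw 0 = fun=> 0.
Proof. by apply/funext => r; rewrite /gw horner0 mul0r. Qed.

Lemma basisE j : @hermite_basis R N M j = hval (hb pfb pgb j).
Proof.
have z : (fun r => (hw 0 r)%:C) = (fun=> 0 : C) by rewrite hw0.
rewrite /hermite_basis /= /rsp /pfb /pgb; case: fintype.split => k; rewrite z.
  by congr (_, _); apply/funext => r; rewrite Phi_psi.
by congr (_, _); apply/funext => r; rewrite Phi_psi.
Qed.

Lemma basis_norm y : gI (lp pfb y * lp pfb y) + gI (lp pgb y * lp pgb y) = \sum_j y j ^+ 2.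
Proof.
rewrite lp_pfb lp_pgb !gI_hsum [RHS]big_split_ord /=.
by congr (_ + _); apply: eq_bigr => k _; rewrite expr2.
Qed.

Lemma hb_ortho j k : ip (hb pfb pgb j) (hb pfb pgb k) = (j == k)%:R.
Proof.
have m0 (p : {poly R}) : gI (0 * p) = 0 by rewrite mul0r -(scale0r 0) gIZ mul0r.
have m1 (p : {poly R}) : gI (p * 0) = 0 by rewrite mulrC.
rewrite ip_hb -[j]splitK -[k]splitK.
case: (fintype.split j) => i; case: (fintype.split k) => l /=;
  rewrite ?pfbl ?pfbr ?pgbl ?pgbr ?m0 ?m1 ?gI_Phi ?addr0 ?add0r.
- by rewrite eq_lshift rmorph_nat.
- by rewrite eq_lrshift.
- by rewrite eq_rlshift.
- by rewrite eq_rshift rmorph_nat.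
Qed.

Lemma sqn_hb x : nrm2 ip (comb (hb pfb pgb) x) = sqn x.
Proof.
rewrite (nrm2_comb x (@ip_hb R _ pfb pgb)) !nrm2_rc_hb !basis_norm -big_split.
by apply: eq_bigr => j _; rewrite sqr_normcE.
Qed.
End Shapes.

Lemma hsum_energy n (y : 'I_n -> R) : energy (hsum y) <= 4 * n%:R * gI (hsum y * hsum y).
Proof.
rewrite /energy gI_hsum; apply: (le_trans (lerD (lexx _) (kinetic_le y))).
rewrite mulr_sumr -big_split ler_sum // => k _ /=.
rewrite -expr2 -[X in X + _]mul1r -mulrDl ler_wpM2r ?sqr_ge0 //.
rewrite -natrM -[X in X + _](mulr1n 1) -natrD ler_nat; have := ltn_ord k; lia.
Qed.

Lemma hsum_kinetic n (y : 'I_n -> R) : gI (dp (hsum y) * dp (hsum y)) <= 4 * n%:R * \sum_k y k ^+ 2.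
Proof.
apply: (le_trans (kinetic_le y)); rewrite mulr_sumr ler_sum // => k _.
rewrite ler_wpM2r ?sqr_ge0 // -natrM ler_nat; have := ltn_ord k; lia.
Qed.

Lemma hsum_point n r : 0 < r -> r <= 1 ->
  \sum_(k < n) hw (psp k.*2.+1) r ^+ 2 <= r ^+ 2 * (4 * n%:R ^+ 2).
Proof.
move=> r0 r1; have -> : r ^+ 2 * (4 * n%:R ^+ 2) = \sum_(k < n) r ^+ 2 * (4 * n%:R).
  by rewrite sumr_const card_ord -mulr_natr; ring.
apply: ler_sum => k _; have := @Phi_near0 R k r; rewrite (ltW r0) r1 => /(_ isT).
rewrite Phi_psi psiE => /le_trans; apply; rewrite ler_wpM2l ?sqr_ge0 //.
rewrite -natrM -[X in X + _](mulr1n 1) -natrD ler_nat; have := ltn_ord k; lia.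
Qed.

Lemma psp_factor n (p : 'I_n -> {poly R}) : (forall j, (p j).[0] = 0) ->
  exists ps : 'I_n -> {poly R}, p = (fun j => 'X * ps j).
Proof.
move=> p0; have ex j : exists s, p j = 'X * s.
  have /factor_theorem [s ->] : root (p j) 0 by rewrite /root p0.
  by exists s; rewrite subr0 mulrC.
by have [ps hps] := choice ex; exists ps; apply/funext => j.
Qed.

Lemma block_unitary n m (U : 'M[C]_n) (U' : 'M[C]_m) : U^t* *m U = 1%:M -> U'^t* *m U' = 1%:M ->
  (block_mx U 0 0 U')^t* *m block_mx U 0 0 U' = 1%:M.
Proof.
move=> h h'; rewrite tr_block_mx map_block_mx !trmx0 !map_mx0 mulmx_block !mulmx0 !mul0mx !addr0 !add0r.
by rewrite h h' scalar_mx_block.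
Qed.
Lemma block_cong n m (U A : 'M[C]_n) (U' A' : 'M[C]_m) d d' :
  U^t* *m A *m U = cdiag d -> U'^t* *m A' *m U' = cdiag d' ->
  (block_mx U 0 0 U')^t* *m block_mx A 0 0 A' *m block_mx U 0 0 U' = cdiag (row_mx d d').
Proof.
move=> h h'; rewrite tr_block_mx map_block_mx !trmx0 !map_mx0.
rewrite !(mulmx_block, mulmx0, mul0mx, addr0, add0r) h h'.
by rewrite /cdiag map_row_mx diag_mx_row.
Qed.

Lemma sqrt_sum_le M t g : 0 < t -> 0 <= g -> t * g ^+ 2 <= M%:R -> g <= Num.sqrt M%:R * (Num.sqrt t)^-1 :> R.
Proof.
move=> t0 g0 h; have st : 0 < Num.sqrt t by rewrite sqrtr_gt0.
rewrite ler_pdivlMr // -(ler_pXn2r (n := 2)) ?nnegrE ?mulr_ge0 ?sqrtr_ge0 //.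
by rewrite exprMn !sqr_sqrtr ?ler0n ?(ltW t0) // mulrC.
Qed.

(** Bounds for a spectrum which consists of the M eigenvalues of the kinetic energy in
    one component, together with N zeros from the other component. *)
Definition kinetic_density n (G : 'M[C]_n) N M := exists (U : 'M[C]_n) (d : 'rV[R]_n),
  [/\ U^t* *m U = 1%:M, U^t* *m G *m U = cdiag d, forall i, 0 <= d 0 i,
   forall t, 0 < t -> \sum_i (d 0 i + t)^-1 <= N%:R / t + Num.sqrt M%:R * (Num.sqrt t)^-1 &
   (0 < M)%N -> Num.sqrt M%:R <= 3 * \sum_i (d 0 i + 1)^-1].

Lemma kin_second N M : kinetic_density (kinmx (@pgb N M)) N M.
Proof.
have [U [d [UU hU d0 hg hs]]] := @kinetic_spectrum R M.
have m0 (p : {poly R}) : gI (0 * p) = 0 by rewrite mul0r -(scale0r 0) gIZ mul0r.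
have m1 (p : {poly R}) : gI (p * 0) = 0 by rewrite mulrC.
have dp0 : dp (0 : {poly R}) = 0 by rewrite /dp derivC mulr0 subr0.
have GE : kinmx (@pgb N M) = block_mx 0 0 0 (Jmx M).
  apply/matrixP => j k; rewrite -[j]splitK -[k]splitK mxE rdot_gw.
  case: (fintype.split j) => i; case: (fintype.split k) => l /=; rewrite ?pgbl ?pgbr ?dp0 ?m0 ?m1.
  - by rewrite block_mxEul mxE.
  - by rewrite block_mxEur mxE.
  - by rewrite block_mxEdl mxE.
  - by rewrite block_mxEdr mxE.
exists (block_mx 1%:M 0 0 U), (row_mx 0 d); split.
- by apply: block_unitary => //; rewrite mulmx1 trC1.
- rewrite GE; apply: block_cong => //; rewrite mulmx0 mul0mx.
  by apply/matrixP => i j; rewrite !mxE mul0rn.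
- by move=> j; rewrite -[j]splitK; case: (fintype.split j) => k /=; rewrite ?row_mxEl ?row_mxEr ?mxE.
- move=> t t0; rewrite big_split_ord /=; apply: lerD.
    rewrite (eq_bigr (fun=> t^-1)) => [|k _]; last by rewrite row_mxEl mxE add0r.
    by rewrite sumr_const card_ord mulr_natl.
  rewrite (eq_bigr (fun k => (d 0 k + t)^-1)) => [|k _]; last by rewrite row_mxEr.
  apply: sqrt_sum_le => //; last exact: hg.
  by apply: sumr_ge0 => k _; rewrite invr_ge0 addr_ge0 // ltW.
- move=> M0; apply: (le_trans (hs M0)); rewrite ler_pM2l // big_split_ord /=.
  rewrite [X in _ <= _ + X](eq_bigr (fun k => (d 0 k + 1)^-1)) => [|k _]; last by rewrite row_mxEr.
  by rewrite lerDr sumr_ge0 // => k _; rewrite row_mxEl mxE add0r invr1.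
Qed.

Lemma kin_first N M : kinetic_density (kinmx (fun j => - @pfb N M j)) M N.
Proof.
have [U [d [UU hU d0 hg hs]]] := @kinetic_spectrum R N.
have m0 (p : {poly R}) : gI (0 * p) = 0 by rewrite mul0r -(scale0r 0) gIZ mul0r.
have m1 (p : {poly R}) : gI (p * 0) = 0 by rewrite mulrC.
have dp0 : dp (0 : {poly R}) = 0 by rewrite /dp derivC mulr0 subr0.
have dpN (p : {poly R}) : dp (- p) = - dp p by rewrite -scaleN1r dpZ scaleN1r.
have GE : kinmx (fun j => - @pfb N M j) = block_mx (Jmx N) 0 0 0.
  apply/matrixP => j k; rewrite -[j]splitK -[k]splitK mxE rdot_gw.
  rewrite !dpN mulrNN.
  case: (fintype.split j) => i; case: (fintype.split k) => l /=; rewrite ?pfbl ?pfbr ?dp0 ?m0 ?m1.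
  - by rewrite block_mxEul mxE.
  - by rewrite block_mxEur mxE.
  - by rewrite block_mxEdl mxE.
  - by rewrite block_mxEdr mxE.
exists (block_mx U 0 0 1%:M), (row_mx d 0); split.
- by apply: block_unitary => //; rewrite mulmx1 trC1.
- rewrite GE; apply: block_cong => //; rewrite mulmx0 mul0mx.
  by apply/matrixP => i j; rewrite !mxE mul0rn.
- by move=> j; rewrite -[j]splitK; case: (fintype.split j) => k /=; rewrite ?row_mxEl ?row_mxEr ?mxE.
- move=> t t0; rewrite big_split_ord /= addrC; apply: lerD.
    rewrite (eq_bigr (fun=> t^-1)) => [|k _]; last by rewrite row_mxEr mxE add0r.
    by rewrite sumr_const card_ord mulr_natl.
  rewrite (eq_bigr (fun k => (d 0 k + t)^-1)) => [|k _]; last by rewrite row_mxEl.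
  apply: sqrt_sum_le => //; last exact: hg.
  by apply: sumr_ge0 => k _; rewrite invr_ge0 addr_ge0 // ltW.
- move=> M0; apply: (le_trans (hs M0)); rewrite ler_pM2l // big_split_ord /=.
  rewrite [X in _ <= X + _](eq_bigr (fun k => (d 0 k + 1)^-1)) => [|k _]; last by rewrite row_mxEl.
  by rewrite lerDl sumr_ge0 // => k _; rewrite row_mxEr mxE add0r invr1.
Qed.

(** The determinant of the pencil is the characteristic polynomial of a matrix of
    twice the size. *)
Lemma hpencil_root n (L K : 'M[C]_n) : (0 < n)%N -> exists z, \det (hpencil L K z) = 0.
Proof.
move=> n0; pose A : 'M[C]_(n + n) := block_mx 0 (- K) 1%:M (2 *: L).
have [z /eigenvalueP [v vA v0]] : exists z, eigenvalue A z.
  by apply: eigenvalue_closed; rewrite addn_gt0 n0.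
exists z; apply/eqP/det0P; exists (lsubmx v).
  apply: contraNneq v0 => x0; rewrite -[v]hsubmxK x0.
  suff -> : rsubmx v = 0 by rewrite row_mx0.
  have := congr1 lsubmx vA; rewrite -[v in v *m A]hsubmxK mul_row_block row_mxKl.
  by rewrite mulmx0 add0r mulmx1 linearZ /= x0 scaler0.
have e1 := congr1 lsubmx vA; have e2 := congr1 rsubmx vA.
rewrite -[v in v *m A]hsubmxK mul_row_block ?row_mxKl mulmx0 add0r mulmx1 linearZ /= in e1.
rewrite -[v in v *m A]hsubmxK mul_row_block ?row_mxKr e1 in e2.
have e3 : rsubmx (z *: v) = (z * z) *: lsubmx v by rewrite linearZ /= e1 scalerA.
rewrite /hpencil mulmxDr mulmxBr -!scalemxAr mulmx1 expr2 -e3 -e2.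
by rewrite mulmxN -scalemxAr -scalemxAl scalerA addrK addNr.
Qed.
End HermiteBasis.

(** * The shifted Dirac operator and its pencil *)

Section Bessel.
Context {R : realType}.
Local Notation ip := (@hip R).
Let fip := @form_hip R.
Variables (n : nat) (e : 'I_n -> @hs R).
Hypothesis eo : forall i j, ip (e i) (e j) = (i == j)%:R.

Definition proj (u : @hs R) : @hs R := \sum_i ip u (e i) *: e i.

Lemma proj_coef u k : ip (proj u) (e k) = ip u (e k).
Proof.
rewrite /proj (form_suml fip) (bigD1 k) //= (formZl fip) eo eqxx mulr1 big1 ?addr0 // => i ik.
by rewrite (formZl fip) eo (negbTE ik) mulr0.
Qed.
Lemma proj_perp u k : ip (u - proj u) (e k) = 0.
Proof. by rewrite (formBl fip) proj_coef subrr. Qed.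
Lemma proj_span (c : 'I_n -> R[i]) w : (forall k, ip w (e k) = 0) -> ip w (\sum_i c i *: e i) = 0.
Proof. by move=> h; rewrite (form_sumr fip) big1 // => i _; rewrite (formZr fip) h mulr0. Qed.
Lemma nrm2_proj u : nrm2 ip (proj u) = \sum_i normc (ip u (e i)) ^+ 2.
Proof.
rewrite /nrm2 {1}/proj (form_suml fip) cRe_sum; apply: eq_bigr => i _.
by rewrite (formZl fip) (formC fip (proj u) (e i)) proj_coef mulJc.
Qed.
Lemma bessel u : \sum_i normc (ip u (e i)) ^+ 2 <= nrm2 ip u.
Proof.
rewrite -nrm2_proj -[X in _ <= nrm2 ip X](subrK (proj u)) (pyth fip).
  by rewrite lerDr (nrm2_ge0 fip).
exact/proj_span/proj_perp.
Qed.
End Bessel.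

Section Centered.
Context {R : realType}.
Local Notation ip := (@hip R).
Let fip := @form_hip R.
Variables (kappa : int) (phisc phiel phiam : R -> R) (E : R).
Hypothesis ess : ess_selfadjoint (dirac_min_op kappa phisc phiel phiam).
Local Notation H := (dirac_op kappa phisc phiel phiam).

(** Shifting moves the isolated eigenvalue to 0, where the gap lemmas apply. *)
Definition centered (f g : @hs R) : Prop := hrel H f (g + E%:C *: f).

Lemma centered_lin : linear_rel centered.
Proof.
move=> a u w v x h1 h2; have := sa_linear_rel ess.2 a h1 h2; rewrite /centered.
by rewrite !scalerDr !scalerA [E%:C * a]mulrC addrACA.
Qed.
Lemma centered_sym : symmetric_rel (ip := ip) centered.
Proof.
move=> u w v x h1 h2; have := sa_sym_rel ess.2 h1 h2.
by rewrite (formDl fip) (formDr fip) (formZl fip) (formZr fip) cconjR => /addIr.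
Qed.
Lemma centered_ae : ae_invariant (ip := ip) centered.
Proof.
move=> u w u' w' h uu ww; apply: (sa_ae ess.2 h uu).
have -> : w + E%:C *: u - (w' + E%:C *: u') = (w - w') + E%:C *: (u - u').
  by rewrite scalerBr opprD addrACA.
apply/eqP; rewrite eq_le (nrm_ge0) andbT; apply: (le_trans (nrmD fip _ _)).
by rewrite (nrmZ fip) uu ww mulr0 addr0.
Qed.

Lemma centered_regular d : (forall z', spectrum H z' -> normc (z' - E%:C) < d -> z' = E%:C) ->
  forall t : R, t != 0 -> `|t| < d -> regular_point (ip := ip) centered t.
Proof.
move=> iso t t0 td.
have [on [B hB]] : resolvent_set H (t%:C + E%:C).
  apply: contrapT => h; have := iso (t%:C + E%:C) h; rewrite addrK normcR => /(_ td).
  move/eqP; rewrite -subr_eq0 addrK => /eqP /(congr1 (fun z : R[i] => Re z)) /= h0.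
  by rewrite h0 eqxx in t0.
have sh (f g : @hs R) : t%:C *: f + g + E%:C *: f = (t%:C + E%:C) *: f + g.
  by rewrite scalerDl addrAC.
split.
  move=> g; have [f Hf] := on (hval g) (hsP g).
  have [lf _ _] := Hf; exists (mkhs lf); rewrite /centered sh.
  by rewrite /hrel hvalD hvalZ.
exists B => f g; rewrite /centered sh /hrel hvalD hvalZ => h.
by rewrite !nrm_hnorm; exact: hB h.
Qed.
End Centered.

Section CompressedPencil.
Context {R : realType}.
Local Notation mu := (@half_line R).
Local Notation l2 f := (f \in Lfun mu 2%:E).
Local Notation hw := (gw (2^-1 : R)).
Local Notation ip := (@hip R).
Local Notation C := R[i].
Let fip := @form_hip R.
Variables (V W a : R -> R) (K : R) (kappa : int) (phisc phiel phiam : R -> R).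
Hypothesis rp : regular_potentials kappa phisc phiel phiam V W a K.
Local Notation H := (dirac_op kappa phisc phiel phiam).

(** A shift of the operator by a real constant only changes the electric potential, so
    that shifted operators belong to the same class. *)
Lemma shift_potentials (s : R) : regular_potentials kappa phisc (fun r => phiel r - s) phiam
  (fun r => V r - s) (fun r => W r - s) a (K + `|s|).
Proof.
have h (U : R -> R) : (forall r, 0 < r -> `|U r| <= K * (1 + r^-1)) ->
    forall r, 0 < r -> `|U r - s| <= (K + `|s|) * (1 + r^-1).
  move=> hU r r0; apply: (le_trans (ler_normB _ _)); rewrite mulrDl lerD ?hU //.
  by rewrite ler_peMr // lerDl invr_ge0 ltW.
split.
- by apply: measurable_funB => //; exact: rp_mV rp.
- by apply: measurable_funB => //; exact: rp_mW rp.
- exact: rp_ma rp.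
- by rewrite addr_ge0 // (rp_K rp).
- exact: h (rp_bV rp).
- exact: h (rp_bW rp).
- move=> r r0; apply: (le_trans (rp_ba rp r0)); rewrite ler_wpM2r ?lerDl //.
  by rewrite addr_ge0 // invr_ge0 ltW.
- by apply: hlS (rp_ae rp) _ => r [-> -> ->]; split => //; ring.
Qed.

(** The exchange (u, v) -> (v, -u) of the components turns a Dirac operator into
    another one. It reduces the case of few functions in the second component to that
    of few in the first. *)
Lemma swap_potentials : regular_potentials (- kappa) (fun r => - 2 - phisc r) phiel (fun r => - phiam r)
  W V (fun r => - a r) K.
Proof.
split.
- exact: rp_mW rp.
- exact: rp_mV rp.
- by apply: measurableT_comp => //; exact: rp_ma rp.
- exact: rp_K rp.
- exact: rp_bW rp.
- exact: rp_bV rp.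
- by move=> r r0; rewrite normrN (rp_ba rp r0).
- by apply: hlS (rp_ae rp) _ => r [-> -> ->]; split; rewrite ?mulrNz; ring.
Qed.

Lemma swap_matrices n (pf pg : 'I_n -> {poly R}) :
  sqmx W V (fun r => - a r) pg (fun j => - pf j) = sqmx V W a pf pg /\
  opmx W V (fun r => - a r) pg (fun j => - pf j) = opmx V W a pf pg.
Proof.
have dpN (p : {poly R}) : dp (- p) = - dp p by rewrite -scaleN1r dpZ scaleN1r.
have hN (p : {poly R}) r : hw (- p) r = - hw p r by rewrite /gw hornerN mulNr.
have E1 j : D1 W (fun r => - a r) (pg j) (- pf j) = D2 W a (pf j) (pg j).
  by apply/funext => r; rewrite /D1 /D2 dpN !hN; ring.
have E2 j : D2 V (fun r => - a r) (pg j) (- pf j) = (fun r => - D1 V a (pf j) (pg j) r).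
  by apply/funext => r; rewrite /D1 /D2 !hN; ring.
split; rewrite /sqmx /opmx addrC; congr (_ + _); apply/matrixP => j k; rewrite !mxE ?E1 ?E2 //; congr (_%:C).
  by apply: eq_Rintegral => x _ /=; rewrite mulrNN.
by apply: eq_Rintegral => x _ /=; rewrite hN mulrNN.
Qed.

Lemma qf_sqmx n (pf pg : 'I_n -> {poly R}) (f0 : forall j, (pf j).[0] = 0) (g0 : forall j, (pg j).[0] = 0) x :
  qf (sqmx V W a pf pg) x = nrm2 ip (comb (ha rp f0 g0) x).
Proof.
have lD1 j : l2 (D1 V a (pf j) (pg j)) by have [] := D_bound rp (f0 j) (g0 j).
have lD2 j : l2 (D2 W a (pf j) (pg j)) by have [] := D_bound rp (f0 j) (g0 j).
have lfD1 y : lf (fun j => D1 V a (pf j) (pg j)) y = D1 V a (lp pf y) (lp pg y).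
  by apply/funext => r; rewrite D1_lp.
have lfD2 y : lf (fun j => D2 W a (pf j) (pg j)) y = D2 W a (lp pf y) (lp pg y).
  by apply/funext => r; rewrite D2_lp.
rewrite (nrm2_comb x (ip_ha rp f0 g0)) !nrm2_rc_ha /sqmx qfD !qf_gram // !lfD1 !lfD2; ring.
Qed.

Lemma sqmxE n (pf pg : 'I_n -> {poly R}) (f0 : forall j, (pf j).[0] = 0) (g0 : forall j, (pg j).[0] = 0) j k :
  sqmx V W a pf pg j k = ip (ha rp f0 g0 j) (ha rp f0 g0 k).
Proof. by rewrite ip_ha /sqmx !mxE -rmorphD. Qed.
Lemma opmxE n (pf pg : 'I_n -> {poly R}) (f0 : forall j, (pf j).[0] = 0) (g0 : forall j, (pg j).[0] = 0) j k :
  opmx V W a pf pg j k = ip (ha rp f0 g0 j) (hb pf pg k).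
Proof. by rewrite ip_ha_hb /opmx !mxE -rmorphD. Qed.
Lemma sqmx_real n (pf pg : 'I_n -> {poly R}) j k : (sqmx V W a pf pg j k)^* = sqmx V W a pf pg j k.
Proof. by rewrite /sqmx !mxE -rmorphD cconjR. Qed.
Lemma opmx_real n (pf pg : 'I_n -> {poly R}) j k : (opmx V W a pf pg j k)^* = opmx V W a pf pg j k.
Proof. by rewrite /opmx !mxE -rmorphD cconjR. Qed.
End CompressedPencil.

Section HermitePencil.
Context {R : realType}.
Local Notation mu := (@half_line R).
Local Notation hw := (gw (2^-1 : R)).
Local Notation ip := (@hip R).
Local Notation C := R[i].
Let fip := @form_hip R.
Variables (V W a : R -> R) (K : R) (kappa : int) (phisc phiel phiam : R -> R).
Hypothesis rp : regular_potentials kappa phisc phiel phiam V W a K.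
Hypothesis ess : ess_selfadjoint (dirac_min_op kappa phisc phiel phiam).
Local Notation H := (dirac_op kappa phisc phiel phiam).
Variable s : R.
Local Notation Vs := (fun r => V r - s).
Local Notation Ws := (fun r => W r - s).
Local Notation rps := (shift_potentials rp s).

Section Basis.
Variables N M : nat.
Local Notation pf := (@pfb R N M).
Local Notation pg := (@pgb R N M).
Definition bh := hb pf pg.
Definition ah := ha rp (@pfb0 R N M) (@pgb0 R N M).
Definition as_ := ha rps (@pfb0 R N M) (@pgb0 R N M).

Lemma asE j : as_ j = ah j - s%:C *: bh j.
Proof.
apply: val_inj; rewrite /= -[LHS]/(hval (as_ j)) -[RHS]/(hval (ah j - s%:C *: bh j)) hvalB hvalZ.
have e1 r : (D1 Vs a (pf j) (pg j) r)%:C = (D1 V a (pf j) (pg j) r)%:C - s%:C * (hw (pf j) r)%:C :> C.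
  by rewrite -rmorphM -rmorphB /=; congr (_%:C); rewrite /D1; ring.
have e2 r : (D2 Ws a (pf j) (pg j) r)%:C = (D2 W a (pf j) (pg j) r)%:C - s%:C * (hw (pg j) r)%:C :> C.
  by rewrite -rmorphM -rmorphB /=; congr (_%:C); rewrite /D2; ring.
by congr (_, _); apply/funext => r; [exact: e1 | exact: e2].
Qed.

Lemma comb_as x : comb as_ x = comb ah x - s%:C *: comb bh x.
Proof.
rewrite /comb scaler_sumr -sumrB; apply: eq_bigr => j _.
by rewrite asE scalerBr !scalerA mulrC.
Qed.

Lemma ah_sym j k : ip (bh j) (ah k) = ip (ah j) (bh k).
Proof. by symmetry; exact: (sa_sym_rel ess.2 (H_hb rp (@pfb0 R N M) (@pgb0 R N M) ess j)
  (H_hb rp (@pfb0 R N M) (@pgb0 R N M) ess k)). Qed.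
Lemma as_sym j k : ip (bh j) (as_ k) = ip (as_ j) (bh k).
Proof. by rewrite !asE (formBr fip) (formBl fip) (formZl fip) (formZr fip) cconjR ah_sym. Qed.

Local Notation L := (opmx Vs Ws a pf pg).
Local Notation S := (sqmx Vs Ws a pf pg).
Lemma LE j k : L j k = ip (as_ j) (bh k). Proof. exact: opmxE. Qed.
Lemma SE j k : S j k = ip (as_ j) (as_ k). Proof. exact: sqmxE. Qed.
Lemma L_sym j k : L k j = L j k.
Proof. by rewrite -opmx_real !LE -(formC fip) as_sym. Qed.
Lemma S_sym j k : S k j = S j k.
Proof. by rewrite -sqmx_real !SE -(formC fip). Qed.
Lemma L_herm : herm L.
Proof. by split; apply/matrixP => j k; rewrite trCE opmx_real L_sym. Qed.

Lemma hpencilE n (A B : 'M[C]_n) z j k : hpencil A B z j k = z ^+ 2 * (j == k)%:R - 2 * z * A j k + B j k.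
Proof. by rewrite !mxE mulr_natr. Qed.

Lemma val_ip j x : inner (value H (hval (bh j))) (hval x) = ip (ah j) x.
Proof.
have Hj := H_hb rp (@pfb0 R N M) (@pgb0 R N M) ess j.
have Hv : H (hval (bh j)) (value H (hval (bh j))).
  by apply: (@xgetPex _ 0 [set w0 | H (hval (bh j)) w0]); exists (hval (ah j)).
have [_ lv _] := Hv.
have n0 : nrm ip (mkhs lv - ah j) = 0 by rewrite nrm_hnorm hvalB; exact: (sa_value ess.2 Hj).
by have := nrm_eq0_form fip x n0; rewrite (formBl fip) => /eqP; rewrite subr_eq0 => /eqP.
Qed.
Lemma val_val j k : inner (value H (hval (bh j))) (value H (hval (bh k))) = ip (ah j) (ah k).
Proof.
have Hk := H_hb rp (@pfb0 R N M) (@pgb0 R N M) ess k.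
have Hv : H (hval (bh k)) (value H (hval (bh k))).
  by apply: (@xgetPex _ 0 [set w0 | H (hval (bh k)) w0]); exists (hval (ah k)).
have [_ lv _] := Hv.
have n0 : nrm ip (mkhs lv - ah k) = 0 by rewrite nrm_hnorm hvalB; exact: (sa_value ess.2 Hk).
rewrite (val_ip j (mkhs lv)).
by have := nrm_eq0_formr fip (ah j) n0; rewrite (formBr fip) => /eqP; rewrite subr_eq0 => /eqP.
Qed.

Lemma Q_hpencil z : Qmx H (@hermite_basis R N M) (z + s%:C) = hpencil L S z.
Proof.
apply/matrixP => j k; rewrite hpencilE LE SE.
have -> : Qmx H (@hermite_basis R N M) (z + s%:C) j k = (z + s%:C) ^+ 2 * (j == k)%:R
    - 2 * (z + s%:C) * ip (ah j) (bh k) + ip (ah j) (ah k).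
  by rewrite !mxE !basisE val_ip val_val -[inner (hval _) (hval _)]/(ip (bh j) (bh k)) hb_ortho.
rewrite !asE !(formBl fip) !(formBr fip) !(formZl fip) !(formZr fip) cconjR ah_sym hb_ortho.
by move: (ip (ah j) (bh k)) (ip (ah j) (ah k)) ((j == k)%:R) (s%:C) => l q e t; ring.
Qed.

Lemma pencil_hpencil z : pencil (ip := ip) bh as_ z = hpencil L S z.
Proof.
apply/matrixP => j k; rewrite hpencilE mxE.
rewrite !(formBl fip) !(formBr fip) !(formZl fip) !(formZr fip) !conjCK.
rewrite as_sym hb_ortho -!LE -SE L_sym S_sym eq_sym.
by move: (L j k) (S j k) ((j == k)%:R) => l q e; ring.
Qed.

(** L is the compression of the operator and S that of its square: the coefficients of
    a vector in an orthonormal system are at most its norm. *)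
Lemma L_bessel x : sqn (L *m x) <= qf S x.
Proof.
rewrite (qf_sqmx rps (@pfb0 R N M) (@pgb0 R N M)).
apply: le_trans (bessel (@hb_ortho R N M) _); rewrite /sqn ler_sum // => j _.
rewrite le_eqVlt; apply/orP; left; apply/eqP; congr (normc _ ^+ 2).
rewrite mxE (form_suml fip); apply: eq_bigr => k _.
by rewrite (formZl fip) mulrC; congr (_ * _); rewrite -L_sym LE.
Qed.

(** The point s = E + d / 2 has distance d / 2 from the spectrum. *)
Lemma Q_gap (E d : R) : (forall t : R, t != 0 -> `|t| < d ->
    regular_point (ip := ip) (centered kappa phisc phiel phiam E) t) -> 0 < d -> s = E + d / 2 ->
  forall x, (d / 2) ^+ 2 * sqn x <= qf S x.
Proof.
move=> reg d0 sE x; rewrite (qf_sqmx rps (@pfb0 R N M) (@pgb0 R N M)) -sqn_hb.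
have d2 : 0 < d / 2 by rewrite divr_gt0.
have Hx : centered kappa phisc phiel phiam E (comb bh x) (comb ah x - E%:C *: comb bh x).
  by rewrite /centered subrK; exact: (H_comb rp (@pfb0 R N M) (@pgb0 R N M) ess x).
have := gap_resolvent fip (centered_lin (E := E) ess) (centered_sym (E := E) ess) reg (t := d / 2) _ Hx.
rewrite (ger0_norm (ltW d2)) => /(_ (lexx _)).
have -> : comb ah x - E%:C *: comb bh x - (d / 2)%:C *: comb bh x = comb as_ x.
  by rewrite comb_as sE rmorphD scalerDl opprD addrA.
move=> h; rewrite -!(sqr_nrm fip) -exprMn ler_pXn2r ?nnegrE ?(nrm_ge0) //.
by rewrite mulr_ge0 ?nrm_ge0 // ltW.
Qed.
End Basis.

Variables (E d : R).
Hypothesis reg : forall t : R, t != 0 -> `|t| < d ->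
    regular_point (ip := ip) (centered kappa phisc phiel phiam E) t.
Hypothesis d0 : 0 < d.
Hypothesis sE : s = E + d / 2.
Local Notation root Y N M := (exists2 z, normc z <= Y &
  \det (hpencil (opmx Vs Ws a (@pfb R N M) (@pgb R N M)) (sqmx Vs Ws a (@pfb R N M) (@pgb R N M)) z) = 0).

Lemma root_any N M : (0 < N)%N -> exists Y, root Y N M.
Proof.
move=> N0; have [|z hz] := @hpencil_root R _ (opmx Vs Ws a (@pfb R N M) (@pgb R N M))
  (sqmx Vs Ws a (@pfb R N M) (@pgb R N M)); first by rewrite addn_gt0 N0.
by exists (normc z), z.
Qed.

Lemma bounded_below (P : R -> nat -> Prop) m0 : (forall Y Y' m, Y <= Y' -> P Y m -> P Y' m) ->
  (forall m, (0 < m)%N -> exists Y, P Y m) -> exists Y, forall m, (0 < m)%N -> (m < m0)%N -> P Y m.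
Proof.
move=> mono ex; elim: m0 => [|m0 [Y hY]]; first by exists 0.
have [m00|m00] := posnP m0; first by exists 0 => m m1; rewrite m00 ltnS leqNgt m1.
have [Y' hY'] := ex _ m00; exists (Num.max Y Y') => m m1; rewrite ltnS leq_eqVlt => /orP[/eqP ->|mm].
  by apply: mono hY'; rewrite le_max lexx orbT.
by apply: mono (hY m m1 mm); rewrite le_max lexx.
Qed.

Lemma CN_ge1 N : (0 < N)%N -> 1 <= 4 * N%:R :> R.
Proof. by move=> N0; rewrite -natrM ler1n muln_gt0. Qed.

Lemma second_large N : (0 < N)%N -> exists Y, forall M, (0 < M)%N -> root Y N M.
Proof.
move=> N0; have kap0 : 0 < (d / 2) ^+ 2 by rewrite exprn_gt0 // divr_gt0.
have [Y [M0 [Y0 hY]]] := small_component rps N kap0 (CN_ge1 N0).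
have [Y' hY'] := @bounded_below (fun Y M => root Y N M) M0
  (fun Y Y' m YY '(ex_intro2 z hz e) => ex_intro2 _ _ z (le_trans hz YY) e) (fun M _ => root_any M N0).
exists (Num.max Y Y') => M M1; have [MM|MM] := ltnP M M0.
  by have [z hz e] := hY' M M1 MM; exists z => //; rewrite (le_trans hz) // le_max lexx orbT.
have [ps psE] := psp_factor (@pgb0 R N M).
have psj j : 'X * ps j = @pgb R N M j by rewrite psE.
have [U [dd [UU hU dd0 hg hs]]] := @kin_second R N M.
suff [z hz e] : root Y N M by exists z => //; rewrite (le_trans hz) // le_max lexx.
have := hY M _ (@pfb R N M) ps U dd MM; rewrite /= -?psE; apply => //.
- by rewrite addn_gt0 N0.
- by rewrite mulSn addnC leq_add2l leq_pmulr.
- exact: pfb0.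
- exact: basis_norm.
- by move=> y; rewrite lp_pfb; exact: hsum_energy.
- move=> y; rewrite lp_pgb; apply: (le_trans (hsum_kinetic _)); rewrite ler_wpM2l ?mulr_ge0 ?ler0n //.
  by rewrite big_split_ord /= lerDr sumr_ge0 // => k _; rewrite sqr_ge0.
- move=> r r0 r1; apply: le_trans (hsum_point M r0 r1); rewrite big_split_ord /= big1 ?add0r => [|k _].
    by rewrite le_eqVlt; apply/orP; left; apply/eqP; apply: eq_bigr => k _; rewrite psj pgbr.
  by rewrite psj pgbl hw0 expr0n.
- exact: L_herm.
- by move=> x; apply: (Q_gap reg).
- exact: L_bessel.
- exact: hs.
Qed.

Lemma first_large M : (0 < M)%N -> exists Y, forall N, (0 < N)%N -> root Y N M.
Proof.
move=> M1; have kap0 : 0 < (d / 2) ^+ 2 by rewrite exprn_gt0 // divr_gt0.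
have [Y [N0 [Y0 hY]]] := small_component (swap_potentials rps) M kap0 (CN_ge1 M1).
have [Y' hY'] := @bounded_below (fun Y N => root Y N M) N0
  (fun Y Y' m YY '(ex_intro2 z hz e) => ex_intro2 _ _ z (le_trans hz YY) e) (fun N h => root_any M h).
exists (Num.max Y Y') => N N1; have [NN|NN] := ltnP N N0.
  by have [z hz e] := hY' N N1 NN; exists z => //; rewrite (le_trans hz) // le_max lexx orbT.
have nf0 (j : 'I_(N + M)) : (- @pfb R N M j).[0] = 0 by rewrite hornerN pfb0 oppr0.
have [ps psE] := psp_factor nf0.
have psj j : 'X * ps j = - @pfb R N M j := esym (congr1 (fun F => F j) psE).
have [U [dd [UU hU dd0 hg hs]]] := @kin_first R N M.
have [sqE opE] := swap_matrices Vs Ws a (@pfb R N M) (@pgb R N M).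
have lpN y : lp (fun j => - @pfb R N M j) y = - lp (@pfb R N M) y.
  by rewrite /lp -sumrN; apply: eq_bigr => j _; rewrite scalerN.
have dpN (p : {poly R}) : dp (- p) = - dp p by rewrite -scaleN1r dpZ scaleN1r.
suff [z hz e] : root Y N M by exists z => //; rewrite (le_trans hz) // le_max lexx.
have := hY N _ (@pgb R N M) ps U dd NN; rewrite /= -?psE ?sqE ?opE; apply => //.
- by rewrite addn_gt0 N1.
- by rewrite mulSn leq_add2l leq_pmulr.
- exact: pgb0.
- by move=> y; rewrite lpN mulrNN addrC; exact: basis_norm.
- by move=> y; rewrite lp_pgb; exact: hsum_energy.
- move=> y; rewrite lpN dpN mulrNN lp_pfb; apply: (le_trans (hsum_kinetic _)); rewrite ler_wpM2l ?mulr_ge0 ?ler0n //.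
  by rewrite big_split_ord /= lerDl sumr_ge0 // => k _; rewrite sqr_ge0.
- move=> r r0 r1; apply: le_trans (hsum_point N r0 r1); rewrite big_split_ord /= [X in _ + X]big1 ?addr0 => [|k _].
    rewrite le_eqVlt; apply/orP; left; apply/eqP; apply: eq_bigr => k _.
    by rewrite psj pfbl /gw hornerN mulNr sqrrN.
  by rewrite psj pfbr oppr0 hw0 expr0n.
- exact: L_herm.
- by move=> x; apply: (Q_gap reg).
- exact: L_bessel.
- exact: hs.
Qed.

(** The bounds of second_large and first_large depend on the fixed number of functions
    in one component; here this number takes finitely many values. *)
Lemma small_roots N0 : exists Y, forall N M, (0 < N)%N -> (0 < M)%N -> (N < N0)%N || (M < N0)%N -> root Y N M.
Proof.

have [Y1 h1] := @bounded_below (fun Y N => forall M, (0 < M)%N -> root Y N M) N0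
  (fun Y Y' m YY h M M1 => let '(ex_intro2 z hz e) := h M M1 in ex_intro2 _ _ z (le_trans hz YY) e)
  second_large.
have [Y2 h2] := @bounded_below (fun Y M => forall N, (0 < N)%N -> root Y N M) N0
  (fun Y Y' m YY h M M1 => let '(ex_intro2 z hz e) := h M M1 in ex_intro2 _ _ z (le_trans hz YY) e)
  first_large.
exists (Num.max Y1 Y2) => N M N1 M1 /orP[h|h].
  by have [z hz e] := h1 N N1 h M M1; exists z => //; rewrite (le_trans hz) // le_max lexx.
by have [z hz e] := h2 M M1 h N N1; exists z => //; rewrite (le_trans hz) // le_max lexx orbT.
Qed.
End HermitePencil.

(** * Near the eigenvalue *)

Section GramSchmidt.
Context {R : realType}.
Local Notation ip := (@hip R).
Let fip := @form_hip R.

Lemma nrm_sum (I : finType) (c : I -> R[i]) (g : I -> @hs R) :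
  nrm ip (\sum_i c i *: g i) <= \sum_i normc (c i) * nrm ip (g i).
Proof.
elim/big_rec2: _ => [|i x y _ h]; first by rewrite (nrm0 fip).
by apply: (le_trans (nrmD fip _ _)); rewrite (nrmZ fip) lerD2l.
Qed.

Variable P : @hs R -> Prop.
Hypothesis P0 : P 0.
Hypothesis Plin : forall a u v, P u -> P v -> P (a *: u + v).

Lemma P_sum (I : finType) (c : I -> R[i]) (g : I -> @hs R) : (forall i, P (g i)) -> P (\sum_i c i *: g i).
Proof. by move=> h; elim/big_rec: _ => // i x _ hx; exact: Plin. Qed.

Lemma P_sub u v : P u -> P v -> P (u - v).
Proof. by move=> hu hv; have := Plin (-1) hv hu; rewrite scaleN1r addrC. Qed.

Lemma gram_schmidt n (v : nat -> @hs R) : (forall i, (i < n)%N -> P (v i)) ->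
  exists m (f : 'I_m -> @hs R), [/\ forall i j, ip (f i) (f j) = (i == j)%:R, forall i, P (f i) &
    forall i, (i < n)%N -> nrm ip (v i - proj f (v i)) = 0].
Proof.
elim: n => [|n IH] Pv.
  by exists 0, (fun i : 'I_0 => 0); split=> // -[].
have [m [f [fo fP fv]]] := IH (fun i h => Pv i (ltnW h)).
have [w wE] : exists w, w = v n - proj f (v n) by eexists.
have [w0|w0] := eqVneq (nrm ip w) 0.
  exists m, f; split; [exact: fo | exact: fP |] => i.
  rewrite ltnS leq_eqVlt => /orP[/eqP ->|ii]; last exact: (fv i ii).
  by rewrite -wE.
have wp : 0 < nrm ip w by rewrite lt_neqAle eq_sym w0 nrm_ge0.
have [g gE] : exists g, g = ((nrm ip w)^-1)%:C *: w by eexists.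
have gf i : ip g (f i) = 0 by rewrite gE (formZl fip) wE (proj_perp fo) mulr0.
have fg i : ip (f i) g = 0 by rewrite (formC fip g) gf conjC0.
have gg : ip g g = 1.
  rewrite gE (form_self fip) (nrm2Z fip) normcR ger0_norm ?invr_ge0 ?nrm_ge0 //.
  by rewrite -(sqr_nrm fip) -exprMn (mulVf w0) expr1n.
pose f' (i : 'I_m.+1) := if unlift ord_max i is Some k then f k else g.
have f'l k : f' (lift ord_max k) = f k by rewrite /f' liftK.
have f'm : f' ord_max = g by rewrite /f' unlift_none.
have projE u : proj f' u = proj f u + ip u g *: g.
  rewrite /proj big_ord_recr /= f'm; congr (_ + _); apply: eq_bigr => k _.
  have -> : widen_ord (leqnSn m) k = lift ord_max k by apply: val_inj; exact: esym (lift_max k).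
  by rewrite f'l.
exists m.+1, f'; split.
- move=> i j; case: (unliftP ord_max i) => [i' ->|->]; case: (unliftP ord_max j) => [j' ->|->];
    rewrite ?f'l ?f'm.
  + by rewrite fo (inj_eq lift_inj).
  + by rewrite fg eq_sym (negbTE (neq_lift _ _)).
  + by rewrite gf (negbTE (neq_lift _ _)).
  + by rewrite gg eqxx.
- have Pw : P w by rewrite wE; apply: P_sub; [exact: Pv | apply: P_sum].
  have Pg : P g by rewrite gE; have := Plin ((nrm ip w)^-1)%:C Pw P0; rewrite addr0.
  by move=> i; case: (unliftP ord_max i) => [i' ->|->]; rewrite ?f'l ?f'm.
- move=> i; rewrite ltnS leq_eqVlt => /orP[/eqP ->|ii].
    have vg : ip (v n) g = (nrm ip w)%:C.
      have -> : v n = w + proj f (v n) by rewrite wE subrK.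
      rewrite (formDl fip) /proj (form_suml fip) [X in _ + X]big1 => [|k _]; last first.
        by rewrite (formZl fip) fg mulr0.
      rewrite addr0 gE (formZr fip) cconjR (form_self fip) -rmorphM -(sqr_nrm fip) expr2 mulrA (mulVf w0).
      by rewrite mul1r.
    by rewrite projE vg opprD addrA -wE gE scalerA -rmorphM (mulfV w0) scale1r subrr (nrm0 fip).
  have h := fv i ii; rewrite projE.
  have -> : ip (v i) g = 0.
    have := nrm_eq0_form fip g h; rewrite (formBl fip) /proj (form_suml fip) [X in _ - X]big1 ?subr0 // => k _.
    by rewrite (formZl fip) fg mulr0.
  by rewrite scale0r addr0.
Qed.
End GramSchmidt.

Section Assembly.
Context {R : realType}.
Local Notation mu := (@half_line R).
Local Notation l2 f := (f \in Lfun mu 2%:E).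
Local Notation hw := (gw (2^-1 : R)).
Local Notation ip := (@hip R).
Let fip := @form_hip R.

Lemma osc_bv i k : oscillator2 (hval (bv i k)) ((ev k)%:C *: hval (bv i k) : @spinor R).
Proof.
have o1 : oscillator (fun r => (hw (psp k.*2.+1) r)%:C) ((ev k)%:C *: (fun r => (hw (psp k.*2.+1) r)%:C : R[i]^o)).
  have -> : (fun r => (hw (psp k.*2.+1) r)%:C) = (fun r => (Phi k r)%:C : R[i]) by rewrite Phi_psi.
  have -> : (ev k)%:C *: (fun r => (Phi k r)%:C : R[i]^o) = (fun r => (ev k * Phi k r)%:C).
    by apply/funext => r; rewrite rmorphM.
  exact: oscillator_Phi.
have o2 : oscillator (fun r => (hw 0 r)%:C) ((ev k)%:C *: (fun r => (hw 0 r)%:C : R[i]^o)).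
  rewrite (_ : (fun r => (hw 0 r)%:C) = (0 : R -> R[i]^o)); last by apply/funext => r; rewrite hw0.
  by rewrite scaler0; exact: oscillator0.
by case: i; split.
Qed.

Lemma coefficient_decay (q : R) (u : @hs R) : dom_power oscillator2 q (hval u) ->
  exists2 Cu : R, 0 <= Cu & forall i n, \sum_(k < n) (ev k `^ q) ^+ 2 * normc (ip u (bv i k)) ^+ 2 <= Cu.
Proof.
move=> [P [nu [sm lu fin]]].
have I0 : (0 <= \int[nu (hval u)]_x ((x `^ q) ^+ 2)%:E)%E.
  by apply: integral_ge0 => x _; rewrite lee_fin sqr_ge0.
have If : ((\int[nu (hval u)]_x ((x `^ q) ^+ 2)%:E)%E \is a fin_num) by rewrite ge0_fin_numE.
exists (fine (\int[nu (hval u)]_x ((x `^ q) ^+ 2)%:E)%E); first exact: fine_ge0.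
move=> i n; rewrite -lee_fin fineK // -sumEFin.
apply: (@spectral_decay R P nu sm q u n (fun k : 'I_n => bv i k) (fun k : 'I_n => ev k)).
- move=> k l /eqP; rewrite /ev eqr_nat => /eqP h; apply: val_inj; move: h => /=; lia.
- by move=> k; exact: osc_bv.
- by move=> k; rewrite /nrm /nrm2 ip_bv !eqxx /= sqrtr1.
Qed.

Section Approximation.
Variables (V W a : R -> R) (K : R) (kappa : int) (phisc phiel phiam : R -> R).
Hypothesis rp : regular_potentials kappa phisc phiel phiam V W a K.
Hypothesis ess : ess_selfadjoint (dirac_min_op kappa phisc phiel phiam).
Local Notation H := (dirac_op kappa phisc phiel phiam).
Variables (E d q D : R) (m : nat) (f : 'I_m -> @hs R).
Local Notation T := (centered kappa phisc phiel phiam E).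
Hypothesis reg : forall t : R, t != 0 -> `|t| < d -> regular_point (ip := ip) T t.
Hypothesis d0 : 0 < d.
Hypothesis fo : forall i j, ip (f i) (f j) = (i == j)%:R.
Hypothesis fT : forall i, T (f i) 0.
Hypothesis fspan : forall p, T p 0 -> nrm ip (p - proj f p) = 0.
Hypothesis D0 : 0 <= D.
Local Notation rate := (fun N : nat => N%:R `^ (- ((q - 1) / 2)) : R).
Hypothesis approx : forall i N M, (0 < N)%N -> (0 < M)%N ->
  nrm ip (f i - (SS (f i) true N + SS (f i) false M)) <= D * (rate N + rate M) /\
  nrm ip ((XX rp (f i) true N + XX rp (f i) false M) - E%:C *: (SS (f i) true N + SS (f i) false M))
    <= D * (rate N + rate M).

Lemma T0 : T 0 0.
Proof.
have h := H_bv rp ess true 0; have := relB (sa_linear_rel ess.2) h h.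
by rewrite /centered scaler0 addr0 !subrr.
Qed.
Lemma T_lin0 b u v : T u 0 -> T v 0 -> T (b *: u + v) 0.
Proof. by move=> hu hv; have := centered_lin ess b hu hv; rewrite scaler0 addr0. Qed.
Lemma T_proj u : T (proj f u) 0.
Proof. exact: (@P_sum R (fun u => T u 0) T0 T_lin0 _ (fun i => ip u (f i)) f fT). Qed.

Lemma proj_orth u p : T p 0 -> ip (u - proj f u) p = 0.
Proof.
move=> hp; have := nrm_eq0_formr fip (u - proj f u) (fspan hp).
rewrite (formBr fip) => /eqP; rewrite subr_eq0 => /eqP ->.
exact/proj_span/proj_perp.
Qed.

Section Dimensions.
Variables N M : nat.
Hypotheses (N1 : (0 < N)%N) (M1 : (0 < M)%N).
Local Notation b := (@bh R N M).
Local Notation aE := (@as_ R V W a K kappa phisc phiel phiam rp E N M).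

(** The coefficients of the truncated Hermite expansion of u. *)
Definition cvec (u : @hs R) : 'cV[R[i]]_(N + M) := \col_j
  match fintype.split j with inl k => ip u (bv true k) | inr k => ip u (bv false k) end.

Lemma cvecl u k : cvec u (lshift M k) 0 = ip u (bv true k).
Proof. by rewrite mxE (unsplitK (inl k)). Qed.
Lemma cvecr u k : cvec u (rshift N k) 0 = ip u (bv false k).
Proof. by rewrite mxE (unsplitK (inr k)). Qed.

Lemma comb_cvec_b u : comb b (cvec u) = SS u true N + SS u false M.
Proof.
rewrite /comb big_split_ord /= /SS; congr (_ + _); apply: eq_bigr => k _.
  by rewrite cvecl; congr (_ *: _); apply: val_inj; rewrite /= pfbl pgbl.
by rewrite cvecr; congr (_ *: _); apply: val_inj; rewrite /= pfbr pgbr.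
Qed.
Lemma comb_cvec_a u : comb (ah rp (N := N) (M := M)) (cvec u) = XX rp u true N + XX rp u false M.
Proof.
rewrite /comb big_split_ord /= /XX; congr (_ + _); apply: eq_bigr => k _.
  by rewrite cvecl; congr (_ *: _); apply: val_inj; rewrite /= pfbl pgbl.
by rewrite cvecr; congr (_ *: _); apply: val_inj; rewrite /= pfbr pgbr.
Qed.

Lemma cvec_b i : nrm ip (comb b (cvec (f i)) - f i) <= D * (rate N + rate M).
Proof. by rewrite comb_cvec_b (nrmBC fip); have [] := approx i N1 M1. Qed.
Lemma cvec_a i : nrm ip (comb aE (cvec (f i))) <= D * (rate N + rate M).
Proof. by rewrite comb_as comb_cvec_a comb_cvec_b; have [] := approx i N1 M1. Qed.

Lemma comb_sum n (c : 'I_n -> @hs R) (I : finType) (y : I -> R[i]) (x : I -> 'cV[R[i]]_n) :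
  comb c (\sum_i y i *: x i) = \sum_i y i *: comb c (x i).
Proof.
rewrite (big_morph (comb c) (combD c) (_ : comb c 0 = 0)); last first.
  by rewrite /comb big1 // => j _; rewrite mxE scale0r.
by apply: eq_bigr => i _; rewrite combZ.
Qed.

Lemma T_comb x : T (comb b x) (comb aE x).
Proof. by rewrite /centered comb_as subrK; exact: (H_comb rp (@pfb0 R N M) (@pgb0 R N M) ess x). Qed.

Definition Pi x := proj f (comb b x).
(** The factor m + 1 is the number of basis vectors of the eigenspace, over which the
    approximation errors add up. *)
Definition de : R := 2 * (m%:R + 1) * (D + 1) * (rate N + rate M).

(** Every vector of the eigenspace is a combination of the basis f, whose elements are
    approximated by their truncated Hermite expansions in the graph norm. *)
Lemma hermite_spectral_approx : spectral_approx (ip := ip) b aE Pi (d / 6) de.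
Proof.
have r0 : 0 <= rate N + rate M by rewrite addr_ge0 ?powR_ge0.
have mD : m%:R * (D * (rate N + rate M)) <= de.
  have m0 : 0 <= m%:R * (rate N + rate M) by rewrite mulr_ge0.
  have Dm := mulr_ge0 D0 m0; have Dr := mulr_ge0 D0 r0; rewrite /de.
  have -> : 2 * (m%:R + 1) * (D + 1) * (rate N + rate M) =
    2 * (D * (m%:R * (rate N + rate M))) + 2 * (D * (rate N + rate M)) + 2 * (m%:R * (rate N + rate M)) + 2 * (rate N + rate M) by ring.
  have -> : m%:R * (D * (rate N + rate M)) = D * (m%:R * (rate N + rate M)) by ring.
  move: (D * (m%:R * (rate N + rate M))) (D * (rate N + rate M)) (m%:R * (rate N + rate M)) (rate N + rate M) Dm Dr m0 r0.
  by move=> x1 x2 x3 x4 *; lra.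
have near (c : 'I_m -> @hs R) x : (forall i, nrm ip (c i) <= D * (rate N + rate M)) ->
    nrm ip (\sum_i ip (comb b x) (f i) *: c i) <= de * nrm ip (Pi x).
  move=> hc; apply: (le_trans (nrm_sum _ _)).
  apply: (@le_trans _ _ (\sum_(i < m) nrm ip (Pi x) * (D * (rate N + rate M)))).
    apply: ler_sum => i _; apply: ler_pM => //; [exact: normc_ge0 | exact: nrm_ge0 |].
    rewrite -(ler_pXn2r (n := 2)) ?nnegrE ?normc_ge0 ?nrm_ge0 // (sqr_nrm fip) (nrm2_proj fo).
    by rewrite (bigD1 i) //= lerDl sumr_ge0 // => k _; rewrite sqr_ge0.
  rewrite -mulr_sumr sumr_const card_ord -[_ *+ m]mulr_natl [leRHS]mulrC.
  by apply: ler_wpM2l => //; exact: nrm_ge0.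
split.
- by move=> x; apply: proj_orth; exact: T_proj.
- by move=> x y; rewrite (centered_sym ess (T_comb x) (T_proj _)) (form0r fip).
- move=> x; apply: (gap_orthogonal fip (centered_lin (E := E) ess) (centered_sym (E := E) ess)
    (centered_ae (E := E) ess) d0 reg (@complete_hip R)).
    by have := relB (centered_lin (E := E) ess) (T_comb x) (T_proj (comb b x)); rewrite subr0.
  by move=> p hp; exact: proj_orth.
- move=> x; exists (\sum_i ip (comb b x) (f i) *: cvec (f i)); rewrite !comb_sum; split.
    rewrite /Pi {2}/proj -sumrB.
    rewrite (eq_bigr (fun i => ip (comb b x) (f i) *: (comb b (cvec (f i)) - f i))) => [|i _]; last first.
      by rewrite scalerBr.
    by apply: near; exact: cvec_b.
  by apply: near; exact: cvec_a.
Qed.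

Lemma de_gt0 : 0 < de.
Proof.
have r0 : 0 < rate N + rate M by rewrite addr_gt0 // powR_gt0 // ltr0n.
by rewrite /de !mulr_gt0 // ltr_wpDl.
Qed.

Hypotheses (m0 : (0 < m)%N) (de1 : 25 * de <= 1) (ded : 25 * de <= d / 6 / 8).

Lemma near_root : exists2 z, normc z <= 25 * de &
  \det (Qmx H (@hermite_basis R N M) (z + E%:C)) = 0.
Proof.
pose i0 := Ordinal m0.
have r0 : 0 <= rate N + rate M by rewrite addr_ge0 ?powR_ge0.
have Dr0 : 0 <= D * (rate N + rate M) by rewrite mulr_ge0.
have two : 2 * (D * (rate N + rate M)) <= de.
  rewrite /de; have -> : 2 * (m%:R + 1) * (D + 1) * (rate N + rate M) =
    2 * (D * (rate N + rate M)) + 2 * (m%:R * ((D + 1) * (rate N + rate M))) + 2 * (rate N + rate M) by ring.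
  have k0 : 0 <= m%:R * ((D + 1) * (rate N + rate M)) by rewrite mulr_ge0 // mulr_ge0 // addr_ge0.
  by rewrite -addrA lerDl; apply: addr_ge0; apply: mulr_ge0.
have hb1 := cvec_b i0; have ha1 := cvec_a i0.
pose y := cvec (f i0).
have fn : nrm ip (f i0) = 1 by rewrite /nrm /nrm2 fo eqxx /= sqrtr1.
have half : 2^-1 <= nrm ip (comb b y).
  have := nrm_tri fip (f i0) (comb b y); rewrite fn (nrmBC fip) => h.
  move: (nrm ip (comb b y)) (nrm ip (comb b y - f i0)) hb1 h => x1 x2 hb1 h.
  by move: (D * _) two hb1 de1 => x3 *; lra.
have np : 0 < nrm ip (comb b y) by apply: lt_le_trans half; rewrite invr_gt0.
have n0 : nrm ip (comb b y) != 0 by rewrite gt_eqF.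
pose x0 := ((nrm ip (comb b y))^-1)%:C *: y.
have [||z hz dz] := pencil_eigenvalue fip de_gt0 hermite_spectral_approx (x0 := x0) de1 ded.
- rewrite combZ (nrmZ fip) normcR ger0_norm ?invr_ge0 ?nrm_ge0 //; exact: mulVf.
- rewrite combZ (nrmZ fip) normcR ger0_norm ?invr_ge0 ?nrm_ge0 //.
  rewrite mulrC ler_pdivrMr //; apply: (le_trans ha1).
  have := ler_wpM2l (ltW de_gt0) half; apply: le_trans.
  by rewrite ler_pdivlMr // mulrC.
by exists z => //; rewrite (Q_hpencil rp ess) -(pencil_hpencil rp ess).
Qed.

Lemma near_vector z x : normc z <= 25 * de -> Qmx H (@hermite_basis R N M) (z + E%:C) *m x = 0 ->
  nrm ip (comb b x) = 1 -> nrm ip (comb b x - proj f (comb b x)) <= 25 * de / (d / 6).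
Proof.
move=> hz; rewrite (Q_hpencil rp ess) -(pencil_hpencil rp ess) => Qx x1.
apply: (pencil_eigenvector fip _ de_gt0 hermite_spectral_approx _ _ hz Qx x1).
- by rewrite divr_gt0.
- exact: le_trans de1.
- exact: le_trans ded.
Qed.
End Dimensions.

(** The orthogonal projection onto the eigenspace, defined by a choice, agrees with
    the one given by the basis f up to a null set. *)
Lemma orth_proj_le u : hnorm (hval u - orth_proj (eigenspace_op H E%:C) (hval u)) <=
  nrm ip (u - proj f u).
Proof.
pose S := [set p | eigenspace_op H E%:C p /\ forall v, eigenspace_op H E%:C v -> inner (hval u - p) v = 0].
have toT v : eigenspace_op H E%:C v -> exists2 v' : @hs R, v = hval v' & T v' 0.
  move=> hv; have [lv _] := closure_L2 (T := dirac_min_op kappa phisc phiel phiam) hv.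
  exists (mkhs lv); first by [].
  by rewrite /centered add0r /hrel hvalZ.
have [Sp Sperp] : S (orth_proj (eigenspace_op H E%:C) (hval u)).
  apply: (@xgetPex _ 0 S); exists (hval (proj f u)); split.
    by have := T_proj u; rewrite /centered add0r /hrel hvalZ.
  move=> v /toT[v' -> hv']; rewrite -hvalB; exact: proj_orth.
have [p pE Tp] := toT _ Sp; rewrite pE in Sperp *.
have Tw : T (proj f u - p) 0 by apply: (@P_sub R (fun u => T u 0) T_lin0 _ _ (T_proj u) Tp).
have h1 : ip (u - p) (proj f u - p) = 0.
  have := Sperp (hval (proj f u - p)); rewrite -hvalB; apply.
  by move: Tw; rewrite /centered add0r /hrel hvalZ.
have h2 := proj_orth u Tw.
have w0 : nrm ip (proj f u - p) = 0.
  have wE : proj f u - p = (u - p) - (u - proj f u) by rewrite opprB [RHS]addrC addrA subrK.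
  have : ip (proj f u - p) (proj f u - p) = 0 by rewrite {1}wE (formBl fip) h1 h2 subrr.
  by rewrite /nrm /nrm2 => ->; rewrite /= sqrtr0.
rewrite -hvalB -nrm_hnorm (_ : u - p = (u - proj f u) + (proj f u - p)); last by rewrite addrA subrK.
by apply: (le_trans (nrmD fip _ _)); rewrite w0 addr0.
Qed.

Lemma proj_le u : nrm ip (u - proj f u) <= nrm ip u.
Proof.
have h : nrm2 ip u = nrm2 ip (u - proj f u) + nrm2 ip (proj f u).
  by rewrite -(pyth fip) ?subrK //; apply: proj_orth; exact: T_proj.
by rewrite /nrm ler_wsqrtr // h lerDl (nrm2_ge0 fip).
Qed.
End Approximation.

Lemma lincomb_hb N M (v : 'cV[R[i]]_(N + M)) : lincomb (@hermite_basis R N M) v = hval (comb (@bh R N M) v).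
Proof.
rewrite /lincomb /comb hval_sum; apply: eq_bigr => j _.
by rewrite hvalZ basisE.
Qed.
End Assembly.

(** * The second order spectrum *)

Section Membership.
Context {R : realType}.
Variables (V W a : R -> R) (K : R) (kappa : int) (phisc phiel phiam : R -> R).
Hypothesis rp : regular_potentials kappa phisc phiel phiam V W a K.
Hypothesis ess : ess_selfadjoint (dirac_min_op kappa phisc phiel phiam).
Local Notation H := (dirac_op kappa phisc phiel phiam).

Lemma spec2_det N M z : \det (Qmx H (@hermite_basis R N M) z) = 0 -> spec2 H (@hermite_basis R N M) z.
Proof.
move=> dz; split.
- by move=> j; rewrite basisE; exists (hval (ah rp j)); exact: (H_hb rp (@pfb0 R N M) (@pgb0 R N M) ess j).
- move=> v; rewrite lincomb_hb -nrm_hnorm => v0; apply/eqP/negP => vn.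
  have := sqn_gt0 (introN idP vn); rewrite -sqn_hb -(sqr_nrm (@form_hip R)).
  by move: v0; rewrite /bh => ->; rewrite expr0n ltxx.
- have /eqP/det0P[v vn vz] : \det (Qmx H (@hermite_basis R N M) z)^T = 0 by rewrite det_tr.
  exists v^T; first by apply: contra_neq vn => h; rewrite -[v]trmxK h trmx0.
  by apply: trmx_inj; rewrite trmx_mul trmxK vz trmx0.
Qed.

Lemma eigenvalue_real (E : R[i]) u0 : eigenspace_op H E u0 -> hnorm u0 != 0 -> exists Er : R, E = Er%:C.
Proof.
move=> hu0 u0n; have fip := @form_hip R; have [lu0 _ _] := hu0; exists (Re E).
have h : hrel H (mkhs lu0) (E *: mkhs lu0) by rewrite /hrel hvalZ.
have := sa_sym_rel ess.2 h h; rewrite (formZl fip) (formZr fip) => /eqP.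
rewrite -subr_eq0 -mulrBl mulf_eq0 => /orP[|].
  rewrite subr_eq0 => /eqP /(congr1 (fun z : R[i] => Im z)); rewrite cImJ => hE.
  by apply: complexP => //=; move: hE; lra.
rewrite (form_self fip) => /eqP /(congr1 (fun z : R[i] => Re z)) /= n2.
by move: u0n; rewrite (_ : hnorm u0 = 0) ?eqxx // -[LHS](nrm_hnorm (mkhs lu0)) /nrm n2 sqrtr0.
Qed.

Lemma centered_hval (E : R) (f : @hs R) : centered kappa phisc phiel phiam E f 0 <->
  eigenspace_op H E%:C (hval f).
Proof. by rewrite /centered add0r /hrel hvalZ. Qed.

(** Gram-Schmidt applied to a finite spanning set, up to vectors of norm zero. *)
Lemma eigenbasis (E : R) : finite_multiplicity H E%:C -> exists m (f : 'I_m -> @hs R),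
  [/\ forall i j, hip (f i) (f j) = (i == j)%:R,
      forall i, centered kappa phisc phiel phiam E (f i) 0 &
      forall p, centered kappa phisc phiel phiam E p 0 -> nrm (@hip R) (p - proj f p) = 0].
Proof.
move=> [n [e [he hspan]]]; have fip := @form_hip R.
have le k : L2 (e k) by have [] := he k.
pose v (i : nat) : @hs R := if insub i is Some k then mkhs (le k) else 0.
have vE (k : 'I_n) : v k = mkhs (le k) by rewrite /v valK.
pose P u := centered kappa phisc phiel phiam E u 0.
have P0 : P 0 by exact: (T0 rp ess).
have Pv i : (i < n)%N -> P (v i).
  move=> i_n; have -> : i = val (Ordinal i_n) by [].
  rewrite vE; apply/centered_hval; exact: he.
have [m [f [fo fT fv]]] := gram_schmidt P0 (T_lin0 (E := E) ess) Pv.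
exists m, f; split=> // p /centered_hval Hp; have [c hc] := hspan _ Hp.
have pc : nrm (@hip R) (p - \sum_k c k *: mkhs (le k)) = 0.
  rewrite nrm_hnorm hvalB (_ : hval (\sum_k c k *: mkhs (le k)) = \sum_k c k *: e k) //.
  by rewrite hval_sum; apply: eq_bigr => k _; exact: hvalZ.
have w1 u : hip (p - proj f p) (proj f u) = 0 by exact/proj_span/proj_perp.
have w2 : hip (p - proj f p) p = 0.
  have := nrm_eq0_formr fip (p - proj f p) pc; rewrite (formBr fip) => /eqP.
  rewrite subr_eq0 => /eqP ->; rewrite (form_sumr fip) big1 // => k _.
  rewrite (formZr fip); have := nrm_eq0_formr fip (p - proj f p) (fv k (ltn_ord k)).
  rewrite vE (formBr fip) => /eqP; rewrite subr_eq0 => /eqP ->.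
  by rewrite (w1 (mkhs (le k))) mulr0.
by rewrite /nrm /nrm2 (formBr fip) w1 w2 subrr /= sqrtr0.
Qed.
End Membership.

Theorem corollary4 (R : realType) (kappa : int) (phisc phiel phiam : R -> R)
    (E : complex R) (c q : R) :
  kappa != 0 ->
  ess_selfadjoint (dirac_min_op kappa phisc phiel phiam) ->
  let H := dirac_op kappa phisc phiel phiam in
  eigenvalue_op H E ->
  isolated_in_spectrum H E ->
  finite_multiplicity H E ->
  0 < c ->
  coulomb_plus_bounded c phisc ->
  coulomb_plus_bounded c phiel ->
  coulomb_plus_bounded c phiam ->
  1 < q ->
  eigenspace_op H E `<=` dom_power oscillator2 q ->
  exists2 b0 : R, 0 < b0 &
    forall b : R, b0 <= b ->
    forall N M : nat, (1 <= N)%N -> (1 <= M)%N ->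
    let basis := @hermite_basis R N M in
    let bound := b * (N%:R `^ (- ((q - 1) / 2)) + M%:R `^ (- ((q - 1) / 2))) in
    exists2 lambda : complex R, spec2 H basis lambda &
      Normc.normc (lambda - E) < bound /\
      forall v : 'cV[complex R]_(N + M),
        hnorm (lincomb basis v) = 1 ->
        Qmx H basis lambda *m v = 0 ->
        hnorm (lincomb basis v - orth_proj (eigenspace_op H E) (lincomb basis v))
          < bound.
Proof.
move=> _ ess H [u0 hu0 u0n] [d d0 iso] fm _ hsc hel ham q1 sub.
have [Er EE] := eigenvalue_real ess hu0 u0n; subst E.
have [V [W [a [K rp]]]] := potentials_regular ess hsc hel ham.
have reg := centered_regular iso.
have [m [f [fo fT fspan]]] := eigenbasis rp ess fm.
have exD i : exists D : R, 0 <= D /\ forall N M, (0 < N)%N -> (0 < M)%N ->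
    nrm (@hip R) (f i - (SS (f i) true N + SS (f i) false M)) <=
      D * (N%:R `^ (- ((q - 1) / 2)) + M%:R `^ (- ((q - 1) / 2))) /\
    nrm (@hip R) ((XX rp (f i) true N + XX rp (f i) false M) - Er%:C *: (SS (f i) true N + SS (f i) false M))
      <= D * (N%:R `^ (- ((q - 1) / 2)) + M%:R `^ (- ((q - 1) / 2))).
  have [Cu Cu0 dec] := coefficient_decay (sub _ (iffLR (centered_hval _ _ _ _ _ _) (fT i))).
  apply: (eigen_approx rp ess q1 _ Cu0 dec).
  by have := fT i; rewrite /centered add0r.
have [Df hD] := choice exD.
pose D := \sum_i Df i.
have D0 : 0 <= D by apply: sumr_ge0 => i _; have [] := hD i.
have approx i N M : (0 < N)%N -> (0 < M)%N ->
    nrm (@hip R) (f i - (SS (f i) true N + SS (f i) false M)) <=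
      D * (N%:R `^ (- ((q - 1) / 2)) + M%:R `^ (- ((q - 1) / 2))) /\
    nrm (@hip R) ((XX rp (f i) true N + XX rp (f i) false M) - Er%:C *: (SS (f i) true N + SS (f i) false M))
      <= D * (N%:R `^ (- ((q - 1) / 2)) + M%:R `^ (- ((q - 1) / 2))).
  move=> N1 M1; have [_ /(_ N M N1 M1) [h1 h2]] := hD i.
  have DD : Df i <= D.
    by rewrite /D (bigD1 i) //= lerDl sumr_ge0 // => k _; have [] := hD k.
  have r0 : 0 <= N%:R `^ (- ((q - 1) / 2)) + M%:R `^ (- ((q - 1) / 2)) :> R by rewrite addr_ge0 ?powR_ge0.
  by split; [apply: (le_trans h1) | apply: (le_trans h2)]; exact: ler_wpM2r.
have m0 : (0 < m)%N.
  rewrite lt0n; apply/negP => /eqP m00; have [lu0 _ _] := hu0.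
  have Tu : centered kappa phisc phiel phiam Er (mkhs lu0) 0 by apply/centered_hval; exact: hu0.
  have := fspan _ Tu.
  have -> : proj f (mkhs lu0) = 0.
    by rewrite /proj big1 // => -[i i_m]; exfalso; move: i_m; rewrite m00.
  by rewrite subr0 nrm_hnorm => /eqP; apply/negP.
pose p : R := (q - 1) / 2; have p0 : 0 < p by rewrite divr_gt0 // subr_gt0.
have [C1 C1E] : exists C1 : R, C1 = 2 * (m%:R + 1) * (D + 1) by eexists.
have C10 : 0 < C1 by rewrite C1E !mulr_gt0 // ltr_wpDl.
have mn0 : 0 < Num.min 1 (d / 6 / 8) by rewrite lt_min ltr01 !divr_gt0.
(* For N, M >= N0 the perturbation lemmas apply. *)
have [N0 hN0] := powR_small p0 (divr_gt0 mn0 (mulr_gt0 (ltr0n R 50) C10)).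
have [Y hY] := small_roots rp ess reg d0 (erefl (Er + d / 2)) N0.
pose rho : R := N0.+1%:R `^ (- p).
have rho0 : 0 < rho by rewrite powR_gt0.
have k1 : 0 < 25 * C1 by rewrite mulr_gt0.
have k2 : 0 < 25 * C1 / (d / 6) by rewrite divr_gt0 // divr_gt0.
have k3 : 0 < (`|Y| + d + 2) / rho by rewrite divr_gt0 // addr_gt0 // ltr_wpDl.
(* The first two terms come from the perturbation lemmas; the third one makes the bound
   exceed |Y| + d + 2 when N or M is below N0. *)
exists (25 * C1 + 25 * C1 / (d / 6) + (`|Y| + d + 2) / rho + 1); first by rewrite !addr_gt0.
move=> b bb N M N1 M1 basis bound.
have rN : 0 < N%:R `^ (- p) :> R by rewrite powR_gt0 // ltr0n.
have rM : 0 < M%:R `^ (- p) :> R by rewrite powR_gt0 // ltr0n.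
have r0 : 0 < N%:R `^ (- p) + M%:R `^ (- p) :> R by rewrite addr_gt0.
have boundE : bound = b * (N%:R `^ (- p) + M%:R `^ (- p)) by [].
have [h|h] := boolP ((N < N0)%N || (M < N0)%N).
  have [z hz dz] := hY N M N1 M1 h.
  have large : `|Y| + d + 2 < bound.
    have low n : (0 < n)%N -> (n < N0)%N -> rho <= n%:R `^ (- p).
      move=> n1 nn; rewrite /rho !powRN lef_pV2 ?posrE ?powR_gt0 ?ltr0n //.
      by rewrite ge0_ler_powR ?nnegrE ?(ltW p0) // ler_nat ltnW // ltnW.
    have rr : rho <= N%:R `^ (- p) + M%:R `^ (- p).
      case/orP: h => h; first by apply: (le_trans (low _ N1 h)); rewrite lerDl ltW.
      by apply: (le_trans (low _ M1 h)); rewrite lerDr ltW.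
    rewrite boundE; apply: (@lt_le_trans _ _ (b * rho)).
      rewrite -ltr_pdivrMr //; apply: lt_le_trans bb.
      by move: k1 k2; move: (25 * C1) (25 * C1 / (d / 6)) (_ / rho) => x1 x2 x3 *; lra.
    by rewrite ler_wpM2l // (le_trans _ bb) // ltW // !addr_gt0.
  exists (z + (Er + d / 2)%:C); first by apply: (spec2_det rp ess); rewrite (Q_hpencil rp ess).
  split.
    rewrite (_ : z + (Er + d / 2)%:C - Er%:C = z + (d / 2)%:C); last by rewrite rmorphD; ring.
    apply: le_lt_trans large; apply: (le_trans (normc_ler _ _)).
    rewrite normcR ger0_norm ?divr_ge0 ?(ltW d0) //.
    by have := le_trans hz (ler_norm Y); move: d0; move: (normc z) (`|Y|) => *; lra.
  move=> v v1 _; apply: le_lt_trans large; rewrite lincomb_hb in v1 *.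
  apply: (le_trans (orth_proj_le rp ess fo fT fspan _)).
  apply: (le_trans (proj_le rp ess fo fT fspan _)); rewrite nrm_hnorm v1.
  by have := normr_ge0 Y; move: d0; move: (`|Y|) => *; lra.
move: h; rewrite negb_or -!leqNgt => /andP[NN MM].
have deE : de q D m N M = C1 * (N%:R `^ (- p) + M%:R `^ (- p)) by rewrite C1E.
have small : 25 * de q D m N M <= Num.min 1 (d / 6 / 8).
  have := lerD (hN0 N NN) (hN0 M MM); rewrite -/p => hh.
  rewrite deE mulrA; apply: (le_trans (ler_wpM2l (ltW k1) hh)).
  by rewrite le_eqVlt; apply/orP; left; apply/eqP; field; rewrite gt_eqF.
move: (small); rewrite le_min => /andP[s1 s2].
have [z hz dz] := near_root ess reg d0 fo fT fspan D0 approx N1 M1 m0 s1 s2.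
have bz : 25 * de q D m N M < bound.
  rewrite deE mulrA boundE ltr_pM2r //; apply: lt_le_trans bb.
  by move: k1 k2 k3; move: (25 * C1) (25 * C1 / (d / 6)) (_ / rho) => x1 x2 x3 *; lra.
have bv : 25 * de q D m N M / (d / 6) < bound.
  rewrite deE mulrA mulrAC boundE ltr_pM2r //; apply: lt_le_trans bb.
  by move: k1 k2 k3; move: (25 * C1) (25 * C1 / (d / 6)) (_ / rho) => x1 x2 x3 *; lra.
exists (z + Er%:C); first exact: (spec2_det rp ess).
split; first by rewrite addrK; exact: le_lt_trans hz bz.
move=> v v1 Qv; rewrite lincomb_hb in v1 *.
apply: (le_lt_trans (orth_proj_le rp ess fo fT fspan _)); apply: le_lt_trans bv.
by apply: (near_vector ess reg d0 fo fT fspan D0 approx N1 M1 s1 s2 hz Qv); rewrite nrm_hnorm.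
Qed.
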